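(* Let $F$ be a function in the Selberg class $\mathcal{S}$, with a fixed functional equation datum $Q_F>0$, $\lambda_1,\dots,\lambda_r>0$, $\mu_1,\dots,\mu_r\in\mathbb{C}$ (with $\Re\mu_j\ge 0$), $|\omega|=1$ as described in the context. Assume the Generalized Riemann Hypothesis for $F$, i.e. all non-trivial zeros of $F$ lie on the line $\Re(s)=\tfrac12$. Then, as $n\to\infty$, $$\lambda_F(n) = \frac{d_F}{2}\, n\log n + c_F\, n + O(\sqrt{n}\,\log n),$$ where $$c_F = \frac{d_F}{2}(\gamma-1) + \frac12 \log\bigl(\lambda Q_F^2\bigr),\qquad \lambda=\prod_{j=1}^r \lambda_j^{2\lambda_j},$$ and $\gamma$ is the Euler constant.
   Context: The Selberg class $\mathcal{S}$ consists of Dirichlet series $F(s)=\sum_{n\ge1}a(n)n^{-s}$ ($\Re s>1$) such that: (i) there is an integer $m\ge 0$ with $(s-1)^mF(s)$ entire of finite order; $m_F$ denotes the least such $m$; (ii) there are $Q_F>0$, $\lambda_j>0$, $\mu_j\in\mathbb{C}$ with $\Re\mu_j\ge0$ ($1\le j\le r$) and $|\omega|=1$ such that $\phi_F(s)=\omega\overline{\phi_F(1-\bar s)}$, where $\phi_F(s)=F(s)Q_F^s\prod_{j=1}^r\Gamma(\lambda_j s+\mu_j)$; (iii) $a(n)=O(n^\epsilon)$ for every $\epsilon>0$; (iv) $F(s)=\prod_p\exp\bigl(\sum_{k\ge1}b(p^k)p^{-ks}\bigr)$ with $b(p^k)=O(p^{k\theta})$ for some $\theta<\tfrac12$. The degree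 is $d_F=2\sum_{j=1}^r\lambda_j$. Define $\xi_F(s)=s^{m_F}(s-1)^{m_F}\phi_F(s)$, an entire function of order 1 whose zeros $\rho$ are the non-trivial zeros of $F$. The (generalized) Li coefficients are $$\lambda_F(n)=\sum_{\rho}\Bigl[1-\Bigl(1-\frac1\rho\Bigr)^{-n}\Bigr],\qquad n\in\mathbb{Z},$$ where the sum is over the zeros $\rho$ of $\xi_F$ counted with multiplicity, interpreted as $\lim_{T\to\infty}\sum_{|\Im\rho|\le T}$. *)

(* Defs.v *)
From Stdlib Require Import Reals Lra List ZArith Znumtheory.
From Coquelicot Require Import Coquelicot.
Open Scope R_scope.

Definition Cexp (z : C) : C := (exp (Re z) * cos (Im z), exp (Re z) * sin (Im z)).

Definition Rcpow (x : R) (s : C) : C := Cexp (Cmult (RtoC (ln x)) s).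

Fixpoint Cpown (z : C) (n : nat) : C :=
  match n with O => RtoC 1 | S k => Cmult z (Cpown z k) end.

Fixpoint Cprod_lt (r : nat) (f : nat -> C) : C :=
  match r with O => RtoC 1 | S k => Cmult (Cprod_lt k f) (f k) end.
Fixpoint Rsum_lt (r : nat) (f : nat -> R) : R :=
  match r with O => 0 | S k => Rsum_lt k f + f k end.
Fixpoint Rprod_lt (r : nat) (f : nat -> R) : R :=
  match r with O => 1 | S k => Rprod_lt k f * f k end.

(* Complex Gamma function, via Gauss' limit
   Gamma(z) = lim_n n^z n! / (z (z+1) ... (z+n))   (z not in {0,-1,-2,...}). *)
Definition gauss_seq (z : C) (n : nat) : C :=
  Cdiv (Cmult (Rcpow (INR n) z) (RtoC (INR (fact n))))
       (Cprod_lt (S n) (fun k => Cplus z (RtoC (INR k)))).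
Definition CGamma (z : C) : C :=
  (real (Lim_seq (fun n => Re (gauss_seq z n))),
   real (Lim_seq (fun n => Im (gauss_seq z n)))).

Definition euler_gamma : R :=
  real (Lim_seq (fun n => sum_f_R0 (fun k => / INR (S k)) n - ln (INR (S n)))).

Definition entire (f : C -> C) : Prop :=
  forall z : C, @ex_derive C_AbsRing C_NormedModule f z.

Definition finite_order (f : C -> C) : Prop :=
  exists (k : nat) (B : R), forall z, Cmod (f z) <= B * exp ((1 + Cmod z) ^ k).

Definition pole_cond (F : C -> C) (m : nat) : Prop :=
  exists G : C -> C, entire G /\ finite_order G /\
    forall s, s <> RtoC 1 -> G s = Cmult (Cpown (Cminus s (RtoC 1)) m) (F s).

Definition prime_nat (p : nat) : Prop := prime (Z.of_nat p).

Definition dirichlet_series (F : C -> C) (a : nat -> C) : Prop :=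
  forall s : C, Re s > 1 ->
    @is_series C_AbsRing C_NormedModule
      (fun n => Cmult (a (S n)) (Rcpow (INR (S n)) (Copp s))) (F s).

Definition ramanujan (a : nat -> C) : Prop :=
  forall eps, eps > 0 -> exists K, forall n, (1 <= n)%nat ->
    Cmod (a n) <= K * Rpower (INR n) eps.

Fixpoint prime_prod (N : nat) (e : nat -> C) : C :=
  match N with
  | O => RtoC 1
  | S k => if prime_dec (Z.of_nat (S k)) then Cmult (prime_prod k e) (e (S k))
           else prime_prod k e
  end.

Definition euler_product (F : C -> C) : Prop :=
  exists (b : nat -> C) (theta K : R), theta < /2 /\
    (forall p k, prime_nat p -> (1 <= k)%nat ->
       Cmod (b (p ^ k)%nat) <= K * Rpower (INR (p ^ k)) theta) /\
    forall s : C, Re s > 1 ->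
      exists E : nat -> C,
        (forall p, prime_nat p ->
           @is_series C_AbsRing C_NormedModule
             (fun k => Cmult (b (p ^ (S k))%nat) (Rcpow (INR (p ^ (S k))) (Copp s)))
             (E p)) /\
        filterlim (fun N => prime_prod N (fun p => Cexp (E p))) eventually
          (locally (F s)).

Definition phi (F : C -> C) (Q : R) (r : nat) (lam : nat -> R) (mu : nat -> C)
  (s : C) : C :=
  Cmult (Cmult (F s) (Rcpow Q s))
        (Cprod_lt r (fun j => CGamma (Cplus (Cmult (RtoC (lam j)) s) (mu j)))).

(* points where every term of phi(s) and phi(1 - conj s) is a genuine value:
   s <> 0, 1 and no Gamma factor sits at a pole *)
Definition regular_pt (r : nat) (lam : nat -> R) (mu : nat -> C) (s : C) : Prop :=
  s <> RtoC 0 /\ s <> RtoC 1 /\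
  forall j k, (j < r)%nat ->
    Cplus (Cmult (RtoC (lam j)) s) (mu j) <> RtoC (- INR k) /\
    Cplus (Cmult (RtoC (lam j)) (Cminus (RtoC 1) (Cconj s))) (mu j) <> RtoC (- INR k).

Definition functional_eq (F : C -> C) (Q : R) (r : nat) (lam : nat -> R)
  (mu : nat -> C) (omega : C) : Prop :=
  Q > 0 /\ (forall j, (j < r)%nat -> lam j > 0 /\ Re (mu j) >= 0) /\ Cmod omega = 1 /\
  forall s, regular_pt r lam mu s ->
    phi F Q r lam mu s = Cmult omega (Cconj (phi F Q r lam mu (Cminus (RtoC 1) (Cconj s)))).

Definition selberg (F : C -> C) (a : nat -> C) (m : nat) (Q : R) (r : nat)
  (lam : nat -> R) (mu : nat -> C) (omega : C) : Prop :=
  dirichlet_series F a /\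
  pole_cond F m /\ (forall m', (m' < m)%nat -> ~ pole_cond F m') /\
  functional_eq F Q r lam mu omega /\
  ramanujan a /\
  euler_product F.

(* X is xi_F(s) = s^m (s-1)^m phi_F(s): the entire function agreeing with this
   formula wherever the formula is defined (unique by the identity theorem) *)
Definition is_xi (X : C -> C) (F : C -> C) (m : nat) (Q : R) (r : nat)
  (lam : nat -> R) (mu : nat -> C) : Prop :=
  entire X /\
  forall s, regular_pt r lam mu s ->
    X s = Cmult (Cmult (Cpown s m) (Cpown (Cminus s (RtoC 1)) m)) (phi F Q r lam mu s).

Definition zero_mult (X : C -> C) (rho : C) (k : nat) : Prop :=
  exists H : C -> C, entire H /\ H rho <> RtoC 0 /\
    forall s, X s = Cmult (Cpown (Cminus s rho) k) (H s).

Fixpoint occ (z : C) (l : list C) : nat :=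
  match l with
  | nil => O
  | w :: l' => ((if Ceq_dec z w then 1 else 0) + occ z l')%nat
  end.

Definition zeros_upto (X : C -> C) (T : R) (l : list C) : Prop :=
  forall z, (X z = RtoC 0 /\ Rabs (Im z) <= T -> zero_mult X z (occ z l)) /\
            (~ (X z = RtoC 0 /\ Rabs (Im z) <= T) -> ~ In z l).

Definition li_term (n : nat) (rho : C) : C :=
  Cminus (RtoC 1) (Cinv (Cpown (Cminus (RtoC 1) (Cinv rho)) n)).

Fixpoint Csum_list (f : C -> C) (l : list C) : C :=
  match l with nil => RtoC 0 | z :: l' => Cplus (f z) (Csum_list f l') end.

Definition li_coeff (X : C -> C) (n : nat) (L : C) : Prop :=
  forall eps, eps > 0 -> exists T0, forall T, T >= T0 ->
    (exists l, zeros_upto X T l) /\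
    forall l, zeros_upto X T l -> Cmod (Cminus (Csum_list (li_term n) l) L) < eps.

Definition degree (r : nat) (lam : nat -> R) : R := 2 * Rsum_lt r lam.
Definition lam_const (r : nat) (lam : nat -> R) : R :=
  Rprod_lt r (fun j => Rpower (lam j) (2 * lam j)).
Definition c_const (Q : R) (r : nat) (lam : nat -> R) : R :=
  degree r lam / 2 * (euler_gamma - 1) + / 2 * ln (lam_const r lam * Q ^ 2).

(* Main.v *)
(* Under GRH a zero is [1/2 + i g], and [1 - 1/rho = exp (i ang g)] with [ang g = pi - 2 atan (2 g)], so
   [lambda_F(n)] is the sum of [1 - cos (n ang g)] (even in [g]); the imaginary parts [sin (n ang g)] are odd.
   Far to the right of the critical strip the argument of [xi_F] is continuous and, by Stirling's formula,
   equals [M T = (d_F/2) T ln T + k T] up to [O(ln T)].  Factoring the zeros out of large discs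
   (Borel-Caratheodory for the quotient) writes its increments on [Re s = 1/2 + b] as limits of sums of
   [atan ((T - g) / b)]; combining the lines [b] and [2 b] gives the Riemann-von Mangoldt formula
   [pi N(T) = M T + O(ln T)].  Abel summation from [V = sqrt n] on replaces the sum over zeros by
   [2/pi] times the integral of [M' t (1 - cos (n ang t))], with error [O(sqrt n ln n)], which also
   bounds the terms with [|g| <= V].  The integrals over [(0, oo)] are exact: their second differences
   in [n] are elementary, and the initial value of the logarithmic one is the classical integral of
   [ln (2 sin x)] over [(0, pi/2)], which is [0]. *)
Require Import Defs.
From Stdlib Require Import Reals Lra Lia ZArith Znumtheory List Permutation Classical ClassicalEpsilon Ranalysis5.
From Coquelicot Require Import Coquelicot.
Open Scope R_scope.

(** No Hadamard product is formed: the quotient of [xi_F] by its zeros in a disc about [3/2] has a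
    logarithm that is linear up to an error vanishing as the disc grows, because the growth exponent
    is below 2. Two obstacles shape the rest. The tail of the arctangent is of order [1/x], too long
    to be summed over zeros; two lines shorten it to [1/x^2], and such a tail is dominated by the
    increment of the same arctangent sum over a window of length 2, which the argument of [xi_F]
    already controls, so no prior bound on the density of zeros enters. The zeros need not be
    symmetric under conjugation, since the coefficients of [F] may be complex; ordinates above and
    below the real axis are therefore counted separately, with the same main term, and the imaginary
    part of the Li sum cancels only up to the error. The cut [sqrt n] balances the [O(V ln V)] zeros
    below [V] against the Abel error [O(n ln V / V)]. Convergence of the Li sum is part of the
    conclusion; it comes from the same Abel estimate by Cauchy's criterion. *)

Lemma Ceq (z w : C) : Re z = Re w -> Im z = Im w -> z = w.
Proof. destruct z, w; simpl; intros; subst; reflexivity. Qed.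

Lemma Cmod_sqr (z : C) : Cmod z * Cmod z = Re z * Re z + Im z * Im z.
Proof. generalize (Cmod2_alt z). simpl. lra. Qed.

Lemma im_le_Cmod (z : C) : Rabs (Im z) <= Cmod z.
Proof.
  apply Rle_trans with (2 := Rmax_Cmod z). apply Rmax_r.
Qed.

Lemma Cmod_le_abs (z : C) : Cmod z <= Rabs (Re z) + Rabs (Im z).
Proof.
  replace z with (Cplus (RtoC (Re z)) (Cmult Ci (RtoC (Im z)))) at 1.
  - eapply Rle_trans; [apply Cmod_triangle|].
    rewrite Cmod_mult, Cmod_Ci, !Cmod_R. lra.
  - apply Ceq; unfold Re, Im; simpl; ring.
Qed.

Lemma Cmod_triangle_minus (z w : C) : Cmod z - Cmod w <= Cmod (z - w)%C.
Proof.
  assert (Cmod z <= Cmod (z - w)%C + Cmod w); [|lra].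
  replace z with ((z - w) + w)%C at 1 by ring. apply Cmod_triangle.
Qed.

Lemma Cmod_sub_sym (z w : C) : Cmod (z - w)%C = Cmod (w - z)%C.
Proof. rewrite <- Cmod_opp. f_equal. ring. Qed.

Lemma Cmod_eq_iff (z w : C) :
  Re z * Re z + Im z * Im z = Re w * Re w + Im w * Im w -> Cmod z = Cmod w.
Proof.
  intros H. apply Rsqr_inj; try apply Cmod_ge_0. unfold Rsqr. rewrite !Cmod_sqr. exact H.
Qed.

Lemma Cmod_le_iff (z w : C) :
  Re z * Re z + Im z * Im z <= Re w * Re w + Im w * Im w -> Cmod z <= Cmod w.
Proof.
  intros H. apply Rsqr_incr_0; try apply Cmod_ge_0. unfold Rsqr. rewrite !Cmod_sqr. exact H.
Qed.

Lemma Cmod_pos_neq (z : C) : 0 < Cmod z -> z <> RtoC 0.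
Proof. intros H ->. rewrite Cmod_0 in H. lra. Qed.

Lemma Cminus_neq (z w : C) : z <> w -> (z - w)%C <> RtoC 0.
Proof. intros H E. apply H. replace z with ((z - w) + w)%C by ring. rewrite E. ring. Qed.

(** * Complex exponential *)

Lemma Cexp_plus (z w : C) : Cexp (z + w)%C = (Cexp z * Cexp w)%C.
Proof.
  unfold Cexp, Re, Im; apply Ceq; unfold Re, Im; simpl; rewrite exp_plus, ?cos_plus, ?sin_plus; ring.
Qed.

Lemma Cexp_0 : Cexp (RtoC 0) = RtoC 1.
Proof. unfold Cexp, Re, Im; apply Ceq; unfold Re, Im; simpl; rewrite ?exp_0, ?cos_0, ?sin_0; ring. Qed.

Lemma Cmod_exp (z : C) : Cmod (Cexp z) = exp (Re z).
Proof.
  assert (0 < exp (Re z)) by apply exp_pos.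
  apply Rsqr_inj; try apply Cmod_ge_0; try lra. unfold Rsqr. rewrite Cmod_sqr.
  assert (E := sin2_cos2 (Im z)). unfold Rsqr in E.
  change (exp (Re z) * cos (Im z) * (exp (Re z) * cos (Im z))
    + exp (Re z) * sin (Im z) * (exp (Re z) * sin (Im z)) = exp (Re z) * exp (Re z)).
  transitivity (exp (Re z) * exp (Re z) * (sin (Im z) * sin (Im z) + cos (Im z) * cos (Im z))).
  - ring.
  - rewrite E; ring.
Qed.

Lemma Cexp_neq0 (z : C) : Cexp z <> RtoC 0.
Proof. apply Cmod_pos_neq. rewrite Cmod_exp. apply exp_pos. Qed.

Lemma Cexp_opp (z : C) : Cexp (- z)%C = (/ Cexp z)%C.
Proof.
  assert (H : (Cexp z * Cexp (- z) = 1)%C).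
  { rewrite <- Cexp_plus. replace (z + - z)%C with (RtoC 0) by ring. apply Cexp_0. }
  replace (Cexp (- z))%C with (/ Cexp z * (Cexp z * Cexp (- z)))%C.
  - rewrite H. ring.
  - field. apply Cexp_neq0.
Qed.

Lemma Cexp_RtoC (x : R) : Cexp (RtoC x) = RtoC (exp x).
Proof. unfold Cexp, Re, Im; apply Ceq; unfold Re, Im; simpl; rewrite ?cos_0, ?sin_0; ring. Qed.

Lemma Cexp_periodic (z : C) : Cexp (z + (0, (2 * PI)%R))%C = Cexp z.
Proof.
  rewrite Cexp_plus. unfold Cexp at 2. simpl. rewrite exp_0, cos_2PI, sin_2PI.
  apply Ceq; unfold Re, Im; simpl; ring.
Qed.

(** * Complex differentiability *)

Definition Ccts (f : C -> C) (z : C) : Prop :=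
  forall eps, 0 < eps -> exists d, 0 < d /\
    forall w, Cmod (w - z)%C < d -> Cmod (f w - f z)%C < eps.

(** Little-o form without a quotient, so that [w = z] needs no exclusion and the chain rule no case
    split. *)
Definition Cder (f : C -> C) (z l : C) : Prop :=
  forall eps, 0 < eps -> exists d, 0 < d /\
    forall w, Cmod (w - z)%C < d ->
      Cmod (f w - f z - l * (w - z))%C <= eps * Cmod (w - z)%C.

Definition Cdiff (f : C -> C) (z : C) : Prop := exists l, Cder f z l.

(** The only passage between the library's derivative, in which [entire] is stated, and the epsilon
    form used from here on. *)
Lemma Cder_ex_derive (f : C -> C) (z : C) :
  @ex_derive C_AbsRing C_NormedModule f z <-> Cdiff f z.
Proof.
  split; intros [l Hl]; exists l.
  - destruct Hl as [_ Hl]. intros eps He.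
    assert (Hz : is_filter_lim (@locally (AbsRing_UniformSpace C_AbsRing) z) z).
    { intros P HP; exact HP. }
    specialize (Hl z Hz (mkposreal eps He)). simpl in Hl.
    destruct Hl as [d Hd]. exists d; split; [apply cond_pos|].
    intros w Hw. specialize (Hd w Hw).
    change (Cmod (f w - f z - (w - z) * l)%C <= eps * Cmod (w - z)%C) in Hd.
    replace (l * (w - z))%C with ((w - z) * l)%C by ring. exact Hd.
  - split.
    + apply is_linear_scal_l.
    + intros x Hx eps.
      assert (E : x = z).
      { symmetry. apply (@is_filter_lim_locally_unique C_AbsRing (AbsRing_NormedModule C_AbsRing)). exact Hx. }
      subst x.
      destruct (Hl eps (cond_pos eps)) as (d & Hd & Hw).
      exists (mkposreal d Hd). intros w Hw'. specialize (Hw w Hw').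
      change (Cmod (f w - f z - (w - z) * l)%C <= eps * Cmod (w - z)%C).
      replace ((w - z) * l)%C with (l * (w - z))%C by ring. exact Hw.
Qed.

Lemma Cder_cts (f : C -> C) (z l : C) : Cder f z l -> Ccts f z.
Proof.
  intros H eps He. destruct (H 1 Rlt_0_1) as (d & Hd & Hw).
  assert (Hp : 0 < Cmod l + 1) by (generalize (Cmod_ge_0 l); lra).
  exists (Rmin d (eps / (Cmod l + 1))). split.
  - apply Rmin_glb_lt; auto. apply Rdiv_lt_0_compat; auto.
  - intros w Hm. assert (H1 := Rlt_le_trans _ _ _ Hm (Rmin_l _ _)).
    assert (H2 := Rlt_le_trans _ _ _ Hm (Rmin_r _ _)).
    specialize (Hw w H1).
    replace (f w - f z)%C with ((f w - f z - l * (w - z)) + l * (w - z))%C by ring.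
    eapply Rle_lt_trans; [apply Cmod_triangle|]. rewrite Cmod_mult.
    apply Rle_lt_trans with ((Cmod l + 1) * Cmod (w - z)%C); [lra|].
    apply Rlt_le_trans with ((Cmod l + 1) * (eps / (Cmod l + 1))).
    + apply Rmult_lt_compat_l; auto.
    + right; field; lra.
Qed.

Lemma Cdiff_cts (f : C -> C) (z : C) : Cdiff f z -> Ccts f z.
Proof. intros [l H]; eapply Cder_cts; eauto. Qed.

Lemma Cder_loc (f g : C -> C) (z l : C) (r : R) : 0 < r ->
  (forall w, Cmod (w - z)%C < r -> f w = g w) -> Cder f z l -> Cder g z l.
Proof.
  intros Hr E H eps He. destruct (H eps He) as (d & Hd & Hw).
  exists (Rmin d r). split; [apply Rmin_glb_lt; auto|].
  intros w Hm. rewrite <- !E; auto.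
  - apply Hw. eapply Rlt_le_trans; [exact Hm|apply Rmin_l].
  - replace (z - z)%C with (RtoC 0) by ring. rewrite Cmod_0; auto.
  - eapply Rlt_le_trans; [exact Hm|apply Rmin_r].
Qed.

Lemma Ccts_loc (f g : C -> C) (z : C) (r : R) : 0 < r ->
  (forall w, Cmod (w - z)%C < r -> f w = g w) -> Ccts f z -> Ccts g z.
Proof.
  intros Hr E H eps He. destruct (H eps He) as (d & Hd & Hw).
  exists (Rmin d r). split; [apply Rmin_glb_lt; auto|].
  intros w Hm. rewrite <- !E; auto.
  - apply Hw. eapply Rlt_le_trans; [exact Hm|apply Rmin_l].
  - replace (z - z)%C with (RtoC 0) by ring. rewrite Cmod_0; auto.
  - eapply Rlt_le_trans; [exact Hm|apply Rmin_r].
Qed.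

Lemma Cder_ext (f g : C -> C) (z l : C) : (forall w, f w = g w) -> Cder f z l -> Cder g z l.
Proof. intros E. apply Cder_loc with 1; auto; lra. Qed.

Lemma Cdiff_loc (f g : C -> C) (z : C) (r : R) : 0 < r ->
  (forall w, Cmod (w - z)%C < r -> f w = g w) -> Cdiff f z -> Cdiff g z.
Proof. intros Hr E [l H]; exists l. eapply Cder_loc; eauto. Qed.

Lemma Cder_const (c z : C) : Cder (fun _ => c) z (RtoC 0).
Proof.
  intros eps He; exists 1; split; [lra|]. intros w _.
  replace (c - c - 0 * (w - z))%C with (RtoC 0) by ring. rewrite Cmod_0.
  apply Rmult_le_pos; [lra|apply Cmod_ge_0].
Qed.

Lemma Cder_id (z : C) : Cder (fun w => w) z (RtoC 1).
Proof.
  intros eps He; exists 1; split; [lra|]. intros w _.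
  replace (w - z - 1 * (w - z))%C with (RtoC 0) by ring. rewrite Cmod_0.
  apply Rmult_le_pos; [lra|apply Cmod_ge_0].
Qed.

Lemma Cder_plus (f g : C -> C) (z l m : C) :
  Cder f z l -> Cder g z m -> Cder (fun w => f w + g w)%C z (l + m)%C.
Proof.
  intros H1 H2 eps He.
  destruct (H1 (eps / 2)) as (d1 & Hd1 & Hw1); [lra|].
  destruct (H2 (eps / 2)) as (d2 & Hd2 & Hw2); [lra|].
  exists (Rmin d1 d2). split; [apply Rmin_glb_lt; auto|]. intros w Hm.
  specialize (Hw1 w (Rlt_le_trans _ _ _ Hm (Rmin_l _ _))).
  specialize (Hw2 w (Rlt_le_trans _ _ _ Hm (Rmin_r _ _))).
  replace (f w + g w - (f z + g z) - (l + m) * (w - z))%C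
    with ((f w - f z - l * (w - z)) + (g w - g z - m * (w - z)))%C by ring.
  eapply Rle_trans; [apply Cmod_triangle|]. lra.
Qed.

Lemma Cder_comp (f g : C -> C) (z l m : C) :
  Cder f z l -> Cder g (f z) m -> Cder (fun w => g (f w)) z (m * l)%C.
Proof.
  intros H1 H2 eps He.
  assert (Hl := Cmod_ge_0 l). assert (Hm := Cmod_ge_0 m).
  set (e1 := Rmin 1 (eps / (2 * (Cmod m + 1)))).
  assert (He1 : 0 < e1).
  { apply Rmin_glb_lt; [lra|]. apply Rdiv_lt_0_compat; lra. }
  assert (He1a : e1 <= 1) by apply Rmin_l.
  assert (He1b : e1 * (Cmod m + 1) <= eps / 2).
  { apply Rle_trans with (eps / (2 * (Cmod m + 1)) * (Cmod m + 1)).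
    - apply Rmult_le_compat_r; [lra|apply Rmin_r].
    - right; field; lra. }
  destruct (H1 e1 He1) as (d1 & Hd1 & Hw1).
  assert (He2 : 0 < eps / (2 * (Cmod l + 1))) by (apply Rdiv_lt_0_compat; lra).
  destruct (H2 _ He2) as (d2 & Hd2 & Hw2).
  assert (Hd3 : 0 < d2 / (Cmod l + 1)) by (apply Rdiv_lt_0_compat; lra).
  exists (Rmin d1 (d2 / (Cmod l + 1))). split; [apply Rmin_glb_lt; auto|]. intros w Hw.
  specialize (Hw1 w (Rlt_le_trans _ _ _ Hw (Rmin_l _ _))).
  assert (Hr := Rlt_le_trans _ _ _ Hw (Rmin_r _ _)).
  assert (Hn := Cmod_ge_0 (w - z)%C).
  assert (Hlip : Cmod (f w - f z)%C <= (Cmod l + 1) * Cmod (w - z)%C).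
  { replace (f w - f z)%C with ((f w - f z - l * (w - z)) + l * (w - z))%C by ring.
    eapply Rle_trans; [apply Cmod_triangle|]. rewrite Cmod_mult. nra. }
  assert (Hsm : Cmod (f w - f z)%C < d2).
  { eapply Rle_lt_trans; [exact Hlip|].
    apply Rlt_le_trans with ((Cmod l + 1) * (d2 / (Cmod l + 1))).
    - apply Rmult_lt_compat_l; lra.
    - right; field; lra. }
  specialize (Hw2 _ Hsm).
  replace (g (f w) - g (f z) - m * l * (w - z))%C
    with ((g (f w) - g (f z) - m * (f w - f z)) + m * (f w - f z - l * (w - z)))%C by ring.
  eapply Rle_trans; [apply Cmod_triangle|]. rewrite Cmod_mult.
  assert (A : Cmod (g (f w) - g (f z) - m * (f w - f z))%C <= eps / 2 * Cmod (w - z)%C).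
  { eapply Rle_trans; [exact Hw2|].
    apply Rle_trans with (eps / (2 * (Cmod l + 1)) * ((Cmod l + 1) * Cmod (w - z)%C)).
    - apply Rmult_le_compat_l; [lra|exact Hlip].
    - right; field; lra. }
  assert (B : Cmod m * Cmod (f w - f z - l * (w - z))%C <= eps / 2 * Cmod (w - z)%C).
  { apply Rle_trans with (Cmod m * (e1 * Cmod (w - z)%C)).
    - apply Rmult_le_compat_l; auto.
    - assert (Cmod m * e1 <= eps / 2) by nra.
      replace (Cmod m * (e1 * Cmod (w - z)%C)) with (Cmod m * e1 * Cmod (w - z)%C) by ring.
      apply Rmult_le_compat_r; auto. }
  lra.
Qed.

Lemma Cder_scal (c z : C) : Cder (fun w => c * w)%C z c.
Proof.
  intros eps He; exists 1; split; [lra|]. intros w _.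
  replace (c * w - c * z - c * (w - z))%C with (RtoC 0) by ring. rewrite Cmod_0.
  apply Rmult_le_pos; [lra|apply Cmod_ge_0].
Qed.

Lemma Cder_sqr (z : C) : Cder (fun w => w * w)%C z (2 * z)%C.
Proof.
  intros eps He; exists eps; split; [lra|]. intros w Hw.
  replace (w * w - z * z - 2 * z * (w - z))%C with ((w - z) * (w - z))%C by ring.
  rewrite Cmod_mult. apply Rmult_le_compat_r; [apply Cmod_ge_0|lra].
Qed.

(** Polarisation, [f g = ((f + g)^2 - f^2 - g^2) / 2], reduces the product rule to the chain rule
    and the derivative of the square. *)
Lemma Cder_mult (f g : C -> C) (z l m : C) :
  Cder f z l -> Cder g z m -> Cder (fun w => f w * g w)%C z (l * g z + f z * m)%C.
Proof.
  intros H1 H2.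
  assert (A := Cder_comp _ _ _ _ _ (Cder_plus _ _ _ _ _ H1 H2) (Cder_sqr _)).
  assert (B := Cder_comp _ _ _ _ _ H1 (Cder_sqr _)).
  assert (D := Cder_comp _ _ _ _ _ H2 (Cder_sqr _)). simpl in A, B, D.
  assert (S := Cder_comp _ _ _ _ _ (Cder_plus _ _ _ _ _ A
     (Cder_comp _ _ _ _ _ (Cder_plus _ _ _ _ _ B D) (Cder_scal (- (1))%C _)))
     (Cder_scal (/ 2)%C _)).
  simpl in S.
  replace (l * g z + f z * m)%C with
    (/ 2 * (2 * (f z + g z) * (l + m) + - (1) * (2 * f z * l + 2 * g z * m)))%C.
  - eapply Cder_ext; [|exact S]. intros w. simpl. field.
  - field.
Qed.

Lemma Cder_Cinv (z : C) : z <> RtoC 0 -> Cder Cinv z (- / (z * z))%C.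
Proof.
  intros Hz eps He. assert (Hp : 0 < Cmod z) by (apply Cmod_gt_0; auto).
  set (P := Cmod z * Cmod z * (Cmod z / 2)).
  assert (HP : 0 < P) by (unfold P; apply Rmult_lt_0_compat; [nra|lra]).
  exists (Rmin (Cmod z / 2) (eps * P)). split.
  - apply Rmin_glb_lt; [lra|]. apply Rmult_lt_0_compat; auto.
  - intros w Hw. assert (A := Rlt_le_trans _ _ _ Hw (Rmin_l _ _)).
    assert (B := Rlt_le_trans _ _ _ Hw (Rmin_r _ _)).
    assert (Hw2 : Cmod z / 2 < Cmod w).
    { generalize (Cmod_triangle_minus z w). rewrite (Cmod_sub_sym z w). lra. }
    assert (Hw0 : w <> RtoC 0) by (apply Cmod_pos_neq; lra).
    replace (/ w - / z - - / (z * z) * (w - z))%C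
      with ((w - z) * (w - z) * / (z * z * w))%C.
    2:{ field. auto. }
    rewrite !Cmod_mult, Cmod_inv.
    2:{ repeat apply Cmult_neq_0; auto. }
    rewrite !Cmod_mult.
    assert (Hn := Cmod_ge_0 (w - z)%C).
    assert (Hq : 0 < Cmod z * Cmod z * Cmod w) by (apply Rmult_lt_0_compat; [nra|lra]).
    rewrite (Rmult_comm eps), Rmult_assoc. apply Rmult_le_compat_l; auto.
    apply Rmult_le_reg_r with (Cmod z * Cmod z * Cmod w); auto.
    rewrite Rmult_assoc, Rinv_l by lra. rewrite Rmult_1_r.
    apply Rle_trans with (eps * P); [lra|]. apply Rmult_le_compat_l; [lra|].
    unfold P. apply Rmult_le_compat_l; [nra|lra].
Qed.

Lemma Cder_val (f : C -> C) (z l m : C) : Cder f z l -> l = m -> Cder f z m.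
Proof. intros H <-; exact H. Qed.

Lemma Cder_opp (f : C -> C) (z l : C) : Cder f z l -> Cder (fun w => - f w)%C z (- l)%C.
Proof.
  intros H eps He. destruct (H eps He) as (d & Hd & Hw). exists d; split; auto.
  intros w Hm. specialize (Hw w Hm).
  replace (- f w - - f z - - l * (w - z))%C with (- (f w - f z - l * (w - z)))%C by ring.
  rewrite Cmod_opp. exact Hw.
Qed.

Lemma Cder_minus (f g : C -> C) (z l m : C) :
  Cder f z l -> Cder g z m -> Cder (fun w => f w - g w)%C z (l - m)%C.
Proof. intros H1 H2. apply (Cder_plus f (fun w => - g w)%C); auto. apply Cder_opp; auto. Qed.

Lemma Cdiff_const (c z : C) : Cdiff (fun _ => c) z.
Proof. eexists; apply Cder_const. Qed.
Lemma Cdiff_id (z : C) : Cdiff (fun w => w) z.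
Proof. eexists; apply Cder_id. Qed.
Lemma Cdiff_plus (f g : C -> C) (z : C) : Cdiff f z -> Cdiff g z -> Cdiff (fun w => f w + g w)%C z.
Proof. intros [l H] [m H']. eexists. apply Cder_plus; eauto. Qed.
Lemma Cdiff_minus (f g : C -> C) (z : C) : Cdiff f z -> Cdiff g z -> Cdiff (fun w => f w - g w)%C z.
Proof. intros [l H] [m H']. eexists. apply Cder_minus; eauto. Qed.
Lemma Cdiff_mult (f g : C -> C) (z : C) : Cdiff f z -> Cdiff g z -> Cdiff (fun w => f w * g w)%C z.
Proof. intros [l H] [m H']. eexists. apply Cder_mult; eauto. Qed.
Lemma Cdiff_comp (f g : C -> C) (z : C) : Cdiff f z -> Cdiff g (f z) -> Cdiff (fun w => g (f w)) z.
Proof. intros [l H] [m H']. eexists. apply (Cder_comp f g); eauto. Qed.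
Lemma Cdiff_inv (f : C -> C) (z : C) : Cdiff f z -> f z <> RtoC 0 -> Cdiff (fun w => / f w)%C z.
Proof. intros H H'. apply (Cdiff_comp f Cinv); auto. eexists. apply Cder_Cinv; auto. Qed.
Lemma Cdiff_div (f g : C -> C) (z : C) :
  Cdiff f z -> Cdiff g z -> g z <> RtoC 0 -> Cdiff (fun w => f w / g w)%C z.
Proof. intros. apply (Cdiff_mult f (fun w => / g w)%C); auto. apply Cdiff_inv; auto. Qed.
Lemma Cdiff_Cpow (f : C -> C) (n : nat) (z : C) : Cdiff f z -> Cdiff (fun w => Cpow (f w) n) z.
Proof.
  intros H; induction n as [|n IH]; simpl.
  - apply Cdiff_const.
  - apply (Cdiff_mult f); auto.
Qed.

Lemma small_o_at0 (f : R -> R) (l : R) : is_derive f 0 l ->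
  forall eps, 0 < eps -> exists d, 0 < d /\ forall x, Rabs x < d ->
    Rabs (f x - f 0 - l * x) <= eps * Rabs x.
Proof.
  intros H eps He. destruct H as [_ H].
  assert (H0 : is_filter_lim (locally 0) 0) by (intros P HP; exact HP).
  specialize (H 0 H0 (mkposreal eps He)). destruct H as [d Hd].
  exists d; split; [apply cond_pos|]. intros x Hx.
  assert (B : @ball R_UniformSpace 0 d x).
  { unfold ball; simpl. unfold AbsRing_ball, abs, minus, plus, opp; simpl. rewrite Ropp_0, Rplus_0_r. exact Hx. }
  specialize (Hd x B). unfold norm, minus, plus, opp, scal in Hd; simpl in Hd.
  unfold abs, mult in Hd; simpl in Hd.
  replace (x + - 0) with x in Hd by ring.
  replace (f x - f 0 - l * x) with (f x + - f 0 + - (x * l)) by ring. exact Hd.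
Qed.

Lemma Cder_Cexp0 : Cder Cexp (RtoC 0) (RtoC 1).
Proof.
  intros eps He.
  assert (D1 : is_derive exp 0 1) by (auto_derive; auto; rewrite exp_0; ring).
  assert (D2 : is_derive cos 0 0) by (auto_derive; auto; rewrite sin_0; ring).
  assert (D3 : is_derive sin 0 1) by (auto_derive; auto; rewrite cos_0; ring).
  (* The two components have remainders at most [4 e |w|] and [5 e |w|]; their sum fits under
     [eps |w|] with the divisor 12. *)
  set (e := Rmin 1 (eps / 12)).
  assert (Hea : e <= 1) by apply Rmin_l. assert (Heb : e <= eps / 12) by apply Rmin_r.
  assert (He1 : 0 < e) by (apply Rmin_glb_lt; lra). clearbody e.
  destruct (small_o_at0 _ _ D1 e He1) as (d1 & Hd1 & H1).
  destruct (small_o_at0 _ _ D2 e He1) as (d2 & Hd2 & H2).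
  destruct (small_o_at0 _ _ D3 e He1) as (d3 & Hd3 & H3).
  rewrite exp_0 in H1. rewrite cos_0 in H2. rewrite sin_0 in H3.
  exists (Rmin e (Rmin d1 (Rmin d2 d3))). split; [repeat apply Rmin_glb_lt; auto|].
  intros w Hw. replace (w - 0)%C with w in * by ring.
  assert (Hx := re_le_Cmod w). assert (Hy := im_le_Cmod w).
  assert (A0 := Rlt_le_trans _ _ _ Hw (Rmin_l _ _)).
  assert (A := Rlt_le_trans _ _ _ Hw (Rmin_r _ _)).
  assert (A1 := Rlt_le_trans _ _ _ A (Rmin_l _ _)).
  assert (B := Rlt_le_trans _ _ _ A (Rmin_r _ _)).
  assert (A2 := Rlt_le_trans _ _ _ B (Rmin_l _ _)).
  assert (A3 := Rlt_le_trans _ _ _ B (Rmin_r _ _)).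
  rewrite Cexp_0. destruct w as [x y]. simpl in Hx, Hy. set (r := Cmod (x, y)) in *.
  assert (Hr : 0 <= r) by apply Cmod_ge_0.
  specialize (H1 x ltac:(lra)). specialize (H2 y ltac:(lra)). specialize (H3 y ltac:(lra)).
  set (a := exp x - 1 - 1 * x) in *. set (b := cos y - 1 - 0 * y) in *.
  set (c := sin y - 0 - 1 * y) in *.
  assert (E1 : exp x = 1 + x + a) by (unfold a; ring).
  assert (E2 : cos y = 1 + b) by (unfold b; ring).
  assert (E3 : sin y = y + c) by (unfold c; ring).
  eapply Rle_trans; [apply Cmod_le_abs|]. unfold Cexp; simpl. rewrite E1, E2, E3.
  assert (Ha : Rabs a <= e * r) by nra. assert (Hb : Rabs b <= e * r) by nra.
  assert (Hc : Rabs c <= e * r) by nra.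
  assert (Hx1 : Rabs x <= e) by lra.
  assert (e * r <= r) by nra.
  replace ((1 + x + a) * (1 + b) + - (1) + - (1 * x - 0 * y)) with (a + (1 + x + a) * b) by ring.
  replace ((1 + x + a) * (y + c) + - 0 + - (1 * y + 0 * x)) with (c + (x + a) * (y + c)) by ring.
  assert (Hs : Rabs (x + a) <= 2 * e).
  { eapply Rle_trans; [apply Rabs_triang|]. nra. }
  assert (Hs1 : Rabs (1 + x + a) <= 3).
  { replace (1 + x + a) with (1 + (x + a)) by ring. eapply Rle_trans; [apply Rabs_triang|].
    rewrite Rabs_R1. lra. }
  assert (Hyc : Rabs (y + c) <= 2 * r).
  { eapply Rle_trans; [apply Rabs_triang|]. lra. }
  assert (T1 : Rabs (a + (1 + x + a) * b) <= 4 * (e * r)).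
  { eapply Rle_trans; [apply Rabs_triang|]. rewrite Rabs_mult.
    generalize (Rabs_pos b) (Rabs_pos (1 + x + a)). nra. }
  assert (T2 : Rabs (c + (x + a) * (y + c)) <= 5 * (e * r)).
  { eapply Rle_trans; [apply Rabs_triang|]. rewrite Rabs_mult.
    generalize (Rabs_pos (y + c)) (Rabs_pos (x + a)). nra. }
  nra.
Qed.

Lemma Cder_Cexp (z : C) : Cder Cexp z (Cexp z).
Proof.
  apply Cder_ext with (fun w => Cexp z * Cexp (w - z))%C.
  { intros w. rewrite <- Cexp_plus. f_equal. ring. }
  apply Cder_val with (Cexp z * (1 * (1 - 0)))%C; [|ring].
  apply (Cder_comp (fun w => Cexp (w - z)%C) (fun u => Cexp z * u)%C).
  - apply (Cder_comp (fun w => w - z)%C Cexp).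
    + apply Cder_minus; [apply Cder_id|apply Cder_const].
    + replace (z - z)%C with (RtoC 0) by ring. apply Cder_Cexp0.
  - apply Cder_scal.
Qed.

Lemma Cdiff_Cexp (f : C -> C) (z : C) : Cdiff f z -> Cdiff (fun w => Cexp (f w)) z.
Proof. intros H. apply (Cdiff_comp f Cexp); auto. eexists; apply Cder_Cexp. Qed.

(** * Integrals of complex-valued functions of a real variable *)

Definition Rcc (g : R -> C) (t : R) : Prop :=
  continuous (fun s => Re (g s)) t /\ continuous (fun s => Im (g s)) t.

Definition Rcts (g : R -> C) (a b : R) : Prop :=
  forall t, Rmin a b <= t <= Rmax a b -> Rcc g t.

Definition CI (g : R -> C) (a b : R) : C :=
  (RInt (fun t => Re (g t)) a b, RInt (fun t => Im (g t)) a b).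

Lemma continuous_eps (u : R -> R) (t : R) :
  continuous u t <-> forall eps, 0 < eps -> exists d, 0 < d /\
    forall s, Rabs (s - t) < d -> Rabs (u s - u t) < eps.
Proof.
  unfold continuous. rewrite filterlim_locally. split.
  - intros H eps He. destruct (H (mkposreal eps He)) as [d Hd].
    exists d. split; [apply cond_pos|]. intros s Hs. apply Hd. exact Hs.
  - intros H eps. destruct (H eps (cond_pos eps)) as (d & Hd & Hs).
    exists (mkposreal d Hd). intros s Hs'. apply Hs. exact Hs'.
Qed.

Lemma Rcc_eps (g : R -> C) (t : R) :
  Rcc g t <-> forall eps, 0 < eps -> exists d, 0 < d /\
    forall s, Rabs (s - t) < d -> Cmod (g s - g t)%C < eps.
Proof.
  unfold Rcc. rewrite !continuous_eps. split.
  - intros [H1 H2] eps He.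
    destruct (H1 (eps / 2)) as (d1 & Hd1 & A); [lra|].
    destruct (H2 (eps / 2)) as (d2 & Hd2 & B); [lra|].
    exists (Rmin d1 d2). split; [apply Rmin_glb_lt; auto|]. intros s Hs.
    specialize (A s (Rlt_le_trans _ _ _ Hs (Rmin_l _ _))).
    specialize (B s (Rlt_le_trans _ _ _ Hs (Rmin_r _ _))).
    eapply Rle_lt_trans; [apply Cmod_le_abs|].
    change (Rabs (Re (g s) - Re (g t)) + Rabs (Im (g s) - Im (g t)) < eps). lra.
  - intros H; split; intros eps He; destruct (H eps He) as (d & Hd & A);
      exists d; split; auto; intros s Hs; eapply Rle_lt_trans; [|apply (A s Hs)| |apply (A s Hs)].
    + apply (re_le_Cmod (g s - g t)%C).
    + apply (im_le_Cmod (g s - g t)%C).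
Qed.

Lemma Rcc_comp (f : C -> C) (g : R -> C) (t : R) :
  Ccts f (g t) -> Rcc g t -> Rcc (fun s => f (g s)) t.
Proof.
  rewrite !Rcc_eps. intros H1 H2 eps He. destruct (H1 eps He) as (d & Hd & A).
  destruct (H2 d Hd) as (e & He' & B). exists e; split; auto.
Qed.

Lemma Rcc_const (c : C) (t : R) : Rcc (fun _ => c) t.
Proof. split; apply continuous_const. Qed.

Lemma Rcc_pair (u v : R -> R) (t : R) :
  continuous u t -> continuous v t -> Rcc (fun s => (u s, v s)) t.
Proof. split; auto. Qed.

Lemma Rcc_plus (f g : R -> C) (t : R) : Rcc f t -> Rcc g t -> Rcc (fun s => f s + g s)%C t.
Proof.
  intros [A B] [A' B']; split.
  - apply (continuous_plus (fun s => Re (f s)) (fun s => Re (g s))); auto.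
  - apply (continuous_plus (fun s => Im (f s)) (fun s => Im (g s))); auto.
Qed.

Lemma Rcc_opp (f : R -> C) (t : R) : Rcc f t -> Rcc (fun s => - f s)%C t.
Proof.
  intros [A B]; split.
  - apply (continuous_opp (fun s => Re (f s))); auto.
  - apply (continuous_opp (fun s => Im (f s))); auto.
Qed.

Lemma Rcc_minus (f g : R -> C) (t : R) : Rcc f t -> Rcc g t -> Rcc (fun s => f s - g s)%C t.
Proof. intros A B. apply (Rcc_plus f (fun s => - g s)%C); auto. apply Rcc_opp; auto. Qed.

Lemma Rcc_mult (f g : R -> C) (t : R) : Rcc f t -> Rcc g t -> Rcc (fun s => f s * g s)%C t.
Proof.
  intros [A B] [A' B']; split.
  - apply (continuous_minus (fun s => Re (f s) * Re (g s)) (fun s => Im (f s) * Im (g s)));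
      apply (continuous_mult (K := R_AbsRing)); auto.
  - apply (continuous_plus (fun s => Re (f s) * Im (g s)) (fun s => Im (f s) * Re (g s)));
      apply (continuous_mult (K := R_AbsRing)); auto.
Qed.

Lemma Rcc_inv (f : R -> C) (t : R) : f t <> RtoC 0 -> Rcc f t -> Rcc (fun s => / f s)%C t.
Proof.
  intros H A. apply (Rcc_comp Cinv f); auto. eapply Cder_cts. apply Cder_Cinv; auto.
Qed.

Lemma Rcc_conj (f : R -> C) (t : R) : Rcc f t -> Rcc (fun s => Cconj (f s)) t.
Proof.
  intros [A B]; split; auto. apply (continuous_opp (fun s => Im (f s))); auto.
Qed.

Lemma Rcc_Cexp (t : R) : Rcc (fun s => Cexp (0, s)) t.
Proof.
  apply (Rcc_comp Cexp (fun s => (0, s))).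
  - eapply Cder_cts, Cder_Cexp.
  - apply Rcc_pair; [apply continuous_const|apply continuous_id].
Qed.

Lemma Rcts_ex (g : R -> C) (a b : R) : Rcts g a b ->
  ex_RInt (fun t => Re (g t)) a b /\ ex_RInt (fun t => Im (g t)) a b.
Proof.
  intros H; split; apply (ex_RInt_continuous (V := R_CompleteNormedModule)); intros t Ht; apply (H t Ht).
Qed.

Lemma CI_plus (f g : R -> C) (a b : R) : Rcts f a b -> Rcts g a b ->
  CI (fun t => f t + g t)%C a b = (CI f a b + CI g a b)%C.
Proof.
  intros H1 H2. destruct (Rcts_ex _ _ _ H1) as [A B]. destruct (Rcts_ex _ _ _ H2) as [A' B'].
  unfold CI. apply Ceq; unfold Re at 1 2, Im at 1 2; simpl.
  - apply (RInt_plus (fun t => Re (f t)) (fun t => Re (g t))); auto.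
  - apply (RInt_plus (fun t => Im (f t)) (fun t => Im (g t))); auto.
Qed.

Lemma CI_mult (c : C) (f : R -> C) (a b : R) : Rcts f a b ->
  CI (fun t => c * f t)%C a b = (c * CI f a b)%C.
Proof.
  intros H1. destruct (Rcts_ex _ _ _ H1) as [A B].
  apply (RInt_correct (V := R_CompleteNormedModule)) in A.
  apply (RInt_correct (V := R_CompleteNormedModule)) in B.
  unfold CI. apply Ceq; unfold Re at 1, Im at 1; cbn [fst snd]; apply is_RInt_unique.
  - apply (is_RInt_minus (V := R_NormedModule) (fun t => Re c * Re (f t)) (fun t => Im c * Im (f t)));
      apply (is_RInt_scal (V := R_NormedModule)); assumption.
  - apply (is_RInt_plus (V := R_NormedModule) (fun t => Re c * Im (f t)) (fun t => Im c * Re (f t)));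
      apply (is_RInt_scal (V := R_NormedModule)); assumption.
Qed.

Lemma CI_opp (f : R -> C) (a b : R) : Rcts f a b -> CI (fun t => - f t)%C a b = (- CI f a b)%C.
Proof.
  intros H. replace (- CI f a b)%C with (- (1) * CI f a b)%C by ring.
  rewrite <- CI_mult by auto. unfold CI. f_equal; apply RInt_ext; intros; f_equal; ring.
Qed.

Lemma CI_minus (f g : R -> C) (a b : R) : Rcts f a b -> Rcts g a b ->
  CI (fun t => f t - g t)%C a b = (CI f a b - CI g a b)%C.
Proof.
  intros H1 H2. unfold Cminus. rewrite <- CI_opp by auto.
  apply (CI_plus f (fun t => - g t)%C); auto. intros t Ht. apply Rcc_opp; auto.
Qed.

Lemma CI_ext (f g : R -> C) (a b : R) :
  (forall t, Rmin a b < t < Rmax a b -> f t = g t) -> CI f a b = CI g a b.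
Proof. intros H. unfold CI. f_equal; apply RInt_ext; intros; f_equal; auto. Qed.

Lemma CI_Chasles (f : R -> C) (a b c : R) : Rcts f a b -> Rcts f b c ->
  (CI f a b + CI f b c)%C = CI f a c.
Proof.
  intros H1 H2. destruct (Rcts_ex _ _ _ H1) as [A B]. destruct (Rcts_ex _ _ _ H2) as [A' B'].
  unfold CI. apply Ceq; unfold Re at 1 2, Im at 1 2; simpl.
  - apply (RInt_Chasles (fun t => Re (f t))); auto.
  - apply (RInt_Chasles (fun t => Im (f t))); auto.
Qed.

Lemma CI_const (c : C) (a b : R) : CI (fun _ => c) a b = (RtoC (b - a) * c)%C.
Proof.
  unfold CI. apply Ceq; unfold Re at 1, Im at 1; simpl; rewrite RInt_const;
    unfold scal; simpl; unfold mult, Re, Im; simpl; ring.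
Qed.

Lemma CI_conj (f : R -> C) (a b : R) : Rcts f a b ->
  CI (fun t => Cconj (f t)) a b = Cconj (CI f a b).
Proof.
  intros H. destruct (Rcts_ex _ _ _ H) as [A B]. unfold CI, Cconj. simpl. f_equal.
  apply (RInt_opp (fun t => Im (f t))); auto.
Qed.

(** [Cmod] is the norm of the product of two copies of [R], so the norm inequality for vector-valued
    integrals applies with constant 1. A componentwise estimate would lose a factor, and the strict
    mean value inequality used for the maximum principle cannot afford one. *)
Lemma CI_bound (f : R -> C) (h : R -> R) (a b : R) : a <= b -> Rcts f a b ->
  (forall t, a <= t <= b -> continuous h t) ->
  (forall t, a <= t <= b -> Cmod (f t) <= h t) -> Cmod (CI f a b) <= RInt h a b.
Proof.
  intros Hab H Hh Hle. destruct (Rcts_ex _ _ _ H) as [A B].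
  rewrite Cmod_norm.
  apply (norm_RInt_le (V := prod_NormedModule R_AbsRing R_NormedModule R_NormedModule) f h a b).
  - exact Hab.
  - intros t Ht. rewrite <- Cmod_norm. auto.
  - apply (is_RInt_fct_extend_pair (U := R_NormedModule) (V := R_NormedModule) f).
    + apply (RInt_correct (V := R_CompleteNormedModule)); exact A.
    + apply (RInt_correct (V := R_CompleteNormedModule)); exact B.
  - apply (RInt_correct (V := R_CompleteNormedModule)). apply ex_RInt_continuous.
    rewrite Rmin_left, Rmax_right by auto. auto.
Qed.

Lemma CI_bound_const (f : R -> C) (M a b : R) : a <= b -> Rcts f a b ->
  (forall t, a <= t <= b -> Cmod (f t) <= M) -> Cmod (CI f a b) <= M * (b - a).
Proof.
  intros Hab H Hle. eapply Rle_trans.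
  - apply (CI_bound f (fun _ => M)); auto. intros; apply continuous_const.
  - rewrite RInt_const. unfold scal; simpl; unfold mult; simpl. lra.
Qed.

Lemma CI_FTC (F f : R -> C) (a b : R) : Rcts f a b ->
  (forall t, Rmin a b <= t <= Rmax a b ->
     is_derive (fun s => Re (F s)) t (Re (f t)) /\ is_derive (fun s => Im (F s)) t (Im (f t))) ->
  CI f a b = (F b - F a)%C.
Proof.
  intros H D. apply Ceq; unfold CI; unfold Re at 1, Im at 1; cbn [fst snd]; apply is_RInt_unique.
  - exact (is_RInt_derive (V := R_CompleteNormedModule) (fun s => Re (F s)) (fun s => Re (f s)) a b
      (fun t Ht => proj1 (D t Ht)) (fun t Ht => proj1 (H t Ht))).
  - exact (is_RInt_derive (V := R_CompleteNormedModule) (fun s => Im (F s)) (fun s => Im (f s)) a b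
      (fun t Ht => proj2 (D t Ht)) (fun t Ht => proj2 (H t Ht))).
Qed.

(** * Goursat's theorem on rectangles *)

(** The contour integral of [f] around the rectangle [[a, b] + i [c, d]], counterclockwise; [Ci]
    comes from [dz = i dy] on the vertical sides. *)
Definition RI (f : C -> C) (a b c d : R) : C :=
  (CI (fun x => f (x, c)) a b - CI (fun x => f (x, d)) a b
   + Ci * (CI (fun y => f (b, y)) c d - CI (fun y => f (a, y)) c d))%C.

Lemma Rcc_horizontal (f : C -> C) (x y : R) : Ccts f (x, y) -> Rcc (fun t => f (t, y)) x.
Proof.
  intros H. apply (Rcc_comp f (fun t => (t, y))); auto.
  apply Rcc_pair; [apply continuous_id|apply continuous_const].
Qed.

Lemma Rcc_vertical (f : C -> C) (x y : R) : Ccts f (x, y) -> Rcc (fun t => f (x, t)) y.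
Proof.
  intros H. apply (Rcc_comp f (fun t => (x, t))); auto.
  apply Rcc_pair; [apply continuous_const|apply continuous_id].
Qed.

Definition rect_cts (f : C -> C) (a b c d : R) : Prop :=
  forall x y, a <= x <= b -> c <= y <= d -> Ccts f (x, y).

Lemma rect_cts_h (f : C -> C) (a b c d a' b' y : R) : rect_cts f a b c d ->
  a <= a' -> a' <= b' -> b' <= b -> c <= y <= d -> Rcts (fun x => f (x, y)) a' b'.
Proof.
  intros H H1 H2 H3 Hy t Ht. rewrite Rmin_left, Rmax_right in Ht by auto.
  apply Rcc_horizontal. apply H; lra.
Qed.

Lemma rect_cts_v (f : C -> C) (a b c d c' d' x : R) : rect_cts f a b c d ->
  c <= c' -> c' <= d' -> d' <= d -> a <= x <= b -> Rcts (fun y => f (x, y)) c' d'.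
Proof.
  intros H H1 H2 H3 Hy t Ht. rewrite Rmin_left, Rmax_right in Ht by auto.
  apply Rcc_vertical. apply H; lra.
Qed.

Ltac rect_cts_tac f H :=
  match goal with
  | |- Rcts (fun x => f (x, _)) _ _ => apply (rect_cts_h f _ _ _ _ _ _ _ H); lra
  | |- Rcts (fun y => f (_, y)) _ _ => apply (rect_cts_v f _ _ _ _ _ _ _ H); lra
  end.

Lemma RI_split (f : C -> C) (a b c d e g : R) : rect_cts f a b c d ->
  a <= e <= b -> c <= g <= d ->
  RI f a b c d = (RI f a e c g + RI f e b c g + RI f a e g d + RI f e b g d)%C.
Proof.
  intros H He Hg. unfold RI.
  rewrite <- (CI_Chasles (fun x => f (x, c)) a e b), <- (CI_Chasles (fun x => f (x, d)) a e b),
    <- (CI_Chasles (fun y => f (b, y)) c g d), <- (CI_Chasles (fun y => f (a, y)) c g d);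
    try rect_cts_tac f H.
  ring.
Qed.

Lemma RI_bound (f : C -> C) (M a b c d : R) : a <= b -> c <= d -> rect_cts f a b c d ->
  (forall x y, a <= x <= b -> c <= y <= d -> Cmod (f (x, y)) <= M) ->
  Cmod (RI f a b c d) <= 2 * M * ((b - a) + (d - c)).
Proof.
  intros Hab Hcd H HM. unfold RI.
  assert (B1 : Cmod (CI (fun x => f (x, c)) a b) <= M * (b - a)).
  { apply CI_bound_const; auto. eapply rect_cts_h; [exact H|lra..]. intros; apply HM; lra. }
  assert (B2 : Cmod (CI (fun x => f (x, d)) a b) <= M * (b - a)).
  { apply CI_bound_const; auto. eapply rect_cts_h; [exact H|lra..]. intros; apply HM; lra. }
  assert (B3 : Cmod (CI (fun y => f (b, y)) c d) <= M * (d - c)).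
  { apply CI_bound_const; auto. eapply rect_cts_v; [exact H|lra..]. intros; apply HM; lra. }
  assert (B4 : Cmod (CI (fun y => f (a, y)) c d) <= M * (d - c)).
  { apply CI_bound_const; auto. eapply rect_cts_v; [exact H|lra..]. intros; apply HM; lra. }
  unfold Cminus. eapply Rle_trans; [apply Cmod_triangle|]. rewrite Cmod_mult, Cmod_Ci, Rmult_1_l.
  assert (C1 := Cmod_triangle (CI (fun x => f (x, c)) a b) (- CI (fun x => f (x, d)) a b)).
  assert (C2 := Cmod_triangle (CI (fun y => f (b, y)) c d) (- CI (fun y => f (a, y)) c d)).
  rewrite !Cmod_opp in C1, C2. lra.
Qed.

Lemma RI_minus (f g : C -> C) (a b c d : R) : a <= b -> c <= d ->
  rect_cts f a b c d -> rect_cts g a b c d ->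
  RI (fun z => f z - g z)%C a b c d = (RI f a b c d - RI g a b c d)%C.
Proof.
  intros Hab Hcd H1 H2. unfold RI.
  rewrite (CI_minus (fun x => f (x, c)) (fun x => g (x, c))), (CI_minus (fun x => f (x, d)) (fun x => g (x, d))),
    (CI_minus (fun y => f (b, y)) (fun y => g (b, y))), (CI_minus (fun y => f (a, y)) (fun y => g (a, y)));
    try rect_cts_tac f H1; try rect_cts_tac g H2.
  ring.
Qed.

Lemma RI_affine (u v : C) (a b c d : R) : a <= b -> c <= d ->
  RI (fun z => u + v * z)%C a b c d = RtoC 0.
Proof.
  intros Hab Hcd. destruct u as [u1 u2], v as [v1 v2].
  assert (K : rect_cts (fun z => (u1, u2) + (v1, v2) * z)%C a b c d).
  { intros x y _ _. apply Cdiff_cts. apply Cdiff_plus; [apply Cdiff_const|].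
    apply Cdiff_mult; [apply Cdiff_const|apply Cdiff_id]. }
  assert (Hh : forall y, c <= y <= d ->
    CI (fun x => (u1, u2) + (v1, v2) * (x, y))%C a b =
     (((u1 * b + v1 * (b * b / 2) - v2 * y * b)%R, (u2 * b + v1 * y * b + v2 * (b * b / 2))%R)
      - ((u1 * a + v1 * (a * a / 2) - v2 * y * a)%R, (u2 * a + v1 * y * a + v2 * (a * a / 2))%R))%C).
  { intros y Hy.
    apply (CI_FTC (fun x => ((u1 * x + v1 * (x * x / 2) - v2 * y * x)%R, (u2 * x + v1 * y * x + v2 * (x * x / 2))%R))).
    - eapply rect_cts_h with (f := fun z => ((u1, u2) + (v1, v2) * z)%C); [exact K|lra..].
    - intros t _. simpl. split; auto_derive; auto; simpl; field. }
  assert (Hv : forall x, a <= x <= b ->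
    CI (fun y => (u1, u2) + (v1, v2) * (x, y))%C c d =
     (((u1 * d + v1 * x * d - v2 * (d * d / 2))%R, (u2 * d + v1 * (d * d / 2) + v2 * x * d)%R)
      - ((u1 * c + v1 * x * c - v2 * (c * c / 2))%R, (u2 * c + v1 * (c * c / 2) + v2 * x * c)%R))%C).
  { intros x Hx.
    apply (CI_FTC (fun y => ((u1 * y + v1 * x * y - v2 * (y * y / 2))%R, (u2 * y + v1 * (y * y / 2) + v2 * x * y)%R))).
    - eapply rect_cts_v with (f := fun z => ((u1, u2) + (v1, v2) * z)%C); [exact K|lra..].
    - intros t _. simpl. split; auto_derive; auto; simpl; field. }
  unfold RI. rewrite !Hh, !Hv by lra. apply Ceq; unfold Re, Im; simpl; field.
Qed.

(** One quarter is chosen at each stage, and completeness applied to the left and lower edges yields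
    the common point. Keeping [P] abstract lets the same construction serve Goursat's theorem and
    the existence of a maximum. *)
Lemma bisection (P : R -> R -> R -> R -> Prop) (a b c d : R) :
  (forall a b c d, a <= b -> c <= d -> P a b c d ->
     P a ((a + b) / 2) c ((c + d) / 2) \/ P ((a + b) / 2) b c ((c + d) / 2) \/
     P a ((a + b) / 2) ((c + d) / 2) d \/ P ((a + b) / 2) b ((c + d) / 2) d) ->
  a <= b -> c <= d -> P a b c d ->
  exists x y, a <= x <= b /\ c <= y <= d /\
    forall del, 0 < del -> exists n a' b' c' d', b' - a' = (b - a) / 2 ^ n /\ d' - c' = (d - c) / 2 ^ n /\
      (b' - a') + (d' - c') < del /\
      a <= a' <= x /\ x <= b' <= b /\ c <= c' <= y /\ y <= d' <= d /\ P a' b' c' d'.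
Proof.
  intros Hstep Hab Hcd HP.
  set (Q := fun (s : (R * R) * (R * R)) => fst (fst s) <= snd (fst s) /\ fst (snd s) <= snd (snd s) /\
     P (fst (fst s)) (snd (fst s)) (fst (snd s)) (snd (snd s))).
  set (N := fun s s' : (R * R) * (R * R) =>
    (snd (fst s') - fst (fst s')) = (snd (fst s) - fst (fst s)) / 2 /\
    (snd (snd s') - fst (snd s')) = (snd (snd s) - fst (snd s)) / 2 /\
    fst (fst s) <= fst (fst s') /\ snd (fst s') <= snd (fst s) /\
    fst (snd s) <= fst (snd s') /\ snd (snd s') <= snd (snd s)).
  (* A rectangle travels together with the proof of its invariant, so that the chosen successor is a
     total function and can be iterated. *)
  assert (Hex : forall s : {s | Q s}, exists s' : {s | Q s}, N (proj1_sig s) (proj1_sig s')).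
  { intros [[[a0 b0] [c0 d0]] (H1 & H2 & H3)]. simpl in H1, H2, H3.
    destruct (Hstep _ _ _ _ H1 H2 H3) as [H|[H|[H|H]]].
    - unshelve eexists (exist _ ((a0, (a0 + b0) / 2), (c0, (c0 + d0) / 2)) _);
        unfold Q, N; simpl; repeat split; auto; lra.
    - unshelve eexists (exist _ (((a0 + b0) / 2, b0), (c0, (c0 + d0) / 2)) _);
        unfold Q, N; simpl; repeat split; auto; lra.
    - unshelve eexists (exist _ ((a0, (a0 + b0) / 2), ((c0 + d0) / 2, d0)) _);
        unfold Q, N; simpl; repeat split; auto; lra.
    - unshelve eexists (exist _ (((a0 + b0) / 2, b0), ((c0 + d0) / 2, d0)) _);
        unfold Q, N; simpl; repeat split; auto; lra. }
  set (nxt := fun s => proj1_sig (constructive_indefinite_description _ (Hex s))).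
  assert (Hnxt : forall s, N (proj1_sig s) (proj1_sig (nxt s))).
  { intros s. unfold nxt. destruct (constructive_indefinite_description _ (Hex s)); auto. }
  assert (Q0 : Q ((a, b), (c, d))) by (unfold Q; simpl; auto).
  set (S := fun n => proj1_sig (Nat.iter n nxt (exist _ _ Q0))).
  assert (HQ : forall n, Q (S n)) by (intros n; unfold S; apply proj2_sig).
  assert (HN : forall n, N (S n) (S (Datatypes.S n))) by (intros n; unfold S; simpl; apply Hnxt).
  set (A := fun n => fst (fst (S n))). set (B := fun n => snd (fst (S n))).
  set (C0 := fun n => fst (snd (S n))). set (D := fun n => snd (snd (S n))).
  assert (Hw : forall n, B n - A n = (b - a) / 2 ^ n /\ D n - C0 n = (d - c) / 2 ^ n).
  { induction n as [|n [I1 I2]].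
    - unfold A, B, C0, D, S; simpl. split; field.
    - destruct (HN n) as (E1 & E2 & _). fold (A n) (B n) (C0 n) (D n) in E1, E2.
      fold (A (Datatypes.S n)) (B (Datatypes.S n)) (C0 (Datatypes.S n)) (D (Datatypes.S n)) in E1, E2.
      rewrite E1, E2, I1, I2. simpl. split; field; apply pow_nonzero; lra. }
  assert (Hmono : forall n k, A n <= A (k + n)%nat /\ B (k + n)%nat <= B n /\
                              C0 n <= C0 (k + n)%nat /\ D (k + n)%nat <= D n).
  { induction k as [|k IH]; [repeat split; simpl; lra|].
    destruct (HN (k + n)%nat) as (_ & _ & E1 & E2 & E3 & E4). 
    fold (A (k + n)%nat) (B (k + n)%nat) (C0 (k + n)%nat) (D (k + n)%nat) in E1, E2, E3, E4.
    rewrite !Nat.add_succ_l.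
    fold (A (Datatypes.S (k + n))) (B (Datatypes.S (k + n))) (C0 (Datatypes.S (k + n)))
      (D (Datatypes.S (k + n))) in E1, E2, E3, E4. destruct IH as (I1 & I2 & I3 & I4). repeat split; lra. }
  assert (HAB : forall n, A n <= B n /\ C0 n <= D n) by (intros n; destruct (HQ n) as (E1 & E2 & _); split; auto).
  assert (Hcross : forall n m, A n <= B m /\ C0 n <= D m).
  { intros n m. destruct (Hmono n m) as (E1 & E2 & E3 & E4). destruct (Hmono m n) as (F1 & F2 & F3 & F4).
    rewrite (Nat.add_comm n m) in F1, F2, F3, F4. destruct (HAB (m + n)%nat). split; lra. }
  destruct (completeness (fun x => exists n, x = A n)) as [x [Hx1 Hx2]].
  { exists (B 0%nat). intros x [n ->]. apply Hcross. }
  { exists (A 0%nat), 0%nat; auto. }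
  destruct (completeness (fun x => exists n, x = C0 n)) as [y [Hy1 Hy2]].
  { exists (D 0%nat). intros y [n ->]. apply Hcross. }
  { exists (C0 0%nat), 0%nat; auto. }
  assert (Bx : forall n, A n <= x <= B n).
  { intros n; split; [apply Hx1; exists n; auto|]. apply Hx2. intros u [k ->]. apply Hcross. }
  assert (By : forall n, C0 n <= y <= D n).
  { intros n; split; [apply Hy1; exists n; auto|]. apply Hy2. intros u [k ->]. apply Hcross. }
  exists x, y. split; [apply (Bx 0%nat)|]. split; [apply (By 0%nat)|].
  intros del Hdel.
  destruct (pow_lt_1_zero (/ 2) ltac:(rewrite Rabs_right; lra) (del / (b - a + (d - c) + 1))) as [n Hn].
  { apply Rdiv_lt_0_compat; lra. }
  specialize (Hn n (Nat.le_refl n)). destruct (Hw n) as [W1 W2].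
  exists n, (A n), (B n), (C0 n), (D n). split; [auto|split; [auto|]].
  destruct (Hmono 0%nat n) as (M1 & M2 & M3 & M4). rewrite Nat.add_0_r in *.
  change (A 0%nat) with a in M1. change (B 0%nat) with b in M2.
  change (C0 0%nat) with c in M3. change (D 0%nat) with d in M4.
  assert (X := Bx n). assert (Y := By n).
  split; [|split; [lra|split; [lra|split; [lra|split; [lra|]]]]].
  - rewrite W1, W2. rewrite pow_inv in Hn.
    assert (Hp : 0 < / 2 ^ n) by (apply Rinv_0_lt_compat, pow_lt; lra).
    rewrite Rabs_right in Hn by lra.
    apply Rle_lt_trans with ((b - a + (d - c) + 1) * / 2 ^ n).
    { unfold Rdiv. nra. }
    apply Rlt_le_trans with ((b - a + (d - c) + 1) * (del / (b - a + (d - c) + 1))).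
    { apply Rmult_lt_compat_l; lra. }
    right; field; lra.
  - destruct (HQ n) as (_ & _ & E). exact E.
Qed.

(** The invariant says that the contour integral is at least [k] times the square of the half
    perimeter. Both are divided by four under quartering, so one quarter inherits it, and at the
    limit point differentiability makes the integral smaller than that. *)
Lemma goursat (f : C -> C) (a b c d : R) : a <= b -> c <= d ->
  (forall x y, a <= x <= b -> c <= y <= d -> Cdiff f (x, y)) -> RI f a b c d = RtoC 0.
Proof.
  intros Hab Hcd Hf. apply NNPP; intros HN.
  assert (Hk : rect_cts f a b c d) by (intros x y Hx Hy; apply Cdiff_cts; auto).
  assert (HI : 0 < Cmod (RI f a b c d)) by (apply Cmod_gt_0; auto).
  set (s0 := (b - a) + (d - c)).
  assert (Hs0 : 0 < s0).
  { apply Rnot_le_lt; intros L. assert (E1 : b = a) by (unfold s0 in L; lra).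
    assert (E2 : d = c) by (unfold s0 in L; lra). subst b d. apply HN.
    unfold RI, CI. rewrite !RInt_point. apply Ceq; unfold Re, Im; simpl; unfold zero; simpl; ring. }
  set (k := Cmod (RI f a b c d) / (s0 * s0)).
  assert (Hkp : 0 < k) by (apply Rdiv_lt_0_compat; nra).
  (* Containment in the original rectangle is a premise inside the predicate, because the quartering
     step is required for arbitrary rectangles while continuity is known only there. *)
  destruct (bisection (fun a' b' c' d' => a <= a' -> b' <= b -> c <= c' -> d' <= d ->
     k * (((b' - a') + (d' - c')) * ((b' - a') + (d' - c'))) <= Cmod (RI f a' b' c' d')) a b c d)
    as (x & y & Hx & Hy & Hlim); auto.
  - intros a1 b1 c1 d1 H1 H2 HP.
    apply NNPP; intros Hno.
    apply not_or_and in Hno; destruct Hno as [N1 Hno].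
    apply not_or_and in Hno; destruct Hno as [N2 Hno].
    apply not_or_and in Hno; destruct Hno as [N3 N4].
    apply imply_to_and in N1; destruct N1 as [X1 N1].
    apply imply_to_and in N1; destruct N1 as [X2 N1].
    apply imply_to_and in N1; destruct N1 as [X3 N1].
    apply imply_to_and in N1; destruct N1 as [X4 N1].
    apply imply_to_and in N4; destruct N4 as [Y1 N4].
    apply imply_to_and in N4; destruct N4 as [Y2 N4].
    apply imply_to_and in N4; destruct N4 as [Y3 N4].
    apply imply_to_and in N4; destruct N4 as [Y4 N4].
    specialize (HP ltac:(lra) ltac:(lra) ltac:(lra) ltac:(lra)).
    apply Rnot_le_lt in N1. apply Rnot_le_lt in N4.
    assert (N2' : ~ k * ((b1 - (a1 + b1) / 2 + ((c1 + d1) / 2 - c1)) * (b1 - (a1 + b1) / 2 + ((c1 + d1) / 2 - c1))) <=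
       Cmod (RI f ((a1 + b1) / 2) b1 c1 ((c1 + d1) / 2))) by (intros G; apply N2; intros; exact G).
    assert (N3' : ~ k * (((a1 + b1) / 2 - a1 + (d1 - (c1 + d1) / 2)) * ((a1 + b1) / 2 - a1 + (d1 - (c1 + d1) / 2))) <=
       Cmod (RI f a1 ((a1 + b1) / 2) ((c1 + d1) / 2) d1)) by (intros G; apply N3; intros; exact G).
    apply Rnot_le_lt in N2'. apply Rnot_le_lt in N3'.
    rewrite (RI_split f a1 b1 c1 d1 ((a1 + b1) / 2) ((c1 + d1) / 2)) in HP; try lra.
    2:{ intros u v Hu Hv; apply Hk; lra. }
    assert (T := Cmod_triangle (RI f a1 ((a1 + b1) / 2) c1 ((c1 + d1) / 2) + RI f ((a1 + b1) / 2) b1 c1 ((c1 + d1) / 2)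
      + RI f a1 ((a1 + b1) / 2) ((c1 + d1) / 2) d1)%C (RI f ((a1 + b1) / 2) b1 ((c1 + d1) / 2) d1)).
    assert (T1 := Cmod_triangle (RI f a1 ((a1 + b1) / 2) c1 ((c1 + d1) / 2) + RI f ((a1 + b1) / 2) b1 c1 ((c1 + d1) / 2))%C
      (RI f a1 ((a1 + b1) / 2) ((c1 + d1) / 2) d1)).
    assert (T2 := Cmod_triangle (RI f a1 ((a1 + b1) / 2) c1 ((c1 + d1) / 2)) (RI f ((a1 + b1) / 2) b1 c1 ((c1 + d1) / 2))).
    nra.
  - intros _ _ _ _. fold s0. unfold k. right; field; lra.
  - destruct (Hf x y Hx Hy) as [l Hl].
    (* With relative error [k / 4] the perimeter bound becomes [k s^2 / 2], half of what the
       invariant demands. *)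
    destruct (Hl (k / 4)) as (del & Hdel & Hw); [lra|].
    destruct (Hlim del Hdel) as (n & a' & b' & c' & d' & W1 & W2 & W3 & Ba & Bb & Bc & Bd & HP).
    specialize (HP ltac:(lra) ltac:(lra) ltac:(lra) ltac:(lra)).
    set (s := (b' - a') + (d' - c')) in *.
    assert (Hs : 0 < s).
    { unfold s. rewrite W1, W2. replace ((b - a) / 2 ^ n + (d - c) / 2 ^ n) with (s0 / 2 ^ n)
        by (unfold s0; field; apply pow_nonzero; lra).
      apply Rdiv_lt_0_compat; auto. apply pow_lt; lra. }
    set (lin := fun z => ((f (x, y) - l * (x, y)) + l * z)%C).
    assert (Hlc : rect_cts lin a' b' c' d').
    { intros u v _ _. apply Cdiff_cts. unfold lin. apply Cdiff_plus; [apply Cdiff_const|].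
      apply Cdiff_mult; [apply Cdiff_const|apply Cdiff_id]. }
    assert (Hfc : rect_cts f a' b' c' d') by (intros u v Hu Hv; apply Hk; lra).
    assert (E : RI f a' b' c' d' = RI (fun z => f z - lin z)%C a' b' c' d').
    { rewrite RI_minus by (auto; lra). unfold lin at 1. rewrite RI_affine by lra. ring. }
    assert (Bd' : Cmod (RI (fun z => f z - lin z)%C a' b' c' d') <= 2 * (k / 4 * s) * s).
    { apply RI_bound; try lra.
      - intros u v Hu Hv eps He. 
        destruct (Hfc u v Hu Hv (eps / 2)) as (d1 & Hd1 & A1); [lra|].
        destruct (Hlc u v Hu Hv (eps / 2)) as (d2 & Hd2 & A2); [lra|].
        exists (Rmin d1 d2). split; [apply Rmin_glb_lt; auto|]. intros w Hm.
        specialize (A1 w (Rlt_le_trans _ _ _ Hm (Rmin_l _ _))).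
        specialize (A2 w (Rlt_le_trans _ _ _ Hm (Rmin_r _ _))).
        replace (f w - lin w - (f (u, v) - lin (u, v)))%C
          with ((f w - f (u, v)) + - (lin w - lin (u, v)))%C by ring.
        eapply Rle_lt_trans; [apply Cmod_triangle|]. rewrite Cmod_opp. lra.
      - intros u v Hu Hv.
        assert (Hd : Cmod ((u, v) - (x, y))%C <= s).
        { eapply Rle_trans; [apply Cmod_le_abs|]. unfold Re, Im; simpl.
          apply Rle_trans with ((b' - a') + (d' - c')); [|unfold s; lra].
          apply Rplus_le_compat; apply Rabs_le; split; lra. }
        specialize (Hw (u, v) (Rle_lt_trans _ _ _ Hd W3)).
        unfold lin. replace (f (u, v) - (f (x, y) - l * (x, y) + l * (u, v)))%C
          with (f (u, v) - f (x, y) - l * ((u, v) - (x, y)))%C by ring.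
        eapply Rle_trans; [exact Hw|]. apply Rmult_le_compat_l; [lra|exact Hd]. }
    rewrite <- E in Bd'. assert (Z : 0 < k * (s * s)) by (apply Rmult_lt_0_compat; [exact Hkp|nra]).
    replace (2 * (k / 4 * s) * s) with (k * (s * s) / 2) in Bd' by field. lra.
Qed.

(** * Cauchy's formula on circles *)

Lemma Ccts_mult (f g : C -> C) (z : C) : Ccts f z -> Ccts g z -> Ccts (fun w => f w * g w)%C z.
Proof.
  intros H1 H2 eps He.
  assert (Hf := Cmod_ge_0 (f z)). assert (Hg := Cmod_ge_0 (g z)).
  set (e := Rmin 1 (eps / (Cmod (f z) + Cmod (g z) + 2))).
  assert (He1 : 0 < e) by (apply Rmin_glb_lt; [lra|apply Rdiv_lt_0_compat; lra]).
  assert (e <= 1) by apply Rmin_l.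
  assert (Hb : e * (Cmod (f z) + Cmod (g z) + 2) <= eps).
  { apply Rle_trans with (eps / (Cmod (f z) + Cmod (g z) + 2) * (Cmod (f z) + Cmod (g z) + 2)).
    - apply Rmult_le_compat_r; [lra|apply Rmin_r].
    - right; field; lra. }
  clearbody e.
  destruct (H1 e He1) as (d1 & Hd1 & A). destruct (H2 e He1) as (d2 & Hd2 & B).
  exists (Rmin d1 d2). split; [apply Rmin_glb_lt; auto|]. intros w Hw.
  specialize (A w (Rlt_le_trans _ _ _ Hw (Rmin_l _ _))).
  specialize (B w (Rlt_le_trans _ _ _ Hw (Rmin_r _ _))).
  replace (f w * g w - f z * g z)%C with ((f w - f z) * (g w - g z) + (f w - f z) * g z + f z * (g w - g z))%C by ring.
  eapply Rle_lt_trans; [apply Cmod_triangle|].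
  eapply Rle_lt_trans; [apply Rplus_le_compat_r, Cmod_triangle|]. rewrite !Cmod_mult.
  generalize (Cmod_ge_0 (f w - f z)%C) (Cmod_ge_0 (g w - g z)%C). nra.
Qed.

Lemma exp_mono (x y : R) : x <= y -> exp x <= exp y.
Proof. intros [H|H]; [left; apply exp_increasing; auto|subst; right; auto]. Qed.

Definition circ (c : C) (r t : R) : C := (c + RtoC r * Cexp (0, t))%C.

(** Integration in the angle, so this is [2 PI] times the mean over the circle; in Cauchy's formula
    [dw / (w - z)] therefore appears as [(w - c) / (w - z)], up to the factor [i]. *)
Definition CM (f : C -> C) (c : C) (r : R) : C := CI (fun t => f (circ c r t)) 0 (2 * PI).

Lemma Cmod_Cexp_im (t : R) : Cmod (Cexp (0, t)) = 1.
Proof. rewrite Cmod_exp. simpl. apply exp_0. Qed.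

Lemma Cmod_circ (c : C) (r t : R) : 0 <= r -> Cmod (circ c r t - c)%C = r.
Proof.
  intros Hr. unfold circ. replace (c + RtoC r * Cexp (0, t) - c)%C with (RtoC r * Cexp (0, t))%C by ring.
  rewrite Cmod_mult, Cmod_R, Cmod_Cexp_im, Rabs_right; lra.
Qed.

Lemma Rcc_circ (c : C) (r t : R) : Rcc (circ c r) t.
Proof.
  apply Rcc_plus; [apply Rcc_const|]. apply Rcc_mult; [apply Rcc_const|apply Rcc_Cexp].
Qed.

Lemma two_pi_pos : 0 < 2 * PI.
Proof. generalize PI_RGT_0; lra. Qed.

Lemma Rcts_circ (f : C -> C) (c : C) (r a b : R) : 0 <= r ->
  (forall z, Cmod (z - c)%C = r -> Ccts f z) -> Rcts (fun t => f (circ c r t)) a b.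
Proof.
  intros Hr H t _. apply (Rcc_comp f (circ c r)); [|apply Rcc_circ]. apply H, Cmod_circ; auto.
Qed.

Lemma CM_bound (f : C -> C) (c : C) (r M : R) : 0 <= r ->
  (forall z, Cmod (z - c)%C = r -> Ccts f z) ->
  (forall z, Cmod (z - c)%C = r -> Cmod (f z) <= M) -> Cmod (CM f c r) <= M * (2 * PI).
Proof.
  intros Hr H HM. unfold CM.
  replace (M * (2 * PI)) with (M * (2 * PI - 0)) by ring.
  apply CI_bound_const.
  - generalize two_pi_pos; lra.
  - apply Rcts_circ; auto.
  - intros t _. apply HM, Cmod_circ; auto.
Qed.

Lemma CM_ext (f g : C -> C) (c : C) (r : R) : 0 <= r ->
  (forall z, Cmod (z - c)%C = r -> f z = g z) -> CM f c r = CM g c r.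
Proof. intros Hr H. apply CI_ext. intros t _. apply H, Cmod_circ; auto. Qed.

Lemma CM_const (k c : C) (r : R) : CM (fun _ => k) c r = (RtoC (2 * PI) * k)%C.
Proof. unfold CM. rewrite CI_const. f_equal. f_equal. ring. Qed.

Lemma CM_minus (f g : C -> C) (c : C) (r : R) : 0 <= r ->
  (forall z, Cmod (z - c)%C = r -> Ccts f z) -> (forall z, Cmod (z - c)%C = r -> Ccts g z) ->
  CM (fun z => f z - g z)%C c r = (CM f c r - CM g c r)%C.
Proof. intros Hr H1 H2. apply CI_minus; apply Rcts_circ; auto. Qed.

Lemma CM_scal (k : C) (f : C -> C) (c : C) (r : R) : 0 <= r ->
  (forall z, Cmod (z - c)%C = r -> Ccts f z) -> CM (fun z => k * f z)%C c r = (k * CM f c r)%C.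
Proof. intros Hr H1. apply (CI_mult k (fun t => f (circ c r t))); apply Rcts_circ; auto. Qed.

(* Pulling back by the exponential turns the annulus into a rectangle whose horizontal sides cancel by periodicity. *)
Lemma annulus_const (f : C -> C) (c : C) (r1 r2 : R) : 0 < r1 -> r1 <= r2 ->
  (forall z, r1 <= Cmod (z - c)%C <= r2 -> Cdiff f z) -> CM f c r1 = CM f c r2.
Proof.
  intros H1 H2 Hf.
  assert (Hl : ln r1 <= ln r2) by (destruct H2 as [H2|H2]; [left; apply ln_increasing; auto|subst; lra]).
  set (g := fun w => f (c + Cexp w)%C).
  assert (G := goursat g (ln r1) (ln r2) 0 (2 * PI) Hl (Rlt_le _ _ two_pi_pos)).
  assert (Hg : forall x y, ln r1 <= x <= ln r2 -> 0 <= y <= 2 * PI -> Cdiff g (x, y)).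
  { intros x y [Hx1 Hx2] _. apply (Cdiff_comp (fun w => (c + Cexp w)%C) f).
    - apply Cdiff_plus; [apply Cdiff_const|apply (Cdiff_Cexp (fun w => w)), Cdiff_id].
    - apply Hf. replace (c + Cexp (x, y) - c)%C with (Cexp (x, y)) by ring. rewrite Cmod_exp. simpl.
      rewrite <- (exp_ln r1) by auto. rewrite <- (exp_ln r2) by lra.
      split; apply exp_mono; assumption. }
  specialize (G Hg). unfold RI in G.
  assert (P : CI (fun x => g (x, 2 * PI)) (ln r1) (ln r2) = CI (fun x => g (x, 0)) (ln r1) (ln r2)).
  { apply CI_ext. intros x _. unfold g. do 2 f_equal. rewrite <- (Cexp_periodic (x, 0)). f_equal.
    apply Ceq; unfold Re, Im; simpl; ring. }
  rewrite P in G.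
  assert (E : forall r, 0 < r -> CI (fun y => g (ln r, y)) 0 (2 * PI) = CM f c r).
  { intros r Hr. apply CI_ext. intros t _. unfold g, circ. do 2 f_equal.
    replace (ln r, t) with (RtoC (ln r) + (0, t))%C by (apply Ceq; unfold Re, Im; simpl; ring).
    rewrite Cexp_plus, Cexp_RtoC, exp_ln by auto. reflexivity. }
  rewrite !E in G by lra.
  assert (N : (CM f c r2 - CM f c r1)%C = RtoC 0).
  { replace (CM f c r2 - CM f c r1)%C with
      (- Ci * (CI (fun x : R => g (x, 0)) (ln r1) (ln r2) - CI (fun x : R => g (x, 0)) (ln r1) (ln r2) +
     Ci * (CM f c r2 - CM f c r1)))%C.
    - rewrite G. ring.
    - replace (CM f c r2 - CM f c r1)%C with (- (Ci * Ci) * (CM f c r2 - CM f c r1))%C at 2.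
      + ring.
      + replace (- (Ci * Ci))%C with (RtoC 1) by (apply Ceq; unfold Re, Im; simpl; ring). ring. }
  symmetry. apply Ceq_minus. exact N.
Qed.

(** The integral is constant in the radius, and small circles bring it within any distance of
    [2 PI f c]. *)
Lemma mean_value (f : C -> C) (c : C) (r R : R) : 0 <= r < R ->
  (forall z, Cmod (z - c)%C < R -> Cdiff f z) -> CM f c r = (RtoC (2 * PI) * f c)%C.
Proof.
  intros [Hr HR] Hf.
  assert (K : forall s, 0 <= s < R -> forall z, Cmod (z - c)%C = s -> Ccts f z).
  { intros s Hs z Hz. apply Cdiff_cts, Hf. lra. }
  destruct (Req_dec r 0) as [->|Hr0].
  { rewrite <- (CM_const (f c) c 0). apply CM_ext; [lra|]. intros z Hz.
    apply Cmod_eq_0 in Hz. f_equal. apply Ceq_minus; auto. }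
  assert (Hc : Ccts f c).
  { apply Cdiff_cts, Hf. replace (c - c)%C with (RtoC 0) by ring. rewrite Cmod_0. lra. }
  apply Ceq_minus, NNPP; intros N.
  assert (HP := two_pi_pos).
  set (D := Cmod (CM f c r - RtoC (2 * PI) * f c)%C).
  assert (HD : 0 < D) by (apply Cmod_gt_0; auto).
  destruct (Hc (D / (4 * PI))) as (d & Hd & Hw).
  { apply Rdiv_lt_0_compat; lra. }
  set (s := Rmin (d / 2) r).
  assert (Hs : 0 < s) by (apply Rmin_glb_lt; lra).
  assert (Hs1 : s <= d / 2) by apply Rmin_l. assert (Hs2 : s <= r) by apply Rmin_r.
  clearbody s.
  assert (E : CM f c r = CM f c s).
  { symmetry; apply annulus_const; auto. intros z Hz. apply Hf; lra. }
  assert (B : D <= D / (4 * PI) * (2 * PI)).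
  { unfold D at 1. rewrite E, <- (CM_const (f c) c s), <- CM_minus; try lra.
    - apply CM_bound; try lra.
      + intros z Hz. apply Cdiff_cts, Cdiff_minus; [apply Hf; lra|apply Cdiff_const].
      + intros z Hz. left. apply Hw. lra.
    - apply K; lra.
    - intros; apply Cdiff_cts, Cdiff_const. }
  replace (D / (4 * PI) * (2 * PI)) with (D / 2) in B by (field; lra). lra.
Qed.

(** The kernel is holomorphic outside the circle through [z], so the radius can be pushed outwards,
    where the kernel tends to 1. The radius [s] in the proof makes the defect [D] at most half of
    itself. *)
Lemma kernel_mean (c z : C) (r : R) : Cmod (z - c)%C < r ->
  CM (fun w => (w - c) / (w - z))%C c r = RtoC (2 * PI).
Proof.
  intros Hz. assert (Hp := Cmod_ge_0 (z - c)%C). assert (HP := two_pi_pos).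
  set (rho := Cmod (z - c)%C) in *.
  assert (Hne : forall w, rho < Cmod (w - c)%C -> (w - z)%C <> RtoC 0).
  { intros w Hw. apply Cminus_neq. intros ->. unfold rho in Hw. lra. }
  assert (Hd : forall w, rho < Cmod (w - c)%C -> Cdiff (fun w => (w - c) / (w - z))%C w).
  { intros w Hw. apply Cdiff_div; [| |apply Hne; auto];
      apply Cdiff_minus; try apply Cdiff_id; apply Cdiff_const. }
  apply Ceq_minus, NNPP; intros N.
  set (D := Cmod (CM (fun w => (w - c) / (w - z))%C c r - RtoC (2 * PI))%C).
  assert (HD : 0 < D) by (apply Cmod_gt_0; auto).
  set (s := r + rho + rho * (4 * PI) / D).
  assert (Hq : 0 <= rho * (4 * PI) / D).
  { apply Rmult_le_pos; [nra|]. left; apply Rinv_0_lt_compat; auto. }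
  assert (Hs : r <= s) by (unfold s; lra).
  assert (B : D <= rho / (s - rho) * (2 * PI)).
  { unfold D. rewrite (annulus_const _ c r s); try lra.
    2:{ intros w Hw. apply Hd. lra. }
    replace (RtoC (2 * PI)) with (RtoC (2 * PI) * 1)%C by ring.
    rewrite <- (CM_const (RtoC 1) c s), <- CM_minus; try lra.
    - apply CM_bound; try lra.
      + intros w Hw. apply Cdiff_cts, Cdiff_minus; [apply Hd; lra|apply Cdiff_const].
      + intros w Hw. assert (Hn : (w - z)%C <> RtoC 0) by (apply Hne; lra).
        replace ((w - c) / (w - z) - 1)%C with ((z - c) / (w - z))%C by (field; auto).
        rewrite Cmod_div by auto. fold rho. apply Rmult_le_compat_l; auto.
        apply Rinv_le_contravar; [lra|].
        generalize (Cmod_triangle_minus (w - c)%C (z - c)%C).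
        replace (w - c - (z - c))%C with (w - z)%C by ring. fold rho. lra.
    - intros w Hw. apply Cdiff_cts, Hd; lra.
    - intros; apply Cdiff_cts, Cdiff_const. }
  assert (F : rho / (s - rho) * (2 * PI) <= D / 2).
  { unfold s. replace (r + rho + rho * (4 * PI) / D - rho) with (r + rho * (4 * PI) / D) by ring.
    set (x := r + rho * (4 * PI) / D).
    assert (Hx : D * x = D * r + rho * (4 * PI)) by (unfold x; field; lra).
    assert (Hx0 : 0 < x) by (unfold x; lra).
    apply Rmult_le_reg_r with x; auto.
    replace (rho / x * (2 * PI) * x) with (rho * (2 * PI)) by (field; lra). nra. }
  lra.
Qed.

Lemma circ_cts_2d (f : C -> C) (c : C) (x y : R) : Ccts f (circ c x y) ->
  continuity_2d_pt (fun r t => Re (f (circ c r t))) x y /\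
  continuity_2d_pt (fun r t => Im (f (circ c r t))) x y.
Proof.
  intros H.
  assert (K : forall eps, 0 < eps -> exists d, 0 < d /\ forall u v, Rabs (u - x) < d -> Rabs (v - y) < d ->
     Cmod (f (circ c u v) - f (circ c x y))%C < eps).
  { intros eps He. destruct (H eps He) as (d & Hd & A).
    destruct (proj1 (Rcc_eps (fun s => Cexp (0, s)) y) (Rcc_Cexp y) (d / (2 * (Rabs x + 1)))) as (d2 & Hd2 & B).
    { apply Rdiv_lt_0_compat; [auto|]. generalize (Rabs_pos x); lra. }
    exists (Rmin (d / 2) d2). split; [apply Rmin_glb_lt; lra|]. intros u v Hu Hv. apply A.
    assert (Hu' := Rlt_le_trans _ _ _ Hu (Rmin_l _ _)).
    specialize (B v (Rlt_le_trans _ _ _ Hv (Rmin_r _ _))).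
    unfold circ. replace (c + RtoC u * Cexp (0, v) - (c + RtoC x * Cexp (0, y)))%C
      with (RtoC (u - x) * Cexp (0, v) + RtoC x * (Cexp (0, v) - Cexp (0, y)))%C
      by (rewrite RtoC_minus; ring).
    eapply Rle_lt_trans; [apply Cmod_triangle|]. rewrite !Cmod_mult, !Cmod_R, Cmod_Cexp_im.
    assert (Hx := Rabs_pos x).
    assert (H9 : Rabs x * Cmod (Cexp (0, v) - Cexp (0, y))%C <= (Rabs x + 1) * (d / (2 * (Rabs x + 1)))).
    { apply Rmult_le_compat; try lra. apply Cmod_ge_0. }
    replace ((Rabs x + 1) * (d / (2 * (Rabs x + 1)))) with (d / 2) in H9 by (field; lra). lra. }
  split; intros eps; destruct (K eps (cond_pos eps)) as (d & Hd & B);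
    exists (mkposreal d Hd); intros u v Hu Hv; specialize (B u v Hu Hv).
  - eapply Rle_lt_trans; [|exact B]. apply (re_le_Cmod (f (circ c u v) - f (circ c x y))%C).
  - eapply Rle_lt_trans; [|exact B]. apply (im_le_Cmod (f (circ c u v) - f (circ c x y))%C).
Qed.

(** Continuity in the radius carries the integral across the one circle on which differentiability
    fails at a point. *)
Lemma CM_cont (f : C -> C) (c : C) (a b : R) : 0 <= a ->
  (forall z, a <= Cmod (z - c)%C <= b -> Ccts f z) ->
  forall eps, 0 < eps -> exists d, 0 < d /\ forall r s, a <= r <= b -> a <= s <= b ->
    Rabs (s - r) < d -> Cmod (CM f c s - CM f c r)%C <= eps.
Proof.
  intros Ha Hf eps He. assert (HP := two_pi_pos).
  set (e := eps / (2 * (2 * PI))). assert (He' : 0 < e) by (apply Rdiv_lt_0_compat; lra).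
  assert (K : forall x y, a <= x <= b -> Ccts f (circ c x y)).
  { intros x y Hx. apply Hf. rewrite Cmod_circ; lra. }
  destruct (uniform_continuity_2d (fun r t => Re (f (circ c r t))) a b 0 (2 * PI)
    (fun x y Hx _ => proj1 (circ_cts_2d f c x y (K x y Hx))) (mkposreal e He')) as [d1 H1].
  destruct (uniform_continuity_2d (fun r t => Im (f (circ c r t))) a b 0 (2 * PI)
    (fun x y Hx _ => proj2 (circ_cts_2d f c x y (K x y Hx))) (mkposreal e He')) as [d2 H2].
  simpl in H1, H2.
  exists (Rmin d1 d2). split; [apply Rmin_glb_lt; apply cond_pos|]. intros r s Hr Hs Hd.
  assert (C1 : forall q, a <= q <= b -> Rcts (fun t => f (circ c q t)) 0 (2 * PI)).
  { intros q Hq. apply Rcts_circ; [lra|]. intros z Hz. apply Hf; lra. }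
  unfold CM. rewrite <- CI_minus by auto.
  replace eps with (2 * e * (2 * PI - 0)) by (unfold e; field; lra).
  apply CI_bound_const; [lra| |].
  - intros t Ht. apply Rcc_minus; apply C1; auto.
  - intros t Ht. eapply Rle_trans; [apply Cmod_le_abs|].
    assert (A := H1 r t s t Hr Ht Hs Ht (Rlt_le_trans _ _ _ Hd (Rmin_l _ _))).
    assert (B := H2 r t s t Hr Ht Hs Ht (Rlt_le_trans _ _ _ Hd (Rmin_r _ _))).
    replace (t - t) with 0 in A, B by ring. rewrite Rabs_R0 in A, B.
    specialize (A (cond_pos d1)). specialize (B (cond_pos d2)).
    change (Rabs (Re (f (circ c s t)) - Re (f (circ c r t))) + Rabs (Im (f (circ c s t)) - Im (f (circ c r t))) <= 2 * e).
    lra.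
Qed.

(** The difference quotient [q] times [w - c] is continuous on the disc and differentiable off [z].
    Its circle integral vanishes for radii below [|z - c|] and is constant above, so continuity in
    the radius makes it vanish throughout; the integral of the bare kernel then gives the
    formula. *)
Lemma cauchy_formula (f : C -> C) (c z : C) (r R : R) : r < R ->
  (forall w, Cmod (w - c)%C < R -> Cdiff f w) -> Cmod (z - c)%C < r ->
  CM (fun w => f w * ((w - c) / (w - z)))%C c r = (RtoC (2 * PI) * f z)%C.
Proof.
  intros HR Hf Hz. assert (HP := two_pi_pos).
  assert (Hp := Cmod_ge_0 (z - c)%C). set (rho := Cmod (z - c)%C) in *.
  destruct (Req_dec rho 0) as [H0|H0].
  { apply Cmod_eq_0 in H0. assert (z = c) by (apply Ceq_minus; auto). subst z.
    rewrite <- (mean_value f c r R) by (auto; lra). apply CM_ext; [lra|]. intros w Hw.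
    field. apply Cmod_pos_neq. lra. }
  assert (Hrho : 0 < rho) by lra.
  destruct (Hf z ltac:(fold rho; lra)) as [l Hl].
  set (q := fun w => if Ceq_dec w z then l else ((f w - f z) / (w - z))%C).
  assert (Hq : forall w, w <> z -> Cmod (w - c)%C < R -> Cdiff q w).
  { intros w Hw Hw'. assert (0 < Cmod (w - z)%C) by (apply Cmod_gt_0, Cminus_neq; auto).
    apply Cdiff_loc with (fun w => (f w - f z) / (w - z))%C (Cmod (w - z)%C); auto.
    - intros v Hv. unfold q. destruct (Ceq_dec v z) as [->|]; auto.
      rewrite Cmod_sub_sym in Hv. lra.
    - apply Cdiff_div; [| |apply Cminus_neq; auto]; apply Cdiff_minus; auto using Cdiff_id, Cdiff_const. }
  assert (Hqz : Ccts q z).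
  { intros eps He. destruct (Hl (eps / 2)) as (d & Hd & A); [lra|]. exists d; split; auto.
    intros w Hw. unfold q. destruct (Ceq_dec z z) as [_|]; [|congruence].
    destruct (Ceq_dec w z) as [_|Hn].
    - replace (l - l)%C with (RtoC 0) by ring. rewrite Cmod_0; auto.
    - specialize (A w Hw). apply Cminus_neq in Hn.
      assert (0 < Cmod (w - z)%C) by (apply Cmod_gt_0; auto).
      replace ((f w - f z) / (w - z) - l)%C with ((f w - f z - l * (w - z)) / (w - z))%C by (field; auto).
      rewrite Cmod_div by auto. apply Rle_lt_trans with (eps / 2); [|lra].
      apply Rmult_le_reg_r with (Cmod (w - z)%C); auto. unfold Rdiv at 1.
      rewrite Rmult_assoc, Rinv_l by lra. lra. }
  set (p := fun w => ((w - c) * q w)%C).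
  assert (Hpd : forall w, w <> z -> Cmod (w - c)%C < R -> Cdiff p w).
  { intros w Hw Hw'. apply Cdiff_mult; auto. apply Cdiff_minus; [apply Cdiff_id|apply Cdiff_const]. }
  assert (Hpc : forall w, Cmod (w - c)%C < R -> Ccts p w).
  { intros w Hw. destruct (Ceq_dec w z) as [->|Hn].
    - apply Ccts_mult; auto. apply Cdiff_cts, Cdiff_minus; [apply Cdiff_id|apply Cdiff_const].
    - apply Cdiff_cts; auto. }
  assert (Hin : forall s, 0 <= s < rho -> CM p c s = RtoC 0).
  { intros s Hs. rewrite (mean_value p c s rho); auto.
    - unfold p. replace (c - c)%C with (RtoC 0) by ring. ring.
    - intros w Hw. apply Hpd; [|lra]. intros ->. fold rho in Hw; lra. }
  assert (Hout : forall s, rho < s <= r -> CM p c s = CM p c r).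
  { intros s Hs. apply annulus_const; try lra. intros w Hw. apply Hpd; [|lra].
    intros ->. fold rho in Hw; lra. }
  assert (HN : CM p c r = RtoC 0).
  { apply NNPP; intros N. apply Cmod_gt_0 in N.
    destruct (CM_cont p c 0 r (Rle_refl 0) ltac:(intros; apply Hpc; lra) (Cmod (CM p c r) / 2)) as (d & Hd & A); [lra|].
    (* The radii [rho - h] and [rho + h] lie on either side of the exceptional circle, inside the
       disc of radius [r], and closer to each other than [d]. *)
    set (h := Rmin (d / 4) (Rmin rho (r - rho)) / 2).
    assert (Hm : 0 < Rmin (d / 4) (Rmin rho (r - rho))) by (repeat apply Rmin_glb_lt; lra).
    assert (M1 := Rmin_l (d / 4) (Rmin rho (r - rho))). assert (M2 := Rmin_r (d / 4) (Rmin rho (r - rho))).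
    assert (M3 := Rmin_l rho (r - rho)). assert (M4 := Rmin_r rho (r - rho)).
    assert (Hh : 0 < h /\ h < d / 4 /\ h < rho /\ h < r - rho) by (unfold h; repeat split; lra).
    clearbody h. destruct Hh as (Hh1 & Hh2 & Hh3 & Hh4).
    specialize (A (rho - h) (rho + h) ltac:(split; lra) ltac:(split; lra)).
    rewrite (Hin (rho - h)), (Hout (rho + h)) in A by (split; lra). clear Hin Hout.
    replace (CM p c r - 0)%C with (CM p c r) in A by ring.
    assert (Rabs (rho + h - (rho - h)) < d) by (apply Rabs_def1; lra).
    specialize (A H). lra. }
  assert (Hne : forall w, Cmod (w - c)%C = r -> (w - z)%C <> RtoC 0).
  { intros w Hw. apply Cminus_neq. intros ->. unfold rho in Hz. lra. }
  assert (Hkd : forall w, Cmod (w - c)%C = r -> Cdiff (fun w => (w - c) / (w - z))%C w).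
  { intros w Hw. apply Cdiff_div; [| |apply Hne; auto];
      apply Cdiff_minus; try apply Cdiff_id; apply Cdiff_const. }
  assert (E : CM p c r = (CM (fun w => f w * ((w - c) / (w - z))) c r - f z * CM (fun w => (w - c) / (w - z)) c r)%C).
  { rewrite <- CM_scal, <- CM_minus; try lra.
    - apply CM_ext; [lra|]. intros w Hw. unfold p, q. destruct (Ceq_dec w z) as [->|Hn].
      + unfold rho in Hz; lra.
      + field. apply Cminus_neq; auto.
    - intros w Hw. apply Cdiff_cts, Cdiff_mult; auto. apply Hf; lra.
    - intros w Hw. apply Cdiff_cts, Cdiff_mult; auto. apply Cdiff_const.
    - intros w Hw. apply Cdiff_cts; auto. }
  rewrite HN, kernel_mean in E by auto. symmetry in E. apply Ceq_minus in E. rewrite E. ring.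
Qed.

Lemma circle_bound (f : C -> C) (c z : C) (M r R : R) : 0 < r < R ->
  (forall w, Cmod (w - c)%C < R -> Cdiff f w) ->
  (forall w, Cmod (w - c)%C = r -> Cmod (f w) <= M) -> Cmod (z - c)%C < r ->
  Cmod (f z) <= M * (r / (r - Cmod (z - c)%C)).
Proof.
  intros [Hr HR] Hf HM Hz. assert (HP := two_pi_pos).
  assert (Hz0 := Cmod_ge_0 (z - c)%C).
  assert (E := cauchy_formula f c z r R HR Hf Hz).
  assert (Hne : forall w, Cmod (w - c)%C = r -> (w - z)%C <> RtoC 0).
  { intros w Hw. apply Cminus_neq. intros ->. lra. }
  assert (B : Cmod (CM (fun w => f w * ((w - c) / (w - z)))%C c r) <= M * (r / (r - Cmod (z - c)%C)) * (2 * PI)).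
  { apply CM_bound; [lra| |].
    - intros w Hw. apply Cdiff_cts, Cdiff_mult; [apply Hf; lra|].
      apply Cdiff_div; [| |apply Hne; auto]; apply Cdiff_minus; try apply Cdiff_id; apply Cdiff_const.
    - intros w Hw. rewrite Cmod_mult, Cmod_div by auto. rewrite Hw.
      apply Rmult_le_compat; auto.
      + apply Cmod_ge_0.
      + apply Rmult_le_pos; [lra|]. left; apply Rinv_0_lt_compat, Cmod_gt_0; auto.
      + apply Rmult_le_compat_l; [lra|]. apply Rinv_le_contravar; [lra|].
        generalize (Cmod_triangle_minus (w - c)%C (z - c)%C).
        replace (w - c - (z - c))%C with (w - z)%C by ring. lra. }
  rewrite E, Cmod_mult, Cmod_R, Rabs_right in B by lra.
  apply Rmult_le_reg_l with (2 * PI); lra.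
Qed.

Lemma mean_bound (f : C -> C) (c : C) (M r R : R) : 0 < r < R ->
  (forall w, Cmod (w - c)%C < R -> Cdiff f w) ->
  (forall w, Cmod (w - c)%C = r -> Cmod (f w) <= M) -> Cmod (f c) <= M.
Proof.
  intros Hr Hf HM. assert (E : Cmod (c - c)%C = 0).
  { replace (c - c)%C with (RtoC 0) by ring. apply Cmod_0. }
  assert (H := circle_bound f c c M r R Hr Hf HM). rewrite E in H. specialize (H (proj1 Hr)).
  replace (M * (r / (r - 0))) with M in H by (field; lra). exact H.
Qed.

(** * Differentiation under the Cauchy integral and removal of a zero *)

Lemma Cder_quadratic (f : C -> C) (z l : C) (K d : R) : 0 < d ->
  (forall w, Cmod (w - z)%C < d -> Cmod (f w - f z - l * (w - z))%C <= K * (Cmod (w - z)%C * Cmod (w - z)%C)) ->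
  Cder f z l.
Proof.
  intros Hd H eps He. assert (Hk := Rabs_pos K).
  exists (Rmin d (eps / (Rabs K + 1))). split.
  { apply Rmin_glb_lt; auto. apply Rdiv_lt_0_compat; lra. }
  intros w Hw. eapply Rle_trans; [apply H, (Rlt_le_trans _ _ _ Hw (Rmin_l _ _))|].
  assert (A := Rlt_le_trans _ _ _ Hw (Rmin_r _ _)). assert (Hn := Cmod_ge_0 (w - z)%C).
  rewrite <- Rmult_assoc. apply Rmult_le_compat_r; auto.
  apply Rle_trans with ((Rabs K + 1) * Cmod (w - z)%C).
  { apply Rmult_le_compat_r; auto. generalize (Rle_abs K); lra. }
  apply Rle_trans with ((Rabs K + 1) * (eps / (Rabs K + 1))).
  { apply Rmult_le_compat_l; lra. }
  right; field; lra.
Qed.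

Lemma continuous_Cmod (g : R -> C) (t : R) : Rcc g t -> continuous (fun s => Cmod (g s)) t.
Proof.
  rewrite Rcc_eps, continuous_eps. intros H eps He. destruct (H eps He) as (d & Hd & A).
  exists d; split; auto. intros s Hs. specialize (A s Hs).
  assert (T1 := Cmod_triangle_minus (g s) (g t)). assert (T2 := Cmod_triangle_minus (g t) (g s)).
  rewrite Cmod_sub_sym in T2. apply Rabs_def1; lra.
Qed.

Lemma RInt_Rscal (f : R -> R) (k a b : R) : ex_RInt f a b ->
  RInt (fun t => k * f t) a b = k * RInt f a b.
Proof.
  intros H. apply is_RInt_unique. apply (is_RInt_scal (V := R_NormedModule)).
  apply (RInt_correct (V := R_CompleteNormedModule)); auto.
Qed.

(** A remainder quadratic in [w - z], with a constant independent of [t], permits differentiation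
    under the integral without dominated convergence. *)
Lemma CI_param_der (phi : R -> C) (k : R -> C -> C) (k1 : R -> C) (z : C) (K d a b : R) : 0 < d -> a <= b ->
  Rcts phi a b -> Rcts k1 a b -> (forall w, Cmod (w - z)%C < d -> Rcts (fun t => k t w) a b) ->
  (forall t w, Cmod (w - z)%C < d ->
     Cmod (k t w - k t z - k1 t * (w - z))%C <= K * (Cmod (w - z)%C * Cmod (w - z)%C)) ->
  Cder (fun w => CI (fun t => phi t * k t w)%C a b) z (CI (fun t => phi t * k1 t)%C a b).
Proof.
  intros Hd Hab Hphi Hk1 Hk HK.
  assert (Hzz : Cmod (z - z)%C < d).
  { replace (z - z)%C with (RtoC 0) by ring. rewrite Cmod_0; auto. }
  apply Cder_quadratic with (K * RInt (fun t => Cmod (phi t)) a b) d; auto. intros w Hw.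
  assert (C1 : Rcts (fun t => phi t * k t w)%C a b) by (intros t Ht; apply Rcc_mult; [|apply (Hk w Hw)]; auto).
  assert (C2 : Rcts (fun t => phi t * k t z)%C a b) by (intros t Ht; apply Rcc_mult; [|apply (Hk z Hzz)]; auto).
  assert (C3 : Rcts (fun t => (w - z) * (phi t * k1 t))%C a b).
  { intros t Ht. apply Rcc_mult; [apply Rcc_const|]. apply Rcc_mult; auto. }
  assert (C4 : Rcts (fun t => phi t * k1 t)%C a b) by (intros t Ht; apply Rcc_mult; auto).
  assert (C5 : Rcts (fun t => phi t * k t w - phi t * k t z)%C a b) by (intros t Ht; apply Rcc_minus; auto).
  rewrite (Cmult_comm _ (w - z)%C), <- CI_mult, <- CI_minus, <- CI_minus by auto.
  set (n2 := Cmod (w - z)%C * Cmod (w - z)%C).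
  assert (Ex : ex_RInt (fun t => Cmod (phi t)) a b).
  { apply (ex_RInt_continuous (V := R_CompleteNormedModule)). intros t Ht. apply continuous_Cmod; auto. }
  replace (K * RInt (fun t => Cmod (phi t)) a b * n2) with (RInt (fun t => K * n2 * Cmod (phi t)) a b).
  2:{ rewrite (RInt_Rscal (fun t => Cmod (phi t)) (K * n2) a b Ex). match goal with |- ?x = ?y => change (@eq R x y) end; ring. }
  apply CI_bound; auto.
  - intros t Ht. apply Rcc_minus; auto.
  - intros t Ht. apply (continuous_scal_r (V := R_NormedModule) (K * n2) (fun t => Cmod (phi t))).
    apply continuous_Cmod, Hphi. rewrite Rmin_left, Rmax_right; auto.
  - intros t Ht.
    replace (phi t * k t w - phi t * k t z - (w - z) * (phi t * k1 t))%C
      with (phi t * (k t w - k t z - k1 t * (w - z)))%C by ring.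
    rewrite Cmod_mult, (Rmult_comm (K * n2)). apply Rmult_le_compat_l; [apply Cmod_ge_0|]. apply HK; auto.
Qed.

Lemma circ_dist (c z w : C) (r t : R) : Cmod (z - c)%C < r ->
  Cmod (w - z)%C < (r - Cmod (z - c)%C) / 2 -> (r - Cmod (z - c)%C) / 2 <= Cmod (circ c r t - w)%C.
Proof.
  intros Hz Hw. assert (H0 := Cmod_ge_0 (z - c)%C).
  assert (E := Cmod_circ c r t ltac:(lra)).
  assert (T := Cmod_triangle_minus (circ c r t - c)%C (w - c)%C).
  replace (circ c r t - c - (w - c))%C with (circ c r t - w)%C in T by ring.
  assert (T2 := Cmod_triangle (w - z) (z - c)). replace (w - z + (z - c))%C with (w - c)%C in T2 by ring. lra.
Qed.

(** Within half the distance to the circle the denominators stay above [d], and partial fractions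
    exhibit the remainder as an explicit multiple of [(w - z)^2]. *)
Lemma cauchy_kernel_der (phi : R -> C) (c z : C) (r : R) : Rcts phi 0 (2 * PI) -> Cmod (z - c)%C < r ->
  Cder (fun w => CI (fun t => phi t * / (circ c r t - w))%C 0 (2 * PI)) z
       (CI (fun t => phi t * / ((circ c r t - z) * (circ c r t - z)))%C 0 (2 * PI)) /\
  Cder (fun w => CI (fun t => phi t * / ((circ c r t - w) * (circ c r t - w)))%C 0 (2 * PI)) z
       (CI (fun t => phi t * (2 / ((circ c r t - z) * (circ c r t - z) * (circ c r t - z))))%C 0 (2 * PI)).
Proof.
  intros Hphi Hz. set (d := (r - Cmod (z - c)%C) / 2). assert (Hd : 0 < d) by (unfold d; lra).
  assert (HP := two_pi_pos).
  assert (L : forall t w, Cmod (w - z)%C < d -> d <= Cmod (circ c r t - w)%C) by (intros; apply circ_dist; auto).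
  assert (N : forall t w, Cmod (w - z)%C < d -> (circ c r t - w)%C <> RtoC 0).
  { intros t w Hw. apply Cmod_pos_neq. generalize (L t w Hw); lra. }
  assert (Hzz : Cmod (z - z)%C < d).
  { replace (z - z)%C with (RtoC 0) by ring. rewrite Cmod_0; auto. }
  assert (Cc : forall w t, Rcc (fun t => circ c r t - w)%C t).
  { intros w t. apply Rcc_minus; [apply Rcc_circ|apply Rcc_const]. }
  assert (I : forall t w, Cmod (w - z)%C < d -> Cmod (/ (circ c r t - w))%C <= / d).
  { intros t w Hw. rewrite Cmod_inv by auto. apply Rinv_le_contravar; auto. }
  assert (Hid : 0 < / d) by (apply Rinv_0_lt_compat; auto).
  split.
  - apply CI_param_der with (k := fun t w => (/ (circ c r t - w))%C) (K := / d * / d * / d) (d := d); auto; try lra.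
    + intros t Ht. apply Rcc_inv; [apply Cmult_neq_0; auto|apply Rcc_mult; auto].
    + intros w Hw t Ht. apply Rcc_inv; auto.
    + intros t w Hw.
      replace (/ (circ c r t - w) - / (circ c r t - z) - / ((circ c r t - z) * (circ c r t - z)) * (w - z))%C
        with ((/ (circ c r t - w)) * (/ (circ c r t - z)) * (/ (circ c r t - z)) * ((w - z) * (w - z)))%C
        by (field; split; auto).
      rewrite !Cmod_mult. apply Rmult_le_compat_r; [generalize (Cmod_ge_0 (w - z)%C); nra|].
      repeat apply Rmult_le_compat; auto; try apply Cmod_ge_0;
        repeat apply Rmult_le_pos; apply Cmod_ge_0.
  - apply CI_param_der with (k := fun t w => (/ ((circ c r t - w) * (circ c r t - w)))%C)
      (K := 3 * (/ d * / d * / d * / d)) (d := d); auto; try lra.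
    + intros t Ht. apply Rcc_mult; [apply Rcc_const|]. apply Rcc_inv; [repeat apply Cmult_neq_0; auto|repeat apply Rcc_mult; auto].
    + intros w Hw t Ht. apply Rcc_inv; [apply Cmult_neq_0; auto|apply Rcc_mult; auto].
    + intros t w Hw. set (a := (/ (circ c r t - w))%C). set (b := (/ (circ c r t - z))%C).
      replace (/ ((circ c r t - w) * (circ c r t - w)) - / ((circ c r t - z) * (circ c r t - z)) -
         2 / ((circ c r t - z) * (circ c r t - z) * (circ c r t - z)) * (w - z))%C
        with ((a * a * b * b + 2 * (a * b * b * b)) * ((w - z) * (w - z)))%C
        by (unfold a, b; field; split; auto).
      rewrite Cmod_mult, (Cmod_mult (w - z)). apply Rmult_le_compat_r; [generalize (Cmod_ge_0 (w - z)%C); nra|].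
      eapply Rle_trans; [apply Cmod_triangle|]. rewrite !Cmod_mult, Cmod_R, Rabs_right by lra.
      assert (Ha : Cmod a <= / d) by (apply I; auto). assert (Hb : Cmod b <= / d) by (apply I; auto).
      assert (Pa := Cmod_ge_0 a). assert (Pb := Cmod_ge_0 b).
      assert (X1 : Cmod a * Cmod a * Cmod b * Cmod b <= / d * / d * / d * / d)
        by (repeat apply Rmult_le_compat; auto; repeat apply Rmult_le_pos; auto).
      assert (X2 : Cmod a * Cmod b * Cmod b * Cmod b <= / d * / d * / d * / d)
        by (repeat apply Rmult_le_compat; auto; repeat apply Rmult_le_pos; auto).
      lra.
Qed.

Lemma cauchy_repr (f : C -> C) (c z : C) (r R : R) : r < R ->
  (forall w, Cmod (w - c)%C < R -> Cdiff f w) -> Cmod (z - c)%C < r ->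
  f z = (/ RtoC (2 * PI) * CI (fun t => f (circ c r t) * (circ c r t - c) * / (circ c r t - z)) 0 (2 * PI))%C.
Proof.
  intros HR Hf Hz. assert (HP := two_pi_pos).
  assert (E := cauchy_formula f c z r R HR Hf Hz). unfold CM in E.
  replace (CI (fun t => f (circ c r t) * (circ c r t - c) * / (circ c r t - z))%C 0 (2 * PI))
    with (CI (fun t => f (circ c r t) * ((circ c r t - c) / (circ c r t - z)))%C 0 (2 * PI)).
  - rewrite E. field. intros H. apply RtoC_inj in H. lra.
  - apply CI_ext. intros t _. unfold Cdiv. ring.
Qed.

(** Two derivatives, because the logarithmic derivative [f1 / f] must itself be differentiable
    before it can be integrated. *)
Lemma holomorphic_derivs (f : C -> C) (c : C) (r R : R) : 0 < r < R ->
  (forall w, Cmod (w - c)%C < R -> Cdiff f w) ->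
  exists f1 f2, forall z, Cmod (z - c)%C < r -> Cder f z (f1 z) /\ Cder f1 z (f2 z).
Proof.
  intros [Hr HR] Hf. set (phi := fun t => (f (circ c r t) * (circ c r t - c))%C).
  assert (Hphi : Rcts phi 0 (2 * PI)).
  { intros t _. apply Rcc_mult.
    - apply (Rcc_comp f (circ c r)); [|apply Rcc_circ]. apply Cdiff_cts, Hf. rewrite Cmod_circ; lra.
    - apply Rcc_minus; [apply Rcc_circ|apply Rcc_const]. }
  exists (fun z => / RtoC (2 * PI) * CI (fun t => phi t * / ((circ c r t - z) * (circ c r t - z))) 0 (2 * PI))%C,
    (fun z => / RtoC (2 * PI) * CI (fun t => phi t * (2 / ((circ c r t - z) * (circ c r t - z) * (circ c r t - z)))) 0 (2 * PI))%C.
  intros z Hz. destruct (cauchy_kernel_der phi c z r Hphi Hz) as [A B]. split.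
  - apply Cder_loc with (f := fun w => (/ RtoC (2 * PI) * CI (fun t => phi t * / (circ c r t - w)) 0 (2 * PI))%C)
      (r := r - Cmod (z - c)%C); [lra| |].
    + intros w Hw. symmetry. apply (cauchy_repr f c w r R); auto.
      replace (w - c)%C with ((w - z) + (z - c))%C by ring.
      eapply Rle_lt_trans; [apply Cmod_triangle|lra].
    + apply (Cder_comp (fun w => CI (fun t => phi t * / (circ c r t - w))%C 0 (2 * PI)) (fun u => / RtoC (2 * PI) * u)%C); auto.
      apply Cder_scal.
  - apply (Cder_comp (fun w => CI (fun t => phi t * / ((circ c r t - w) * (circ c r t - w)))%C 0 (2 * PI))
      (fun u => / RtoC (2 * PI) * u)%C); auto. apply Cder_scal.
Qed.

(** On the unit circle about [a], [(w - a) / (w - z) = 1 + (z - a) / (w - z)], and the term 1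
    integrates to a multiple of [f a = 0]. So near [a] the quotient is a Cauchy integral, which is
    differentiable at [a] as well. *)
Lemma removable (f : C -> C) (a : C) : (forall z, Cdiff f z) -> f a = RtoC 0 ->
  exists q, (forall z, Cdiff q z) /\ forall z, f z = ((z - a) * q z)%C.
Proof.
  intros Hf H0. assert (HP := two_pi_pos).
  assert (Hphi : Rcts (fun t => f (circ a 1 t)) 0 (2 * PI)).
  { intros t _. apply (Rcc_comp f (circ a 1)); [|apply Rcc_circ]. apply Cdiff_cts, Hf. }
  set (g := fun z => (/ RtoC (2 * PI) * CI (fun t => f (circ a 1 t) * / (circ a 1 t - z)) 0 (2 * PI))%C).
  assert (Ha : Cmod (a - a)%C < 1) by (replace (a - a)%C with (RtoC 0) by ring; rewrite Cmod_0; lra).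
  assert (Hg : forall z, Cmod (z - a)%C < 1 -> f z = ((z - a) * g z)%C).
  { intros z Hz.
    assert (Nz : forall t, (circ a 1 t - z)%C <> RtoC 0).
    { intros t. apply Cminus_neq. intros E. rewrite <- E, Cmod_circ in Hz; lra. }
    assert (Cz : Rcts (fun t => f (circ a 1 t) * / (circ a 1 t - z))%C 0 (2 * PI)).
    { intros t Ht. apply Rcc_mult; auto. apply Rcc_inv; auto. apply Rcc_minus; [apply Rcc_circ|apply Rcc_const]. }
    replace (f z) with (f z - f a)%C by (rewrite H0; ring).
    rewrite (cauchy_repr f a z 1 2), (cauchy_repr f a a 1 2) by (auto; lra). unfold g.
    replace (CI (fun t => f (circ a 1 t) * (circ a 1 t - a) * / (circ a 1 t - z))%C 0 (2 * PI))
      with (CI (fun t => f (circ a 1 t) + (z - a) * (f (circ a 1 t) * / (circ a 1 t - z)))%C 0 (2 * PI)).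
    2:{ apply CI_ext. intros t _. field. auto. }
    rewrite CI_plus, CI_mult; auto.
    2:{ intros t Ht. apply Rcc_mult; [apply Rcc_const|]. apply Cz; auto. }
    replace (CI (fun t => f (circ a 1 t) * (circ a 1 t - a) * / (circ a 1 t - a))%C 0 (2 * PI))
      with (CI (fun t => f (circ a 1 t)) 0 (2 * PI)).
    2:{ apply CI_ext. intros t _. field. apply Cmod_pos_neq. rewrite Cmod_circ; lra. }
    ring. }
  assert (Hgd : Cdiff g a).
  { destruct (cauchy_kernel_der _ a a 1 Hphi Ha) as [A _]. eexists.
    apply (Cder_comp (fun w => CI (fun t => f (circ a 1 t) * / (circ a 1 t - w))%C 0 (2 * PI)) (fun u => / RtoC (2 * PI) * u)%C).
    - exact A.
    - apply Cder_scal. }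
  exists (fun z => if Ceq_dec z a then g a else (f z / (z - a))%C). split.
  - intros z. destruct (Ceq_dec z a) as [->|Hn].
    + apply Cdiff_loc with g 1; [lra| |exact Hgd]. intros w Hw. destruct (Ceq_dec w a) as [->|Hn]; auto.
      rewrite Hg by auto. field. apply Cminus_neq; auto.
    + assert (0 < Cmod (z - a)%C) by (apply Cmod_gt_0, Cminus_neq; auto).
      apply Cdiff_loc with (fun w => f w / (w - a))%C (Cmod (z - a)%C); auto.
      * intros w Hw. destruct (Ceq_dec w a) as [->|]; auto. rewrite Cmod_sub_sym in Hw. lra.
      * apply Cdiff_div; auto; [|apply Cminus_neq; auto]. apply Cdiff_minus; [apply Cdiff_id|apply Cdiff_const].
  - intros z. destruct (Ceq_dec z a) as [->|Hn].
    + rewrite H0. ring.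
    + field. apply Cminus_neq; auto.
Qed.

(** * Factoring out zeros *)

Fixpoint Clprod (l : list C) (z : C) : C :=
  match l with nil => RtoC 1 | a :: l' => ((z - a) * Clprod l' z)%C end.

Lemma Clprod_lower (l : list C) (z : C) (d : R) : 0 <= d ->
  (forall a, In a l -> d <= Cmod (z - a)%C) -> d ^ length l <= Cmod (Clprod l z).
Proof.
  intros Hd; induction l as [|a l IH]; intros H; simpl.
  - rewrite Cmod_1; lra.
  - rewrite Cmod_mult. apply Rmult_le_compat; auto.
    + apply pow_le; auto.
    + apply H; left; auto.
    + apply IH. intros b Hb. apply H; right; auto.
Qed.

Lemma Clprod_upper (l : list C) (z : C) (d : R) :
  (forall a, In a l -> Cmod (z - a)%C <= d) -> Cmod (Clprod l z) <= d ^ length l.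
Proof.
  induction l as [|a l IH]; intros H; simpl.
  - rewrite Cmod_1; lra.
  - rewrite Cmod_mult. apply Rmult_le_compat; try apply Cmod_ge_0.
    + apply H; left; auto.
    + apply IH. intros b Hb. apply H; right; auto.
Qed.

Lemma Clprod_neq0 (l : list C) (z : C) : ~ In z l -> Clprod l z <> RtoC 0.
Proof.
  induction l as [|a l IH]; intros H; simpl.
  - apply C1_nz.
  - apply Cmult_neq_0.
    + apply Cminus_neq. intros ->. apply H; left; auto.
    + apply IH. intros G; apply H; right; auto.
Qed.

(* Jensen-type bound: [n] zeros in the disc of radius [R] force [2^n |X c| <= M]. *)
Lemma zero_count_bound (X H : C -> C) (c : C) (R M : R) (l : list C) : 0 < R ->
  (forall z, Cdiff H z) -> (forall z, X z = (Clprod l z * H z)%C) ->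
  (forall a, In a l -> Cmod (a - c)%C <= R) ->
  (forall z, Cmod (z - c)%C = 3 * R -> Cmod (X z) <= M) ->
  Cmod (H c) * (2 * R) ^ length l <= M.
Proof.
  intros HR HH HX Hl HM.
  assert (Hp : 0 < (2 * R) ^ length l) by (apply pow_lt; lra).
  assert (B : Cmod (H c) <= M / (2 * R) ^ length l).
  { apply mean_bound with (3 * R) (4 * R); [lra|auto|]. intros w Hw.
    assert (L : (2 * R) ^ length l <= Cmod (Clprod l w)).
    { apply Clprod_lower; [lra|]. intros a Ha. specialize (Hl a Ha).
      generalize (Cmod_triangle_minus (w - c)%C (a - c)%C).
      replace (w - c - (a - c))%C with (w - a)%C by ring. lra. }
    apply Rmult_le_reg_r with ((2 * R) ^ length l); auto.
    unfold Rdiv. rewrite Rmult_assoc, Rinv_l by lra. rewrite Rmult_1_r.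
    apply Rle_trans with (Cmod (X w)); auto. rewrite HX, Cmod_mult, Rmult_comm.
    apply Rmult_le_compat_r; [apply Cmod_ge_0|auto]. }
  apply Rmult_le_reg_r with (/ (2 * R) ^ length l); [apply Rinv_0_lt_compat; auto|].
  rewrite Rmult_assoc, Rinv_r by lra. lra.
Qed.

(** Zeros are removed one at a time. With [k] of them removed, [|X c| 2^k <= M], so the process
    stops: each linear factor is at least [2 R] on the circle of radius [3 R] and at most [R] at the
    centre. *)
Lemma factor_disc (X : C -> C) (c : C) (R M : R) : 0 < R -> (forall z, Cdiff X z) -> X c <> RtoC 0 ->
  (forall z, Cmod (z - c)%C = 3 * R -> Cmod (X z) <= M) ->
  exists l H, (forall z, Cdiff H z) /\ (forall z, X z = (Clprod l z * H z)%C) /\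
    (forall a, In a l -> Cmod (a - c)%C <= R) /\ (forall z, Cmod (z - c)%C <= R -> H z <> RtoC 0).
Proof.
  intros HR HX Hc HM.
  set (V := fun (l : list C) (H : C -> C) => (forall z, Cdiff H z) /\ (forall z, X z = (Clprod l z * H z)%C) /\
    (forall a, In a l -> Cmod (a - c)%C <= R)).
  assert (Hstep : forall k, (exists l H, V l H /\ length l = k) \/
     (exists l H, V l H /\ (forall z, Cmod (z - c)%C <= R -> H z <> RtoC 0))).
  { induction k as [|k [(l & H & (V1 & V2 & V3) & Hk)|IH]]; [| |right; auto].
    - left. exists nil, X. split; auto. split; [auto|split; [|simpl; tauto]]. intros z; simpl; ring.
    - destruct (classic (forall z, Cmod (z - c)%C <= R -> H z <> RtoC 0)) as [N|N].
      + right. exists l, H. split; auto. split; auto.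
      + left. apply not_all_ex_not in N. destruct N as [a N]. apply imply_to_and in N.
        destruct N as [Ha Hz]. apply NNPP in Hz.
        destruct (removable H a V1 Hz) as (q & Hq & Eq).
        exists (a :: l), q. split; [|simpl; lia]. split; [auto|split].
        * intros z. rewrite V2, Eq. simpl. ring.
        * intros b [->|Hb]; auto. }
  assert (Hp : 0 < Cmod (X c)) by (apply Cmod_gt_0; auto).
  destruct (Pow_x_infinity 2 ltac:(rewrite Rabs_right; lra) (M / Cmod (X c) + 1)) as [k Hk].
  specialize (Hk k (Nat.le_refl k)). rewrite Rabs_right in Hk by (apply Rle_ge, pow_le; lra).
  destruct (Hstep k) as [(l & H & (V1 & V2 & V3) & HL)|(l & H & (V1 & V2 & V3) & HN)].
  2:{ exists l, H; auto. }
  exfalso. assert (B := zero_count_bound X H c R M l HR V1 V2 V3 HM). rewrite HL in B.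
  assert (U : Cmod (X c) <= R ^ k * Cmod (H c)).
  { rewrite V2, Cmod_mult, <- HL. apply Rmult_le_compat_r; [apply Cmod_ge_0|].
    apply Clprod_upper. intros a Ha. rewrite Cmod_sub_sym. auto. }
  rewrite Rpow_mult_distr in B.
  assert (P2 : 0 < 2 ^ k) by (apply pow_lt; lra).
  assert (Cmod (X c) * 2 ^ k <= M).
  { apply Rle_trans with (R ^ k * Cmod (H c) * 2 ^ k); [apply Rmult_le_compat_r; lra|]. lra. }
  assert (Cmod (X c) * (M / Cmod (X c) + 1) <= M).
  { apply Rle_trans with (Cmod (X c) * 2 ^ k); auto. apply Rmult_le_compat_l; lra. }
  replace (Cmod (X c) * (M / Cmod (X c) + 1)) with (M + Cmod (X c)) in H1 by (field; lra). lra.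
Qed.

(** * Primitives and logarithms on discs *)

Lemma Rcts_swap (f : R -> C) (a b : R) : Rcts f a b -> Rcts f b a.
Proof. intros H t Ht. apply H. rewrite Rmin_comm, Rmax_comm. exact Ht. Qed.

Lemma CI_swap (f : R -> C) (a b : R) : Rcts f a b -> CI f a b = (- CI f b a)%C.
Proof.
  intros H. assert (E := CI_Chasles f a b a H (Rcts_swap _ _ _ H)).
  replace (CI f a b) with ((CI f a b + CI f b a) - CI f b a)%C by ring. rewrite E.
  unfold CI. rewrite !RInt_point. apply Ceq; unfold Re, Im; simpl; unfold zero; simpl; ring.
Qed.

Lemma CI_bound_abs (f : R -> C) (M a b : R) : Rcts f a b ->
  (forall t, Rmin a b <= t <= Rmax a b -> Cmod (f t) <= M) -> Cmod (CI f a b) <= M * Rabs (b - a).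
Proof.
  intros H HM. destruct (Rle_dec a b) as [L|L].
  - rewrite Rabs_right by lra. apply CI_bound_const; auto. intros t Ht. apply HM.
    rewrite Rmin_left, Rmax_right; auto.
  - assert (L' : b <= a) by lra. rewrite CI_swap, Cmod_opp, Rabs_left1 by (auto; lra).
    replace (- (b - a)) with (a - b) by ring. apply CI_bound_const; auto using Rcts_swap.
    intros t Ht. apply HM. rewrite Rmin_right, Rmax_left; auto.
Qed.

(** The rectangle spanned by two points has no fixed orientation; reversing either pair of sides
    changes only the sign. *)
Lemma goursat_any (f : C -> C) (a b c d : R) :
  (forall x y, Rmin a b <= x <= Rmax a b -> Rmin c d <= y <= Rmax c d -> Cdiff f (x, y)) -> RI f a b c d = RtoC 0.
Proof.
  intros Hf.
  assert (Hh : forall y, Rmin c d <= y <= Rmax c d -> Rcts (fun x => f (x, y)) a b).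
  { intros y Hy x Hx. apply Rcc_horizontal, Cdiff_cts; auto. }
  assert (Hv : forall x, Rmin a b <= x <= Rmax a b -> Rcts (fun y => f (x, y)) c d).
  { intros x Hx y Hy. apply Rcc_vertical, Cdiff_cts; auto. }
  assert (Ia : Rmin a b <= a <= Rmax a b) by (split; [apply Rmin_l|apply Rmax_l]).
  assert (Ib : Rmin a b <= b <= Rmax a b) by (split; [apply Rmin_r|apply Rmax_r]).
  assert (Ic : Rmin c d <= c <= Rmax c d) by (split; [apply Rmin_l|apply Rmax_l]).
  assert (Id : Rmin c d <= d <= Rmax c d) by (split; [apply Rmin_r|apply Rmax_r]).
  assert (X : RI f a b c d = (- RI f b a c d)%C).
  { unfold RI. rewrite (CI_swap (fun x => f (x, c)) a b), (CI_swap (fun x => f (x, d)) a b) by auto. ring. }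
  assert (Y : RI f a b c d = (- RI f a b d c)%C).
  { unfold RI. rewrite (CI_swap (fun y => f (b, y)) c d), (CI_swap (fun y => f (a, y)) c d) by auto. ring. }
  assert (XY : RI f a b c d = RI f b a d c).
  { rewrite Y. unfold RI. rewrite (CI_swap (fun x => f (x, c)) a b), (CI_swap (fun x => f (x, d)) a b) by auto. ring. }
  destruct (Rle_dec a b) as [L|L]; destruct (Rle_dec c d) as [L'|L'].
  - apply goursat; auto. intros x y Hx Hy. apply Hf; rewrite Rmin_left, Rmax_right; auto.
  - rewrite Y, goursat; [ring|lra|lra|]. intros x y Hx Hy.
    apply Hf; [rewrite Rmin_left, Rmax_right|rewrite Rmin_right, Rmax_left]; auto; lra.
  - rewrite X, goursat; [ring|lra|lra|]. intros x y Hx Hy.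
    apply Hf; [rewrite Rmin_right, Rmax_left|rewrite Rmin_left, Rmax_right]; auto; lra.
  - rewrite XY, goursat; [ring|lra|lra|]. intros x y Hx Hy.
    apply Hf; rewrite Rmin_right, Rmax_left; auto; lra.
Qed.

Lemma Rabs_between (u v w x : R) : Rmin u v <= w <= Rmax u v -> Rabs (w - x) <= Rmax (Rabs (u - x)) (Rabs (v - x)).
Proof.
  unfold Rmin, Rmax. intros H. destruct (Rle_dec u v), (Rle_dec (Rabs (u - x)) (Rabs (v - x))); revert n || revert r0;
    unfold Rabs in *; repeat destruct Rcase_abs; intros; lra.
Qed.

(** The primitive integrates along a horizontal and then a vertical leg from the centre. The disc
    contains this path, since neither coordinate distance from the centre exceeds that of the end
    point. Goursat on one rectangle moves the horizontal increment to the height of the point, where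
    [f] is close to its value. *)
Lemma primitive_disc (f : C -> C) (c : C) (R : R) : (forall z, Cmod (z - c)%C < R -> Cdiff f z) ->
  exists F, F c = RtoC 0 /\ forall z, Cmod (z - c)%C < R -> Cder F z (f z).
Proof.
  intros Hf. destruct c as [a b].
  set (F := fun z => (CI (fun t => f (t, b)) a (Re z) + Ci * CI (fun t => f (Re z, t)) b (Im z))%C).
  exists F. split.
  { unfold F, CI. simpl. rewrite !RInt_point. apply Ceq; unfold Re, Im; simpl; unfold zero; simpl; ring. }
  intros [x y] Hz.
  assert (Hin : forall x' y' u v, Rabs (u - a) <= Rabs (x' - a) -> Rabs (v - b) <= Rabs (y' - b) ->
    Cmod ((u, v) - (a, b))%C <= Cmod ((x', y') - (a, b))%C).
  { intros x' y' u v H1 H2. apply Cmod_le_iff. unfold Re, Im; simpl.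
    apply Rsqr_le_abs_1 in H1. apply Rsqr_le_abs_1 in H2. unfold Rsqr in *.
    replace (u + - a) with (u - a) by ring. replace (x' + - a) with (x' - a) by ring.
    replace (v + - b) with (v - b) by ring. replace (y' + - b) with (y' - b) by ring. lra. }
  intros eps He. destruct (Cdiff_cts _ _ (Hf _ Hz) (eps / 2)) as (d & Hd & Hw); [lra|].
  exists (Rmin d (R - Cmod ((x, y) - (a, b))%C)). split; [apply Rmin_glb_lt; lra|].
  intros [x' y'] Hw'. assert (Hw1 := Rlt_le_trans _ _ _ Hw' (Rmin_l _ _)).
  assert (Hw2 := Rlt_le_trans _ _ _ Hw' (Rmin_r _ _)).
  assert (Hx : Rabs (x' - x) <= Cmod ((x', y') - (x, y))%C) by apply (re_le_Cmod ((x', y') - (x, y))%C).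
  assert (Hy : Rabs (y' - y) <= Cmod ((x', y') - (x, y))%C) by apply (im_le_Cmod ((x', y') - (x, y))%C).
  assert (Hcorner : forall s t, Rabs (s - x) <= Rabs (x' - x) -> Rabs (t - y) <= Rabs (y' - y) ->
     Cmod ((s, t) - (x, y))%C <= Cmod ((x', y') - (x, y))%C).
  { intros s t H1 H2. apply Cmod_le_iff. unfold Re, Im; simpl.
    apply Rsqr_le_abs_1 in H1. apply Rsqr_le_abs_1 in H2. unfold Rsqr in *.
    replace (s + - x) with (s - x) by ring. replace (x' + - x) with (x' - x) by ring.
    replace (t + - y) with (t - y) by ring. replace (y' + - y) with (y' - y) by ring. lra. }
  assert (Hdisc : forall s t, Cmod ((s, t) - (x, y))%C <= Cmod ((x', y') - (x, y))%C -> Cmod ((s, t) - (a, b))%C < R).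
  { intros s t H. replace ((s, t) - (a, b))%C with (((s, t) - (x, y)) + ((x, y) - (a, b)))%C by ring.
    eapply Rle_lt_trans; [apply Cmod_triangle|]. lra. }
  assert (M1 : forall s, Rmin x x' <= s <= Rmax x x' -> Rabs (s - x) <= Rabs (x' - x)).
  { intros s Hs. apply (Rabs_between _ _ _ x) in Hs. replace (x - x) with 0 in Hs by ring.
    rewrite Rabs_R0, Rmax_right in Hs; auto. apply Rabs_pos. }
  assert (M2 : forall t, Rmin y y' <= t <= Rmax y y' -> Rabs (t - y) <= Rabs (y' - y)).
  { intros t Ht. apply (Rabs_between _ _ _ y) in Ht. replace (y - y) with 0 in Ht by ring.
    rewrite Rabs_R0, Rmax_right in Ht; auto. apply Rabs_pos. }
  assert (Z0 : Rabs (x - x) <= Rabs (x' - x)) by (replace (x - x) with 0 by ring; rewrite Rabs_R0; apply Rabs_pos).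
  assert (Z1 : Rabs (y - y) <= Rabs (y' - y)) by (replace (y - y) with 0 by ring; rewrite Rabs_R0; apply Rabs_pos).
  assert (Hin2 : forall u v s t, Cmod ((u, v) - (a, b))%C < R -> Rmin a u <= s <= Rmax a u -> Rmin b v <= t <= Rmax b v ->
     Cmod ((s, t) - (a, b))%C < R).
  { intros u v s t Hu Hs Ht. eapply Rle_lt_trans; [apply (Hin u v)|exact Hu].
    - apply (Rabs_between _ _ _ a) in Hs. replace (a - a) with 0 in Hs by ring.
      rewrite Rabs_R0, Rmax_right in Hs; auto. apply Rabs_pos.
    - apply (Rabs_between _ _ _ b) in Ht. replace (b - b) with 0 in Ht by ring.
      rewrite Rabs_R0, Rmax_right in Ht; auto. apply Rabs_pos. }
  assert (Iab : Rmin b y <= b <= Rmax b y) by (split; [apply Rmin_l|apply Rmax_l]).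
  assert (Iab' : Rmin b y' <= b <= Rmax b y') by (split; [apply Rmin_l|apply Rmax_l]).
  assert (Ixx : Rmin a x <= x <= Rmax a x) by (split; [apply Rmin_r|apply Rmax_r]).
  assert (Ixx' : Rmin a x' <= x' <= Rmax a x') by (split; [apply Rmin_r|apply Rmax_r]).
  assert (Dw : Cmod ((x', y') - (a, b))%C < R) by (apply Hdisc; apply Hcorner; lra).
  assert (Dwy : Cmod ((x', y) - (a, b))%C < R) by (apply Hdisc; apply Hcorner; lra).
  assert (Hrect : forall s t, Rmin x x' <= s <= Rmax x x' -> Rmin b y <= t <= Rmax b y -> Cmod ((s, t) - (a, b))%C < R).
  { intros s t Hs Ht. eapply Rle_lt_trans; [apply (Hin s y s t)|].
    - lra.
    - apply (Rabs_between _ _ _ b) in Ht. replace (b - b) with 0 in Ht by ring.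
      rewrite Rabs_R0, Rmax_right in Ht; auto. apply Rabs_pos.
    - apply Hdisc, Hcorner; auto. }
  assert (G := goursat_any f x x' b y (fun s t Hs Ht => Hf _ (Hrect s t Hs Ht))). unfold RI in G.
  assert (S1 : CI (fun t => f (t, b)) a x' = (CI (fun t => f (t, b)) a x + CI (fun t => f (t, b)) x x')%C).
  { symmetry. apply CI_Chasles; intros t Ht; apply Rcc_horizontal, Cdiff_cts, Hf.
    - apply (Hin2 x y); auto.
    - apply Hrect; auto. }
  assert (S2 : CI (fun t => f (x', t)) b y' = (CI (fun t => f (x', t)) b y + CI (fun t => f (x', t)) y y')%C).
  { symmetry. apply CI_Chasles; intros t Ht; apply Rcc_vertical, Cdiff_cts, Hf.
    - apply (Hin2 x' y); auto.
    - apply Hdisc, Hcorner; [lra|auto]. }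
  assert (Ex' : F (x', y') = (F (x, y) + (CI (fun t => f (t, y)) x x' + Ci * CI (fun t => f (x', t)) y y'))%C).
  { unfold F. unfold Re, Im; simpl. rewrite S1, S2.
    replace (CI (fun t => f (t, y)) x x') with
      (CI (fun t => f (t, b)) x x' + Ci * (CI (fun t => f (x', t)) b y - CI (fun t => f (x, t)) b y)
       - (CI (fun x0 => f (x0, b)) x x' - CI (fun x0 => f (x0, y)) x x' +
     Ci * (CI (fun y0 => f (x', y0)) b y - CI (fun y0 => f (x, y0)) b y)))%C by ring.
    rewrite G. ring. }
  rewrite Ex'.
  assert (C1 : Rcts (fun t => f (t, y)) x x').
  { intros t Ht. apply Rcc_horizontal, Cdiff_cts, Hf, Hdisc, Hcorner; auto. }
  assert (C2 : Rcts (fun t => f (x', t)) y y').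
  { intros t Ht. apply Rcc_vertical, Cdiff_cts, Hf, Hdisc, Hcorner; [lra|auto]. }
  replace (F (x, y) + (CI (fun t => f (t, y)) x x' + Ci * CI (fun t => f (x', t)) y y') - F (x, y) - f (x, y) * ((x', y') - (x, y)))%C
    with ((CI (fun t => f (t, y)) x x' - CI (fun _ => f (x, y)) x x') + Ci * (CI (fun t => f (x', t)) y y' - CI (fun _ => f (x, y)) y y'))%C.
  2:{ rewrite !CI_const. replace ((x', y') - (x, y))%C with (RtoC (x' - x) + Ci * RtoC (y' - y))%C
        by (apply Ceq; unfold Re, Im; simpl; ring). ring. }
  rewrite <- !CI_minus; auto; try (intros t _; apply Rcc_const).
  assert (B1 : Cmod (CI (fun t => f (t, y) - f (x, y))%C x x') <= eps / 2 * Rabs (x' - x)).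
  { apply CI_bound_abs. { intros t Ht; apply Rcc_minus; auto. apply Rcc_const. }
    intros t Ht. left. apply Hw. eapply Rle_lt_trans; [apply Hcorner|]; eauto. }
  assert (B2 : Cmod (CI (fun t => f (x', t) - f (x, y))%C y y') <= eps / 2 * Rabs (y' - y)).
  { apply CI_bound_abs. { intros t Ht; apply Rcc_minus; auto. apply Rcc_const. }
    intros t Ht. left. apply Hw. eapply Rle_lt_trans; [apply Hcorner|]; eauto. lra. }
  eapply Rle_trans; [apply Cmod_triangle|]. rewrite Cmod_mult, Cmod_Ci.
  assert (eps / 2 * Rabs (x' - x) <= eps / 2 * Cmod ((x', y') - (x, y))%C) by (apply Rmult_le_compat_l; lra).
  assert (eps / 2 * Rabs (y' - y) <= eps / 2 * Cmod ((x', y') - (x, y))%C) by (apply Rmult_le_compat_l; lra).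
  lra.
Qed.

Lemma Cder_line (f : C -> C) (c v l : C) (t : R) : Cder f (c + RtoC t * v)%C l ->
  is_derive (fun s => Re (f (c + RtoC s * v)%C)) t (Re (l * v)%C) /\
  is_derive (fun s => Im (f (c + RtoC s * v)%C)) t (Im (l * v)%C).
Proof.
  intros H.
  assert (K : forall eps, 0 < eps -> exists d, 0 < d /\ forall h, h <> 0 -> Rabs h < d ->
    Cmod ((f (c + RtoC (t + h) * v)%C - f (c + RtoC t * v)%C) / RtoC h - l * v)%C < eps).
  { intros eps He. assert (Hv := Cmod_ge_0 v).
    destruct (H (eps / (2 * (Cmod v + 1)))) as (d & Hd & A); [apply Rdiv_lt_0_compat; lra|].
    exists (d / (Cmod v + 1)). split; [apply Rdiv_lt_0_compat; lra|]. intros h Hh0 Hh.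
    assert (E : Cmod (c + RtoC (t + h) * v - (c + RtoC t * v))%C = Rabs h * Cmod v).
    { replace (c + RtoC (t + h) * v - (c + RtoC t * v))%C with (RtoC h * v)%C by (rewrite RtoC_plus; ring).
      rewrite Cmod_mult, Cmod_R; auto. }
    assert (Hh' : 0 < Rabs h) by (apply Rabs_pos_lt; auto).
    assert (Hs : Rabs h * Cmod v < d).
    { apply Rle_lt_trans with (Rabs h * (Cmod v + 1)); [nra|].
      apply Rlt_le_trans with (d / (Cmod v + 1) * (Cmod v + 1)); [apply Rmult_lt_compat_r; lra|right; field; lra]. }
    specialize (A (c + RtoC (t + h) * v)%C). rewrite E in A. specialize (A Hs).
    assert (Hc : RtoC h <> RtoC 0) by (intros G; apply RtoC_inj in G; auto).
    replace ((f (c + RtoC (t + h) * v) - f (c + RtoC t * v)) / RtoC h - l * v)%C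
      with ((f (c + RtoC (t + h) * v)%C - f (c + RtoC t * v)%C - l * (c + RtoC (t + h) * v - (c + RtoC t * v))) / RtoC h)%C
      by (rewrite RtoC_plus; field; auto).
    rewrite Cmod_div, Cmod_R by auto. apply Rle_lt_trans with (eps / 2); [|lra].
    apply Rmult_le_reg_r with (Rabs h); auto. unfold Rdiv at 1. rewrite Rmult_assoc, Rinv_l by lra.
    rewrite Rmult_1_r. eapply Rle_trans; [exact A|].
    replace (eps / (2 * (Cmod v + 1)) * (Rabs h * Cmod v)) with (eps / 2 * Rabs h * (Cmod v / (Cmod v + 1))) by (field; lra).
    rewrite <- (Rmult_1_r (eps / 2 * Rabs h)) at 2. apply Rmult_le_compat_l; [nra|].
    apply Rmult_le_reg_r with (Cmod v + 1); [lra|]. unfold Rdiv. rewrite Rmult_assoc, Rinv_l by lra. lra. }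
  split; apply is_derive_Reals; intros eps He; destruct (K eps He) as (d & Hd & A); exists (mkposreal d Hd);
    intros h Hh Hh'; eapply Rle_lt_trans; [|apply (A h Hh Hh')| |apply (A h Hh Hh')].
  - eapply Rle_trans; [|apply re_le_Cmod]. right. f_equal.
    unfold Cdiv. rewrite <- RtoC_inv by auto. unfold Re, Im; simpl. field; auto.
  - eapply Rle_trans; [|apply im_le_Cmod]. right. f_equal.
    unfold Cdiv. rewrite <- RtoC_inv by auto. unfold Re, Im; simpl. field; auto.
Qed.

Lemma Cder_zero_const (f : C -> C) (c z : C) (R : R) :
  (forall w, Cmod (w - c)%C < R -> Cder f w (RtoC 0)) -> Cmod (z - c)%C < R -> f z = f c.
Proof.
  intros H Hz.
  assert (D : forall t, 0 <= t <= 1 -> Cder f (c + RtoC t * (z - c))%C (RtoC 0)).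
  { intros t Ht. apply H. replace (c + RtoC t * (z - c) - c)%C with (RtoC t * (z - c))%C by ring.
    rewrite Cmod_mult, Cmod_R, Rabs_right by lra. generalize (Cmod_ge_0 (z - c)%C); nra. }
  assert (E0 : (c + RtoC 0 * (z - c))%C = c) by ring.
  assert (E1 : (c + RtoC 1 * (z - c))%C = z) by ring.
  assert (Zr : Re (RtoC 0 * (z - c))%C = 0) by (unfold Re; simpl; ring).
  assert (Zi : Im (RtoC 0 * (z - c))%C = 0) by (unfold Im; simpl; ring).
  assert (F : f (c + RtoC 0 * (z - c))%C = f (c + RtoC 1 * (z - c))%C).
  { apply Ceq.
    - apply (eq_is_derive (fun s => Re (f (c + RtoC s * (z - c))%C)) 0 1); [|lra].
      intros t Ht. destruct (Cder_line _ _ _ _ _ (D t Ht)) as [A _]. rewrite Zr in A. exact A.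
    - apply (eq_is_derive (fun s => Im (f (c + RtoC s * (z - c))%C)) 0 1); [|lra].
      intros t Ht. destruct (Cder_line _ _ _ _ _ (D t Ht)) as [_ A]. rewrite Zi in A. exact A. }
  rewrite E0, E1 in F. symmetry; exact F.
Qed.

(** [l] is a primitive of [H' / H], and [H exp (- l)] has derivative zero. *)
Lemma log_disc (H : C -> C) (c : C) (R : R) : 0 < R -> (forall z, Cdiff H z) ->
  (forall z, Cmod (z - c)%C < R -> H z <> RtoC 0) ->
  exists l, l c = RtoC 0 /\ (forall z, Cmod (z - c)%C < R -> Cdiff l z) /\
    forall z, Cmod (z - c)%C < R -> H z = (H c * Cexp (l z))%C.
Proof.
  intros HR HH HN.
  destruct (holomorphic_derivs H c R (2 * R)) as (f1 & f2 & D); [lra|auto|].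
  destruct (primitive_disc (fun z => f1 z / H z)%C c R) as (l & L0 & L).
  { intros z Hz. apply Cdiff_div; auto. exists (f2 z). apply D; auto. }
  exists l. split; [auto|split]. { intros z Hz. eexists; apply L; auto. }
  intros z Hz.
  assert (E := Cder_zero_const (fun w => H w * Cexp (- l w))%C c z R).
  cbv beta in E. rewrite L0 in E. replace (- 0)%C with (RtoC 0) in E by ring. rewrite Cexp_0 in E.
  rewrite <- (Cmult_1_r (H c)), <- E; auto.
  - rewrite <- Cmult_assoc, <- Cexp_plus. replace (- l z + l z)%C with (RtoC 0) by ring.
    rewrite Cexp_0. ring.
  - intros w Hw.
    eapply Cder_val.
    + apply Cder_mult; [apply D; auto|].
      apply (Cder_comp (fun w => - l w)%C Cexp); [apply Cder_opp, L; auto|apply Cder_Cexp].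
    + cbv beta. field. auto.
Qed.

(* Adding the conjugate (whose integral against the same kernel vanishes) replaces [l] by [2 Re l]
   in the Cauchy remainder, so an upper bound on [Re l] suffices. *)
Lemma borel_caratheodory (l : C -> C) (c : C) (r R M : R) : 0 < r < R ->
  (forall z, Cmod (z - c)%C < R -> Cdiff l z) -> l c = RtoC 0 ->
  (forall z, Cmod (z - c)%C = r -> Re (l z) <= M) ->
  exists c1, forall z, Cmod (z - c)%C <= r / 2 ->
    Cmod (l z - c1 * (z - c))%C <= 8 * M * (Cmod (z - c)%C * Cmod (z - c)%C) / (r * r).
Proof.
  intros [Hr HR] Hl L0 HM. assert (HP := two_pi_pos).
  assert (Hpi : RtoC (2 * PI) <> RtoC 0) by (intros G; apply RtoC_inj in G; lra).
  assert (Hne : forall w, Cmod (w - c)%C = r -> (w - c)%C <> RtoC 0) by (intros w Hw; apply Cmod_pos_neq; lra).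
  assert (Hdl : forall a w, Cdiff (fun w => w - a)%C w) by (intros a w; apply Cdiff_minus; [apply Cdiff_id|apply Cdiff_const]).
  (* This is [l'(c)] by Cauchy; subtracting the constant and linear terms turns [(w - c) / (w - z)]
     into the kernel [K], which carries the factor [u^2]. *)
  exists (/ RtoC (2 * PI) * CM (fun w => l w * / (w - c)) c r)%C.
  intros z Hz. set (u := (z - c)%C) in *. assert (Hu := Cmod_ge_0 u).
  assert (Hne2 : forall w, Cmod (w - c)%C = r -> (w - z)%C <> RtoC 0).
  { intros w Hw. apply Cminus_neq. intros ->. unfold u in Hz. lra. }
  set (K := fun w => (u * u / ((w - c) * (w - z)))%C).
  assert (HKd : forall w, Cmod (w - c)%C = r -> Cdiff K w).
  { intros w Hw. apply Cdiff_div; [apply Cdiff_const|apply Cdiff_mult; auto|apply Cmult_neq_0; auto]. }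
  assert (HlK : forall w, Cmod (w - c)%C = r -> Ccts (fun w => l w * K w)%C w).
  { intros w Hw. apply Cdiff_cts, Cdiff_mult; auto. apply Hl; lra. }
  assert (Hmv : CM l c r = RtoC 0) by (rewrite (mean_value l c r R); auto; [rewrite L0; ring|lra]).
  assert (Hlc : forall w, Cmod (w - c)%C = r -> Ccts l w) by (intros w Hw; apply Cdiff_cts, Hl; lra).
  assert (E1 : (l z - / RtoC (2 * PI) * CM (fun w => l w * / (w - c)) c r * u)%C
     = (/ RtoC (2 * PI) * CM (fun w => l w * K w) c r)%C).
  { assert (A := cauchy_formula l c z r R HR Hl ltac:(fold u; lra)).
    replace (l z) with (/ RtoC (2 * PI) * (RtoC (2 * PI) * l z))%C by (field; auto). rewrite <- A.
    replace (CM (fun w => l w * K w) c r)%C with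
      (CM (fun w => l w * ((w - c) / (w - z)))%C c r - CM l c r - u * CM (fun w => l w * / (w - c))%C c r)%C.
    { rewrite Hmv. ring. }
    assert (Q1 : forall w, Cmod (w - c)%C = r -> Ccts (fun w => l w * ((w - c) / (w - z)))%C w).
    { intros w Hw. apply Cdiff_cts, Cdiff_mult; [apply Hl; lra|]. apply Cdiff_div; auto. }
    assert (Q2 : forall w, Cmod (w - c)%C = r -> Cdiff (fun w => l w * / (w - c))%C w).
    { intros w Hw. apply Cdiff_mult; [apply Hl; lra|]. apply Cdiff_inv; auto. }
    rewrite <- CM_scal, <- CM_minus, <- CM_minus; try lra; auto.
    - apply CM_ext; [lra|]. intros w Hw. unfold K.
      replace u with ((w - c) - (w - z))%C by (unfold u; ring). field. auto.
    - intros w Hw. apply Cdiff_cts, Cdiff_minus; [|apply Hl; lra].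
      apply Cdiff_mult; [apply Hl; lra|]. apply Cdiff_div; auto.
    - intros w Hw. apply Cdiff_cts, Cdiff_mult; auto. apply Cdiff_const.
    - intros w Hw. apply Cdiff_cts, Q2; auto. }
  set (ub := Cconj u).
  assert (Hub : Cmod ub = Cmod u) by apply Cmod_conj.
  (* On the circle [Cconj (w - c) = r^2 / (w - c)], so [G] is there the conjugate of [Cconj l * K],
     continued holomorphically; the zero of the denominator has distance at least [2 r] from [c]
     because [|u| <= r / 2]. *)
  set (G := fun w => (l w * (ub * ub * ((w - c) * (w - c)) / (RtoC (r * r) * (RtoC (r * r) - ub * (w - c)))))%C).
  assert (Hrr : RtoC (r * r) <> RtoC 0) by (intros g; apply RtoC_inj in g; nra).
  assert (HGn : forall w, Cmod (w - c)%C < 2 * r -> (RtoC (r * r) - ub * (w - c))%C <> RtoC 0).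
  { intros w Hw. apply Cminus_neq. intros g. assert (g' : Cmod (RtoC (r * r)) = Cmod (ub * (w - c))%C) by (rewrite g; auto).
    rewrite Cmod_mult, Cmod_R, Hub, Rabs_right in g' by nra.
    generalize (Cmod_ge_0 (w - c)%C). intros. nra. }
  assert (HG : CM G c r = RtoC 0).
  { rewrite (mean_value G c r (Rmin R (2 * r))).
    - unfold G. rewrite L0. ring.
    - split; [lra|apply Rmin_glb_lt; lra].
    - intros w Hw. assert (Hw1 := Rlt_le_trans _ _ _ Hw (Rmin_l _ _)). assert (Hw2 := Rlt_le_trans _ _ _ Hw (Rmin_r _ _)).
      apply Cdiff_mult; auto. apply Cdiff_div.
      + apply Cdiff_mult; [apply Cdiff_const|]. apply Cdiff_mult; auto.
      + apply Cdiff_mult; [apply Cdiff_const|]. apply Cdiff_minus; [apply Cdiff_const|].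
        apply Cdiff_mult; [apply Cdiff_const|auto].
      + apply Cmult_neq_0; auto. }
  assert (HK : forall w, Cmod (w - c)%C = r -> Cmod (K w) <= 2 * (Cmod u * Cmod u) / (r * r)).
  { intros w Hw. unfold K. rewrite Cmod_div by (apply Cmult_neq_0; auto). rewrite !Cmod_mult, Hw.
    assert (T := Cmod_triangle_minus (w - c)%C u). replace (w - c - u)%C with (w - z)%C in T by (unfold u; ring).
    rewrite Hw in T.
    assert (Hq : r / 2 <= Cmod (w - z)%C) by lra.
    replace (2 * (Cmod u * Cmod u) / (r * r)) with (Cmod u * Cmod u * / (r * (r / 2))) by (field; lra).
    apply Rmult_le_compat_l; [nra|]. apply Rinv_le_contravar; nra. }
  assert (Hconj : forall w, Cmod (w - c)%C = r -> (Cconj (l w) * K w)%C = Cconj (G w)).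
  { intros w Hw. unfold G, K. rewrite Cmult_conj. f_equal.
    assert (Hwz : (r * r)%R = (Cmod (w - c)%C * Cmod (w - c)%C)%R) by (rewrite Hw; auto).
    assert (Hcc : RtoC (r * r) = ((w - c) * Cconj (w - c))%C).
    { rewrite <- Cmod2_conj. rewrite Hwz. f_equal. ring. }
    assert (Hcz : Cconj (RtoC (r * r)) = RtoC (r * r)) by (apply Ceq; unfold Re, Im; simpl; ring).
    rewrite Cdiv_conj by (apply Cmult_neq_0; auto; apply HGn; lra).
    rewrite !Cmult_conj, (Cminus_conj (RtoC (r * r))), Cmult_conj, Hcz. unfold ub. rewrite Cconj_conj.
    assert (Hcn : Cconj (w - c)%C <> RtoC 0).
    { apply Cmod_pos_neq. rewrite Cmod_conj. lra. }
    replace (RtoC (r * r) - u * Cconj (w - c))%C with ((w - z) * Cconj (w - c))%C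
      by (rewrite Hcc; unfold u; ring).
    rewrite Hcc. field. auto. }
  assert (E2 : CM (fun w => Cconj (l w) * K w)%C c r = RtoC 0).
  { transitivity (Cconj (CM G c r)).
    - unfold CM. rewrite <- CI_conj.
      + apply CI_ext. intros t _. apply Hconj. apply Cmod_circ; lra.
      + apply Rcts_circ; [lra|]. intros w Hw. apply Cdiff_cts. apply Cdiff_mult; [apply Hl; lra|].
        apply Cdiff_div.
        * apply Cdiff_mult; [apply Cdiff_const|]. apply Cdiff_mult; auto.
        * apply Cdiff_mult; [apply Cdiff_const|]. apply Cdiff_minus; [apply Cdiff_const|].
          apply Cdiff_mult; [apply Cdiff_const|auto].
        * apply Cmult_neq_0; auto. apply HGn. lra.
    - rewrite HG. apply Ceq; unfold Re, Im; simpl; ring. }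
  rewrite E1, Cmod_mult, Cmod_inv, Cmod_R, Rabs_right by (auto; lra).
  set (k := 2 * (Cmod u * Cmod u) / (r * r)).
  assert (Hk : 0 <= k).
  { unfold k, Rdiv. apply Rmult_le_pos; [nra|]. left; apply Rinv_0_lt_compat; nra. }
  assert (Hcirc : forall t, Cmod (circ c r t - c)%C = r) by (intros; apply Cmod_circ; lra).
  assert (R1 : Rcts (fun t => l (circ c r t)) 0 (2 * PI)) by (apply Rcts_circ; auto; lra).
  assert (Hre := proj1 (Rcts_ex _ _ _ R1)). cbv beta in Hre.
  assert (R2 : Rcts (fun t => l (circ c r t) * K (circ c r t))%C 0 (2 * PI)) by (apply (Rcts_circ (fun w => l w * K w)%C); auto; lra).
  assert (R3 : Rcts (fun t => Cconj (l (circ c r t)) * K (circ c r t))%C 0 (2 * PI)).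
  { intros t Ht. apply Rcc_mult; [apply Rcc_conj; auto|].
    apply (Rcts_circ K c r 0 (2 * PI)); auto; [lra|]. intros; apply Cdiff_cts; auto. }
  (* For [M >= 0], [|Re l| <= 2 M - Re l]; since [Re l] has mean 0, the majorant integrates to
     [k * 4 M * 2 PI]. *)
  assert (B : Cmod (CM (fun w => l w * K w)%C c r) <= RInt (fun t => k * (2 * (2 * M - Re (l (circ c r t))))) 0 (2 * PI)).
  { replace (CM (fun w => l w * K w)%C c r) with
      (CI (fun t => l (circ c r t) * K (circ c r t) + Cconj (l (circ c r t)) * K (circ c r t))%C 0 (2 * PI)).
    2:{ rewrite CI_plus by auto. unfold CM in E2 |- *. rewrite E2. ring. }
    apply CI_bound; [lra| | |].
    - intros t Ht. apply Rcc_plus; auto.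
    - intros t Ht.
      apply (continuous_scal_r (V := R_NormedModule) k (fun t => 2 * (2 * M - Re (l (circ c r t))))).
      apply (continuous_scal_r (V := R_NormedModule) 2 (fun t => 2 * M - Re (l (circ c r t)))).
      apply (continuous_minus (V := R_NormedModule) (fun t => 2 * M) (fun t => Re (l (circ c r t)))).
      + apply continuous_const.
      + refine (proj1 (R1 t _)). rewrite Rmin_left, Rmax_right; lra.
    - intros t Ht. set (w := circ c r t).
      replace (l w * K w + Cconj (l w) * K w)%C with (RtoC (2 * Re (l w)) * K w)%C
        by (apply Ceq; unfold Re, Im; simpl; ring).
      rewrite Cmod_mult, Cmod_R, Rmult_comm. apply Rmult_le_compat; auto using Cmod_ge_0, Rabs_pos.
      + apply HK. apply Hcirc.
      + assert (Hm : Re (l w) <= M) by (apply HM, Hcirc).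
        assert (HM0 : 0 <= 2 * M - Re (l w) \/ 2 * M - Re (l w) < 0) by lra.
        rewrite Rabs_mult, (Rabs_right 2) by lra. apply Rmult_le_compat_l; [lra|].
        apply Rabs_le. split; [|lra].
        destruct (Rle_dec 0 M); [lra|]. exfalso.
        (* the mean of Re l is 0, so M cannot be negative *)
        assert (Z : RInt (fun t => Re (l (circ c r t))) 0 (2 * PI) = 0).
        { unfold CM, CI in Hmv. apply (f_equal Re) in Hmv. exact Hmv. }
        assert (Z2 : RInt (fun t => Re (l (circ c r t))) 0 (2 * PI) <= RInt (fun _ => M) 0 (2 * PI)).
        { apply RInt_le; [lra|exact Hre|apply (ex_RInt_const (V := R_NormedModule))|intros; apply HM, Hcirc]. }
        rewrite Z, RInt_const in Z2. unfold scal in Z2; simpl in Z2; unfold mult in Z2; simpl in Z2. nra. }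
  assert (EI : RInt (fun t => k * (2 * (2 * M - Re (l (circ c r t))))) 0 (2 * PI) = k * (4 * M * (2 * PI))).
  { apply is_RInt_unique.
    assert (I1 : is_RInt (fun t => Re (l (circ c r t))) 0 (2 * PI) 0).
    { replace 0 with (RInt (fun t => Re (l (circ c r t))) 0 (2 * PI)) at 2.
      - exact (RInt_correct (V := R_CompleteNormedModule) _ _ _ Hre).
      - unfold CM, CI in Hmv. apply (f_equal Re) in Hmv. exact Hmv. }
    assert (I2 : is_RInt (fun t => k * (2 * (2 * M - Re (l (circ c r t))))) 0 (2 * PI)
        (k * (2 * ((2 * PI - 0) * (2 * M) - 0)))).
    { apply (is_RInt_scal (V := R_NormedModule)). apply (is_RInt_scal (V := R_NormedModule)).
      apply (is_RInt_minus (V := R_NormedModule)); auto. apply (is_RInt_const (V := R_NormedModule)). }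
    replace (k * (4 * M * (2 * PI))) with (k * (2 * ((2 * PI - 0) * (2 * M) - 0))) by ring. exact I2. }
  rewrite EI in B.
  apply Rle_trans with (/ (2 * PI) * (k * (4 * M * (2 * PI)))).
  - apply Rmult_le_compat_l; [left; apply Rinv_0_lt_compat; lra|exact B].
  - right. unfold k. field. split; lra.
Qed.

(** * Maximum principle and Phragmen-Lindelof in a strip *)

(** A quarter is kept if every value of [|h|] on the whole rectangle is dominated by a value on it.
    If all four failed, the largest of the four witnesses would contradict the property of the
    parent. No supremum is formed. *)
Lemma rect_argmax (h : C -> C) (a b c d : R) : a <= b -> c <= d -> rect_cts h a b c d ->
  exists x y, a <= x <= b /\ c <= y <= d /\
    forall u v, a <= u <= b -> c <= v <= d -> Cmod (h (u, v)) <= Cmod (h (x, y)).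
Proof.
  intros Hab Hcd Hh.
  set (dom := fun (z : C) (a' b' c' d' : R) => exists x y, a' <= x <= b' /\ c' <= y <= d' /\ Cmod (h z) <= Cmod (h (x, y))).
  destruct (bisection (fun a' b' c' d' => forall u v, a <= u <= b -> c <= v <= d -> dom (u, v) a' b' c' d') a b c d)
    as (x & y & Hx & Hy & Hlim); auto.
  - intros a1 b1 c1 d1 H1 H2 HP. apply NNPP; intros Hno.
    apply not_or_and in Hno; destruct Hno as [N1 Hno].
    apply not_or_and in Hno; destruct Hno as [N2 Hno].
    apply not_or_and in Hno; destruct Hno as [N3 N4].
    assert (K : forall a' b' c' d', ~ (forall u v, a <= u <= b -> c <= v <= d -> dom (u, v) a' b' c' d') ->
       exists u v, a <= u <= b /\ c <= v <= d /\ forall x y, a' <= x <= b' -> c' <= y <= d' -> Cmod (h (x, y)) < Cmod (h (u, v))).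
    { intros a' b' c' d' N. apply not_all_ex_not in N. destruct N as [u N]. apply not_all_ex_not in N.
      destruct N as [v N]. apply imply_to_and in N. destruct N as [A N]. apply imply_to_and in N. destruct N as [B N].
      exists u, v. split; [auto|split; [auto|]]. intros x y Hx Hy. apply Rnot_le_lt. intros L. apply N.
      exists x, y; auto. }
    apply K in N1. apply K in N2. apply K in N3. apply K in N4.
    destruct N1 as (u1 & v1 & U1 & V1 & N1). destruct N2 as (u2 & v2 & U2 & V2 & N2).
    destruct N3 as (u3 & v3 & U3 & V3 & N3). destruct N4 as (u4 & v4 & U4 & V4 & N4).
    assert (KM : exists u v, a <= u <= b /\ c <= v <= d /\ Cmod (h (u1, v1)) <= Cmod (h (u, v)) /\
       Cmod (h (u2, v2)) <= Cmod (h (u, v)) /\ Cmod (h (u3, v3)) <= Cmod (h (u, v)) /\ Cmod (h (u4, v4)) <= Cmod (h (u, v))).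
    { destruct (Rle_dec (Cmod (h (u1, v1))) (Cmod (h (u2, v2)))), (Rle_dec (Cmod (h (u3, v3))) (Cmod (h (u4, v4)))).
      - destruct (Rle_dec (Cmod (h (u2, v2))) (Cmod (h (u4, v4)))); [exists u4, v4|exists u2, v2]; repeat split; lra.
      - destruct (Rle_dec (Cmod (h (u2, v2))) (Cmod (h (u3, v3)))); [exists u3, v3|exists u2, v2]; repeat split; lra.
      - destruct (Rle_dec (Cmod (h (u1, v1))) (Cmod (h (u4, v4)))); [exists u4, v4|exists u1, v1]; repeat split; lra.
      - destruct (Rle_dec (Cmod (h (u1, v1))) (Cmod (h (u3, v3)))); [exists u3, v3|exists u1, v1]; repeat split; lra. }
    destruct KM as (u & v & Hu & Hv & M1 & M2 & M3 & M4).
    destruct (HP u v Hu Hv) as (x & y & Hx & Hy & L).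
    destruct (Rle_dec x ((a1 + b1) / 2)) as [Lx|Lx]; destruct (Rle_dec y ((c1 + d1) / 2)) as [Ly|Ly].
    + specialize (N1 x y ltac:(lra) ltac:(lra)). lra.
    + specialize (N3 x y ltac:(lra) ltac:(lra)). lra.
    + specialize (N2 x y ltac:(lra) ltac:(lra)). lra.
    + specialize (N4 x y ltac:(lra) ltac:(lra)). lra.
  - intros u v Hu Hv. exists u, v. split; [auto|split; [auto|lra]].
  - exists x, y. split; [auto|split; [auto|]]. intros u v Hu Hv. apply Rnot_lt_le; intros L.
    destruct (Hh x y Hx Hy (Cmod (h (u, v)) - Cmod (h (x, y)))) as (del & Hdel & A); [lra|].
    destruct (Hlim del Hdel) as (n & a' & b' & c' & d' & _ & _ & W & B1 & B2 & B3 & B4 & HP).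
    destruct (HP u v Hu Hv) as (s & t & Hs & Ht & L2).
    assert (Hm : Cmod ((s, t) - (x, y))%C < del).
    { eapply Rle_lt_trans; [apply Cmod_le_abs|]. eapply Rle_lt_trans; [|exact W].
      apply Rplus_le_compat; unfold Re, Im; simpl; apply Rabs_le; split; lra. }
    specialize (A _ Hm). generalize (Cmod_triangle_minus (h (s, t)) (h (x, y))). lra.
Qed.

Lemma RInt_pos_point (phi : R -> R) (a b p q eta : R) : a <= p -> p < q -> q <= b -> 0 < eta ->
  (forall t, a <= t <= b -> continuous phi t) -> (forall t, a <= t <= b -> 0 <= phi t) ->
  (forall t, p <= t <= q -> eta <= phi t) -> 0 < RInt phi a b.
Proof.
  intros H1 H2 H3 He Hc H0 Hp.
  assert (Ex : forall u v, a <= u -> u <= v -> v <= b -> ex_RInt phi u v).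
  { intros u v A B D. apply (ex_RInt_continuous (V := R_CompleteNormedModule)). intros t Ht.
    rewrite Rmin_left, Rmax_right in Ht by auto. apply Hc; lra. }
  rewrite <- (RInt_Chasles phi a p b), <- (RInt_Chasles phi p q b) by (apply Ex; lra).
  assert (A : 0 <= RInt phi a p) by (apply RInt_ge_0; [lra|apply Ex; lra|intros; apply H0; lra]).
  assert (B : 0 <= RInt phi q b) by (apply RInt_ge_0; [lra|apply Ex; lra|intros; apply H0; lra]).
  assert (D : RInt (fun _ => eta) p q <= RInt phi p q).
  { apply RInt_le; [lra|apply ex_RInt_const|apply Ex; lra|intros; apply Hp; lra]. }
  rewrite RInt_const in D. unfold scal in D; simpl in D; unfold mult in D; simpl in D.
  unfold plus; simpl. nra.
Qed.

(** [|h c|] is at most the mean of [|h|] over the circle, and continuity spreads one point of strict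
    deficit over an interval. The interval is taken to the right of [t0], hence [t0 < 2 PI]. *)
Lemma strict_mean (h : C -> C) (c : C) (r R t0 : R) : 0 < r < R -> 0 <= t0 < 2 * PI ->
  (forall z, Cmod (z - c)%C < R -> Cdiff h z) ->
  (forall z, Cmod (z - c)%C = r -> Cmod (h z) <= Cmod (h c)) ->
  Cmod (h (circ c r t0)) < Cmod (h c) -> False.
Proof.
  intros Hr Ht0 Hh Hle Hlt. assert (HP := two_pi_pos).
  assert (Hc : Rcts (fun t => h (circ c r t)) 0 (2 * PI)).
  { apply Rcts_circ; [lra|]. intros z Hz. apply Cdiff_cts, Hh. lra. }
  assert (Hcc : forall t, continuous (fun t => Cmod (h (circ c r t))) t).
  { intros t. apply continuous_Cmod. apply (Rcc_comp h (circ c r)); [|apply Rcc_circ].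
    apply Cdiff_cts, Hh. rewrite Cmod_circ; lra. }
  set (phi := fun t => Cmod (h c) - Cmod (h (circ c r t))).
  assert (Hphi : forall t, continuous phi t).
  { intros t. apply (continuous_minus (V := R_NormedModule) (fun _ => Cmod (h c)) (fun t => Cmod (h (circ c r t)))); auto.
    apply continuous_const. }
  destruct (proj1 (continuous_eps phi t0) (Hphi t0) (phi t0 / 2)) as (d & Hd & A); [unfold phi; lra|].
  assert (Pos : 0 < RInt phi 0 (2 * PI)).
  { apply RInt_pos_point with (p := t0) (q := t0 + Rmin (d / 2) (2 * PI - t0)) (eta := phi t0 / 2); auto.
    - lra.
    - assert (0 < Rmin (d / 2) (2 * PI - t0)) by (apply Rmin_glb_lt; lra). lra.
    - generalize (Rmin_r (d / 2) (2 * PI - t0)). lra.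
    - unfold phi; lra.
    - intros t _. unfold phi. assert (Cmod (h (circ c r t)) <= Cmod (h c)); [|lra].
      apply Hle, Cmod_circ; lra.
    - intros t Ht. assert (M := Rmin_l (d / 2) (2 * PI - t0)).
      assert (Hs : Rabs (t - t0) < d) by (apply Rabs_def1; lra).
      specialize (A t Hs). apply Rabs_def2 in A. lra. }
  assert (E : RInt phi 0 (2 * PI) = 2 * PI * Cmod (h c) - RInt (fun t => Cmod (h (circ c r t))) 0 (2 * PI)).
  { apply is_RInt_unique.
    replace (2 * PI * Cmod (h c)) with ((2 * PI - 0) * Cmod (h c)) by ring.
    apply (is_RInt_minus (V := R_NormedModule) (fun _ => Cmod (h c)) (fun t => Cmod (h (circ c r t)))).
    - apply (is_RInt_const (V := R_NormedModule)).
    - apply (RInt_correct (V := R_CompleteNormedModule)).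
      apply (ex_RInt_continuous (V := R_CompleteNormedModule)). intros; auto. }
  assert (B := CI_bound (fun t => h (circ c r t)) (fun t => Cmod (h (circ c r t))) 0 (2 * PI) ltac:(lra) Hc
    (fun t _ => Hcc t) (fun t _ => Rle_refl _)).
  fold (CM h c r) in B. rewrite (mean_value h c r R) in B by (auto; lra).
  rewrite Cmod_mult, Cmod_R, Rabs_right in B by lra. lra.
Qed.

Lemma Cdiff_cos_like (al : R) (z : C) : Cdiff (fun z => Cexp (RtoC al * Ci * z) + Cexp (- (RtoC al * Ci * z)))%C z.
Proof.
  assert (A : Cdiff (fun z => RtoC al * Ci * z)%C z) by (apply Cdiff_mult; [apply Cdiff_const|apply Cdiff_id]).
  apply Cdiff_plus; apply (Cdiff_Cexp); auto.
  destruct A as [l A]. exists (- l)%C. apply Cder_opp; auto.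
Qed.

Lemma Re_cos_like (al x y : R) :
  Re (Cexp (RtoC al * Ci * (x, y)) + Cexp (- (RtoC al * Ci * (x, y))))%C = cos (al * x) * (exp (al * y) + exp (- (al * y))).
Proof.
  unfold Cexp, Re, Im; simpl.
  replace ((al * 0 - 0 * 1) * x - (al * 1 + 0 * 0) * y) with (- (al * y)) by ring.
  replace ((al * 0 - 0 * 1) * y + (al * 1 + 0 * 0) * x) with (al * x) by ring.
  replace (- - (al * y)) with (al * y) by ring. rewrite cos_neg. ring.
Qed.

(** One term of the exponential series, of degree [k + 1], already outgrows
    [(1 + y)^k <= (2 y)^k]. *)
Lemma exp_beats_pow (a : R) (k : nat) (A : R) : 0 < a -> exists Y, 0 < Y /\ forall y, Y <= y -> A * (1 + y) ^ k <= exp (a * y).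
Proof.
  intros Ha.
  assert (Hf : 0 < INR (fact (S k))) by apply INR_fact_lt_0.
  set (B := Rabs A * 2 ^ k * INR (fact (S k)) / a ^ S k).
  assert (Ak : 0 < a ^ S k) by (apply pow_lt; auto).
  exists (Rmax 1 B). split; [generalize (Rmax_l 1 B); lra|]. intros y Hy.
  assert (Hy1 : 1 <= y) by (generalize (Rmax_l 1 B); lra). assert (Hy2 : B <= y) by (generalize (Rmax_r 1 B); lra).
  assert (Hay : 0 <= a * y) by nra.
  assert (E : (a * y) ^ S k / INR (fact (S k)) <= exp (a * y)).
  { apply Rle_trans with (sum_f_R0 (fun j => (a * y) ^ j / INR (fact j)) (S k)); [|apply exp_ge_taylor; auto].
    rewrite tech5. assert (0 <= sum_f_R0 (fun j => (a * y) ^ j / INR (fact j)) k); [|lra].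
    apply cond_pos_sum. intros j. apply Rmult_le_pos; [apply pow_le; auto|left; apply Rinv_0_lt_compat, INR_fact_lt_0]. }
  eapply Rle_trans; [|exact E].
  rewrite Rpow_mult_distr.
  apply Rle_trans with (Rabs A * (2 ^ k * y ^ k)).
  - apply Rle_trans with (Rabs A * (1 + y) ^ k).
    + apply Rmult_le_compat_r; [apply pow_le; lra|apply Rle_abs].
    + apply Rmult_le_compat_l; [apply Rabs_pos|]. rewrite <- Rpow_mult_distr. apply pow_incr. lra.
  - apply Rmult_le_reg_r with (INR (fact (S k)) / a ^ S k); [apply Rdiv_lt_0_compat; auto|].
    replace (Rabs A * (2 ^ k * y ^ k) * (INR (fact (S k)) / a ^ S k)) with (B * y ^ k) by (unfold B; field; lra).
    replace (a ^ S k * y ^ S k / INR (fact (S k)) * (INR (fact (S k)) / a ^ S k)) with (y * y ^ k).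
    + apply Rmult_le_compat_r; [apply pow_le; lra|auto].
    + simpl (y ^ S k). field. split; apply Rgt_not_eq; auto.
Qed.

(** The damping factor [exp (- eps E)] with [E z = 2 cos (al z)] decays doubly exponentially in the
    strip, which beats [exp] of any power. The damped function then has a maximum over the whole
    strip; edge values are too small, so it is attained inside, and the circle about that point
    touching the nearer edge contradicts the mean value inequality. *)
Lemma phragmen_lindelof (f : C -> C) (B B' M A A2 : R) (k : nat) : 0 < B < B' -> 0 < A -> 0 <= A2 -> 0 <= M ->
  (forall z, Rabs (Re z) < B' -> Cdiff f z) ->
  (forall z, Rabs (Re z) = B -> Cmod (f z) <= M) ->
  (forall z, Rabs (Re z) <= B -> Cmod (f z) <= A * exp (A2 * (1 + Rabs (Im z)) ^ k)) ->
  forall z, Rabs (Re z) <= B -> Cmod (f z) <= M.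
Proof.
  intros [HB HB'] HA HA2 HM0 Hf HM Hg z0 Hz0. apply Rnot_lt_le; intros Hlt.
  assert (HPI := PI_RGT_0).
  (* The angle [al |Re z|] is at most [PI / 3], so the cosine is at least [1/2] on the closed
     strip. *)
  set (al := PI / (3 * B)). assert (Hal : 0 < al) by (apply Rdiv_lt_0_compat; lra).
  set (E := fun z => (Cexp (RtoC al * Ci * z) + Cexp (- (RtoC al * Ci * z)))%C).
  assert (Hcos : forall x, Rabs x <= B -> / 2 <= cos (al * x)).
  { intros x Hx. replace (/ 2) with (1 / 2) by lra. rewrite <- cos_PI3.
    assert (Hb : Rabs (al * x) <= PI / 3).
    { rewrite Rabs_mult, (Rabs_right al) by lra. replace (PI / 3) with (al * B) by (unfold al; field; lra).
      apply Rmult_le_compat_l; lra. }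
    assert (Hb2 := Rabs_pos (al * x)).
    replace (cos (al * x)) with (cos (Rabs (al * x))).
    2:{ unfold Rabs; destruct Rcase_abs; auto. apply cos_neg. }
    apply cos_decr_1; lra. }
  assert (HT : forall x y, Rabs x <= B -> exp (al * Rabs y) / 2 <= Re (E (x, y))).
  { intros x y Hx. unfold E. rewrite Re_cos_like. specialize (Hcos x Hx).
    assert (H1 := exp_pos (al * y)). assert (H2 := exp_pos (- (al * y))).
    assert (H3 : exp (al * Rabs y) <= exp (al * y) + exp (- (al * y))).
    { unfold Rabs; destruct Rcase_abs; [replace (al * - y) with (- (al * y)) by ring|]; lra. }
    nra. }
  assert (HEd : forall z, Cdiff E z) by (intros; apply Cdiff_cos_like).
  destruct z0 as [x0 y0]. simpl in Hz0.
  set (F0 := Cmod (f (x0, y0))) in *. set (T0 := Re (E (x0, y0))).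
  assert (HT0 : 0 < T0).
  { generalize (HT x0 y0 Hz0) (exp_pos (al * Rabs y0)). fold T0. lra. }
  (* Small enough that the damping costs [|f z0|] at most half of its excess over [M]. *)
  set (eps := (F0 - M) / (2 * F0 * (T0 + 1))).
  assert (Heps : 0 < eps) by (apply Rdiv_lt_0_compat; nra).
  set (h := fun z => (f z * Cexp (- (RtoC eps * E z)))%C).
  assert (Hhd : forall z, Rabs (Re z) < B' -> Cdiff h z).
  { intros z Hz. apply Cdiff_mult; auto. apply Cdiff_Cexp.
    destruct (Cdiff_mult (fun _ => RtoC eps) E z (Cdiff_const _ _) (HEd z)) as [l Hl].
    exists (- l)%C. apply Cder_opp; auto. }
  assert (Hhm : forall z, Cmod (h z) = Cmod (f z) * exp (- (eps * Re (E z)))).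
  { intros z. unfold h. rewrite Cmod_mult, Cmod_exp. do 2 f_equal. unfold Re; simpl; ring. }
  assert (Hhf : forall z, Rabs (Re z) <= B -> Cmod (h z) <= Cmod (f z)).
  { intros [x y] Hz. rewrite Hhm. rewrite <- (Rmult_1_r (Cmod (f (x, y)))) at 2.
    apply Rmult_le_compat_l; [apply Cmod_ge_0|]. rewrite <- exp_0. apply exp_mono.
    specialize (HT x y Hz). assert (0 < exp (al * Rabs y)) by apply exp_pos. nra. }
  set (H0 := Cmod (h (x0, y0))).
  assert (HH0 : M < H0).
  { unfold H0. rewrite Hhm. fold F0 T0.
    assert (X : 1 + - (eps * T0) <= exp (- (eps * T0))) by apply exp_ineq1_le.
    assert (Y : eps * (T0 + 1) * (2 * F0) = F0 - M) by (unfold eps; field; lra).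
    assert (F0 * (1 + - (eps * T0)) <= F0 * exp (- (eps * T0))) by (apply Rmult_le_compat_l; lra). nra. }
  set (D := Rabs (ln (A / H0) + 1)).
  destruct (exp_beats_pow al k ((2 / eps) * (A2 + D)) Hal) as (Y & HY & HYb).
  assert (HD : 0 <= D) by apply Rabs_pos.
  assert (Hfar : forall x y, Rabs x <= B -> Y <= Rabs y -> Cmod (h (x, y)) <= H0).
  { intros x y Hx Hy. rewrite Hhm.
    assert (G1 := Hg (x, y) Hx). simpl in G1.
    specialize (HYb (Rabs y) Hy). specialize (HT x y Hx).
    set (pw := (1 + Rabs y) ^ k) in *.
    assert (Hpw : 1 <= pw).
    { unfold pw. apply pow_R1_Rle. generalize (Rabs_pos y); lra. }
    assert (Hk : (A2 + D) * pw <= eps * Re (E (x, y))).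
    { apply Rle_trans with (eps * (exp (al * Rabs y) / 2)).
      - replace ((A2 + D) * pw) with (eps * ((2 / eps * (A2 + D) * pw) / 2)) by (field; lra).
        apply Rmult_le_compat_l; [lra|]. lra.
      - apply Rmult_le_compat_l; lra. }
    apply Rle_trans with (A * exp (A2 * pw) * exp (- (eps * Re (E (x, y))))).
    { apply Rmult_le_compat_r; [left; apply exp_pos|exact G1]. }
    rewrite Rmult_assoc, <- exp_plus.
    apply Rle_trans with (A * exp (- ln (A / H0))).
    - apply Rmult_le_compat_l; [lra|]. apply exp_mono.
      assert (ln (A / H0) + 1 <= D) by apply Rle_abs. nra.
    - rewrite exp_Ropp, exp_ln; [|apply Rdiv_lt_0_compat; lra]. right. field. lra. }
  set (Y' := Rmax Y (Rabs y0)).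
  assert (Hy0 : Rabs y0 <= Y') by apply Rmax_r. assert (HYY : Y <= Y') by apply Rmax_l.
  assert (HY' : 0 <= Y') by lra. clearbody Y'.
  assert (Hstrip : forall x, - B <= x <= B -> Rabs x <= B) by (intros; apply Rabs_le; lra).
  destruct (rect_argmax h (- B) B (- Y') Y') as (x & y & Hx & Hy & Hmax); try lra.
  { intros u v Hu Hv. apply Cdiff_cts, Hhd. apply Hstrip in Hu. simpl. lra. }
  assert (HS : H0 <= Cmod (h (x, y))).
  { apply Hmax; [|]; apply Rabs_le_between; auto. }
  assert (Hall : forall u v, Rabs u <= B -> Cmod (h (u, v)) <= Cmod (h (x, y))).
  { intros u v Hu. destruct (Rle_dec (Rabs v) Y') as [L|L].
    - apply Hmax; apply Rabs_le_between; auto.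
    - eapply Rle_trans; [apply Hfar|exact HS]; auto. lra. }
  assert (Hxb : Rabs x < B).
  { destruct (Rle_lt_or_eq_dec _ _ (Hstrip x Hx)) as [L|L]; auto. exfalso.
    assert (Q := Hhf (x, y) ltac:(simpl; lra)). assert (Q2 := HM (x, y) L). lra. }
  set (r := B - Rabs x). assert (Hr : 0 < r) by (unfold r; lra).
  assert (Hin : forall z, Cmod (z - (x, y))%C <= r -> Rabs (Re z) <= B).
  { intros [u v] Hz. simpl. assert (P := re_le_Cmod ((u, v) - (x, y))%C). unfold Re in P; simpl in P.
    assert (T := Rabs_triang (u + - x) x). replace (u + - x + x) with u in T by ring. unfold r in Hz. lra. }
  assert (Hd2 : forall z, Cmod (z - (x, y))%C < r + (B' - B) -> Cdiff h z).
  { intros [u v] Hz. apply Hhd. simpl. assert (P := re_le_Cmod ((u, v) - (x, y))%C). unfold Re in P; simpl in P.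
    assert (T := Rabs_triang (u + - x) x). replace (u + - x + x) with u in T by ring. unfold r in Hz. lra. }
  assert (Hle : forall z, Cmod (z - (x, y))%C = r -> Cmod (h z) <= Cmod (h (x, y))).
  { intros [u v] Hz. apply Hall. apply (Hin (u, v)). lra. }
  assert (Hbd : forall w, Rabs (Re w) = B -> Cmod (h w) < Cmod (h (x, y))).
  { intros w Hw. apply Rle_lt_trans with M; [|lra]. eapply Rle_trans; [apply Hhf; lra|]. auto. }
  destruct (Rle_dec 0 x) as [L|L].
  - apply (strict_mean h (x, y) r (r + (B' - B)) 0); auto; try lra.
    apply Hbd. unfold circ, Cexp, Re, Im; simpl. rewrite exp_0, cos_0, sin_0. unfold r.
    rewrite (Rabs_right x) by lra. rewrite Rabs_right; lra.
  - apply (strict_mean h (x, y) r (r + (B' - B)) PI); auto; try lra.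
    apply Hbd. unfold circ, Cexp, Re, Im; simpl. rewrite exp_0, cos_PI, sin_PI. unfold r.
    rewrite (Rabs_left x) by lra. rewrite Rabs_left; lra.
Qed.

(** * Lists of zeros *)

Lemma occ_count (z : C) (l : list C) : occ z l = count_occ Ceq_dec l z.
Proof.
  induction l as [|a l IH]; simpl; auto. rewrite IH.
  destruct (Ceq_dec z a), (Ceq_dec a z); congruence || lia.
Qed.

Lemma occ_not_in (z : C) (l : list C) : ~ In z l -> occ z l = O.
Proof. rewrite occ_count. apply count_occ_not_In. Qed.

Lemma Cpown_Cpow (z : C) (n : nat) : Cpown z n = Cpow z n.
Proof. induction n as [|n IH]; simpl; [reflexivity|rewrite IH; reflexivity]. Qed.

Lemma Clprod_occ (l : list C) (z : C) : exists l', ~ In z l' /\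
  forall s, Clprod l s = (Cpown (s - z) (occ z l) * Clprod l' s)%C.
Proof.
  induction l as [|a l (l' & Hn & IH)]; simpl.
  - exists nil. split; auto. intros s; simpl; ring.
  - destruct (Ceq_dec z a) as [<-|Hne].
    + exists l'. split; auto. intros s. rewrite IH. simpl. ring.
    + exists (a :: l'). split; [intros [E|E]; auto|]. intros s. rewrite IH. simpl. ring.
Qed.

Lemma Cdiff_Clprod (l : list C) (z : C) : Cdiff (Clprod l) z.
Proof.
  induction l as [|a l IH]; simpl; [apply Cdiff_const|].
  apply (Cdiff_mult (fun s => (s - a)%C) (Clprod l)); auto.
  apply Cdiff_minus; [apply Cdiff_id|apply Cdiff_const].
Qed.

Lemma Clprod_In (l : list C) (z : C) : In z l -> Clprod l z = RtoC 0.
Proof.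
  induction l as [|a l IH]; simpl; [tauto|]. intros [->|H]; [ring|rewrite IH; auto; ring].
Qed.

Lemma factor_zero_mult (X H : C -> C) (l : list C) (z : C) : (forall s, Cdiff H s) ->
  (forall s, X s = (Clprod l s * H s)%C) -> H z <> RtoC 0 -> zero_mult X z (occ z l).
Proof.
  intros HH HX Hz. destruct (Clprod_occ l z) as (l' & Hn & E).
  exists (fun s => (Clprod l' s * H s)%C). split; [|split].
  - intros s. apply Cder_ex_derive, Cdiff_mult; auto. apply Cdiff_Clprod.
  - apply Cmult_neq_0; auto. apply Clprod_neq0; auto.
  - intros s. rewrite HX, E. ring.
Qed.

(** If [k < k'], cancelling [(s - z)^k] away from [z] leaves a factor that vanishes at [z], and
    continuity contradicts [H z <> 0]. *)
Lemma zero_mult_unique_le (X : C -> C) (z : C) (k k' : nat) : zero_mult X z k -> zero_mult X z k' -> (k' <= k)%nat.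
Proof.
  intros (H & E1 & E2 & E3) (H' & F1 & F2 & F3).
  apply Nat.nlt_ge; intros L. 
  assert (Hc : Ccts H z) by (apply Cdiff_cts, Cder_ex_derive, E1).
  set (G := fun s => (Cpow (s - z) (k' - k) * H' s)%C).
  assert (Gc : Ccts G z).
  { apply Cdiff_cts, Cdiff_mult; [|apply Cder_ex_derive, F1].
    apply (Cdiff_Cpow (fun s => (s - z)%C)), Cdiff_minus; [apply Cdiff_id|apply Cdiff_const]. }
  assert (Gz : G z = RtoC 0).
  { unfold G. replace (z - z)%C with (RtoC 0) by ring.
    replace (k' - k)%nat with (S (k' - k - 1)) by lia. rewrite Cpow_S. ring. }
  assert (HG : forall s, s <> z -> H s = G s).
  { intros s Hs. unfold G. assert (D := Cminus_neq _ _ Hs).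
    assert (P : (Cpow (s - z) k * H s = Cpow (s - z) k * (Cpow (s - z) (k' - k) * H' s))%C).
    { rewrite <- Cpown_Cpow, <- E3, F3, Cpown_Cpow. rewrite Cmult_assoc, <- Cpow_add_r. do 2 f_equal. lia. }
    assert (Pn : Cpow (s - z) k <> RtoC 0) by (apply Cpow_nz; auto).
    replace (H s) with (/ Cpow (s - z) k * (Cpow (s - z) k * H s))%C by (field; auto).
    rewrite P. field; auto. }
  assert (P : 0 < Cmod (H z)) by (apply Cmod_gt_0; auto).
  destruct (Hc (Cmod (H z) / 2)) as (d1 & Hd1 & A1); [lra|].
  destruct (Gc (Cmod (H z) / 2)) as (d2 & Hd2 & A2); [lra|].
  assert (Hm : 0 < Rmin d1 d2) by (apply Rmin_glb_lt; auto).
  set (s := (z + RtoC (Rmin d1 d2 / 2))%C).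
  assert (Hs : Cmod (s - z)%C = Rmin d1 d2 / 2).
  { unfold s. replace (z + RtoC (Rmin d1 d2 / 2) - z)%C with (RtoC (Rmin d1 d2 / 2)) by ring.
    rewrite Cmod_R, Rabs_right; lra. }
  specialize (A1 s ltac:(generalize (Rmin_l d1 d2); lra)). specialize (A2 s ltac:(generalize (Rmin_r d1 d2); lra)).
  assert (s <> z).
  { intros E. rewrite E in Hs. replace (z - z)%C with (RtoC 0) in Hs by ring. rewrite Cmod_0 in Hs. lra. }
  rewrite HG in A1 by auto. rewrite Gz in A2.
  generalize (Cmod_triangle_minus (H z) (G s)). rewrite Cmod_sub_sym. replace (G s - 0)%C with (G s) in A2 by ring. lra.
Qed.

Lemma zero_mult_unique (X : C -> C) (z : C) (k k' : nat) : zero_mult X z k -> zero_mult X z k' -> k = k'.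
Proof. intros A B. apply Nat.le_antisymm; eapply zero_mult_unique_le; eauto. Qed.

(** Makes a sum over the zeros up to height [T] independent of the list that enumerates them. *)
Lemma zeros_upto_perm (X : C -> C) (T : R) (l l' : list C) :
  zeros_upto X T l -> zeros_upto X T l' -> Permutation l l'.
Proof.
  intros H H'. apply (Permutation_count_occ Ceq_dec). intros z. rewrite <- !occ_count.
  destruct (H z) as [A B], (H' z) as [A' B'].
  destruct (classic (X z = RtoC 0 /\ Rabs (Im z) <= T)) as [P|P].
  - eapply zero_mult_unique; eauto.
  - rewrite !occ_not_in; auto.
Qed.

Definition im_le (T : R) (z : C) : bool := if Rle_dec (Rabs (Im z)) T then true else false.

Lemma im_le_spec (T : R) (z : C) : im_le T z = true <-> Rabs (Im z) <= T.
Proof. unfold im_le. destruct (Rle_dec _ _); split; auto; discriminate. Qed.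

Lemma occ_filter (z : C) (p : C -> bool) (l : list C) : p z = true -> occ z (filter p l) = occ z l.
Proof.
  intros Hp. induction l as [|a l IH]; simpl; auto.
  destruct (p a) eqn:E; simpl; rewrite IH; auto.
  destruct (Ceq_dec z a) as [->|]; auto. congruence.
Qed.

Lemma zeros_upto_filter (X : C -> C) (T U : R) (l : list C) : T <= U ->
  zeros_upto X U l -> zeros_upto X T (filter (im_le T) l).
Proof.
  intros HTU H z. destruct (H z) as [A B]. split.
  - intros [P Q]. rewrite occ_filter by (apply im_le_spec; auto). apply A. split; auto. lra.
  - intros N G. apply filter_In in G. destruct G as [G1 G2]. apply im_le_spec in G2.
    apply B; auto. intros [P Q]. apply N; auto.
Qed.

Lemma zeros_upto_In (X : C -> C) (T : R) (l : list C) (z : C) :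
  zeros_upto X T l -> In z l -> X z = RtoC 0 /\ Rabs (Im z) <= T.
Proof. intros H Hin. apply NNPP; intros N. destruct (H z) as [_ B]. apply B in N. auto. Qed.

Definition half_line (X : C -> C) : Prop := forall rho, X rho = RtoC 0 -> Re rho = / 2.

(** A point [1/2 + i t] has squared distance [1 + t^2] from [3/2]. The disc of radius
    [sqrt (1 + W^2)] about it thus holds exactly the zeros up to height [W], and [X] does not vanish
    at the centre itself. *)
Definition center : C := RtoC (3 / 2).

Lemma center_dist (z : C) : Re z = / 2 -> Cmod (z - center)%C * Cmod (z - center)%C = 1 + Im z * Im z.
Proof. intros H. rewrite Cmod_sqr. unfold center, Re, Im in *; simpl. rewrite H. field. Qed.

Lemma factor_zeros_upto (X H : C -> C) (l : list C) (W : R) : 0 <= W -> half_line X ->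
  (forall z, Cdiff H z) -> (forall z, X z = (Clprod l z * H z)%C) ->
  (forall a, In a l -> Cmod (a - center)%C <= sqrt (1 + W * W)) ->
  (forall z, Cmod (z - center)%C <= sqrt (1 + W * W) -> H z <> RtoC 0) -> zeros_upto X W l.
Proof.
  intros HW HR HH HX Hl HN.
  assert (S0 : 0 <= sqrt (1 + W * W)) by apply sqrt_pos.
  assert (S1 : sqrt (1 + W * W) * sqrt (1 + W * W) = 1 + W * W) by (apply sqrt_sqrt; nra).
  assert (K : forall z, Re z = / 2 -> (Cmod (z - center)%C <= sqrt (1 + W * W) <-> Rabs (Im z) <= W)).
  { intros z Hz. assert (E := center_dist z Hz). assert (P := Cmod_ge_0 (z - center)%C).
    assert (Q := Rabs_pos (Im z)). assert (E2 : Im z * Im z = Rabs (Im z) * Rabs (Im z)) by (rewrite <- Rabs_mult, Rabs_right; nra).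
    split; intros L.
    - apply Rnot_lt_le; intros G. nra.
    - apply Rnot_lt_le; intros G. nra. }
  intros z. split.
  - intros [P Q]. apply factor_zero_mult with H; auto. apply HN, K; auto.
  - intros N G. apply N. assert (P : X z = RtoC 0) by (rewrite HX, Clprod_In; auto; ring).
    split; auto. apply K; auto.
Qed.

(** * The argument of an entire function of order less than two whose zeros lie on a line *)

(** Order [3/2]: Stirling's [u ln u] is bounded through [ln u <= 2 sqrt u]. Any exponent below 2
    would serve, because a quadratic remainder is divided by the square of the radius. *)
Definition growth (X : C -> C) (C0 : R) : Prop :=
  forall z, Cmod (X z) <= exp (C0 * ((1 + Cmod z) * sqrt (1 + Cmod z))).

Lemma growth_circle (X : C -> C) (C0 r : R) (z : C) : 0 <= C0 -> growth X C0 ->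
  Cmod (z - center)%C <= 3 * r -> 0 <= r -> Cmod (X z) <= exp (C0 * ((3 + 3 * r) * sqrt (3 + 3 * r))).
Proof.
  intros H0 HX Hz Hr. eapply Rle_trans; [apply HX|]. apply exp_mono. apply Rmult_le_compat_l; auto.
  assert (T : 1 + Cmod z <= 3 + 3 * r).
  { assert (T := Cmod_triangle (z - center) center). replace (z - center + center)%C with z in T by ring.
    unfold center at 2 in T. rewrite Cmod_R, Rabs_right in T; lra. }
  assert (P := Cmod_ge_0 z).
  apply Rmult_le_compat; try lra; [apply sqrt_pos|apply sqrt_le_1; lra].
Qed.

Lemma zeros_upto_exists (X : C -> C) (C0 W : R) : 0 <= C0 -> (forall z, Cdiff X z) -> growth X C0 -> half_line X ->
  0 <= W -> exists l, zeros_upto X W l.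
Proof.
  intros H0 HX HG HR HW. set (r := sqrt (1 + W * W)).
  assert (Hr : 0 < r) by (apply sqrt_lt_R0; nra).
  destruct (factor_disc X center r (exp (C0 * ((3 + 3 * r) * sqrt (3 + 3 * r)))) Hr HX) as (l & H & A & B & D & E).
  - intros E. apply HR in E. unfold center, Re in E; simpl in E. lra.
  - intros z Hz. apply growth_circle; auto; lra.
  - exists l. apply factor_zeros_upto with H; auto.
Qed.

(** After division by the zeros, Borel-Caratheodory bounds the quadratic remainder of the logarithm
    by a multiple of [M / r^2], with [M] of order [r^(3/2)]. The coefficient decays like [r^(-1/2)],
    so near the centre only the linear term survives as [W] grows. *)
Lemma log_remainder (X : C -> C) (C0 : R) : 0 <= C0 -> (forall z, Cdiff X z) -> growth X C0 -> half_line X ->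
  exists C1, forall W, 0 <= W -> exists l lg c1 H0, zeros_upto X W l /\ H0 <> RtoC 0 /\
    (forall z, Cmod (z - center)%C < sqrt (1 + W * W) -> Cdiff lg z /\ X z = (Clprod l z * (H0 * Cexp (lg z)))%C) /\
    forall z, Cmod (z - center)%C <= sqrt (1 + W * W) / 4 ->
      Cmod (lg z - c1 * (z - center))%C <= C1 / sqrt (sqrt (1 + W * W)) * (Cmod (z - center)%C * Cmod (z - center)%C).
Proof.
  intros H0 HX HG HR.
  assert (Xc : X center <> RtoC 0).
  { intros E. apply HR in E. unfold center, Re in E; simpl in E. lra. }
  assert (Pc : 0 < Cmod (X center)) by (apply Cmod_gt_0; auto).
  set (D := Rabs (ln (3 / 2 / Cmod (X center)))).
  assert (HD : 0 <= D) by apply Rabs_pos.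
  (* [32 = 8 / (1/2)^2] from the radius [r / 2]; 18 from [(3 + 3 r) sqrt (3 + 3 r) <= 6 r * 3 sqrt
     r]; [D] absorbs the value at the centre and the factor [3/2] lost between the circles of radius
     [3 r] and [r]. *)
  exists (32 * (18 * C0 + D)). intros W HW.
  set (r := sqrt (1 + W * W)).
  assert (Hr : 1 <= r) by (unfold r; rewrite <- sqrt_1 at 1; apply sqrt_le_1; nra).
  set (M0 := exp (C0 * ((3 + 3 * r) * sqrt (3 + 3 * r)))).
  assert (HM0 : forall z, Cmod (z - center)%C = 3 * r -> Cmod (X z) <= M0).
  { intros z Hz. apply growth_circle; auto; lra. }
  destruct (factor_disc X center r M0 ltac:(lra) HX Xc HM0) as (l & H & A & B & Hl & HN).
  destruct (log_disc H center r ltac:(lra) A) as (lg & L0 & L1 & L2); [intros; apply HN; lra|].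
  set (n := length l).
  assert (Pn : 0 < r ^ n) by (apply pow_lt; lra).
  assert (P2n : 1 <= 2 ^ n) by (apply pow_R1_Rle; lra).
  assert (Pcc : Cmod (center - center)%C = 0) by (replace (center - center)%C with (RtoC 0) by ring; apply Cmod_0).
  assert (Hc0 : H center <> RtoC 0) by (apply HN; lra).
  assert (Hcp : 0 < Cmod (H center)) by (apply Cmod_gt_0; auto).
  assert (Hc1 : Cmod (X center) <= r ^ n * Cmod (H center)).
  { rewrite B, Cmod_mult. apply Rmult_le_compat_r; [apply Cmod_ge_0|].
    apply Clprod_upper. intros a Ha. rewrite Cmod_sub_sym. auto. }
  assert (Hcirc : forall w, Cmod (w - center)%C = 3 * r -> Cmod (H w) <= M0 / r ^ n).
  { intros w Hw.
    assert (Lw : (2 * r) ^ n <= Cmod (Clprod l w)).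
    { apply Clprod_lower; [lra|]. intros a Ha. specialize (Hl a Ha).
      generalize (Cmod_triangle_minus (w - center)%C (a - center)%C).
      replace (w - center - (a - center))%C with (w - a)%C by ring. lra. }
    rewrite Rpow_mult_distr in Lw.
    assert (Lw2 : r ^ n <= Cmod (Clprod l w)) by nra.
    apply Rmult_le_reg_r with (r ^ n); auto. unfold Rdiv. rewrite Rmult_assoc, Rinv_l by lra. rewrite Rmult_1_r.
    apply Rle_trans with (Cmod (X w)); auto. rewrite B, Cmod_mult, Rmult_comm.
    apply Rmult_le_compat_r; [apply Cmod_ge_0|auto]. }
  assert (HM0p : 0 < M0) by apply exp_pos.
  assert (Hin : forall z, Cmod (z - center)%C < r -> Cmod (H z) <= M0 / r ^ n * (3 / 2)).
  { intros z Hz. eapply Rle_trans; [apply (circle_bound H center z (M0 / r ^ n) (3 * r) (4 * r)); auto; lra|].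
    apply Rmult_le_compat_l; [apply Rmult_le_pos; [lra|left; apply Rinv_0_lt_compat; auto]|].
    apply Rmult_le_reg_r with (3 * r - Cmod (z - center)%C); [lra|]. unfold Rdiv.
    rewrite Rmult_assoc, Rinv_l by lra. lra. }
  set (M := C0 * ((3 + 3 * r) * sqrt (3 + 3 * r)) + D).
  assert (HRe : forall z, Cmod (z - center)%C < r -> Re (lg z) <= M).
  { intros z Hz. specialize (Hin z Hz). rewrite L2, Cmod_mult, Cmod_exp in Hin by auto.
    assert (Q : exp (Re (lg z)) <= M0 * (3 / 2 / Cmod (X center))).
    { apply Rmult_le_reg_l with (r ^ n * Cmod (H center)); [nra|].
      apply Rle_trans with (M0 * (3 / 2)).
      - apply Rle_trans with (r ^ n * (M0 / r ^ n * (3 / 2))); [rewrite Rmult_assoc; apply Rmult_le_compat_l; lra|].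
        right; field; lra.
      - replace (r ^ n * Cmod (H center) * (M0 * (3 / 2 / Cmod (X center))))
          with (M0 * (3 / 2) * (r ^ n * Cmod (H center) / Cmod (X center))) by (field; lra).
        rewrite <- (Rmult_1_r (M0 * (3 / 2))) at 1. apply Rmult_le_compat_l; [lra|].
        apply Rmult_le_reg_r with (Cmod (X center)); auto. unfold Rdiv. rewrite Rmult_assoc, Rinv_l by lra. lra. }
    assert (Q2 : exp (Re (lg z)) <= exp M).
    { eapply Rle_trans; [exact Q|]. unfold M. rewrite exp_plus. fold M0. apply Rmult_le_compat_l; [lra|].
      assert (X0 : 0 < 3 / 2 / Cmod (X center)) by (apply Rdiv_lt_0_compat; lra).
      rewrite <- (exp_ln (3 / 2 / Cmod (X center))) at 1 by auto. apply exp_mono. apply Rle_abs. }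
    apply Rnot_lt_le; intros G. apply exp_increasing in G. lra. }
  destruct (borel_caratheodory lg center (r / 2) r M ltac:(lra) L1 L0) as (c1 & Hc).
  { intros z Hz. apply HRe. lra. }
  exists l, lg, c1, (H center). split; [apply factor_zeros_upto with H; auto|]. split; [auto|split].
  - intros z Hz. split; auto. rewrite B, L2; auto.
  - intros z Hz. eapply Rle_trans; [apply Hc; lra|].
    set (q := Cmod (z - center)%C * Cmod (z - center)%C).
    assert (Hq : 0 <= q) by (unfold q; generalize (Cmod_ge_0 (z - center)%C); nra).
    set (sr := sqrt r). assert (Hsr : sr * sr = r) by (apply sqrt_sqrt; lra).
    assert (Hsr1 : 1 <= sr) by (unfold sr; rewrite <- sqrt_1 at 1; apply sqrt_le_1; lra).
    assert (HM : M <= (18 * C0 + D) * (r * sr)).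
    { unfold M.
      assert (Q1 : sqrt (3 + 3 * r) <= 3 * sr).
      { replace (3 * sr) with (sqrt (9 * r)).
        - apply sqrt_le_1; lra.
        - rewrite sqrt_mult by lra. replace (sqrt 9) with 3; auto.
          replace 9 with (3 * 3) by ring. rewrite sqrt_square; lra. }
      assert (Q0 := sqrt_pos (3 + 3 * r)).
      assert (Q2 : (3 + 3 * r) * sqrt (3 + 3 * r) <= 6 * r * (3 * sr)) by (apply Rmult_le_compat; lra).
      assert (Q4 : 1 <= r * sr) by nra. assert (Q3 : D <= D * (r * sr)) by (rewrite <- (Rmult_1_r D) at 1; apply Rmult_le_compat_l; auto).
      assert (C0 * ((3 + 3 * r) * sqrt (3 + 3 * r)) <= C0 * (6 * r * (3 * sr))) by (apply Rmult_le_compat_l; lra).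
      replace ((18 * C0 + D) * (r * sr)) with (C0 * (6 * r * (3 * sr)) + D * (r * sr)) by ring. lra. }
    replace (8 * M * q / (r / 2 * (r / 2))) with (32 * q / (r * r) * M) by (field; lra).
    apply Rle_trans with (32 * q / (r * r) * ((18 * C0 + D) * (r * sr))).
    + apply Rmult_le_compat_l; auto. unfold Rdiv. apply Rmult_le_pos; [lra|]. left; apply Rinv_0_lt_compat; nra.
    + right. replace (r * r) with (r * (sr * sr)) by (rewrite Hsr; auto). field. split; lra.
Qed.

(** A continuous function that moved would, by the intermediate value theorem, take a displacement
    [m] in [(0, 1/2]], where the cosine is below 1. *)
Lemma continuous_arg_const (u : R -> R) (a b : R) : a <= b -> (forall t, a <= t <= b -> continuous u t) ->
  (forall t, a <= t <= b -> cos (u t - u a) = 1) -> u b = u a.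
Proof.
  intros Hab Hc Hcos. destruct (Req_dec a b) as [->|Hne]; auto.
  apply NNPP; intros N.
  assert (Hcp : forall (k m : R) t, a <= t <= b -> continuity_pt (fun t => k * (u t - u a) - m) t).
  { intros k m t Ht. apply continuity_pt_filterlim.
    apply (continuous_minus (V := R_NormedModule) (fun t => k * (u t - u a)) (fun _ => m)); [|apply continuous_const].
    apply (continuous_scal_r (V := R_NormedModule) k (fun t => u t - u a)).
    apply (continuous_minus (V := R_NormedModule) u (fun _ => u a)); auto. apply continuous_const. }
  assert (K : forall k, k = 1 \/ k = -1 -> 0 < k * (u b - u a) -> False).
  { intros k Hk Hpos.
    set (m := Rmin (k * (u b - u a)) 1 / 2).
    assert (Hm : 0 < Rmin (k * (u b - u a)) 1) by (apply Rmin_glb_lt; lra).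
    assert (M1 := Rmin_l (k * (u b - u a)) 1). assert (M2 := Rmin_r (k * (u b - u a)) 1).
    destruct (IVT_interv (fun t => k * (u t - u a) - m) a b (Hcp k m)) as [z [Hz Ez]].
    - lra.
    - unfold m. replace (u a - u a) with 0 by ring. lra.
    - unfold m; lra.
    - specialize (Hcos z Hz). assert (Hcm : cos m = 1).
      { replace m with (k * (u z - u a)) by lra.
        destruct Hk as [->| ->]; [rewrite Rmult_1_l; auto|].
        replace (-1 * (u z - u a)) with (- (u z - u a)) by ring. rewrite cos_neg; auto. }
      rewrite <- cos_0 in Hcm.
      assert (cos m < cos 0); [|lra].
      apply cos_decreasing_1; try (unfold m; lra); generalize PI2_1; unfold m; lra. }
  destruct (Rtotal_order (u b) (u a)) as [L|[L|L]]; auto.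
  - apply (K (-1)); auto; lra.
  - apply (K 1); auto; lra.
Qed.

Fixpoint Rlsum (f : C -> R) (l : list C) : R :=
  match l with nil => 0 | z :: l' => f z + Rlsum f l' end.

Lemma Rlsum_perm (f : C -> R) (l l' : list C) : Permutation l l' -> Rlsum f l = Rlsum f l'.
Proof. induction 1; simpl; lra. Qed.

Lemma polar_right (x y : R) : 0 < x -> (x, y) = (RtoC (Cmod (x, y)) * Cexp (0, atan (y / x)))%C.
Proof.
  intros Hx. set (th := atan (y / x)).
  assert (Hb := atan_bound (y / x)). fold th in Hb.
  assert (Hc : 0 < cos th) by (apply cos_gt_0; lra).
  assert (Ht : sin th = y / x * cos th).
  { replace (y / x) with (tan th) by (unfold th; apply tan_atan). unfold tan. field. lra. }
  assert (E : Cmod (x, y) = x / cos th).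
  { apply Rsqr_inj; [apply Cmod_ge_0|left; apply Rdiv_lt_0_compat; auto|]. unfold Rsqr.
    rewrite Cmod_sqr. unfold Re, Im; simpl.
    assert (S := sin2_cos2 th). unfold Rsqr in S. rewrite Ht in S.
    apply Rmult_eq_reg_r with (cos th * cos th); [|nra].
    replace (x / cos th * (x / cos th) * (cos th * cos th)) with (x * x) by (field; lra).
    replace ((x * x + y * y) * (cos th * cos th)) with (x * x * (y / x * cos th * (y / x * cos th) + cos th * cos th)) by (field; lra).
    rewrite S. ring. }
  rewrite E. unfold Cexp. apply Ceq; unfold Re, Im; simpl; rewrite exp_0.
  - field; lra.
  - rewrite Ht. field; lra.
Qed.

Lemma Clprod_polar (l : list C) (b t : R) : 0 < b -> (forall a, In a l -> Re a = / 2) ->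
  Clprod l (/ 2 + b, t) = (RtoC (Cmod (Clprod l ((/ 2 + b)%R, t))) * Cexp (0, Rlsum (fun a => atan ((t - Im a) / b)) l))%C.
Proof.
  intros Hb Hl. induction l as [|a l IH]; simpl.
  - rewrite Cmod_1, <- Cexp_0. unfold Cexp; apply Ceq; unfold Re, Im; simpl; rewrite ?exp_0, ?cos_0, ?sin_0; ring.
  - rewrite Cmod_mult, RtoC_mult.
    replace (0, atan ((t - Im a) / b) + Rlsum (fun a0 => atan ((t - Im a0) / b)) l)
      with ((0, atan ((t - Im a) / b)) + (0, Rlsum (fun a0 => atan ((t - Im a0) / b)) l))%C
      by (apply Ceq; unfold Re, Im; simpl; ring).
    rewrite Cexp_plus. rewrite IH at 1 by (intros; apply Hl; right; auto).
    assert (E : (((/ 2 + b)%R, t) - a)%C = (b, t - Im a)).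
    { specialize (Hl a (or_introl eq_refl)). apply Ceq; unfold Re, Im in *; simpl; rewrite ?Hl; lra. }
    rewrite E. rewrite (polar_right b (t - Im a) Hb) at 1. ring.
Qed.

(** All roots lie on the axis of reflection, so the modulus of each linear factor is unchanged. *)
Lemma Clprod_reflect (l : list C) (b t : R) : (forall a, In a l -> Re a = / 2) ->
  Cmod (Clprod l (/ 2 + b, t)) = Cmod (Clprod l (/ 2 - b, t)).
Proof.
  intros Hl. induction l as [|a l IH]; simpl; auto.
  rewrite !Cmod_mult, IH by (intros; apply Hl; right; auto). f_equal.
  specialize (Hl a (or_introl eq_refl)). apply Cmod_eq_iff. unfold Re, Im in *; simpl. rewrite Hl. ring.
Qed.

Lemma continuous_Rlsum_atan (l : list C) (b t : R) : b <> 0 ->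
  continuous (fun t => Rlsum (fun a => atan ((t - Im a) / b)) l) t.
Proof.
  intros Hb. induction l as [|a l IH]; simpl; [apply continuous_const|].
  apply (continuous_plus (V := R_NormedModule) (fun t => atan ((t - Im a) / b))); auto.
  apply (ex_derive_continuous (V := R_NormedModule) (fun t => atan ((t - Im a) / b))).
  auto_derive. auto.
Qed.

Definition reflect_sym (X : C -> C) : Prop := forall b t, Cmod (X (/ 2 + b, t)) = Cmod (X (/ 2 - b, t)).

(* In the Hadamard factorisation the exponential factor contributes nothing to the argument along
   Re s = 1/2 + b in the limit: the reflection symmetry of |X| kills the real part of its linear coefficient. *)
Lemma arg_sum (X : C -> C) (C0 : R) : 0 <= C0 -> (forall z, Cdiff X z) -> growth X C0 -> half_line X -> reflect_sym X ->
  forall b T1 T2 (A : R -> R), 0 < b -> T1 <= T2 -> (forall t, T1 <= t <= T2 -> continuous A t) ->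
  (forall t, T1 <= t <= T2 -> X (/ 2 + b, t) = (RtoC (Cmod (X ((/ 2 + b)%R, t))) * Cexp (0, A t))%C) ->
  forall eps, 0 < eps -> exists W0, 0 <= W0 /\ forall W l, W0 <= W -> zeros_upto X W l ->
    Rabs (Rlsum (fun a => atan ((T2 - Im a) / b)) l - Rlsum (fun a => atan ((T1 - Im a) / b)) l - (A T2 - A T1)) <= eps.
Proof.
  intros H0 HX HG HR Hsym b T1 T2 A Hb HT HA HXA eps Heps.
  destruct (log_remainder X C0 H0 HX HG HR) as [C1 HC1].
  (* [K] bounds the distance from [center] of all points with [|Re s - 1/2| <= b] and ordinate in
     [[T1, T2]]; [F] collects the final error [2 e + (T2 - T1) e / b], and [s0] is the size of
     [sqrt r] that brings it below [eps]. *)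
  set (K := b + 1 + Rabs T1 + Rabs T2).
  assert (HK : 1 < K) by (unfold K; generalize (Rabs_pos T1) (Rabs_pos T2); lra).
  set (F := (T2 - T1) / b + 2). assert (HF : 0 < F).
  { unfold F. assert (0 <= (T2 - T1) / b); [|lra]. apply Rmult_le_pos; [lra|left; apply Rinv_0_lt_compat; auto]. }
  set (s0 := Rabs C1 * (K * K) * F / eps).
  assert (Hs0 : 0 <= s0).
  { unfold s0, Rdiv. apply Rmult_le_pos; [|left; apply Rinv_0_lt_compat; auto].
    apply Rmult_le_pos; [|lra]. apply Rmult_le_pos; [apply Rabs_pos|nra]. }
  set (W0 := 5 * K + s0 * s0). exists W0. split; [unfold W0; nra|].
  intros W l HW Hl.
  destruct (HC1 W ltac:(unfold W0 in HW; nra)) as (l' & lg & c1 & HHc & Hz & HHn & HL & HR2).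
  rewrite !(Rlsum_perm _ l l') by (eapply zeros_upto_perm; eauto).
  set (r := sqrt (1 + W * W)) in *.
  assert (HrW : W <= r).
  { unfold r. rewrite <- (sqrt_square W) at 1 by (unfold W0 in HW; nra). apply sqrt_le_1; nra. }
  assert (Hr1 : 5 * K <= r) by (unfold W0 in HW; nra).
  assert (Hr2 : s0 <= sqrt r).
  { rewrite <- (sqrt_square s0) by auto. unfold W0 in HW. apply sqrt_le_1; [apply Rle_0_sqr|lra|lra]. }
  assert (Hsr : 0 < sqrt r) by (apply sqrt_lt_R0; lra).
  set (e := Rabs C1 / sqrt r * (K * K)).
  assert (He : e * F <= eps).
  { unfold e. apply Rmult_le_reg_r with (sqrt r); auto.
    replace (Rabs C1 / sqrt r * (K * K) * F * sqrt r) with (eps * s0) by (unfold s0; field; lra). apply Rmult_le_compat_l; lra. }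
  assert (Hpt : forall x t, Rabs (x - / 2) <= b -> T1 <= t <= T2 -> Cmod ((x, t) - center)%C <= K).
  { intros x t Hx Ht. eapply Rle_trans; [apply Cmod_le_abs|]. unfold Re, Im, center, K; simpl.
    assert (Rabs (t + - 0) <= Rabs T1 + Rabs T2) by (replace (t + -0) with t by ring; unfold Rabs; repeat destruct Rcase_abs; lra).
    assert (Rabs (x + - (3 / 2)) <= b + 1); [|lra].
    replace (x + - (3 / 2)) with ((x - / 2) + - (1)) by lra. eapply Rle_trans; [apply Rabs_triang|].
    rewrite Rabs_Ropp, Rabs_R1. lra. }
  assert (Hrem : forall x t, Rabs (x - / 2) <= b -> T1 <= t <= T2 -> Cmod (lg (x, t) - c1 * ((x, t) - center))%C <= e).
  { intros x t Hx Ht. specialize (Hpt x t Hx Ht). assert (P := Cmod_ge_0 ((x, t) - center)%C).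
    eapply Rle_trans; [apply HR2; lra|]. unfold e.
    assert (Hq : Cmod ((x, t) - center)%C * Cmod ((x, t) - center)%C <= K * K) by (apply Rmult_le_compat; auto).
    apply Rle_trans with (Rabs C1 / sqrt r * (Cmod ((x, t) - center)%C * Cmod ((x, t) - center)%C)).
    - apply Rmult_le_compat_r; [nra|]. unfold Rdiv.
      apply Rmult_le_compat_r; [left; apply Rinv_0_lt_compat; auto|apply Rle_abs].
    - apply Rmult_le_compat_l; auto. unfold Rdiv. apply Rmult_le_pos; [apply Rabs_pos|].
      left; apply Rinv_0_lt_compat; auto. }
  assert (Hl' : forall a, In a l' -> Re a = / 2).
  { intros a Ha. apply HR. eapply zeros_upto_In; eauto. }
  assert (Hb1 : Rabs (/ 2 + b - / 2) <= b) by (apply Rabs_le; lra).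
  assert (Hb2 : Rabs (/ 2 - b - / 2) <= b) by (apply Rabs_le; lra).
  assert (Hin : forall x t, Rabs (x - / 2) <= b -> T1 <= t <= T2 -> Cmod ((x, t) - center)%C < r).
  { intros x t Hx Ht. specialize (Hpt x t Hx Ht). lra. }
  assert (Hne : forall t, Clprod l' (/ 2 + b, t) <> RtoC 0).
  { intros t. apply Clprod_neq0. intros G. apply Hl' in G. unfold Re in G; simpl in G. lra. }
  (* Equal moduli of [X] and of the zero product at the two reflected points force equal real parts
     of [lg]; the real parts of the linear term, which differ by [2 b Re c1], then differ by no more
     than the remainders. *)
  assert (HRe : Re (lg ((/ 2 + b)%R, T1)) = Re (lg ((/ 2 - b)%R, T1))).
  { assert (E := Hsym b T1).
    rewrite (proj2 (HL (/ 2 + b, T1) (Hin _ T1 Hb1 ltac:(lra)))), (proj2 (HL (/ 2 - b, T1) (Hin _ T1 Hb2 ltac:(lra)))) in E.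
    rewrite !Cmod_mult, <- (Clprod_reflect l' b T1 Hl'), !Cmod_exp in E.
    assert (P1 : 0 < Cmod (Clprod l' (/ 2 + b, T1))) by (apply Cmod_gt_0, Hne).
    assert (P2 : 0 < Cmod HHc) by (apply Cmod_gt_0; auto).
    apply exp_inv. apply Rmult_eq_reg_l in E; [|lra]. apply Rmult_eq_reg_l in E; lra. }
  assert (HRc : Rabs (Re c1) <= e / b).
  { assert (E1 := Hrem _ T1 Hb1 ltac:(lra)). assert (E2 := Hrem _ T1 Hb2 ltac:(lra)).
    assert (E3 := re_le_Cmod (lg ((/ 2 + b)%R, T1) - c1 * (((/ 2 + b)%R, T1) - center))%C).
    assert (E4 := re_le_Cmod (lg ((/ 2 - b)%R, T1) - c1 * (((/ 2 - b)%R, T1) - center))%C).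
    assert (E5 : 2 * b * Re c1 = Re (lg ((/ 2 - b)%R, T1) - c1 * (((/ 2 - b)%R, T1) - center))%C
      - Re (lg ((/ 2 + b)%R, T1) - c1 * (((/ 2 + b)%R, T1) - center))%C).
    { unfold Cminus. rewrite !re_plus, !re_opp, HRe. unfold Re, Im, center; simpl. ring. }
    assert (E6 : Rabs (2 * b * Re c1) <= 2 * e).
    { rewrite E5. unfold Rminus at 1. eapply Rle_trans; [apply Rabs_triang|]. rewrite Rabs_Ropp. lra. }
    rewrite Rabs_mult, (Rabs_right (2 * b)) in E6 by lra.
    apply Rmult_le_reg_r with b; auto. unfold Rdiv. rewrite Rmult_assoc, Rinv_l by lra. lra. }
  set (S := fun t => Rlsum (fun a => atan ((t - Im a) / b)) l').
  (* The given argument minus the one read off the factorisation. Its exponential is the constant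
     [HHc / |HHc|], so by continuity [u] itself is constant. *)
  set (u := fun t => A t - (S t + Im (lg ((/ 2 + b)%R, t)))).
  assert (Hdir : forall t, T1 <= t <= T2 -> Cexp (0, u t) = (HHc / RtoC (Cmod HHc))%C).
  { intros t Ht.
    assert (E := proj2 (HL (/ 2 + b, t) (Hin _ _ Hb1 Ht))).
    assert (P1 : 0 < Cmod (Clprod l' (/ 2 + b, t))) by (apply Cmod_gt_0, Hne).
    assert (P2 : 0 < Cmod HHc) by (apply Cmod_gt_0; auto).
    assert (Em := f_equal Cmod E). rewrite !Cmod_mult, Cmod_exp in Em.
    set (g := lg ((/ 2 + b)%R, t)) in *.
    assert (Eg : Cexp g = (RtoC (exp (Re g)) * Cexp (0, Im g))%C).
    { rewrite <- Cexp_RtoC, <- Cexp_plus. f_equal. apply Ceq; unfold Re, Im; simpl; ring. }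
    rewrite HXA, (Clprod_polar l' b t Hb Hl'), Eg, Em in E by auto. fold (S t) in E.
    assert (P3 := exp_pos (Re g)).
    rewrite !RtoC_mult in E.
    assert (N1 : RtoC (Cmod (Clprod l' ((/ 2 + b)%R, t))) <> RtoC 0) by (intros q; apply RtoC_inj in q; lra).
    assert (N2 : RtoC (Cmod HHc) <> RtoC 0) by (intros q; apply RtoC_inj in q; lra).
    assert (N3 : RtoC (exp (Re g)) <> RtoC 0) by (intros q; apply RtoC_inj in q; lra).
    assert (E2 : (RtoC (Cmod HHc) * Cexp (0, A t) = HHc * (Cexp (0, S t) * Cexp (0, Im g)))%C).
    { replace (RtoC (Cmod HHc) * Cexp (0, A t))%C with
        (/ (RtoC (Cmod (Clprod l' ((/ 2 + b)%R, t))) * RtoC (exp (Re g))) *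
         (RtoC (Cmod (Clprod l' ((/ 2 + b)%R, t))) * (RtoC (Cmod HHc) * RtoC (exp (Re g))) * Cexp (0, A t)))%C by (field; auto).
      rewrite E. field. auto. }
    rewrite <- Cexp_plus in E2.
    replace (0, u t) with ((0, A t) + - ((0, S t) + (0, Im g)))%C
      by (unfold u; apply Ceq; unfold Re, Im, g; simpl; unfold Im; ring).
    rewrite Cexp_plus, Cexp_opp.
    assert (N4 := Cexp_neq0 ((0, S t) + (0, Im g))%C).
    replace (Cexp (0, A t)) with (/ RtoC (Cmod HHc) * (RtoC (Cmod HHc) * Cexp (0, A t)))%C by (field; auto).
    rewrite E2. field. auto. }
  assert (Hu : u T2 = u T1).
  { apply continuous_arg_const; auto.
    - intros t Ht. apply (continuous_minus (V := R_NormedModule) A); auto.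
      apply (continuous_plus (V := R_NormedModule) S).
      + apply continuous_Rlsum_atan. lra.
      + refine (proj2 (Rcc_vertical lg (/ 2 + b) t _)). apply Cdiff_cts, HL. apply Hin; auto.
    - intros t Ht. assert (E := Hdir t Ht). rewrite <- (Hdir T1) in E by lra.
      assert (Ec := f_equal Re E). assert (Es := f_equal Im E). unfold Cexp, Re, Im in Ec, Es; simpl in Ec, Es.
      rewrite exp_0, !Rmult_1_l in Ec, Es. rewrite cos_minus, Ec, Es.
      generalize (sin2_cos2 (u T1)). unfold Rsqr. lra. }
  fold (S T1) (S T2).
  replace (S T2 - S T1 - (A T2 - A T1)) with (Im (lg ((/ 2 + b)%R, T1)) - Im (lg ((/ 2 + b)%R, T2)))
    by (unfold u in Hu; lra).
  assert (E1 := Hrem _ T1 Hb1 ltac:(lra)). assert (E2 := Hrem _ T2 Hb1 ltac:(lra)).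
  assert (E3 := im_le_Cmod (lg ((/ 2 + b)%R, T1) - c1 * (((/ 2 + b)%R, T1) - center))%C).
  assert (E4 := im_le_Cmod (lg ((/ 2 + b)%R, T2) - c1 * (((/ 2 + b)%R, T2) - center))%C).
  set (q1 := Im (lg ((/ 2 + b)%R, T1) - c1 * (((/ 2 + b)%R, T1) - center))%C) in *.
  set (q2 := Im (lg ((/ 2 + b)%R, T2) - c1 * (((/ 2 + b)%R, T2) - center))%C) in *.
  replace (Im (lg ((/ 2 + b)%R, T1)) - Im (lg ((/ 2 + b)%R, T2))) with (q1 + - q2 + - ((T2 - T1) * Re c1)).
  2:{ unfold q1, q2. unfold Cminus. rewrite !im_plus, !im_opp. unfold Re, Im, center; simpl. ring. }
  eapply Rle_trans; [apply Rabs_triang|]. rewrite Rabs_Ropp, Rabs_mult, (Rabs_right (T2 - T1)) by lra.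
  assert (Rabs (q1 + - q2) <= 2 * e) by (eapply Rle_trans; [apply Rabs_triang|]; rewrite Rabs_Ropp; lra).
  assert ((T2 - T1) * Rabs (Re c1) <= (T2 - T1) * (e / b)) by (apply Rmult_le_compat_l; lra).
  replace (e * F) with (2 * e + (T2 - T1) * (e / b)) in He by (unfold F; field; lra). lra.
Qed.

(** * Modulus and argument of the Gamma function *)

Lemma Rsum_lt_ext (n : nat) (f g : nat -> R) : (forall k, (k < n)%nat -> f k = g k) -> Rsum_lt n f = Rsum_lt n g.
Proof. induction n as [|n IH]; intros H; simpl; auto. rewrite IH, H; auto. Qed.

Lemma Rsum_lt_le (n : nat) (f g : nat -> R) : (forall k, (k < n)%nat -> f k <= g k) -> Rsum_lt n f <= Rsum_lt n g.
Proof.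
  induction n as [|n IH]; intros H; simpl; [lra|].
  assert (Rsum_lt n f <= Rsum_lt n g) by (apply IH; auto). assert (f n <= g n) by auto. lra.
Qed.

Lemma Rsum_lt_plus (n : nat) (f g : nat -> R) : Rsum_lt n (fun k => f k + g k) = Rsum_lt n f + Rsum_lt n g.
Proof. induction n as [|n IH]; simpl; [ring|rewrite IH; ring]. Qed.

Lemma Rsum_lt_scal (n : nat) (c : R) (f : nat -> R) : Rsum_lt n (fun k => c * f k) = c * Rsum_lt n f.
Proof. induction n as [|n IH]; simpl; [ring|rewrite IH; ring]. Qed.

Lemma ln_le_sub1 (v : R) : 0 < v -> ln v <= v - 1.
Proof. intros H. assert (E := exp_ineq1_le (ln v)). rewrite exp_ln in E by auto. lra. Qed.

Lemma ln_mono (x y : R) : 0 < x -> x <= y -> ln x <= ln y.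
Proof. intros H [L|L]; [left; apply ln_increasing; auto|subst; right; auto]. Qed.

Lemma ln_step (u : R) : 0 < u -> / (u + 1) <= ln (u + 1) - ln u <= / u.
Proof.
  intros Hu. assert (H1 : ln (u + 1) - ln u = ln ((u + 1) / u)) by (unfold Rdiv; rewrite ln_mult, ln_Rinv; try lra; apply Rinv_0_lt_compat; lra).
  assert (H2 : ln (u + 1) - ln u = - ln (u / (u + 1))).
  { unfold Rdiv. rewrite ln_mult, ln_Rinv; try lra. apply Rinv_0_lt_compat; lra. }
  split.
  - rewrite H2. assert (A := ln_le_sub1 (u / (u + 1)) ltac:(apply Rdiv_lt_0_compat; lra)).
    replace (u / (u + 1) - 1) with (- / (u + 1)) in A by (field; lra). lra.
  - rewrite H1. assert (A := ln_le_sub1 ((u + 1) / u) ltac:(apply Rdiv_lt_0_compat; lra)).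
    replace ((u + 1) / u - 1) with (/ u) in A by (field; lra). lra.
Qed.

Lemma harmonic_upper (n : nat) : Rsum_lt (S n) (fun k => / INR (S k)) <= 1 + ln (INR (S n)).
Proof.
  induction n as [|n IH].
  - simpl. rewrite ln_1. lra.
  - cbn [Rsum_lt] in *. assert (P : 0 < INR (S n)) by (apply lt_0_INR; lia).
    assert (A := ln_step (INR (S n)) P). rewrite (S_INR (S n)). lra.
Qed.

Lemma shifted_harmonic_lower (c : R) (n : nat) : 0 < c -> ln (INR n + c) - ln c <= Rsum_lt n (fun k => / (INR k + c)).
Proof.
  intros Hc. induction n as [|n IH].
  - simpl. rewrite Rplus_0_l. lra.
  - cbn [Rsum_lt]. assert (P := pos_INR n). assert (A := ln_step (INR n + c) ltac:(lra)).
    rewrite S_INR. replace (INR n + 1 + c) with (INR n + c + 1) by ring. lra.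
Qed.

Lemma inv_sqr_sum (n : nat) : Rsum_lt (S n) (fun k => / (INR (S k) * INR (S k))) <= 2 - / INR (S n).
Proof.
  induction n as [|n IH].
  - simpl. rewrite Rmult_1_l, Rinv_1. lra.
  - cbn [Rsum_lt] in *. assert (P : 0 < INR (S n)) by (apply lt_0_INR; lia).
    rewrite (S_INR (S n)). set (u := INR (S n)) in *.
    assert (/ ((u + 1) * (u + 1)) <= / u - / (u + 1)); [|lra].
    replace (/ u - / (u + 1)) with (/ (u * (u + 1))) by (field; lra).
    apply Rinv_le_contravar; nra.
Qed.

(** Argument of Gauss' approximant of index [S n], and below its log-modulus; the shift keeps [ln 0]
    out. *)
Definition gamma_arg (x y : R) (n : nat) : R :=
  y * ln (INR (S n)) - Rsum_lt (S (S n)) (fun k => atan (y / (x + INR k))).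

Definition gamma_logmod (x y : R) (n : nat) : R :=
  x * ln (INR (S n)) + ln (INR (fact (S n))) - Rsum_lt (S (S n)) (fun k => ln (Cmod (x + INR k, y))).

Lemma Cmod_pos_right (x y : R) : 0 < x -> 0 < Cmod (x, y).
Proof. intros H. apply Cmod_gt_0. intros E. apply (f_equal fst) in E. simpl in E. lra. Qed.

Lemma Cprod_lt_polar (x y : R) (n : nat) : 0 < x ->
  Cprod_lt n (fun k => Cplus (x, y) (RtoC (INR k))) =
  (RtoC (exp (Rsum_lt n (fun k => ln (Cmod ((x + INR k)%R, y))))) * Cexp (0, Rsum_lt n (fun k => atan (y / (x + INR k)))%R))%C.
Proof.
  intros Hx. induction n as [|n IH]; simpl.
  - rewrite exp_0. replace (Cexp (0, 0)) with (RtoC 1); [ring|].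
    symmetry. apply Cexp_0.
  - assert (P := pos_INR n).
    assert (E : ((x, y) + RtoC (INR n))%C = (x + INR n, y)) by (apply Ceq; unfold Re, Im; simpl; ring).
    rewrite IH, E, exp_plus, exp_ln by (apply Cmod_pos_right; lra).
    rewrite (polar_right (x + INR n) y) at 1 by lra.
    replace (0, Rsum_lt n (fun k => atan (y / (x + INR k))) + atan (y / (x + INR n)))
      with ((0, Rsum_lt n (fun k => atan (y / (x + INR k)))%R) + (0, atan (y / (x + INR n))%R))%C
      by (apply Ceq; unfold Re, Im; simpl; ring).
    rewrite Cexp_plus, RtoC_mult. ring.
Qed.

Lemma gauss_seq_polar (x y : R) (n : nat) : 0 < x ->
  gauss_seq (x, y) (S n) = (RtoC (exp (gamma_logmod x y n)) * Cexp (0, gamma_arg x y n))%C.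
Proof.
  intros Hx. unfold gauss_seq. rewrite Cprod_lt_polar by auto.
  unfold gamma_logmod, gamma_arg.
  set (L := Rsum_lt (S (S n)) (fun k => ln (Cmod (x + INR k, y)))).
  set (B := Rsum_lt (S (S n)) (fun k => atan (y / (x + INR k)))).
  assert (Pf : 0 < INR (fact (S n))) by apply INR_fact_lt_0.
  unfold Rcpow.
  replace (RtoC (ln (INR (S n))) * (x, y))%C with (RtoC (x * ln (INR (S n))) + (0, (y * ln (INR (S n)))%R))%C
    by (apply Ceq; unfold Re, Im; simpl; ring).
  rewrite Cexp_plus, Cexp_RtoC.
  unfold Rminus at 1. rewrite !exp_plus, exp_ln, exp_Ropp by auto.
  replace (0, y * ln (INR (S n)) - B) with ((0, (y * ln (INR (S n)))%R) + - (0, B))%C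
    by (apply Ceq; unfold Re, Im; simpl; ring).
  rewrite Cexp_plus, Cexp_opp, !RtoC_mult.
  assert (PL := exp_pos L). rewrite RtoC_inv by lra.
  assert (RtoC (exp L) <> RtoC 0) by (intros q; apply RtoC_inj in q; lra).
  field. split; auto. apply Cexp_neq0.
Qed.

Lemma fact_ln (n : nat) : ln (INR (fact n)) = Rsum_lt n (fun k => ln (INR (S k))).
Proof.
  induction n as [|n IH]; [simpl; apply ln_1|].
  cbn [Rsum_lt]. rewrite <- IH.
  rewrite fact_simpl, mult_INR, ln_mult.
  - ring.
  - apply lt_0_INR; lia.
  - apply INR_fact_lt_0.
Qed.

(** One step changes the value by [x (ln (u + 1) - ln u) - ln (1 + x / (u + 1))], and both parts
    compare with [x / (u + 1)]. *)
Lemma gamma_logmod_0_incr (x : R) (n : nat) : 0 < x -> gamma_logmod x 0 n <= gamma_logmod x 0 (S n).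
Proof.
  intros Hx. unfold gamma_logmod.
  replace (Rsum_lt (S (S (S n))) (fun k => ln (Cmod (x + INR k, 0)))) with
    (Rsum_lt (S (S n)) (fun k => ln (Cmod (x + INR k, 0))) + ln (Cmod (x + INR (S (S n)), 0))) by reflexivity.
  set (L := Rsum_lt _ _).
  assert (Pn : 0 < INR (S n)) by (apply lt_0_INR; lia).
  change (x + INR (S (S n)), 0) with (RtoC (x + INR (S (S n)))).
  rewrite Cmod_R, Rabs_right by (assert (Q := pos_INR (S (S n))); lra).
  rewrite (fact_simpl (S n)), mult_INR, ln_mult; [|apply lt_0_INR; lia|apply INR_fact_lt_0].
  rewrite (S_INR (S n)). set (u := INR (S n)) in *.
  assert (A := proj1 (ln_step u Pn)).
  assert (B : ln (x + (u + 1)) - ln (u + 1) <= x * / (u + 1)).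
  { replace (ln (x + (u + 1)) - ln (u + 1)) with (ln ((x + (u + 1)) / (u + 1))).
    - eapply Rle_trans; [apply ln_le_sub1; apply Rdiv_lt_0_compat; lra|]. right. field. lra.
    - unfold Rdiv. rewrite ln_mult, ln_Rinv; try lra. apply Rinv_0_lt_compat; lra. }
  assert (x * / (u + 1) <= x * (ln (u + 1) - ln u)) by (apply Rmult_le_compat_l; lra). lra.
Qed.

(** A crude substitute for the upper Stirling bound, from comparing a shifted harmonic sum with a
    logarithm; its growth [x ln x] is all that the order of [xi_F] needs. *)
Lemma gamma_logmod_0_upper (x : R) (n : nat) : 0 < x -> gamma_logmod x 0 n <= x * ln (1 + x) - ln x.
Proof.
  intros Hx. unfold gamma_logmod. rewrite fact_ln.
  assert (E : Rsum_lt (S (S n)) (fun k => ln (Cmod (x + INR k, 0))) = ln x + Rsum_lt (S n) (fun k => ln (x + INR (S k)))).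
  { assert (K : forall m, Rsum_lt (S m) (fun k => ln (Cmod (x + INR k, 0))) = ln x + Rsum_lt m (fun k => ln (x + INR (S k)))).
    { induction m as [|m IH].
      - simpl. rewrite Rplus_0_r. change (x, 0) with (RtoC x). rewrite Cmod_R, Rabs_right by lra. ring.
      - replace (Rsum_lt (S (S m)) (fun k => ln (Cmod (x + INR k, 0)))) with
          (Rsum_lt (S m) (fun k => ln (Cmod (x + INR k, 0))) + ln (Cmod (x + INR (S m), 0))) by reflexivity.
        rewrite IH. cbn [Rsum_lt]. change (x + INR (S m), 0) with (RtoC (x + INR (S m))).
        rewrite Cmod_R, Rabs_right by (assert (Q := pos_INR (S m)); lra). ring. }
    apply K. }
  rewrite E.
  assert (B : x * (ln (INR (S n) + (1 + x)) - ln (1 + x)) <= Rsum_lt (S n) (fun k => ln (x + INR (S k)) - ln (INR (S k)))).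
  { eapply Rle_trans; [apply Rmult_le_compat_l; [lra|apply shifted_harmonic_lower; lra]|].
    rewrite <- Rsum_lt_scal. apply Rsum_lt_le. intros k _.
    assert (P : 0 < INR (S k)) by (apply lt_0_INR; lia). rewrite S_INR in *. set (u := INR k) in *.
    assert (A := ln_le_sub1 ((u + 1) / (x + (u + 1))) ltac:(apply Rdiv_lt_0_compat; lra)).
    unfold Rdiv in A. rewrite ln_mult, ln_Rinv in A; try lra; [|apply Rinv_0_lt_compat; lra].
    replace ((u + 1) * / (x + (u + 1)) - 1) with (- (x * / (u + (1 + x)))) in A by (field; lra). lra. }
  assert (D : Rsum_lt (S n) (fun k => ln (x + INR (S k)) - ln (INR (S k))) =
    Rsum_lt (S n) (fun k => ln (x + INR (S k))) - Rsum_lt (S n) (fun k => ln (INR (S k)))).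
  { unfold Rminus. rewrite Rsum_lt_plus. f_equal. rewrite <- (Rmult_1_l (Rsum_lt (S n) (fun k => ln (INR (S k))))).
    replace (- (1 * Rsum_lt (S n) (fun k => ln (INR (S k))))) with (-1 * Rsum_lt (S n) (fun k => ln (INR (S k)))) by ring.
    rewrite <- Rsum_lt_scal. apply Rsum_lt_ext. intros; ring. }
  assert (Pn : 0 < INR (S n)) by (apply lt_0_INR; lia).
  assert (F : ln (INR (S n)) <= ln (INR (S n) + (1 + x))) by (apply ln_mono; lra).
  assert (x * ln (INR (S n)) <= x * ln (INR (S n) + (1 + x))) by (apply Rmult_le_compat_l; lra). lra.
Qed.

Lemma ln_Cmod_bounds (u y : R) : 0 < u -> 0 <= ln (Cmod (u, y)) - ln u <= y * y / 2 * / (u * u).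
Proof.
  intros Hu. assert (P := Cmod_pos_right u y Hu).
  assert (E : Cmod (u, y) * Cmod (u, y) = u * u + y * y) by apply Cmod_sqr.
  assert (L : 2 * ln (Cmod (u, y)) = ln (u * u + y * y)) by (rewrite <- E, ln_mult by auto; ring).
  assert (L2 : 2 * ln u = ln (u * u)) by (rewrite ln_mult by auto; ring).
  assert (A := ln_le_sub1 ((u * u + y * y) / (u * u)) ltac:(apply Rdiv_lt_0_compat; nra)).
  unfold Rdiv in A. rewrite ln_mult, ln_Rinv in A; try nra; [|apply Rinv_0_lt_compat; nra].
  assert (B : ln (u * u) <= ln (u * u + y * y)) by (apply ln_mono; nra).
  replace ((u * u + y * y) * / (u * u) - 1) with (y * y * / (u * u)) in A by (field; lra). lra.
Qed.

Lemma gamma_logmod_diff (x y : R) (n : nat) :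
  gamma_logmod x y n = gamma_logmod x 0 n - Rsum_lt (S (S n)) (fun k => ln (Cmod (x + INR k, y)) - ln (Cmod (x + INR k, 0))).
Proof.
  unfold gamma_logmod.
  rewrite (Rsum_lt_ext _ (fun k => ln (Cmod (x + INR k, y)))
    (fun k => (ln (Cmod (x + INR k, y)) - ln (Cmod (x + INR k, 0))) + ln (Cmod (x + INR k, 0)))) by (intros; ring).
  rewrite Rsum_lt_plus. ring.
Qed.

Lemma gamma_mod_terms (x y : R) (k : nat) : 0 < x ->
  0 <= ln (Cmod (x + INR k, y)) - ln (Cmod (x + INR k, 0)) <= y * y / 2 * / ((x + INR k) * (x + INR k)).
Proof.
  intros Hx. assert (P := pos_INR k). change (x + INR k, 0) with (RtoC (x + INR k)).
  rewrite Cmod_R, Rabs_right by lra. apply ln_Cmod_bounds. lra.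
Qed.

Lemma gamma_mod_sum_upper (x y : R) (n : nat) : 0 < x ->
  Rsum_lt n (fun k => ln (Cmod (x + INR k, y)) - ln (Cmod (x + INR k, 0))) <= y * y / 2 * (/ (x * x) + 2).
Proof.
  intros Hx. eapply Rle_trans; [apply Rsum_lt_le; intros k _; apply gamma_mod_terms; auto|].
  rewrite Rsum_lt_scal. apply Rmult_le_compat_l; [nra|].
  assert (Px : 0 < / (x * x)) by (apply Rinv_0_lt_compat; nra).
  destruct n as [|n]; [simpl; lra|].
  assert (K : forall m, Rsum_lt (S m) (fun k => / ((x + INR k) * (x + INR k))) <= / (x * x) + Rsum_lt m (fun k => / (INR (S k) * INR (S k)))).
  { induction m as [|m IH].
    - simpl. rewrite Rplus_0_r. lra.
    - replace (Rsum_lt (S (S m)) (fun k => / ((x + INR k) * (x + INR k)))) with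
        (Rsum_lt (S m) (fun k => / ((x + INR k) * (x + INR k))) + / ((x + INR (S m)) * (x + INR (S m)))) by reflexivity.
      cbn [Rsum_lt]. cbn [Rsum_lt] in IH.
      assert (P : 0 < INR (S m)) by (apply lt_0_INR; lia).
      assert (/ ((x + INR (S m)) * (x + INR (S m))) <= / (INR (S m) * INR (S m))) by (apply Rinv_le_contravar; nra). lra. }
  eapply Rle_trans; [apply K|]. apply Rplus_le_compat_l.
  destruct n as [|n]; [simpl; lra|]. eapply Rle_trans; [apply inv_sqr_sum|].
  assert (0 < / INR (S n)) by (apply Rinv_0_lt_compat, lt_0_INR; lia). lra.
Qed.

(** [CGamma] is read off [Lim_seq], which says nothing without convergence. Off the axis the
    log-modulus is the difference of two bounded increasing sequences, the second with the
    nonnegative terms [ln |x + k + i y| - ln (x + k)]. *)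
Lemma gamma_logmod_cv (x y : R) : 0 < x -> ex_finite_lim_seq (gamma_logmod x y).
Proof.
  intros Hx.
  destruct (ex_finite_lim_seq_incr (gamma_logmod x 0) (x * ln (1 + x) - ln x)) as [l1 H1].
  { intros n; apply gamma_logmod_0_incr; auto. }
  { intros n; apply gamma_logmod_0_upper; auto. }
  destruct (ex_finite_lim_seq_incr (fun n => Rsum_lt (S (S n)) (fun k => ln (Cmod (x + INR k, y)) - ln (Cmod (x + INR k, 0))))
    (y * y / 2 * (/ (x * x) + 2))) as [l2 H2].
  { intros n. generalize (proj1 (gamma_mod_terms x y (S (S n)) Hx)). cbn [Rsum_lt]. lra. }
  { intros n. apply gamma_mod_sum_upper; auto. }
  exists (l1 - l2).
  apply is_lim_seq_ext with (fun n => gamma_logmod x 0 n -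
    Rsum_lt (S (S n)) (fun k => ln (Cmod (x + INR k, y)) - ln (Cmod (x + INR k, 0)))).
  { intros n. symmetry. apply gamma_logmod_diff. }
  apply is_lim_seq_minus'; auto.
Qed.

Lemma gamma_logmod_upper (x y : R) (n : nat) : 0 < x -> gamma_logmod x y n <= x * ln (1 + x) - ln x.
Proof.
  intros Hx. rewrite gamma_logmod_diff. generalize (gamma_logmod_0_upper x n Hx).
  assert (0 <= Rsum_lt (S (S n)) (fun k => ln (Cmod (x + INR k, y)) - ln (Cmod (x + INR k, 0)))); [|lra].
  assert (Z : forall m, Rsum_lt m (fun _ => 0) = 0) by (induction m as [|m IH]; simpl; lra).
  rewrite <- (Z (S (S n))) at 1. apply Rsum_lt_le. intros k _. apply gamma_mod_terms; auto.
Qed.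

Lemma lim_inv_bound (u : nat -> R) (l K : R) : (forall n, Rabs (u n - l) <= K / INR (S n)) -> is_lim_seq u l.
Proof.
  intros H. apply is_lim_seq_spec. intros eps.
  assert (HK : 0 <= K).
  { specialize (H O). simpl in H. generalize (Rabs_pos (u O - l)). lra. }
  destruct (INR_unbounded (K / eps)) as [N HN].
  exists N. intros n Hn. eapply Rle_lt_trans; [apply H|].
  assert (P : 0 < INR (S n)) by (apply lt_0_INR; lia). assert (Pe := cond_pos eps).
  assert (Q : K / eps < INR (S n)) by (apply Rlt_le_trans with (INR N); auto; apply le_INR; lia).
  apply Rmult_lt_reg_r with (INR (S n)); auto. unfold Rdiv. rewrite Rmult_assoc, Rinv_l by lra.
  apply Rmult_lt_compat_l with (r := eps) in Q; auto. replace (eps * (K / eps)) with K in Q by (field; lra). lra.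
Qed.

Definition atan_prim (y u : R) : R := u * atan (y / u) + y / 2 * ln (u * u + y * y).

Lemma atan_prim_derive (y u : R) : 0 < u -> is_derive (atan_prim y) u (atan (y / u)).
Proof.
  intros Hu. unfold atan_prim. auto_derive; [split; [lra|split; [nra|auto]]|]. unfold Rdiv. field. repeat split; nra.
Qed.

Lemma atan_le (x y : R) : x <= y -> atan x <= atan y.
Proof. intros [H|H]; [left; apply atan_increasing; auto|subst; right; auto]. Qed.

Lemma atan_nonneg (x : R) : 0 <= x -> 0 <= atan x.
Proof. intros H. rewrite <- atan_0. apply atan_le; auto. Qed.

Lemma div_le_den (y u v : R) : 0 <= y -> 0 < u -> u <= v -> y / v <= y / u.
Proof. intros. apply Rmult_le_compat_l; auto. apply Rinv_le_contravar; auto. Qed.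

Lemma atan_prim_step (y u : R) : 0 <= y -> 0 < u ->
  atan (y / (u + 1)) <= atan_prim y (u + 1) - atan_prim y u <= atan (y / u).
Proof.
  intros Hy Hu.
  destruct (MVT_gen (atan_prim y) u (u + 1) (fun u => atan (y / u))) as (c & Hc & E).
  - intros x Hx. rewrite Rmin_left in Hx by lra. apply atan_prim_derive. lra.
  - intros x Hx. rewrite Rmin_left in Hx by lra. apply continuity_pt_filterlim.
    apply (ex_derive_continuous (V := R_NormedModule)). eexists. apply atan_prim_derive. lra.
  - rewrite Rmin_left, Rmax_right in Hc by lra. rewrite E.
    replace (u + 1 - u) with 1 by ring. rewrite Rmult_1_r. split; apply atan_le; apply div_le_den; lra.
Qed.

(** The error of replacing the sum of arctangents by an integral. For [y >= 0] monotone comparison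
    keeps it in [[0, PI / 2]], accurate enough for Stirling's formula with bounded error. *)
Definition gamma_err (x y : R) (n : nat) : R :=
  Rsum_lt (S n) (fun k => atan (y / (x + INR k))) - (atan_prim y (x + INR n) - atan_prim y x).

Lemma gamma_err_decr (x y : R) (n : nat) : 0 < x -> 0 <= y -> gamma_err x y (S n) <= gamma_err x y n.
Proof.
  intros Hx Hy. unfold gamma_err.
  replace (Rsum_lt (S (S n)) (fun k => atan (y / (x + INR k)))) with
   (Rsum_lt (S n) (fun k => atan (y / (x + INR k))) + atan (y / (x + INR (S n)))) by reflexivity.
  assert (P := pos_INR n). assert (A := proj1 (atan_prim_step y (x + INR n) Hy ltac:(lra))).
  rewrite S_INR, <- Rplus_assoc. lra.
Qed.

Lemma gamma_err_bounds (x y : R) (n : nat) : 0 < x -> 0 <= y -> 0 <= gamma_err x y n <= PI / 2.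
Proof.
  intros Hx Hy.
  assert (A : gamma_err x y n <= PI / 2).
  { induction n as [|n IH].
    - unfold gamma_err. simpl. rewrite Rplus_0_r. generalize (atan_bound (y / x)). lra.
    - generalize (gamma_err_decr x y n Hx Hy). lra. }
  split; auto.
  assert (B : atan (y / (x + INR n)) <= gamma_err x y n).
  { clear A. induction n as [|n IH].
    - unfold gamma_err. simpl. rewrite Rplus_0_r. lra.
    - unfold gamma_err in *.
      replace (Rsum_lt (S (S n)) (fun k => atan (y / (x + INR k)))) with
       (Rsum_lt (S n) (fun k => atan (y / (x + INR k))) + atan (y / (x + INR (S n)))) by reflexivity.
      assert (P := pos_INR n). assert (A := proj2 (atan_prim_step y (x + INR n) Hy ltac:(lra))).
      rewrite S_INR, <- Rplus_assoc. lra. }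
  eapply Rle_trans; [|exact B]. apply atan_nonneg. assert (P := pos_INR n).
  apply Rmult_le_pos; auto. left; apply Rinv_0_lt_compat; lra.
Qed.

Lemma atan_approx (v : R) : 0 <= v -> v - v * v <= atan v <= v.
Proof.
  intros Hv. destruct Hv as [Hv|<-]; [|rewrite atan_0; lra]. split.
  - destruct (MVT_gen (fun s => atan s - (s - s * s)) 0 v (fun s => / (1 + s * s) - (1 - 2 * s))) as (c & Hc & E).
    + intros s _. auto_derive; auto. ring_simplify. replace (1 + s ^ 2) with (1 + s * s) by ring. field. nra.
    + intros s _. apply continuity_pt_filterlim.
      apply (ex_derive_continuous (V := R_NormedModule) (fun s => atan s - (s - s * s))). auto_derive; auto.
    + rewrite Rmin_left, Rmax_right in Hc by lra. rewrite atan_0 in E.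
      assert (0 <= / (1 + c * c) - (1 - 2 * c)).
      { apply Rmult_le_reg_r with (1 + c * c); [nra|]. rewrite Rmult_0_l, Rmult_minus_distr_r, Rinv_l by nra. nra. }
      assert (0 <= (/ (1 + c * c) - (1 - 2 * c)) * (v - 0)) by (apply Rmult_le_pos; lra). lra.
  - destruct (MVT_gen (fun s => s - atan s) 0 v (fun s => 1 - / (1 + s * s))) as (c & Hc & E).
    + intros s _. auto_derive; auto. replace (1 + s ^ 2) with (1 + s * s) by ring. field. nra.
    + intros s _. apply continuity_pt_filterlim.
      apply (ex_derive_continuous (V := R_NormedModule) (fun s => s - atan s)). auto_derive; auto.
    + rewrite Rmin_left, Rmax_right in Hc by lra. rewrite atan_0 in E.
      assert (/ (1 + c * c) <= 1).
      { rewrite <- Rinv_1. apply Rinv_le_contravar; nra. }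
      assert (0 <= (1 - / (1 + c * c)) * (v - 0)) by (apply Rmult_le_pos; lra). lra.
Qed.

(** [u atan (y / u)] tends to [y], while the logarithms of [u^2 + y^2] and of [N^2] agree in the
    limit. The value [y] is the source of the term [- y] in Stirling's formula for the argument. *)
Lemma atan_prim_infty (x y : R) : 0 < x -> 0 <= y ->
  is_lim_seq (fun n => atan_prim y (x + INR (S n)) - y * ln (INR (S n))) y.
Proof.
  intros Hx Hy. apply lim_inv_bound with (y * y + y * (2 * x + x * x + y * y)). intros n.
  assert (P : 0 < INR (S n)) by (apply lt_0_INR; lia).
  assert (P1 : 1 <= INR (S n)) by (apply (le_INR 1); lia). set (N := INR (S n)) in *.
  unfold atan_prim. set (u := x + N). assert (Hu : N < u) by (unfold u; lra).
  assert (A := atan_approx (y / u) ltac:(apply Rmult_le_pos; [lra|left; apply Rinv_0_lt_compat; lra])).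
  assert (A1 : - (y * y / N) <= u * atan (y / u) - y <= 0).
  { destruct A as [A1 A2]. apply Rmult_le_compat_l with (r := u) in A1; [|lra]. apply Rmult_le_compat_l with (r := u) in A2; [|lra].
    replace (u * (y / u)) with y in A2 by (field; lra).
    replace (u * (y / u - y / u * (y / u))) with (y - y * y / u) in A1 by (field; lra).
    assert (y * y / u <= y * y / N) by (apply div_le_den; nra). lra. }
  assert (B0 : 1 <= (u * u + y * y) / (N * N)).
  { apply Rmult_le_reg_r with (N * N); [nra|]. unfold Rdiv. rewrite Rmult_assoc, Rinv_l by nra. nra. }
  assert (B1 : ln (u * u + y * y) - 2 * ln N = ln ((u * u + y * y) / (N * N))).
  { unfold Rdiv. rewrite ln_mult, ln_Rinv, ln_mult; try (apply Rinv_0_lt_compat); nra. }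
  assert (B2 : 0 <= ln ((u * u + y * y) / (N * N))) by (rewrite <- ln_1; apply ln_mono; lra).
  assert (B3 : ln ((u * u + y * y) / (N * N)) <= (2 * x + x * x + y * y) / N).
  { eapply Rle_trans; [apply ln_le_sub1; lra|].
    replace ((u * u + y * y) / (N * N) - 1) with ((2 * x + (x * x + y * y) / N) / N) by (unfold u; field; lra).
    apply Rmult_le_compat_r; [left; apply Rinv_0_lt_compat; lra|].
    assert ((x * x + y * y) / N <= x * x + y * y); [|lra].
    apply Rmult_le_reg_r with N; auto. unfold Rdiv. rewrite Rmult_assoc, Rinv_l by lra. nra. }
  replace (u * atan (y / u) + y / 2 * ln (u * u + y * y) - y * ln N - y)
    with ((u * atan (y / u) - y) + y / 2 * ln ((u * u + y * y) / (N * N))) by (rewrite <- B1; field).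
  set (w := ln ((u * u + y * y) / (N * N))) in *.
  assert (C1 : 0 <= y / 2 * w) by (apply Rmult_le_pos; lra).
  assert (C2 : y / 2 * w <= y * ((2 * x + x * x + y * y) / N)).
  { apply Rmult_le_compat; lra. }
  replace ((y * y + y * (2 * x + x * x + y * y)) / N) with (y * y / N + y * ((2 * x + x * x + y * y) / N)) by (field; lra).
  assert (0 <= y * y / N) by (apply Rmult_le_pos; [nra|left; apply Rinv_0_lt_compat; lra]).
  apply Rabs_le. lra.
Qed.

Definition gamma_argl (x y : R) : R := real (Lim_seq (gamma_arg x y)).

Lemma gamma_arg_cv_pos (x y : R) : 0 < x -> 0 <= y ->
  exists e, 0 <= e <= PI / 2 /\ is_lim_seq (gamma_arg x y) (- y + atan_prim y x - e).
Proof.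
  intros Hx Hy.
  destruct (ex_finite_lim_seq_decr (fun n => gamma_err x y (S n)) 0) as [e He].
  { intros n. apply gamma_err_decr; auto. }
  { intros n. apply gamma_err_bounds; auto. }
  exists e. split.
  - split.
    + apply (is_lim_seq_le (fun _ => 0) (fun n => gamma_err x y (S n)) 0 e); auto; [|apply is_lim_seq_const].
      intros n; apply gamma_err_bounds; auto.
    + apply (is_lim_seq_le (fun n => gamma_err x y (S n)) (fun _ => PI / 2) e (PI / 2)); auto; [|apply is_lim_seq_const].
      intros n; apply gamma_err_bounds; auto.
  - apply is_lim_seq_ext with (fun n => (- (atan_prim y (x + INR (S n)) - y * ln (INR (S n))) + atan_prim y x) - gamma_err x y (S n)).
    { intros n. unfold gamma_err, gamma_arg. ring. }
    apply is_lim_seq_minus'; auto. apply is_lim_seq_plus'; [|apply is_lim_seq_const].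
    apply (is_lim_seq_opp _ y). apply atan_prim_infty; auto.
Qed.

Lemma gamma_arg_odd (x y : R) (n : nat) : gamma_arg x (- y) n = - gamma_arg x y n.
Proof.
  unfold gamma_arg.
  rewrite (Rsum_lt_ext _ _ (fun k => -1 * atan (y / (x + INR k)))).
  - rewrite Rsum_lt_scal. ring.
  - intros k _. replace (- y / (x + INR k)) with (- (y / (x + INR k))) by (unfold Rdiv; ring). rewrite atan_opp. ring.
Qed.

Lemma gamma_arg_cv (x y : R) : 0 < x -> is_lim_seq (gamma_arg x y) (gamma_argl x y).
Proof.
  intros Hx. unfold gamma_argl.
  assert (K : exists l : R, is_lim_seq (gamma_arg x y) l).
  { destruct (Rle_dec 0 y) as [H|H].
    - destruct (gamma_arg_cv_pos x y Hx H) as (e & _ & L). eexists; exact L.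
    - destruct (gamma_arg_cv_pos x (- y) Hx ltac:(lra)) as (e & _ & L). apply is_lim_seq_opp in L.
      eexists. eapply is_lim_seq_ext; [|exact L]. intros n. simpl. rewrite gamma_arg_odd. ring. }
  destruct K as [l Hl]. rewrite (is_lim_seq_unique _ _ Hl). exact Hl.
Qed.

Lemma gamma_argl_odd (x y : R) : 0 < x -> gamma_argl x (- y) = - gamma_argl x y.
Proof.
  intros Hx. assert (A := gamma_arg_cv x (- y) Hx). assert (B := gamma_arg_cv x y Hx).
  apply is_lim_seq_opp in B. apply (is_lim_seq_ext _ (gamma_arg x (- y))) in B.
  - apply is_lim_seq_unique in A. apply is_lim_seq_unique in B. rewrite A in B. injection B; auto.
  - intros n. symmetry. apply gamma_arg_odd.
Qed.

(** The limit is an elementary integral up to [PI / 2], and that integral differs from [y ln y] by a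
    bounded amount. No finer error is wanted, since the zero count loses [O(ln T)] anyway. *)
Lemma gamma_stirling (x : R) : 0 < x -> exists K, 0 <= K /\ forall y, 1 <= y -> Rabs (gamma_argl x y - (y * ln y - y)) <= K.
Proof.
  intros Hx. exists (x * PI + x * x + PI). assert (HP := PI_RGT_0). split; [nra|]. intros y Hy.
  destruct (gamma_arg_cv_pos x y Hx ltac:(lra)) as (e & He & L).
  assert (E : gamma_argl x y = - y + atan_prim y x - e).
  { unfold gamma_argl. rewrite (is_lim_seq_unique _ _ L). reflexivity. }
  rewrite E. unfold atan_prim.
  assert (B := atan_bound (y / x)).
  assert (B' := atan_nonneg (y / x) ltac:(apply Rmult_le_pos; [lra|left; apply Rinv_0_lt_compat; lra])).
  assert (C1 : ln (x * x + y * y) - 2 * ln y = ln ((x * x + y * y) / (y * y))).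
  { unfold Rdiv. rewrite ln_mult, ln_Rinv, ln_mult; try (apply Rinv_0_lt_compat); nra. }
  assert (C0 : 1 <= (x * x + y * y) / (y * y)).
  { apply Rmult_le_reg_r with (y * y); [nra|]. unfold Rdiv. rewrite Rmult_assoc, Rinv_l by nra. nra. }
  assert (C2 : 0 <= ln ((x * x + y * y) / (y * y))) by (rewrite <- ln_1; apply ln_mono; lra).
  assert (C3 : y / 2 * ln ((x * x + y * y) / (y * y)) <= x * x).
  { apply Rle_trans with (y / 2 * (x * x / (y * y))).
    - apply Rmult_le_compat_l; [lra|]. eapply Rle_trans; [apply ln_le_sub1; lra|]. right. field. lra.
    - replace (y / 2 * (x * x / (y * y))) with (x * x * / (2 * y)) by (field; lra).
      rewrite <- (Rmult_1_r (x * x)) at 2. apply Rmult_le_compat_l; [nra|]. rewrite <- Rinv_1. apply Rinv_le_contravar; lra. }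
  replace (- y + (x * atan (y / x) + y / 2 * ln (x * x + y * y)) - e - (y * ln y - y))
    with (x * atan (y / x) + y / 2 * ln ((x * x + y * y) / (y * y)) - e) by (rewrite <- C1; field).
  assert (0 <= y / 2 * ln ((x * x + y * y) / (y * y))) by (apply Rmult_le_pos; lra).
  assert (0 <= x * atan (y / x) <= x * (PI / 2)) by (split; [nra|apply Rmult_le_compat_l; lra]).
  assert (0 <= x * PI) by nra.
  apply Rabs_le. split; nra.
Qed.

Lemma gamma_arg_derive (x y : R) (n : nat) : 0 < x ->
  is_derive (fun y => gamma_arg x y n) y
    (ln (INR (S n)) - Rsum_lt (S (S n)) (fun k => (x + INR k) / ((x + INR k) * (x + INR k) + y * y))).
Proof.
  intros Hx. unfold gamma_arg. apply (is_derive_minus (V := R_NormedModule) (fun y => y * ln (INR (S n)))).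
  - generalize (ln (INR (S n))). intros c. auto_derive; auto. ring.
  - generalize (S (S n)). intros m. induction m as [|m IH]; cbn [Rsum_lt].
    + apply (is_derive_const (V := R_NormedModule)).
    + apply (is_derive_plus (V := R_NormedModule) (fun y => Rsum_lt m (fun k => atan (y / (x + INR k))))); auto.
      assert (P := pos_INR m). auto_derive; [lra|]. field. split; [|lra]. nra.
Qed.

(** Uniformity in [n] is the point: an equi-Lipschitz bound survives the limit and makes
    [gamma_argl] continuous. The terms lie between [1 / (k + c)] and, for [k >= 1], [1 / k], so
    harmonic comparison with the logarithm works on both sides. *)
Lemma gamma_arg_derive_bound (x Y : R) : 0 < x -> exists B, 0 <= B /\ forall y n, Rabs y <= Y ->
  Rabs (ln (INR (S n)) - Rsum_lt (S (S n)) (fun k => (x + INR k) / ((x + INR k) * (x + INR k) + y * y))) <= B.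
Proof.
  intros Hx. set (c := x + Y * Y / x).
  assert (Hc : 0 < c).
  { unfold c. assert (0 <= Y * Y / x); [|lra]. apply Rmult_le_pos; [nra|left; apply Rinv_0_lt_compat; auto]. }
  assert (Hix : 0 < / x) by (apply Rinv_0_lt_compat; auto).
  exists (/ x + 2 + Rabs (ln c)). split; [generalize (Rabs_pos (ln c)); lra|]. intros y n Hy.
  assert (Hy2 : y * y <= Y * Y).
  { replace (y * y) with (Rabs y * Rabs y) by (rewrite <- Rabs_mult, Rabs_right; nra). 
    assert (P := Rabs_pos y). apply Rmult_le_compat; auto. }
  assert (PN : 1 <= INR (S n)) by (apply (le_INR 1); lia).
  assert (U : Rsum_lt (S (S n)) (fun k => (x + INR k) / ((x + INR k) * (x + INR k) + y * y)) <= / x + 1 + ln (INR (S n))).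
  { apply Rle_trans with (/ x + Rsum_lt (S n) (fun k => / INR (S k))).
    2:{ generalize (harmonic_upper n). lra. }
    assert (K : forall m, Rsum_lt (S m) (fun k => (x + INR k) / ((x + INR k) * (x + INR k) + y * y)) <= / x + Rsum_lt m (fun k => / INR (S k))).
    { induction m as [|m IH].
      - simpl. rewrite Rplus_0_r, Rplus_0_l, Rplus_0_r.
        apply Rmult_le_reg_r with (x * x + y * y); [nra|]. unfold Rdiv. rewrite Rmult_assoc, Rinv_l by nra.
        replace (/ x * (x * x + y * y)) with (x + y * y * / x) by (field; lra).
        assert (0 <= y * y * / x) by (apply Rmult_le_pos; nra). lra.
      - cbn [Rsum_lt] in *. assert (P : 0 < INR (S m)) by (apply lt_0_INR; lia).
        assert ((x + INR (S m)) / ((x + INR (S m)) * (x + INR (S m)) + y * y) <= / INR (S m)); [|lra].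
        set (u := x + INR (S m)) in *. assert (Hu : INR (S m) <= u) by (unfold u; lra).
        apply Rle_trans with (/ u); [|apply Rinv_le_contravar; lra].
        apply Rmult_le_reg_r with (u * u + y * y); [nra|]. unfold Rdiv. rewrite Rmult_assoc, Rinv_l by nra.
        replace (/ u * (u * u + y * y)) with (u + y * y * / u) by (field; lra).
        assert (0 <= y * y * / u) by (apply Rmult_le_pos; [nra|left; apply Rinv_0_lt_compat; lra]). lra. }
    apply K. }
  assert (Lw : ln (INR (S n)) - ln c <= Rsum_lt (S (S n)) (fun k => (x + INR k) / ((x + INR k) * (x + INR k) + y * y))).
  { apply Rle_trans with (Rsum_lt (S (S n)) (fun k => / (INR k + c))).
    - eapply Rle_trans; [|apply shifted_harmonic_lower; auto]. apply Rplus_le_compat_r. apply ln_mono; [lra|].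
      rewrite (S_INR (S n)). lra.
    - apply Rsum_lt_le. intros k _. assert (P := pos_INR k). set (u := x + INR k).
      assert (Hu : x <= u) by (unfold u; lra).
      replace (u / (u * u + y * y)) with (/ (u + y * y / u)) by (field; split; nra).
      assert (0 <= y * y / u) by (apply Rmult_le_pos; [nra|left; apply Rinv_0_lt_compat; lra]).
      apply Rinv_le_contravar; [lra|]. unfold c.
      assert (y * y / u <= Y * Y / x); [|unfold u in *; lra].
      apply Rmult_le_compat; try nra; [left; apply Rinv_0_lt_compat; lra|apply Rinv_le_contravar; lra]. }
  assert (A := Rle_abs (ln c)). assert (A' := Rabs_pos (ln c)). apply Rabs_le. lra.
Qed.

Lemma gamma_argl_lipschitz (x Y : R) : 0 < x -> exists B, 0 <= B /\ forall y y', Rabs y <= Y -> Rabs y' <= Y ->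
  Rabs (gamma_argl x y' - gamma_argl x y) <= B * Rabs (y' - y).
Proof.
  intros Hx. destruct (gamma_arg_derive_bound x Y Hx) as (B & HB & H). exists B. split; auto. intros y y' Hy Hy'.
  assert (K : forall n, Rabs (gamma_arg x y' n - gamma_arg x y n) <= B * Rabs (y' - y)).
  { intros n. destruct (MVT_gen (fun y => gamma_arg x y n) y y'
      (fun y => ln (INR (S n)) - Rsum_lt (S (S n)) (fun k => (x + INR k) / ((x + INR k) * (x + INR k) + y * y)))) as (c & Hc & E).
    - intros t _. apply gamma_arg_derive; auto.
    - intros t _. apply continuity_pt_filterlim.
      apply (ex_derive_continuous (V := R_NormedModule) (fun y => gamma_arg x y n)). eexists. apply gamma_arg_derive; auto.
    - rewrite E, Rabs_mult. apply Rmult_le_compat_r; [apply Rabs_pos|]. apply H.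
      apply Rabs_le. apply Rabs_le_between in Hy. apply Rabs_le_between in Hy'.
      unfold Rmin, Rmax in Hc. destruct (Rle_dec y y'); lra. }
  assert (L : is_lim_seq (fun n => Rabs (gamma_arg x y' n - gamma_arg x y n)) (Rabs (gamma_argl x y' - gamma_argl x y))).
  { apply (is_lim_seq_abs _ (gamma_argl x y' - gamma_argl x y)). apply is_lim_seq_minus'; apply gamma_arg_cv; auto. }
  apply (is_lim_seq_le _ (fun _ => B * Rabs (y' - y)) _ (B * Rabs (y' - y)) K L). apply is_lim_seq_const.
Qed.

Lemma gamma_argl_continuous (x y : R) : 0 < x -> continuous (gamma_argl x) y.
Proof.
  intros Hx. apply continuous_eps. intros eps He.
  destruct (gamma_argl_lipschitz x (Rabs y + 1) Hx) as (B & HB & H).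
  exists (Rmin 1 (eps / (B + 1))). split; [apply Rmin_glb_lt; [lra|apply Rdiv_lt_0_compat; lra]|].
  intros s Hs. assert (S1 := Rlt_le_trans _ _ _ Hs (Rmin_l _ _)). assert (S2 := Rlt_le_trans _ _ _ Hs (Rmin_r _ _)).
  assert (T := Rabs_triang (s - y) y). replace (s - y + y) with s in T by ring.
  eapply Rle_lt_trans; [apply H; lra|]. assert (P := Rabs_pos (s - y)).
  apply Rle_lt_trans with ((B + 1) * Rabs (s - y)); [nra|].
  apply Rlt_le_trans with ((B + 1) * (eps / (B + 1))); [apply Rmult_lt_compat_l; lra|right; field; lra].
Qed.

Lemma CGamma_polar (x y : R) : 0 < x -> exists L, L <= x * ln (1 + x) - ln x /\
  CGamma (x, y) = (RtoC (exp L) * Cexp (0, gamma_argl x y))%C.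
Proof.
  intros Hx. destruct (gamma_logmod_cv x y Hx) as [L HL]. exists L. split.
  - apply (is_lim_seq_le (gamma_logmod x y) (fun _ => x * ln (1 + x) - ln x) L (x * ln (1 + x) - ln x)); auto.
    + intros n; apply gamma_logmod_upper; auto.
    + apply is_lim_seq_const.
  - assert (HA := gamma_arg_cv x y Hx).
    assert (Lre : is_lim_seq (fun n => Re (gauss_seq (x, y) n)) (exp L * cos (gamma_argl x y))).
    { apply is_lim_seq_incr_1. apply is_lim_seq_ext with (fun n => exp (gamma_logmod x y n) * cos (gamma_arg x y n)).
      { intros n. rewrite gauss_seq_polar by auto. unfold Cexp, Re, Im; simpl. rewrite exp_0. ring. }
      apply is_lim_seq_mult'; [apply (is_lim_seq_continuous exp)|apply (is_lim_seq_continuous cos)]; auto.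
      - apply derivable_continuous_pt, derivable_pt_exp.
      - apply continuity_cos. }
    assert (Lim : is_lim_seq (fun n => Im (gauss_seq (x, y) n)) (exp L * sin (gamma_argl x y))).
    { apply is_lim_seq_incr_1. apply is_lim_seq_ext with (fun n => exp (gamma_logmod x y n) * sin (gamma_arg x y n)).
      { intros n. rewrite gauss_seq_polar by auto. unfold Cexp, Re, Im; simpl. rewrite exp_0. ring. }
      apply is_lim_seq_mult'; [apply (is_lim_seq_continuous exp)|apply (is_lim_seq_continuous sin)]; auto.
      - apply derivable_continuous_pt, derivable_pt_exp.
      - apply continuity_sin. }
    unfold CGamma. rewrite (is_lim_seq_unique _ _ Lre), (is_lim_seq_unique _ _ Lim).
    unfold Cexp; apply Ceq; unfold Re, Im; simpl; rewrite exp_0; ring.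
Qed.

Lemma CGamma_bound (x y : R) : 0 < x -> Cmod (CGamma (x, y)) <= exp (x * ln (1 + x) - ln x).
Proof.
  intros Hx. destruct (CGamma_polar x y Hx) as (L & HL & E). rewrite E, Cmod_mult, Cmod_R, Cmod_Cexp_im.
  rewrite Rabs_right by (left; apply exp_pos). rewrite Rmult_1_r. apply exp_mono; auto.
Qed.

(** * The Euler product far to the right *)

Lemma locally_Cmod (l : C) (eps : R) : 0 < eps -> @locally C_UniformSpace l (fun z => Cmod (z - l)%C < eps).
Proof.
  intros He. exists (mkposreal (eps / 2) ltac:(lra)). intros z [H1 H2].
  eapply Rle_lt_trans; [apply Cmod_le_abs|].
  change (Rabs (Re z - Re l) < eps / 2) in H1. change (Rabs (Im z - Im l) < eps / 2) in H2.
  change (Rabs (Re z - Re l) + Rabs (Im z - Im l) < eps). lra.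
Qed.

Lemma lim_Cmod_bound (u : nat -> C) (l c : C) (B : R) :
  filterlim u eventually (@locally C_UniformSpace l) -> (forall n, Cmod (u n - c)%C <= B) -> Cmod (l - c)%C <= B.
Proof.
  intros H HB. apply Rnot_lt_le; intros L.
  destruct (H _ (locally_Cmod l (Cmod (l - c)%C - B) ltac:(lra))) as [N HN].
  specialize (HN N (Nat.le_refl N)). specialize (HB N).
  assert (T := Cmod_triangle (l - u N) (u N - c)). replace (l - u N + (u N - c))%C with (l - c)%C in T by ring.
  rewrite Cmod_sub_sym in HN. lra.
Qed.

Lemma Rabs_sin_le (x : R) : Rabs (sin x) <= Rabs x.
Proof.
  assert (K : forall x, 0 < x -> Rabs (sin x) <= x).
  { intros y Hy. destruct (Rle_dec y PI) as [L|L].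
    - rewrite Rabs_right; [left; apply sin_lt_x; auto|apply Rle_ge, sin_ge_0; lra].
    - assert (B := SIN_bound y). assert (P := PI2_1). unfold PI2 in *. apply Rabs_le. lra. }
  destruct (Rtotal_order x 0) as [H|[->|H]].
  - rewrite (Rabs_left x) by lra. rewrite <- Rabs_Ropp, <- sin_neg. apply K. lra.
  - rewrite sin_0. lra.
  - rewrite (Rabs_right x) by lra. apply K; auto.
Qed.

Lemma Cexp_im_minus1 (y : R) : Cmod (Cexp (0, y) - 1)%C <= Rabs y.
Proof.
  assert (E : Cmod (Cexp (0, y) - 1)%C = 2 * Rabs (sin (y / 2))).
  { apply Rsqr_inj; [apply Cmod_ge_0|generalize (Rabs_pos (sin (y / 2))); lra|]. unfold Rsqr.
    replace (2 * Rabs (sin (y / 2)) * (2 * Rabs (sin (y / 2)))) with (4 * (sin (y / 2) * sin (y / 2))).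
    2:{ replace (sin (y / 2) * sin (y / 2)) with (Rabs (sin (y / 2)) * Rabs (sin (y / 2))); [ring|].
        rewrite <- Rabs_mult, Rabs_right; nra. }
    rewrite Cmod_sqr. unfold Cexp, Re, Im; simpl. rewrite exp_0.
    replace y with (2 * (y / 2)) by field. set (h := y / 2). replace (2 * h / 2) with h by field.
    rewrite cos_2a_sin, sin_2a. assert (S := sin2_cos2 h). unfold Rsqr in S.
    replace (cos h * cos h) with (1 - sin h * sin h) by lra.
    replace (1 * (2 * sin h * cos h) + - 0) with (2 * sin h * cos h) by ring.
    replace (2 * sin h * cos h * (2 * sin h * cos h)) with (4 * (sin h * sin h) * (cos h * cos h)) by ring.
    replace (cos h * cos h) with (1 - sin h * sin h) by lra. ring. }
  rewrite E. assert (A := Rabs_sin_le (y / 2)). unfold Rdiv in A. rewrite (Rabs_mult y), (Rabs_right (/ 2)) in A by lra.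
  unfold Rdiv. lra.
Qed.

Lemma Cexp_minus1 (z : C) : Cmod z <= 1 -> Cmod (Cexp z - 1)%C <= 6 * Cmod z.
Proof.
  intros Hz. destruct z as [x y].
  assert (Hx := re_le_Cmod (x, y)). assert (Hy := im_le_Cmod (x, y)). simpl in Hx, Hy.
  set (r := Cmod (x, y)) in *. assert (Hr : 0 <= r) by apply Cmod_ge_0.
  replace (x, y) with (RtoC x + (0, y))%C by (apply Ceq; unfold Re, Im; simpl; ring).
  rewrite Cexp_plus, Cexp_RtoC.
  replace (RtoC (exp x) * Cexp (0, y) - 1)%C with (RtoC (exp x) * (Cexp (0, y) - 1) + RtoC (exp x - 1))%C
    by (rewrite RtoC_minus; ring).
  eapply Rle_trans; [apply Cmod_triangle|]. rewrite Cmod_mult, !Cmod_R.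
  assert (A := Cexp_im_minus1 y). assert (P := exp_pos x).
  assert (Hx1 : x <= 1) by (generalize (Rle_abs x); lra).
  assert (E3 : exp x <= 3) by (eapply Rle_trans; [apply exp_mono; exact Hx1|apply exp_le_3]).
  rewrite (Rabs_right (exp x)) by lra.
  assert (Rabs (exp x - 1) <= 3 * Rabs x).
  { assert (I1 := exp_ineq1_le x). assert (I2 := exp_ineq1_le (- x)).
    assert (I3 : exp x * exp (- x) = 1) by (rewrite <- exp_plus, Rplus_opp_r; apply exp_0).
    destruct (Rle_dec 0 x).
    - rewrite !Rabs_right by lra. nra.
    - rewrite !Rabs_left1; try lra. rewrite <- exp_0. apply Rle_minus, exp_mono; lra. }
  assert (exp x * Cmod (Cexp (0, y) - 1)%C <= 3 * r).
  { apply Rmult_le_compat; try lra. apply Cmod_ge_0. }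
  lra.
Qed.

Lemma Rcpow_norm (x : R) (s : C) : Cmod (Rcpow x s) = exp (ln x * Re s).
Proof. unfold Rcpow. rewrite Cmod_exp. f_equal. unfold Re; simpl. ring. Qed.

Lemma geometric_series_bound (f : nat -> C) (l : C) (K q : R) : 0 <= K -> 0 <= q <= / 2 ->
  @is_series C_AbsRing C_NormedModule f l -> (forall k, Cmod (f k) <= K * q ^ S k) -> Cmod l <= 2 * K * q.
Proof.
  intros HK Hq Hs Hf. assert (Z : forall z : C, (z - 0)%C = z) by (intros; ring). rewrite <- (Z l).
  apply (lim_Cmod_bound (sum_n f)); [exact Hs|]. intros n.
  rewrite Z. assert (B : Cmod (sum_n f n) <= 2 * K * q - 2 * K * q ^ S (S n)).
  { induction n as [|n IH].
    - rewrite sum_O. eapply Rle_trans; [apply Hf|]. simpl.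
      assert (0 <= K * q * (1 - 2 * q)) by (apply Rmult_le_pos; [nra|lra]). nra.
    - rewrite sum_Sn. change (Cmod (sum_n f n + f (S n))%C <= 2 * K * q - 2 * K * q ^ S (S (S n))). eapply Rle_trans; [apply Cmod_triangle|].
      specialize (Hf (S n)).
      assert (P : 0 <= K * q ^ S (S n)) by (apply Rmult_le_pos; [auto|apply pow_le; lra]).
      replace (q ^ S (S (S n))) with (q * q ^ S (S n)) by reflexivity.
      assert (0 <= K * q ^ S (S n) * (1 - 2 * q)) by (apply Rmult_le_pos; [auto|lra]).
      set (w := q ^ S (S n)) in *. nra. }
  assert (0 <= K * q ^ S (S n)) by (apply Rmult_le_pos; [auto|apply pow_le; lra]). lra.
Qed.

(** The sum over primes is majorised by a sum over all integers, and the bound [exp S0 - 1] is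
    stable under one more factor: [|P z - 1| <= |P| |z - 1| + |P - 1|]. *)
Lemma prime_prod_bound (E : nat -> C) (e : nat -> R) (N : nat) :
  (forall p, prime_nat p -> Cmod (E p) <= 1 /\ 6 * Cmod (E p) <= e p) -> (forall p, 0 <= e p) ->
  Cmod (prime_prod N (fun p => Cexp (E p)) - 1)%C <= exp (Rsum_lt N (fun k => e (S k))) - 1.
Proof.
  intros HE He. induction N as [|N IH]; cbn [prime_prod Rsum_lt].
  - replace (1 - 1)%C with (RtoC 0) by ring. rewrite Cmod_0, exp_0. lra.
  - set (S0 := Rsum_lt N (fun k => e (S k))) in *. rewrite exp_plus.
    assert (P1 : 1 <= exp (e (S N))) by (rewrite <- exp_0; apply exp_mono; auto).
    assert (P0 := exp_pos S0).
    destruct (prime_dec (Z.of_nat (S N))) as [Hp|_]; [|nra].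
    destruct (HE (S N) Hp) as [H1 H2].
    set (P := prime_prod N (fun p => Cexp (E p))) in *. set (z := Cexp (E (S N))).
    replace (P * z - 1)%C with (P * (z - 1) + (P - 1))%C by ring.
    eapply Rle_trans; [apply Cmod_triangle|]. rewrite Cmod_mult.
    assert (A : Cmod (z - 1)%C <= exp (e (S N)) - 1).
    { eapply Rle_trans; [apply Cexp_minus1; auto|]. generalize (exp_ineq1_le (e (S N))). lra. }
    assert (B : Cmod P <= exp S0).
    { generalize (Cmod_triangle_minus P 1). rewrite Cmod_1. lra. }
    assert (Cmod P * Cmod (z - 1)%C <= exp S0 * (exp (e (S N)) - 1)) by (apply Rmult_le_compat; auto using Cmod_ge_0).
    lra.
Qed.

(** Keeping [F] in the disc of radius [1/2] about 1 makes the arctangent of the quotient of its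
    parts a continuous and bounded argument on lines far to the right. *)
Lemma euler_near_one (F : C -> C) : euler_product F ->
  exists s0, 1 < s0 /\ forall s, s0 <= Re s -> Cmod (F s - 1)%C <= / 2.
Proof.
  intros (b & theta & K0 & Hth & Hb & HF). set (K := Rmax K0 0).
  assert (HK : 0 <= K) by apply Rmax_r. assert (HK0 : K0 <= K) by apply Rmax_l.
  (* [2^j >= 72 K] makes [12 K / 2^j] times the sum of [1 / k^2], which is at most 2, no larger than
     [1/3]; and [exp (1/3) - 1 <= 1/2]. *)
  destruct (Pow_x_infinity 2 ltac:(rewrite Rabs_right; lra) (72 * K + 2)) as [j Hj].
  specialize (Hj j (Nat.le_refl j)). rewrite Rabs_right in Hj by (apply Rle_ge, pow_le; lra).
  (* With [theta < 1/2] the exponent of [p] is at most [- (2 + j)]: two powers make the sum over [p]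
     converge, the other [j] give the factor [1 / 2^j]. *)
  exists (5 / 2 + INR j). assert (Pj := pos_INR j). split; [lra|].
  intros s Hs. destruct (HF s ltac:(lra)) as (E & HE & HL).
  assert (P2j : 0 < 2 ^ j) by lra.
  assert (HEp : forall p, prime_nat p -> Cmod (E p) <= 2 * K / 2 ^ j * / (INR p * INR p)).
  { intros p Hp. assert (Hp2 : (2 <= p)%nat) by (destruct Hp as [Hp _]; lia).
    assert (Rp : 2 <= INR p) by (apply (le_INR 2); auto).
    set (q := exp (- ((2 + INR j) * ln (INR p)))).
    assert (Hq : q = / (INR p * INR p) * / (INR p ^ j)).
    { unfold q. replace (- ((2 + INR j) * ln (INR p))) with (- (ln (INR p) + ln (INR p)) + - (INR j * ln (INR p))) by ring.
      rewrite exp_plus, !exp_Ropp, exp_plus, exp_ln by lra. f_equal. f_equal.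
      fold (Rpower (INR p) (INR j)). apply Rpower_pow. lra. }
    assert (Ppj : 2 ^ j <= INR p ^ j) by (apply pow_incr; lra).
    assert (Hq1 : q <= / (INR p * INR p) * / 2 ^ j).
    { rewrite Hq. apply Rmult_le_compat_l; [left; apply Rinv_0_lt_compat; nra|apply Rinv_le_contravar; lra]. }
    assert (Hi : / (INR p * INR p) <= / 4) by (apply Rinv_le_contravar; nra).
    assert (Hi0 : 0 < / (INR p * INR p)) by (apply Rinv_0_lt_compat; nra).
    assert (Hj1 : / 2 ^ j <= 1) by (rewrite <- Rinv_1; apply Rinv_le_contravar; lra).
    assert (Hj0 : 0 < / 2 ^ j) by (apply Rinv_0_lt_compat; lra).
    assert (Q0 : 0 <= q) by (left; apply exp_pos).
    replace (2 * K / 2 ^ j * / (INR p * INR p)) with (2 * K * (/ (INR p * INR p) * / 2 ^ j)) by (unfold Rdiv; ring).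
    apply Rle_trans with (2 * K * q); [|apply Rmult_le_compat_l; lra].
    apply (geometric_series_bound _ _ K q HK) with (2 := HE p Hp); [split; nra|].
    intros k. rewrite Cmod_mult, Rcpow_norm.
    assert (Hlp : 0 < ln (INR p)) by (rewrite <- ln_1; apply ln_increasing; lra).
    assert (Hpk : ln (INR (p ^ S k)) = INR (S k) * ln (INR p)).
    { rewrite pow_INR, <- Rpower_pow by lra. unfold Rpower. apply ln_exp. }
    rewrite Hpk.
    apply Rle_trans with (K * Rpower (INR (p ^ S k)) theta * exp (INR (S k) * ln (INR p) * Re (- s)%C)).
    - apply Rmult_le_compat_r; [left; apply exp_pos|]. eapply Rle_trans; [apply Hb; auto; lia|].
      apply Rmult_le_compat_r; [left; apply exp_pos|auto].
    - unfold Rpower. rewrite Hpk, Rmult_assoc, <- exp_plus. apply Rmult_le_compat_l; auto.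
      unfold q. rewrite <- Rpower_pow by apply exp_pos. unfold Rpower. rewrite ln_exp. apply exp_mono.
      assert (P : 0 <= INR (S k)) by apply pos_INR.
      rewrite re_opp. 
      replace (theta * (INR (S k) * ln (INR p)) + INR (S k) * ln (INR p) * - Re s)
        with (INR (S k) * (ln (INR p) * (theta - Re s))) by ring.
      apply Rmult_le_compat_l; auto.
      replace (- ((2 + INR j) * ln (INR p))) with (ln (INR p) * - (2 + INR j)) by ring.
      apply Rmult_le_compat_l; lra. }
  set (e := fun p => 12 * K / 2 ^ j * / (INR p * INR p)).
  assert (Hij : 72 * K / 2 ^ j <= 1).
  { apply Rmult_le_reg_r with (2 ^ j); auto. unfold Rdiv. rewrite Rmult_assoc, Rinv_l by lra. lra. }
  assert (Hij0 : 0 <= K / 2 ^ j) by (apply Rmult_le_pos; [auto|left; apply Rinv_0_lt_compat; auto]).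
  apply (lim_Cmod_bound (fun N => prime_prod N (fun p => Cexp (E p)))); [exact HL|]. intros N.
  eapply Rle_trans; [apply (prime_prod_bound E e)|].
  - intros p Hp. specialize (HEp p Hp). assert (Hp2 : (2 <= p)%nat) by (destruct Hp as [Hp _]; lia).
    assert (Rp : 2 <= INR p) by (apply (le_INR 2); auto).
    assert (Hi : / (INR p * INR p) <= / 4) by (apply Rinv_le_contravar; nra).
    assert (Hi0 : 0 < / (INR p * INR p)) by (apply Rinv_0_lt_compat; nra).
    unfold e. unfold Rdiv in *. split; nra.
  (* At [p = 0] the term is 0 by the convention [/ 0 = 0]. *)
  - intros p. unfold e. destruct p as [|p]; [simpl; rewrite Rmult_0_l, Rinv_0; lra|].
    apply Rmult_le_pos; [unfold Rdiv in *; lra|]. left; apply Rinv_0_lt_compat.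
    assert (0 < INR (S p)) by (apply lt_0_INR; lia). nra.
  - unfold e. rewrite Rsum_lt_scal.
    assert (B : Rsum_lt N (fun k => / (INR (S k) * INR (S k))) <= 2).
    { destruct N as [|N]; [simpl; lra|]. eapply Rle_trans; [apply inv_sqr_sum|].
      assert (0 < / INR (S N)) by (apply Rinv_0_lt_compat, lt_0_INR; lia). lra. }
    set (x := 12 * K / 2 ^ j * Rsum_lt N (fun k => / (INR (S k) * INR (S k)))).
    assert (Hx : x <= / 3).
    { unfold x. apply Rle_trans with (12 * K / 2 ^ j * 2); [apply Rmult_le_compat_l; unfold Rdiv in *; lra|unfold Rdiv in *; lra]. }
    assert (I2 := exp_ineq1_le (- x)).
    assert (I3 : exp x * exp (- x) = 1) by (rewrite <- exp_plus, Rplus_opp_r; apply exp_0).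
    assert (P := exp_pos x). nra.
Qed.

(** * Growth and symmetry of xi_F *)

(** Heights at which no point of the horizontal line is excluded: an excluded point has imaginary
    part 0 or makes some [lam j * s + mu j] real, so only finitely many heights are bad. *)
Definition good (r : nat) (lam : nat -> R) (mu : nat -> C) (t : R) : Prop :=
  t <> 0 /\ forall j, (j < r)%nat -> lam j * t + Im (mu j) <> 0.

Lemma good_regular (r : nat) (lam : nat -> R) (mu : nat -> C) (x t : R) :
  good r lam mu t -> regular_pt r lam mu (x, t).
Proof.
  intros [H0 H]. split; [|split].
  - intros E. apply (f_equal snd) in E. simpl in E. lra.
  - intros E. apply (f_equal snd) in E. simpl in E. lra.
  - intros j k Hj. specialize (H j Hj). split; intros E; apply (f_equal Im) in E; unfold Im in *; simpl in E; apply H; lra.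
Qed.

(** A punctured right neighbourhood is enough for approximation and covers the case that [t] itself
    is bad. *)
Lemma good_near (r : nat) (lam : nat -> R) (mu : nat -> C) (t : R) :
  (forall j, (j < r)%nat -> lam j > 0 /\ Re (mu j) >= 0) ->
  exists d, 0 < d /\ forall t', t < t' < t + d -> good r lam mu t'.
Proof.
  assert (K : forall l v, 0 < l -> exists d, 0 < d /\ forall t', t < t' < t + d -> l * t' + v <> 0).
  { intros l v Hl. destruct (Rle_dec (- v) (l * t)) as [L|L].
    - exists 1. split; [lra|]. intros t' Ht' E. assert (l * t < l * t') by (apply Rmult_lt_compat_l; lra). lra.
    - exists ((- v - l * t) / l). split; [apply Rdiv_lt_0_compat; lra|]. intros t' Ht' E.
      assert (A : l * t' < l * (t + (- v - l * t) / l)) by (apply Rmult_lt_compat_l; lra).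
      replace (l * (t + (- v - l * t) / l)) with (- v) in A by (field; lra). lra. }
  intros Hlam. induction r as [|r IH].
  - destruct (K 1 0 Rlt_0_1) as (d & Hd & A). exists d. split; auto. intros t' Ht'. split.
    + specialize (A t' Ht'). lra.
    + intros j Hj; lia.
  - destruct IH as (d1 & Hd1 & A1); [intros j Hj; apply Hlam; lia|].
    destruct (K (lam r) (Im (mu r))) as (d2 & Hd2 & A2); [apply Hlam; lia|].
    assert (M1 := Rmin_l d1 d2). assert (M2 := Rmin_r d1 d2).
    exists (Rmin d1 d2). split; [apply Rmin_glb_lt; auto|]. intros t' Ht'.
    destruct (A1 t' ltac:(lra)) as [B1 B2]. split; auto. intros j Hj.
    destruct (Nat.eq_dec j r) as [->|N]; [apply A2; lra|apply B2; lia].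
Qed.

Lemma good_far (r : nat) (lam : nat -> R) (mu : nat -> C) :
  (forall j, (j < r)%nat -> lam j > 0 /\ Re (mu j) >= 0) ->
  exists t0, 1 <= t0 /\ forall t, t0 <= Rabs t -> good r lam mu t.
Proof.
  intros Hlam. induction r as [|r IH].
  - exists 1. split; [lra|]. intros t Ht. split; [intros ->; rewrite Rabs_R0 in Ht; lra|intros j Hj; lia].
  - destruct IH as (t1 & Ht1 & A1); [intros j Hj; apply Hlam; lia|].
    destruct (Hlam r ltac:(lia)) as [Hl _].
    set (t2 := Rabs (Im (mu r)) / lam r + 1).
    exists (Rmax t1 t2). split; [generalize (Rmax_l t1 t2); lra|]. intros t Ht.
    assert (M1 := Rmax_l t1 t2). assert (M2 := Rmax_r t1 t2).
    destruct (A1 t ltac:(lra)) as [B1 B2]. split; auto. intros j Hj.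
    destruct (Nat.eq_dec j r) as [->|N]; [|apply B2; lia]. intros E.
    assert (E2 : lam r * Rabs t = Rabs (Im (mu r))).
    { rewrite <- (Rabs_right (lam r)) by lra. rewrite <- Rabs_mult.
      replace (lam r * t) with (- Im (mu r)) by lra. apply Rabs_Ropp. }
    assert (lam r * t2 <= lam r * Rabs t) by (apply Rmult_le_compat_l; lra).
    replace (lam r * t2) with (Rabs (Im (mu r)) + lam r) in H by (unfold t2; field; lra). lra.
Qed.

Lemma vertical_approx (X : C -> C) (r : nat) (lam : nat -> R) (mu : nat -> C) (x t eps : R) :
  (forall j, (j < r)%nat -> lam j > 0 /\ Re (mu j) >= 0) -> (forall z, Cdiff X z) -> 0 < eps ->
  exists d, 0 < d /\ forall t', Rabs (t' - t) < d -> Cmod (X (x, t') - X (x, t))%C < eps.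
Proof.
  intros Hlam HX He. apply (proj1 (Rcc_eps (fun t => X (x, t)) t)); auto. apply Rcc_vertical, Cdiff_cts, HX.
Qed.

(** The formula for [xi_F] is available only at regular points; continuity moves a bound to any
    height at the price of 1 in the modulus and at most 1 in the ordinate. *)
Lemma good_approx (X : C -> C) (r : nat) (lam : nat -> R) (mu : nat -> C) (x t : R) :
  (forall j, (j < r)%nat -> lam j > 0 /\ Re (mu j) >= 0) -> (forall z, Cdiff X z) ->
  exists t', good r lam mu t' /\ Rabs (t' - t) <= 1 /\ Cmod (X (x, t)) <= Cmod (X (x, t')) + 1.
Proof.
  intros Hlam HX. destruct (good_near r lam mu t Hlam) as (d1 & Hd1 & A1).
  destruct (vertical_approx X r lam mu x t 1 Hlam HX Rlt_0_1) as (d2 & Hd2 & A2).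
  set (d := Rmin 1 (Rmin d1 d2) / 2).
  assert (Hd : 0 < d) by (unfold d; assert (0 < Rmin 1 (Rmin d1 d2)) by (repeat apply Rmin_glb_lt; lra); lra).
  assert (d < 1 /\ d < d1 /\ d < d2).
  { assert (M1 := Rmin_l 1 (Rmin d1 d2)). assert (M2 := Rmin_r 1 (Rmin d1 d2)).
    assert (M3 := Rmin_l d1 d2). assert (M4 := Rmin_r d1 d2). unfold d in *. repeat split; lra. }
  exists (t + d). split; [apply A1; lra|]. replace (t + d - t) with d by ring. rewrite Rabs_right by lra.
  split; [lra|]. specialize (A2 (t + d)). replace (t + d - t) with d in A2 by ring. rewrite Rabs_right in A2 by lra.
  specialize (A2 ltac:(lra)). rewrite Cmod_sub_sym in A2.
  generalize (Cmod_triangle_minus (X (x, t)) (X (x, t + d))). lra.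
Qed.

Lemma Cmod_Cpown (z : C) (n : nat) : Cmod (Cpown z n) = Cmod z ^ n.
Proof. rewrite Cpown_Cpow. apply Cmod_pow. Qed.

(** [s -> 1 - Cconj s] reflects in the critical line and exchanges [|s|] with [|s - 1|], so the
    polynomial factor of [xi_F] is symmetric in modulus. The functional equation does the rest at
    good heights, continuity at the others. *)
Lemma xi_reflect (X F : C -> C) (m : nat) (Q : R) (r : nat) (lam : nat -> R) (mu : nat -> C) (omega : C) :
  functional_eq F Q r lam mu omega -> is_xi X F m Q r lam mu -> (forall z, Cdiff X z) -> reflect_sym X.
Proof.
  intros (HQ & Hlam & Hom & Hfe) [_ Hxi] HX.
  assert (Hgood : forall b t, good r lam mu t -> Cmod (X (/ 2 + b, t)) = Cmod (X (/ 2 - b, t))).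
  { intros b t Ht. rewrite !Hxi by (apply good_regular; auto).
    rewrite Hfe by (apply good_regular; auto).
    replace (1 - Cconj ((/ 2 + b)%R, t))%C with ((/ 2 - b)%R, t) by (apply Ceq; unfold Re, Im; simpl; field).
    rewrite !Cmod_mult, !Cmod_Cpown, Cmod_conj, Hom.
    replace (Cmod (((/ 2 + b)%R, t) - 1)%C) with (Cmod ((/ 2 - b)%R, t)) by (apply Cmod_eq_iff; unfold Re, Im; simpl; field).
    replace (Cmod (((/ 2 - b)%R, t) - 1)%C) with (Cmod ((/ 2 + b)%R, t)) by (apply Cmod_eq_iff; unfold Re, Im; simpl; field).
    ring. }
  intros b t. apply Rminus_diag_uniq, NNPP; intros N. apply Rabs_pos_lt in N.
  set (e := Rabs (Cmod (X (/ 2 + b, t)) - Cmod (X (/ 2 - b, t)))) in *.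
  destruct (good_near r lam mu t Hlam) as (d0 & Hd0 & A0).
  destruct (vertical_approx X r lam mu (/ 2 + b) t (e / 2) Hlam HX) as (d1 & Hd1 & A1); [lra|].
  destruct (vertical_approx X r lam mu (/ 2 - b) t (e / 2) Hlam HX) as (d2 & Hd2 & A2); [lra|].
  set (d := Rmin d0 (Rmin d1 d2) / 2).
  assert (Hd : 0 < d) by (unfold d; assert (0 < Rmin d0 (Rmin d1 d2)) by (repeat apply Rmin_glb_lt; lra); lra).
  assert (Hdd : d < d0 /\ d < d1 /\ d < d2).
  { assert (M1 := Rmin_l d0 (Rmin d1 d2)). assert (M2 := Rmin_r d0 (Rmin d1 d2)).
    assert (M3 := Rmin_l d1 d2). assert (M4 := Rmin_r d1 d2). unfold d in *. repeat split; lra. }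
  assert (Ed : Rabs (t + d - t) = d) by (replace (t + d - t) with d by ring; apply Rabs_right; lra).
  specialize (A1 (t + d) ltac:(lra)). specialize (A2 (t + d) ltac:(lra)).
  assert (G := Hgood b (t + d) (A0 (t + d) ltac:(lra))).
  assert (U1 := Cmod_triangle_minus (X (/ 2 + b, t + d)) (X (/ 2 + b, t))).
  assert (U2 := Cmod_triangle_minus (X (/ 2 + b, t)) (X (/ 2 + b, t + d))). rewrite Cmod_sub_sym in U2.
  assert (V1 := Cmod_triangle_minus (X (/ 2 - b, t + d)) (X (/ 2 - b, t))).
  assert (V2 := Cmod_triangle_minus (X (/ 2 - b, t)) (X (/ 2 - b, t + d))). rewrite Cmod_sub_sym in V2.
  assert (e < e); [|lra]. unfold e at 1. apply Rabs_def1; lra.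
Qed.

Definition gamma_exponent (r : nat) (lam : nat -> R) (mu : nat -> C) (x : R) : R :=
  Rsum_lt r (fun j => let u := lam j * x + Re (mu j) in u * ln (1 + u) - ln u).

Lemma gamma_factors_bound (r : nat) (lam : nat -> R) (mu : nat -> C) (x t : R) :
  (forall j, (j < r)%nat -> lam j > 0 /\ Re (mu j) >= 0) -> 0 < x ->
  Cmod (Cprod_lt r (fun j => CGamma (Cplus (Cmult (RtoC (lam j)) (x, t)) (mu j)))) <= exp (gamma_exponent r lam mu x).
Proof.
  intros Hlam Hx. unfold gamma_exponent. induction r as [|r IH]; cbn [Cprod_lt Rsum_lt].
  - rewrite Cmod_1, exp_0. lra.
  - rewrite Cmod_mult, exp_plus. destruct (Hlam r ltac:(lia)) as [Hl Hm].
    apply Rmult_le_compat; try apply Cmod_ge_0.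
    + apply IH. intros j Hj; apply Hlam; lia.
    + replace (RtoC (lam r) * (x, t) + mu r)%C with ((lam r * x + Re (mu r))%R, (lam r * t + Im (mu r))%R)
        by (apply Ceq; unfold Re, Im; simpl; ring).
      apply CGamma_bound. assert (0 < lam r * x) by (apply Rmult_lt_0_compat; lra). lra.
Qed.

Definition order32 (u : R) : R := u * sqrt u.

Lemma order32_ge (u : R) : 1 <= u -> u <= order32 u.
Proof.
  intros H. unfold order32. assert (1 <= sqrt u) by (rewrite <- sqrt_1 at 1; apply sqrt_le_1; lra). nra.
Qed.

Lemma order32_mono (u v : R) : 0 <= u -> u <= v -> order32 u <= order32 v.
Proof.
  intros H0 H. unfold order32. apply Rmult_le_compat; auto; [apply sqrt_pos|apply sqrt_le_1; lra].
Qed.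

Lemma order32_scal (c u : R) : 1 <= c -> 0 <= u -> order32 (c * u) <= c * c * order32 u.
Proof.
  intros Hc Hu. unfold order32. rewrite sqrt_mult by lra.
  assert (S1 : sqrt c <= c).
  { rewrite <- (sqrt_square c) at 2 by lra. apply sqrt_le_1; nra. }
  assert (S2 := sqrt_pos c). assert (S3 := sqrt_pos u).
  replace (c * c * (u * sqrt u)) with (c * (u * sqrt u) * c) by ring.
  replace (c * u * (sqrt c * sqrt u)) with (c * (u * sqrt u) * sqrt c) by ring.
  apply Rmult_le_compat_l; auto. apply Rmult_le_pos; [lra|apply Rmult_le_pos; auto].
Qed.

Lemma ln_le_sqrt (u : R) : 0 < u -> ln u <= 2 * sqrt u.
Proof.
  intros Hu. assert (P : 0 < sqrt u) by (apply sqrt_lt_R0; auto).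
  assert (E : ln u = 2 * ln (sqrt u)) by (rewrite <- (sqrt_sqrt u) at 1 by lra; rewrite ln_mult by auto; ring).
  assert (A := ln_le_sub1 (sqrt u) P). lra.
Qed.

(** [x >= 1/2] keeps [- ln u] bounded, as [u] may tend to 0 with [x] when [Re (mu j) = 0]. *)
Lemma gamma_exponent_growth (r : nat) (lam : nat -> R) (mu : nat -> C) :
  (forall j, (j < r)%nat -> lam j > 0 /\ Re (mu j) >= 0) ->
  exists K, 0 <= K /\ forall x, / 2 <= x -> gamma_exponent r lam mu x <= K * order32 (1 + x).
Proof.
  intros Hlam. unfold gamma_exponent. induction r as [|r IH]; cbn [Rsum_lt].
  - exists 0. split; [lra|]. intros; lra.
  - destruct IH as (K & HK & A); [intros j Hj; apply Hlam; lia|].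
    destruct (Hlam r ltac:(lia)) as [Hl Hm]. set (l := lam r) in *. set (v := Re (mu r)) in *.
    set (c := 1 + l + v). assert (Hc : 1 <= c) by (unfold c; lra).
    exists (K + 2 * (c * c) + Rabs (ln (l / 2))). assert (P := Rabs_pos (ln (l / 2))). split; [nra|]. intros x Hx.
    specialize (A x Hx). set (u := l * x + v). set (S := Rsum_lt r _) in *.
    assert (Hu : l / 2 <= u) by (unfold u; nra).
    assert (O1 := order32_ge (1 + x) ltac:(lra)).
    assert (B : u * ln (1 + u) <= 2 * (c * c) * order32 (1 + x)).
    { apply Rle_trans with (2 * order32 (c * (1 + x))).
      - apply Rle_trans with (2 * order32 (1 + u)).
        + unfold order32. assert (L := ln_le_sqrt (1 + u) ltac:(lra)). assert (Sp := sqrt_pos (1 + u)).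
          apply Rle_trans with (u * (2 * sqrt (1 + u))); [apply Rmult_le_compat_l; lra|]. nra.
        + apply Rmult_le_compat_l; [lra|]. apply order32_mono; [lra|]. unfold c, u. nra.
      - rewrite (Rmult_assoc 2). apply Rmult_le_compat_l; [lra|]. apply order32_scal; lra. }
    assert (D : - ln u <= Rabs (ln (l / 2)) * order32 (1 + x)).
    { assert (ln (l / 2) <= ln u) by (apply ln_mono; lra). assert (E := Rle_abs (- ln (l / 2))). rewrite Rabs_Ropp in E.
      apply Rle_trans with (Rabs (ln (l / 2)) * 1); [lra|apply Rmult_le_compat_l; lra]. }
    lra.
Qed.

(** [(s - 1)^m] is grouped with [F] because this product is the entire function of finite order
    supplied by [pole_cond]. *)
Lemma xi_bound (X F : C -> C) (m : nat) (Q : R) (r : nat) (lam : nat -> R) (mu : nat -> C) (x t : R) : Q > 0 ->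
  (forall j, (j < r)%nat -> lam j > 0 /\ Re (mu j) >= 0) -> is_xi X F m Q r lam mu -> 0 < x -> good r lam mu t ->
  Cmod (X (x, t)) <= Cmod (x, t) ^ m * Cmod (Cpown ((x, t) - 1) m * F (x, t))%C * exp (ln Q * x + gamma_exponent r lam mu x).
Proof.
  intros HQ Hlam [_ Hxi] Hx Ht. rewrite Hxi by (apply good_regular; auto). unfold phi.
  rewrite !Cmod_mult, Cmod_Cpown, Rcpow_norm, exp_plus.
  assert (G := gamma_factors_bound r lam mu x t Hlam Hx).
  set (g := Cmod (Cprod_lt r _)) in *.
  change (Re (x, t)) with x.
  replace (Cmod (x, t) ^ m * Cmod (Cpown ((x, t) - 1) m) * (Cmod (F (x, t)) * exp (ln Q * x) * g))
    with (Cmod (x, t) ^ m * (Cmod (Cpown ((x, t) - 1)%C m) * Cmod (F (x, t))) * exp (ln Q * x) * g) by ring.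
  rewrite <- !Rmult_assoc. apply Rmult_le_compat_l; auto.
  repeat apply Rmult_le_pos; try apply Cmod_ge_0; [apply pow_le, Cmod_ge_0|left; apply exp_pos].
Qed.

Lemma pow_le_exp (u : R) (m : nat) : 0 <= u -> u ^ m <= exp (INR m * u).
Proof.
  intros Hu. apply Rle_trans with (exp u ^ m).
  - apply pow_incr. split; auto. generalize (exp_ineq1_le u). lra.
  - rewrite <- Rpower_pow by apply exp_pos. unfold Rpower. rewrite ln_exp. right; auto.
Qed.

Lemma exp_plus1 (y : R) : 0 <= y -> exp y + 1 <= exp (y + 1).
Proof.
  intros Hy. rewrite exp_plus. assert (1 <= exp y) by (rewrite <- exp_0; apply exp_mono; auto).
  assert (2 <= exp 1) by (generalize (exp_ineq1_le 1); lra). nra.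
Qed.

Lemma Cmod_shift_im (x t t' : R) : Rabs (t' - t) <= 1 -> Cmod (x, t') <= Cmod (x, t) + 1.
Proof.
  intros H. replace (x, t') with ((x, t) + (0, (t' - t)%R))%C by (apply Ceq; unfold Re, Im; simpl; ring).
  eapply Rle_trans; [apply Cmod_triangle|]. apply Rplus_le_compat_l.
  eapply Rle_trans; [apply Cmod_le_abs|]. unfold Re, Im; simpl. rewrite Rabs_R0. lra.
Qed.

Lemma Cmod_minus1 (z : C) : Cmod (z - 1)%C <= 1 + Cmod z.
Proof.
  unfold Cminus. eapply Rle_trans; [apply Cmod_triangle|]. rewrite Cmod_opp, Cmod_1. lra.
Qed.

Lemma xi_growth_right (X F : C -> C) (m : nat) (Q : R) (r : nat) (lam : nat -> R) (mu : nat -> C) (s0 : R) : Q > 0 ->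
  (forall j, (j < r)%nat -> lam j > 0 /\ Re (mu j) >= 0) -> is_xi X F m Q r lam mu -> (forall z, Cdiff X z) ->
  1 < s0 -> (forall s, s0 <= Re s -> Cmod (F s - 1)%C <= / 2) ->
  exists C1, 0 <= C1 /\ forall x t, s0 <= x -> Cmod (X (x, t)) <= exp (C1 * order32 (1 + Cmod (x, t))).
Proof.
  intros HQ Hlam Hxi HX Hs0 HF.
  destruct (gamma_exponent_growth r lam mu Hlam) as (K & HK & HG).
  assert (Pm := pos_INR m). assert (PQ := Rabs_pos (ln Q)).
  set (C1 := 2 * INR m + 1 + Rabs (ln Q) + K). assert (HC1 : 0 <= C1) by (unfold C1; lra).
  assert (Hg : forall x t, s0 <= x -> good r lam mu t -> Cmod (X (x, t)) <= exp (C1 * order32 (1 + Cmod (x, t)))).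
  { intros x t Hx Ht. eapply Rle_trans; [apply (xi_bound X F m Q r lam mu); auto; lra|].
    assert (P := Cmod_ge_0 (x, t)). set (u := 1 + Cmod (x, t)).
    assert (Ou := order32_ge u ltac:(unfold u; lra)).
    assert (Hx' : x <= Cmod (x, t)).
    { assert (A := re_le_Cmod (x, t)). unfold Re in A; simpl in A. rewrite Rabs_right in A; lra. }
    assert (B1 : Cmod (x, t) ^ m <= exp (INR m * order32 u)).
    { eapply Rle_trans; [apply pow_le_exp; auto|]. apply exp_mono. apply Rmult_le_compat_l; auto. unfold u in *; lra. }
    assert (B2 : Cmod (Cpown ((x, t) - 1) m * F (x, t))%C <= exp (INR m * order32 u + order32 u)).
    { rewrite Cmod_mult, Cmod_Cpown, exp_plus. apply Rmult_le_compat.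
      - apply pow_le, Cmod_ge_0.
      - apply Cmod_ge_0.
      - apply Rle_trans with (u ^ m).
        + apply pow_incr. split; [apply Cmod_ge_0|apply Cmod_minus1].
        + eapply Rle_trans; [apply pow_le_exp; unfold u; lra|]. apply exp_mono, Rmult_le_compat_l; auto.
      - specialize (HF (x, t) Hx). assert (T := Cmod_triangle_minus (F (x, t)) 1). rewrite Cmod_1 in T.
        assert (E := exp_ineq1_le (order32 u)). unfold u in Ou. fold u in Ou. assert (1 <= u) by (unfold u; lra). lra. }
    assert (B3 : exp (ln Q * x + gamma_exponent r lam mu x) <= exp (Rabs (ln Q) * order32 u + K * order32 u)).
    { apply exp_mono. apply Rplus_le_compat.
      - apply Rle_trans with (Rabs (ln Q) * x); [apply Rmult_le_compat_r; [lra|apply Rle_abs]|].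
        apply Rmult_le_compat_l; auto. unfold u in *; lra.
      - eapply Rle_trans; [apply HG; lra|]. apply Rmult_le_compat_l; auto. apply order32_mono; unfold u; lra. }
    replace (C1 * order32 u) with (INR m * order32 u + (INR m * order32 u + order32 u) + (Rabs (ln Q) * order32 u + K * order32 u))
      by (unfold C1; ring).
    rewrite (exp_plus (INR m * order32 u + (INR m * order32 u + order32 u))), (exp_plus (INR m * order32 u) (INR m * order32 u + order32 u)).
    assert (E1 := exp_pos (ln Q * x + gamma_exponent r lam mu x)).
    apply Rmult_le_compat; auto; try lra.
    - apply Rmult_le_pos; [apply pow_le; auto|apply Cmod_ge_0].
    - apply Rmult_le_compat; auto; [apply pow_le; auto|apply Cmod_ge_0]. }
  (* 4 comes from [order32 (2 u) <= 4 order32 u] after the shift to a good height, 1 from the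
     additive loss. *)
  exists (4 * C1 + 1). split; [lra|]. intros x t Hx.
  destruct (good_approx X r lam mu x t Hlam HX) as (t' & Ht' & Hd & HB).
  eapply Rle_trans; [exact HB|]. specialize (Hg x t' Hx Ht').
  assert (S1 := Cmod_shift_im x t t' Hd). assert (P := Cmod_ge_0 (x, t)). assert (P' := Cmod_ge_0 (x, t')).
  assert (O1 : order32 (1 + Cmod (x, t')) <= 4 * order32 (1 + Cmod (x, t))).
  { apply Rle_trans with (order32 (2 * (1 + Cmod (x, t)))); [apply order32_mono; lra|].
    eapply Rle_trans; [apply order32_scal; lra|]. lra. }
  assert (O2 := order32_ge (1 + Cmod (x, t)) ltac:(lra)).
  apply Rle_trans with (exp (4 * C1 * order32 (1 + Cmod (x, t))) + 1).
  - apply Rplus_le_compat_r. eapply Rle_trans; [exact Hg|]. apply exp_mono.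
    rewrite (Rmult_comm 4), Rmult_assoc. apply Rmult_le_compat_l; auto.
  - eapply Rle_trans; [apply exp_plus1|apply exp_mono; lra]. apply Rmult_le_pos; lra.
Qed.

(** Inside the strip only [exp] of a power of [|t|] is known, from the finite order of
    [(s - 1)^m F]. On the right edge [F] is close to 1 and the Gamma factors are bounded, so [X] is
    [O(|t|^(2m))]. Phragmen-Lindelof carries the polynomial bound inside, and reflection supplies
    the left half. *)
Lemma xi_growth_strip (X F : C -> C) (m : nat) (Q : R) (r : nat) (lam : nat -> R) (mu : nat -> C) (B : R) : Q > 0 ->
  (forall j, (j < r)%nat -> lam j > 0 /\ Re (mu j) >= 0) -> is_xi X F m Q r lam mu -> (forall z, Cdiff X z) ->
  reflect_sym X -> pole_cond F m -> 1 <= B -> (forall s, / 2 + B <= Re s -> Cmod (F s - 1)%C <= / 2) ->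
  exists M, 1 <= M /\ forall x t, Rabs (x - / 2) <= B -> Cmod (X (x, t)) <= M * (2 * B + 1 + Cmod (x, t)) ^ (2 * m).
Proof.
  intros HQ Hlam Hxi HX Hsym (G & _ & (k & Bf & HGf) & HGF) HB HF.
  destruct (gamma_exponent_growth r lam mu Hlam) as (K & HK & HG).
  assert (Pm := pos_INR m). assert (PQ := Rabs_pos (ln Q)).
  assert (E2B : RtoC (2 * B) = (RtoC 2 * RtoC B)%C) by apply RtoC_mult.
  (* Dividing by a power of [w + 2 B], which has no zero in the wider strip [|Re w| < 2 B], turns
     the polynomial edge bound into a constant. *)
  set (f := fun w => (X (/ 2 + w) * / Cpow (w + RtoC (2 * B)) (2 * m))%C).
  assert (Hne : forall w, Rabs (Re w) < 2 * B -> (w + RtoC (2 * B))%C <> RtoC 0).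
  { intros w Hw E. apply (f_equal Re) in E. unfold Re in *; simpl in E. apply Rabs_def2 in Hw. lra. }
  assert (Hhalf : forall x t, (/ 2 + (x, t))%C = ((/ 2 + x)%R, t)) by (intros; apply Ceq; unfold Re, Im; simpl; field).
  set (c := exp (ln Q * (/ 2 + B) + gamma_exponent r lam mu (/ 2 + B))).
  assert (Hc : 0 < c) by apply exp_pos.
  set (M1 := 3 / 2 * c + 1).
  assert (Hline : forall t, Cmod (X (/ 2 + B, t)) <= M1 * (2 + Cmod (/ 2 + B, t)) ^ (2 * m)).
  { intros t. destruct (good_approx X r lam mu (/ 2 + B) t Hlam HX) as (t' & Ht' & Hd & HBd).
    assert (S1 := Cmod_shift_im (/ 2 + B) t t' Hd). assert (P := Cmod_ge_0 (/ 2 + B, t)). assert (P' := Cmod_ge_0 (/ 2 + B, t')).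
    assert (A := xi_bound X F m Q r lam mu (/ 2 + B) t' HQ Hlam Hxi ltac:(lra) Ht'). fold c in A.
    set (v := 2 + Cmod (/ 2 + B, t)) in *.
    assert (A1 : Cmod (/ 2 + B, t') ^ m <= v ^ m) by (apply pow_incr; unfold v; lra).
    assert (A2 : Cmod (Cpown (((/ 2 + B)%R, t') - 1) m * F ((/ 2 + B)%R, t'))%C <= v ^ m * (3 / 2)).
    { rewrite Cmod_mult, Cmod_Cpown. apply Rmult_le_compat; [apply pow_le, Cmod_ge_0|apply Cmod_ge_0| |].
      - apply pow_incr. split; [apply Cmod_ge_0|]. eapply Rle_trans; [apply Cmod_minus1|unfold v; lra].
      - specialize (HF ((/ 2 + B)%R, t') ltac:(unfold Re; simpl; lra)).
        assert (T := Cmod_triangle_minus (F ((/ 2 + B)%R, t')) 1). rewrite Cmod_1 in T. lra. }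
    assert (V1 : 1 <= v ^ m) by (apply pow_R1_Rle; unfold v; lra).
    replace (v ^ (2 * m)) with (v ^ m * v ^ m) by (rewrite <- pow_add; f_equal; lia).
    eapply Rle_trans; [exact HBd|]. unfold M1.
    assert (A3 : Cmod (/ 2 + B, t') ^ m * Cmod (Cpown (((/ 2 + B)%R, t') - 1) m * F ((/ 2 + B)%R, t'))%C * c
       <= v ^ m * (v ^ m * (3 / 2)) * c).
    { apply Rmult_le_compat_r; [lra|]. apply Rmult_le_compat; auto; [apply pow_le; auto|apply Cmod_ge_0]. }
    nra. }
  set (M := M1 * 4 ^ (2 * m)).
  assert (HM1 : 1 <= M1) by (unfold M1; lra).
  assert (H4 : 1 <= 4 ^ (2 * m)) by (apply pow_R1_Rle; lra).
  assert (HM : 1 <= M) by (unfold M; nra).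
  set (c2 := Rabs (ln Q) * (/ 2 + B) + K * order32 (1 + (/ 2 + B))).
  set (c3 := 3 + B).
  assert (Hstrip : forall x t, / 2 <= x <= / 2 + B ->
     Cmod (X (x, t)) <= (Rabs Bf * exp c2 + 1) * exp ((INR m * c3 + c3 ^ k) * (1 + Rabs t) ^ S k)).
  { intros x t Hx. destruct (good_approx X r lam mu x t Hlam HX) as (t' & Ht' & Hd & HBd).
    assert (A := xi_bound X F m Q r lam mu x t' HQ Hlam Hxi ltac:(lra) Ht').
    rewrite <- HGF in A.
    2:{ intros E. apply (f_equal snd) in E. simpl in E. destruct Ht' as [Ht' _]. lra. }
    set (v := 1 + Rabs t). assert (Hv : 1 <= v) by (unfold v; generalize (Rabs_pos t); lra).
    assert (S1 : 1 + Cmod (x, t') <= c3 * v).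
    { assert (T := Cmod_le_abs (x, t')). unfold Re, Im in T; simpl in T. rewrite Rabs_right in T by lra.
      assert (T2 := Rabs_triang (t' - t) t). replace (t' - t + t) with t' in T2 by ring. unfold c3, v in *. nra. }
    assert (P' := Cmod_ge_0 (x, t')).
    assert (Hc3 : 1 <= c3) by (unfold c3; lra).
    assert (Vk : 1 <= v ^ k) by (apply pow_R1_Rle; lra).
    assert (A1 : Cmod (x, t') ^ m <= exp (INR m * c3 * v ^ S k)).
    { eapply Rle_trans; [apply pow_le_exp; auto|]. apply exp_mono. rewrite Rmult_assoc. apply Rmult_le_compat_l; auto.
      simpl. apply Rle_trans with (c3 * v); [lra|]. apply Rmult_le_compat_l; [lra|]. nra. }
    assert (A2 : Cmod (G (x, t')) <= Rabs Bf * exp (c3 ^ k * v ^ S k)).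
    { eapply Rle_trans; [apply HGf|].
      apply Rmult_le_compat; [|left; apply exp_pos|apply Rle_abs|].
      - assert (G0 := Cmod_ge_0 (G (x, t'))). assert (G1 := HGf (x, t')).
        assert (E := exp_pos ((1 + Cmod (x, t')) ^ k)). apply Rnot_lt_le; intros N. nra.
      - apply exp_mono. apply Rle_trans with ((c3 * v) ^ k); [apply pow_incr; lra|].
        rewrite Rpow_mult_distr. apply Rmult_le_compat_l; [apply pow_le; lra|]. simpl. nra. }
    assert (A3 : exp (ln Q * x + gamma_exponent r lam mu x) <= exp c2).
    { apply exp_mono. unfold c2. apply Rplus_le_compat.
      - apply Rle_trans with (Rabs (ln Q) * x); [apply Rmult_le_compat_r; [lra|apply Rle_abs]|].
        apply Rmult_le_compat_l; auto. lra.
      - eapply Rle_trans; [apply HG; lra|]. apply Rmult_le_compat_l; auto. apply order32_mono; lra. }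
    eapply Rle_trans; [exact HBd|].
    replace ((INR m * c3 + c3 ^ k) * v ^ S k) with (INR m * c3 * v ^ S k + c3 ^ k * v ^ S k) by ring.
    set (y1 := INR m * c3 * v ^ S k) in *. set (y2 := c3 ^ k * v ^ S k) in *.
    assert (Y1 : 0 <= y1). { unfold y1. apply Rmult_le_pos; [nra|apply pow_le; lra]. }
    assert (Y2 : 0 <= y2). { unfold y2. apply Rmult_le_pos; [apply pow_le; lra|apply pow_le; lra]. }
    assert (A4 : Cmod (x, t') ^ m * Cmod (G (x, t')) * exp (ln Q * x + gamma_exponent r lam mu x)
       <= exp y1 * (Rabs Bf * exp y2) * exp c2).
    { apply Rmult_le_compat; auto; [|left; apply exp_pos|].
      - apply Rmult_le_pos; [apply pow_le; auto|apply Cmod_ge_0].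
      - apply Rmult_le_compat; auto; [apply pow_le; auto|apply Cmod_ge_0]. }
    rewrite exp_plus. assert (1 <= exp y1) by (rewrite <- exp_0; apply exp_mono; auto).
    assert (1 <= exp y2) by (rewrite <- exp_0; apply exp_mono; auto).
    replace ((Rabs Bf * exp c2 + 1) * (exp y1 * exp y2)) with (exp y1 * (Rabs Bf * exp y2) * exp c2 + exp y1 * exp y2) by ring.
    nra. }
  assert (Hden : forall x t, Rabs x <= B -> Cmod (B, t) <= Cmod ((x, t) + RtoC (2 * B))%C).
  { intros x t Hx. apply Rabs_le_between in Hx. apply Cmod_le_iff. unfold Re, Im; simpl. nra. }
  assert (HBt : forall t, B <= Cmod (B, t)).
  { intros t. assert (A := re_le_Cmod (B, t)). unfold Re in A; simpl in A. rewrite Rabs_right in A; lra. }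
  assert (HPL : forall w, Rabs (Re w) <= B -> Cmod (f w) <= M).
  { apply (phragmen_lindelof f B (2 * B) M (Rabs Bf * exp c2 + 1) (INR m * c3 + c3 ^ k) (S k)).
    - lra.
    - assert (0 <= Rabs Bf * exp c2) by (apply Rmult_le_pos; [apply Rabs_pos|left; apply exp_pos]). lra.
    - assert (0 <= c3 ^ k) by (apply pow_le; unfold c3; lra). assert (0 <= INR m * c3) by (apply Rmult_le_pos; unfold c3; lra). lra.
    - lra.
    - intros w Hw. apply Cdiff_mult.
      + apply (Cdiff_comp (fun w => / 2 + w)%C X); auto. apply Cdiff_plus; [apply Cdiff_const|apply Cdiff_id].
      + apply Cdiff_inv; [|apply Cpow_nz, Hne; auto].
        apply (Cdiff_Cpow (fun w => (w + RtoC (2 * B))%C)). apply Cdiff_plus; [apply Cdiff_id|apply Cdiff_const].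
    - intros [x t] Hw. simpl in Hw. unfold f. rewrite Hhalf.
      assert (Hn := Hne (x, t) ltac:(unfold Re; simpl; lra)).
      rewrite Cmod_mult, Cmod_inv, Cmod_pow by (apply Cpow_nz; auto).
      assert (Ex : Cmod (X (/ 2 + x, t)) = Cmod (X (/ 2 + B, t))).
      { destruct (Rle_dec 0 x) as [L|L]; [rewrite Rabs_right in Hw by lra; subst x; auto|].
        rewrite Rabs_left in Hw by lra. replace x with (- B) by lra. rewrite (Hsym B t). auto. }
      rewrite Ex. specialize (Hline t). specialize (Hden x t ltac:(lra)). specialize (HBt t).
      assert (Pd : 0 < Cmod ((x, t) + RtoC (2 * B))%C) by lra.
      set (dd := Cmod ((x, t) + RtoC (2 * B))%C) in *.
      assert (Hs : 2 + Cmod (/ 2 + B, t) <= 4 * dd).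
      { assert (T : Cmod (/ 2 + B, t) <= / 2 + Cmod (B, t)); [|lra].
        replace (/ 2 + B, t) with (RtoC (/ 2) + (B, t))%C by (apply Ceq; unfold Re, Im; simpl; ring).
        eapply Rle_trans; [apply Cmod_triangle|]. rewrite Cmod_R, Rabs_right; lra. }
      assert (P0 := Cmod_ge_0 (/ 2 + B, t)).
      apply Rmult_le_reg_r with (dd ^ (2 * m)); [apply pow_lt; auto|].
      rewrite Rmult_assoc, Rinv_l by (apply pow_nonzero; lra). rewrite Rmult_1_r.
      eapply Rle_trans; [exact Hline|]. unfold M. rewrite Rmult_assoc, <- Rpow_mult_distr.
      apply Rmult_le_compat_l; [lra|]. apply pow_incr. lra.
    - intros [x t] Hw. simpl in Hw. unfold f. rewrite Hhalf.
      assert (Hn := Hne (x, t) ltac:(unfold Re; simpl; lra)).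
      rewrite Cmod_mult, Cmod_inv, Cmod_pow by (apply Cpow_nz; auto).
      specialize (Hden x t ltac:(lra)). specialize (HBt t).
      set (dd := Cmod ((x, t) + RtoC (2 * B))%C) in *.
      assert (Pd : 1 <= dd ^ (2 * m)) by (apply pow_R1_Rle; lra).
      assert (Pi : / dd ^ (2 * m) <= 1) by (rewrite <- Rinv_1; apply Rinv_le_contravar; lra).
      apply Rle_trans with (Cmod (X (/ 2 + x, t)) * 1); [apply Rmult_le_compat_l; [apply Cmod_ge_0|auto]|].
      rewrite Rmult_1_r. change (Im (x, t)) with t. apply Rabs_le_between in Hw.
      destruct (Rle_dec 0 x) as [L|L]; [apply Hstrip; lra|].
      replace (/ 2 + x) with (/ 2 - - x) by ring. rewrite <- Hsym. apply Hstrip; lra. }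
  exists M. split; auto. intros x t Hx.
  specialize (HPL (x - / 2, t) Hx). unfold f in HPL. rewrite Hhalf in HPL. replace (/ 2 + (x - / 2)) with x in HPL by ring.
  assert (Hn := Hne ((x - / 2)%R, t) ltac:(unfold Re; simpl; lra)).
  rewrite Cmod_mult, Cmod_inv, Cmod_pow in HPL by (apply Cpow_nz; auto).
  set (dd := Cmod (((x - / 2)%R, t) + RtoC (2 * B))%C) in *.
  assert (Pd : 0 < dd) by (apply Cmod_gt_0; auto).
  assert (Hdd : dd <= 2 * B + 1 + Cmod (x, t)).
  { unfold dd. replace (((x - / 2)%R, t) + RtoC (2 * B))%C with ((x, t) + RtoC (2 * B - / 2))%C
      by (apply Ceq; unfold Re, Im; simpl; ring).
    eapply Rle_trans; [apply Cmod_triangle|]. rewrite Cmod_R, Rabs_right; lra. }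
  apply Rle_trans with (M * dd ^ (2 * m)).
  - apply Rmult_le_reg_r with (/ dd ^ (2 * m)); [apply Rinv_0_lt_compat, pow_lt; auto|].
    rewrite Rmult_assoc, Rinv_r by (apply pow_nonzero; lra). lra.
  - apply Rmult_le_compat_l; [lra|]. apply pow_incr. lra.
Qed.

(** Left of the strip the bound comes by reflection; the modulus of the reflected point is larger by
    at most 1, which costs a constant factor in the exponent. *)
Lemma xi_growth (X F : C -> C) (m : nat) (Q : R) (r : nat) (lam : nat -> R) (mu : nat -> C) (s0 : R) : Q > 0 ->
  (forall j, (j < r)%nat -> lam j > 0 /\ Re (mu j) >= 0) -> is_xi X F m Q r lam mu -> (forall z, Cdiff X z) ->
  reflect_sym X -> pole_cond F m -> 1 < s0 -> (forall s, s0 <= Re s -> Cmod (F s - 1)%C <= / 2) ->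
  exists C0, 0 <= C0 /\ growth X C0.
Proof.
  intros HQ Hlam Hxi HX Hsym Hp Hs0 HF.
  destruct (xi_growth_right X F m Q r lam mu s0 HQ Hlam Hxi HX Hs0 HF) as (C1 & HC1 & HR).
  set (B := s0). 
  destruct (xi_growth_strip X F m Q r lam mu B HQ Hlam Hxi HX Hsym Hp) as (M & HM & HS).
  { unfold B; lra. }
  { intros s Hs. apply HF. unfold B in Hs. lra. }
  assert (Pm := pos_INR (2 * m)).
  assert (HlM : 0 <= ln M) by (rewrite <- ln_1; apply ln_mono; lra).
  set (C2 := ln M + INR (2 * m) * (2 * B + 1)).
  assert (HC2 : 0 <= C2). { unfold C2, B. assert (0 <= INR (2 * m) * (2 * s0 + 1)) by (apply Rmult_le_pos; lra). lra. }
  exists (4 * C1 + C2). split; [lra|]. intros [x t].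
  assert (P := Cmod_ge_0 (x, t)). fold (order32 (1 + Cmod (x, t))). set (u := 1 + Cmod (x, t)).
  assert (Ou := order32_ge u ltac:(unfold u; lra)). assert (Hu : 1 <= u) by (unfold u; lra).
  destruct (Rle_dec (Rabs (x - / 2)) B) as [L|L].
  - eapply Rle_trans; [apply HS; auto|].
    rewrite <- (exp_ln M) at 1 by lra.
    assert (A : (2 * B + 1 + Cmod (x, t)) ^ (2 * m) <= exp (INR (2 * m) * ((2 * B + 1) * order32 u))).
    { eapply Rle_trans; [apply pow_le_exp; unfold B; lra|]. apply exp_mono, Rmult_le_compat_l; auto.
      apply Rle_trans with ((2 * B + 1) * u); [unfold u, B; nra|]. apply Rmult_le_compat_l; [unfold B; lra|auto]. }
    apply Rle_trans with (exp (ln M) * exp (INR (2 * m) * ((2 * B + 1) * order32 u))).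
    + apply Rmult_le_compat_l; [left; apply exp_pos|auto].
    + rewrite <- exp_plus. apply exp_mono. unfold C2.
      assert (ln M <= ln M * order32 u) by nra.
      assert (0 <= 4 * C1 * order32 u) by (apply Rmult_le_pos; lra). lra.
  - assert (Right : forall x', B < x' - / 2 -> Cmod (x', t) <= Cmod (x, t) + 1 -> Cmod (X (x', t)) <= exp ((4 * C1 + C2) * order32 u)).
    { intros x' Hx' Hm. eapply Rle_trans; [apply HR; unfold B in Hx'; lra|]. apply exp_mono.
      assert (P' := Cmod_ge_0 (x', t)).
      assert (O1 : order32 (1 + Cmod (x', t)) <= 4 * order32 u).
      { apply Rle_trans with (order32 (2 * u)); [apply order32_mono; unfold u; lra|].
        eapply Rle_trans; [apply order32_scal; lra|]. lra. }
      assert (0 <= C2 * order32 u) by (apply Rmult_le_pos; lra).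
      assert (C1 * order32 (1 + Cmod (x', t)) <= C1 * (4 * order32 u)) by (apply Rmult_le_compat_l; auto). lra. }
    destruct (Rle_dec 0 (x - / 2)) as [Lx|Lx].
    + rewrite Rabs_right in L by lra. apply Right; lra.
    + rewrite Rabs_left in L by lra.
      replace x with (/ 2 - (/ 2 - x)) by ring. rewrite <- Hsym. apply Right; [lra|].
      replace (Cmod (/ 2 + (/ 2 - x), t)) with (Cmod ((x, t) - 1)%C).
      * eapply Rle_trans; [apply Cmod_minus1|lra].
      * apply Cmod_eq_iff. unfold Re, Im; simpl. field.
Qed.

(** * The argument of xi_F on a vertical line *)

(** A relation rather than a function: the argument wanted is continuous and unbounded along a line,
    so no principal value fits. It holds for every [a] at [z = 0]. *)
Definition has_arg (z : C) (a : R) : Prop := z = (RtoC (Cmod z) * Cexp (0, a))%C.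

Lemma has_arg_mult (z w : C) (a b : R) : has_arg z a -> has_arg w b -> has_arg (z * w)%C (a + b).
Proof.
  unfold has_arg. intros Hz Hw. rewrite Cmod_mult, RtoC_mult.
  replace (0, a + b) with ((0, a) + (0, b))%C by (apply Ceq; unfold Re, Im; simpl; ring).
  rewrite Cexp_plus. rewrite Hz at 1. rewrite Hw at 1. ring.
Qed.

Lemma has_arg_pos (c : R) (z : C) (a : R) : 0 <= c -> z = (RtoC c * Cexp (0, a))%C -> has_arg z a.
Proof.
  intros Hc E. unfold has_arg. assert (M : Cmod z = c).
  { rewrite E, Cmod_mult, Cmod_R, Cmod_Cexp_im, Rabs_right; lra. }
  rewrite M. exact E.
Qed.

Lemma has_arg_1 : has_arg (RtoC 1) 0.
Proof.
  apply (has_arg_pos 1); [lra|]. change (0, 0) with (RtoC 0). rewrite Cexp_0. ring.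
Qed.

Lemma has_arg_Cpown (z : C) (a : R) (n : nat) : has_arg z a -> has_arg (Cpown z n) (INR n * a).
Proof.
  intros H. induction n as [|n IH]; cbn [Cpown].
  - simpl INR. rewrite Rmult_0_l. apply has_arg_1.
  - rewrite S_INR. replace ((INR n + 1) * a) with (a + INR n * a) by ring. apply has_arg_mult; auto.
Qed.

Lemma has_arg_right (x y : R) : 0 < x -> has_arg (x, y) (atan (y / x)).
Proof. intros H. apply polar_right; auto. Qed.

Lemma has_arg_Re (z : C) : 0 < Re z -> has_arg z (atan (Im z / Re z)).
Proof. destruct z as [x y]. apply has_arg_right. Qed.

Lemma has_arg_gamma_prod (r : nat) (lam : nat -> R) (mu : nat -> C) (x t : R) :
  (forall j, (j < r)%nat -> lam j > 0 /\ Re (mu j) >= 0) -> 0 < x ->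
  has_arg (Cprod_lt r (fun j => CGamma (Cplus (Cmult (RtoC (lam j)) (x, t)) (mu j))))
    (Rsum_lt r (fun j => gamma_argl (lam j * x + Re (mu j)) (lam j * t + Im (mu j)))).
Proof.
  intros Hlam Hx. induction r as [|r IH]; cbn [Cprod_lt Rsum_lt]; [apply has_arg_1|].
  apply has_arg_mult; [apply IH; intros; apply Hlam; lia|].
  destruct (Hlam r ltac:(lia)) as [Hl Hm].
  replace (RtoC (lam r) * (x, t) + mu r)%C with ((lam r * x + Re (mu r))%R, (lam r * t + Im (mu r))%R)
    by (apply Ceq; unfold Re, Im; simpl; ring).
  assert (0 < lam r * x) by (apply Rmult_lt_0_compat; lra).
  destruct (CGamma_polar (lam r * x + Re (mu r)) (lam r * t + Im (mu r))) as (L & _ & E); [lra|].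
  apply (has_arg_pos (exp L)); [left; apply exp_pos|exact E].
Qed.

Lemma stirling_shift (l v : R) : 0 < l -> exists K t1, 0 <= K /\ 3 <= t1 /\ forall t, t1 <= t ->
  1 <= l * t + v /\
  Rabs (((l * t + v) * ln (l * t + v) - (l * t + v)) - (l * (t * ln t) + (l * ln l - l) * t)) <= K * ln t.
Proof.
  intros Hl. set (a := Rabs v). assert (Ha : 0 <= a) by apply Rabs_pos.
  assert (Hva : - a <= v <= a) by (unfold a; apply Rabs_le_between; lra).
  set (ll := Rabs (ln l)). assert (Hll : 0 <= ll) by apply Rabs_pos.
  assert (Hlla : - ll <= ln l <= ll) by (unfold ll; apply Rabs_le_between; lra).
  (* 3 gives [ln t >= 1]; the second summand gives [l t >= 2 |v| + 2], which keeps [l t + v] above 1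
     and [|v| / (l t)] below [1/2]. *)
  exists (a * (ll + 4)), (3 + (2 * a + 2) / l).
  assert (Hq : 0 <= (2 * a + 2) / l) by (apply Rmult_le_pos; [lra|left; apply Rinv_0_lt_compat; auto]).
  split; [nra|split; [lra|]]. intros t Ht.
  assert (Hlt : 2 * a + 2 <= l * t).
  { replace (2 * a + 2) with (l * ((2 * a + 2) / l)) by (field; lra). apply Rmult_le_compat_l; lra. }
  set (w := l * t) in *. set (y := w + v). assert (Hy : 1 <= y) by (unfold y; lra). split; auto.
  assert (Hlnt : 1 <= ln t).
  { rewrite <- (ln_exp 1). apply ln_mono; [apply exp_pos|]. generalize exp_le_3. lra. }
  assert (Elw : ln w = ln l + ln t) by (unfold w; rewrite ln_mult; lra).
  assert (Hy1 : ln y - ln w <= v / w).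
  { assert (E : ln y - ln w = ln (y / w)) by (unfold Rdiv; rewrite ln_mult, ln_Rinv; try lra; apply Rinv_0_lt_compat; lra).
    rewrite E. eapply Rle_trans; [apply ln_le_sub1; apply Rdiv_lt_0_compat; lra|]. right. unfold y. field. lra. }
  assert (Hy2 : v / y <= ln y - ln w).
  { assert (E : ln y - ln w = - ln (w / y)) by (unfold Rdiv; rewrite ln_mult, ln_Rinv; try lra; apply Rinv_0_lt_compat; lra).
    rewrite E. assert (A := ln_le_sub1 (w / y) ltac:(apply Rdiv_lt_0_compat; lra)).
    replace (w / y - 1) with (- (v / y)) in A by (unfold y; field; fold y; lra). lra. }
  assert (Hy3 : y * (ln y - ln w) <= 2 * a).
  { apply Rle_trans with (y * (v / w)); [apply Rmult_le_compat_l; lra|].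
    replace (y * (v / w)) with (v + v * v / w) by (unfold y; field; lra).
    assert (v * v / w <= a); [|lra]. apply Rmult_le_reg_r with w; [lra|]. unfold Rdiv.
    rewrite Rmult_assoc, Rinv_l by lra. nra. }
  assert (Hy4 : - a <= y * (ln y - ln w)).
  { apply Rle_trans with (y * (v / y)); [replace (y * (v / y)) with v by (field; lra); lra|apply Rmult_le_compat_l; lra]. }
  replace (y * ln y - y - (l * (t * ln t) + (l * ln l - l) * t)) with (y * (ln y - ln w) + v * ln w - v).
  2:{ rewrite Elw. unfold y, w. ring. }
  set (q := y * (ln y - ln w)) in *. clearbody q. rewrite Elw.
  assert (Hv2 : Rabs (v * (ln l + ln t)) <= a * (ll + ln t)).
  { rewrite Rabs_mult. apply Rmult_le_compat; try apply Rabs_pos; [unfold a; lra|]. apply Rabs_le; lra. }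
  apply Rabs_le_between in Hv2.
  assert (a * ll <= a * ll * ln t) by (rewrite <- (Rmult_1_r (a * ll)) at 1; apply Rmult_le_compat_l; nra).
  assert (a <= a * ln t) by (rewrite <- (Rmult_1_r a) at 1; apply Rmult_le_compat_l; lra).
  apply Rabs_le. lra.
Qed.

Lemma gamma_line_asymp (x l v : R) : 0 < x -> 0 < l -> exists K t1, 0 <= K /\ 3 <= t1 /\ forall t, t1 <= t ->
  Rabs (gamma_argl x (l * t + v) - (l * (t * ln t) + (l * ln l - l) * t)) <= K * ln t.
Proof.
  intros Hx Hl. destruct (gamma_stirling x Hx) as (K1 & HK1 & A). destruct (stirling_shift l v Hl) as (K2 & t1 & HK2 & Ht1 & B).
  exists (K1 + K2), t1. split; [lra|split; [auto|]]. intros t Ht. destruct (B t Ht) as [B1 B2]. specialize (A _ B1).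
  assert (Hlnt : 1 <= ln t).
  { rewrite <- (ln_exp 1). apply ln_mono; [apply exp_pos|]. generalize exp_le_3. lra. }
  set (y := l * t + v) in *.
  replace (gamma_argl x y - (l * (t * ln t) + (l * ln l - l) * t)) with
    ((gamma_argl x y - (y * ln y - y)) + ((y * ln y - y) - (l * (t * ln t) + (l * ln l - l) * t))) by ring.
  eapply Rle_trans; [apply Rabs_triang|]. nra.
Qed.

Definition main_slope (Q : R) (r : nat) (lam : nat -> R) : R :=
  ln Q + Rsum_lt r (fun j => lam j * ln (lam j) - lam j).

Definition main_term (Q : R) (r : nat) (lam : nat -> R) (t : R) : R :=
  Rsum_lt r lam * (t * ln t) + main_slope Q r lam * t.

(** Negative heights reduce to positive ones by oddness of [gamma_argl] in the ordinate, with
    [Im (mu j)] changing sign; the shift by [Im (mu j)] enters only the error, hence the same main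
    term on both sides. *)
Lemma gamma_sum_asymp (r : nat) (lam : nat -> R) (mu : nat -> C) (x : R) :
  (forall j, (j < r)%nat -> lam j > 0 /\ Re (mu j) >= 0) -> 0 < x ->
  exists K t1, 0 <= K /\ 3 <= t1 /\ forall t, t1 <= t ->
   Rabs (Rsum_lt r (fun j => gamma_argl (lam j * x + Re (mu j)) (lam j * t + Im (mu j))) -
      (Rsum_lt r lam * (t * ln t) + Rsum_lt r (fun j => lam j * ln (lam j) - lam j) * t)) <= K * ln t /\
   Rabs (Rsum_lt r (fun j => gamma_argl (lam j * x + Re (mu j)) (lam j * (- t) + Im (mu j))) +
      (Rsum_lt r lam * (t * ln t) + Rsum_lt r (fun j => lam j * ln (lam j) - lam j) * t)) <= K * ln t.
Proof.
  intros Hlam Hx. induction r as [|r IH]; cbn [Rsum_lt].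
  - exists 0, 3. split; [lra|split; [lra|]]. intros t Ht.
    replace (0 - (0 * (t * ln t) + 0 * t)) with 0 by ring. replace (0 + (0 * (t * ln t) + 0 * t)) with 0 by ring.
    rewrite Rabs_R0. lra.
  - destruct IH as (K & t1 & HK & Ht1 & A); [intros; apply Hlam; lia|].
    destruct (Hlam r ltac:(lia)) as [Hl Hm]. assert (Hlx : 0 < lam r * x) by (apply Rmult_lt_0_compat; lra).
    destruct (gamma_line_asymp (lam r * x + Re (mu r)) (lam r) (Im (mu r))) as (K1 & u1 & HK1 & Hu1 & B1); try lra.
    destruct (gamma_line_asymp (lam r * x + Re (mu r)) (lam r) (- Im (mu r))) as (K2 & u2 & HK2 & Hu2 & B2); try lra.
    exists (K + K1 + K2), (Rmax t1 (Rmax u1 u2)).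
    assert (M1 := Rmax_l t1 (Rmax u1 u2)). assert (M2 := Rmax_r t1 (Rmax u1 u2)).
    assert (M3 := Rmax_l u1 u2). assert (M4 := Rmax_r u1 u2).
    split; [lra|split; [lra|]]. intros t Ht. destruct (A t ltac:(lra)) as [A1 A2].
    specialize (B1 t ltac:(lra)). specialize (B2 t ltac:(lra)).
    replace (lam r * t + - Im (mu r)) with (- (lam r * - t + Im (mu r))) in B2 by ring.
    rewrite gamma_argl_odd in B2 by lra.
    assert (Hlnt : 1 <= ln t).
    { rewrite <- (ln_exp 1). apply ln_mono; [apply exp_pos|]. generalize exp_le_3. lra. }
    apply Rabs_le_between in A1. apply Rabs_le_between in A2. apply Rabs_le_between in B1. apply Rabs_le_between in B2.
    assert (0 <= K1 * ln t) by nra. assert (0 <= K2 * ln t) by nra.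
    split; apply Rabs_le; lra.
Qed.

Lemma continuous_Rsum_lt (n : nat) (f : nat -> R -> R) (t : R) :
  (forall j, (j < n)%nat -> continuous (f j) t) -> continuous (fun t => Rsum_lt n (fun j => f j t)) t.
Proof.
  intros H. induction n as [|n IH]; cbn [Rsum_lt]; [apply continuous_const|].
  apply (continuous_plus (V := R_NormedModule) (fun t => Rsum_lt n (fun j => f j t))); auto.
Qed.

Lemma continuous_affine (a b t : R) : continuous (fun t => a * t + b) t.
Proof.
  apply (ex_derive_continuous (V := R_NormedModule) (fun t => a * t + b)). auto_derive. auto.
Qed.

Lemma continuous_atan_comp (u : R -> R) (t : R) : continuous u t -> continuous (fun t => atan (u t)) t.
Proof.
  intros H. apply (continuous_comp u atan); auto.
  apply (ex_derive_continuous (V := R_NormedModule) atan). auto_derive. auto.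
Qed.

(** Right of 1, [F] is the entire function [(s - 1)^m F] divided by a nonvanishing power. *)
Lemma pole_cond_cts (F : C -> C) (m : nat) (s : C) : pole_cond F m -> 1 < Re s -> Ccts F s.
Proof.
  intros (G & HG & _ & E) Hs.
  apply Ccts_loc with (f := fun s => (G s * / Cpow (s - 1) m)%C) (r := Re s - 1); [lra| |].
  - intros w Hw. assert (Hr : Rabs (Re w - Re s) <= Cmod (w - s)%C) by apply (re_le_Cmod (w - s)%C).
    assert (Hw1 : 1 < Re w).
    { assert (A := Rle_abs (- (Re w - Re s))). rewrite Rabs_Ropp in A. lra. }
    assert (N : w <> RtoC 1) by (intros ->; unfold Re in Hw1; simpl in Hw1; lra).
    rewrite E, Cpown_Cpow by auto. field. apply Cpow_nz, Cminus_neq; auto.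
  - apply Cdiff_cts, Cdiff_mult; [apply Cder_ex_derive, HG|].
    apply Cdiff_inv.
    + apply (Cdiff_Cpow (fun s => (s - 1)%C)), Cdiff_minus; [apply Cdiff_id|apply Cdiff_const].
    + apply Cpow_nz, Cminus_neq. intros ->. unfold Re in Hs; simpl in Hs; lra.
Qed.

(** The argument is a sum of explicit continuous arguments of the factors, defined for all [t]; it
    is tied to [X] only beyond the finitely many bad heights. All factors except [Q^s] and the Gamma
    functions contribute a bounded amount. *)
Lemma xi_arg (X F : C -> C) (m : nat) (Q : R) (r : nat) (lam : nat -> R) (mu : nat -> C) (s0 b : R) : Q > 0 ->
  (forall j, (j < r)%nat -> lam j > 0 /\ Re (mu j) >= 0) -> is_xi X F m Q r lam mu ->
  pole_cond F m -> 1 < s0 -> (forall s, s0 <= Re s -> Cmod (F s - 1)%C <= / 2) -> s0 <= b ->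
  exists A K t1, 3 <= t1 /\ 0 <= K /\ (forall t, continuous A t) /\
    (forall t, t1 <= Rabs t -> has_arg (X (/ 2 + b, t)) (A t)) /\
    forall t, t1 <= t -> Rabs (A t - main_term Q r lam t) <= K * ln t /\ Rabs (A (- t) + main_term Q r lam t) <= K * ln t.
Proof.
  intros HQ Hlam [_ Hxi] Hp Hs0 HF Hb.
  set (x := / 2 + b). assert (Hx : 1 < x) by (unfold x; lra).
  assert (HFre : forall t, / 2 <= Re (F (x, t))).
  { intros t. specialize (HF (x, t) ltac:(unfold Re, x; simpl; lra)).
    assert (A : Rabs (Re (F (x, t)) - 1) <= Cmod (F (x, t) - 1)%C) by apply (re_le_Cmod (F (x, t) - 1)%C).
    assert (B : Rabs (Re (F (x, t)) - 1) <= / 2) by lra. apply Rabs_le_between in B. lra. }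
  set (A := fun t => INR m * atan (t / x) + INR m * atan (t / (x - 1)) + ((atan (Im (F (x, t)) / Re (F (x, t))) + ln Q * t)
     + Rsum_lt r (fun j => gamma_argl (lam j * x + Re (mu j)) (lam j * t + Im (mu j))))).
  destruct (good_far r lam mu Hlam) as (t0 & Ht0 & Hgood).
  destruct (gamma_sum_asymp r lam mu x Hlam ltac:(lra)) as (K & t1 & HK & Ht1 & HA).
  assert (HP := PI_RGT_0). assert (Pm := pos_INR m).
  exists A, (K + (2 * INR m + 1) * PI), (Rmax t0 t1).
  assert (M1 := Rmax_l t0 t1). assert (M2 := Rmax_r t0 t1).
  split; [lra|split; [nra|split; [|split]]].
  - intros t. unfold A.
    assert (HFc : Rcc (fun t => F (x, t)) t).
    { apply Rcc_vertical, (pole_cond_cts F m); auto. }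
    assert (HFn : Re (F (x, t)) <> 0) by (apply Rgt_not_eq, Rlt_gt, Rlt_le_trans with (/ 2); [lra|apply HFre]).
    apply (continuous_plus (V := R_NormedModule) (fun t => INR m * atan (t / x) + INR m * atan (t / (x - 1)))).
    { apply (ex_derive_continuous (V := R_NormedModule) (fun t => INR m * atan (t / x) + INR m * atan (t / (x - 1)))).
      generalize (INR m). intros c. auto_derive. auto. }
    apply (continuous_plus (V := R_NormedModule) (fun t => atan (Im (F (x, t)) / Re (F (x, t))) + ln Q * t)).
    + apply (continuous_plus (V := R_NormedModule) (fun t => atan (Im (F (x, t)) / Re (F (x, t)))) (fun t => ln Q * t)).
      * apply continuous_atan_comp. apply (continuous_mult (K := R_AbsRing) (fun t => Im (F (x, t))) (fun t => / Re (F (x, t)))).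
        -- apply HFc.
        -- apply (continuous_comp (fun t => Re (F (x, t))) Rinv); [apply HFc|].
           apply continuity_pt_filterlim, continuity_pt_inv; [apply continuity_pt_id|exact HFn].
      * apply (ex_derive_continuous (V := R_NormedModule) (fun t => ln Q * t)). generalize (ln Q). intros c. auto_derive. auto.
    + apply (continuous_Rsum_lt r (fun j t => gamma_argl (lam j * x + Re (mu j)) (lam j * t + Im (mu j)))). intros j Hj.
      destruct (Hlam j Hj) as [Hl Hm]. assert (0 < lam j * x) by (apply Rmult_lt_0_compat; lra).
      apply (continuous_comp (fun t => lam j * t + Im (mu j)) (gamma_argl (lam j * x + Re (mu j)))).
      * apply continuous_affine.
      * apply gamma_argl_continuous. lra.
  - intros t Ht. fold x. rewrite Hxi by (apply good_regular, Hgood; lra). unfold phi, A.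
    repeat apply has_arg_mult.
    + apply has_arg_Cpown, has_arg_right; lra.
    + apply has_arg_Cpown. replace ((x, t) - 1)%C with ((x - 1)%R, t) by (apply Ceq; unfold Re, Im; simpl; ring).
      apply has_arg_right; lra.
    + apply has_arg_Re. apply Rlt_le_trans with (/ 2); [lra|apply HFre].
    + unfold Rcpow. apply (has_arg_pos (exp (ln Q * x))); [left; apply exp_pos|].
      rewrite <- Cexp_RtoC, <- Cexp_plus. f_equal. apply Ceq; unfold Re, Im; simpl; ring.
    + apply has_arg_gamma_prod; auto. lra.
  - intros t Ht. destruct (HA t ltac:(lra)) as [A1 A2].
    assert (Hlnt : 1 <= ln t).
    { rewrite <- (ln_exp 1). apply ln_mono; [apply exp_pos|]. generalize exp_le_3. lra. }
    assert (Hat : forall v, - (PI / 2) <= atan v <= PI / 2) by (intros v; generalize (atan_bound v); lra).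
    assert (Hbd : forall t, Rabs (INR m * atan (t / x) + INR m * atan (t / (x - 1)) + atan (Im (F (x, t)) / Re (F (x, t)))) <= (2 * INR m + 1) * PI).
    { intros u. assert (B1 := Hat (u / x)). assert (B2 := Hat (u / (x - 1))). assert (B3 := Hat (Im (F (x, u)) / Re (F (x, u)))).
      apply Rabs_le. split; nra. }
    assert (Hb1 := Hbd t). assert (Hb2 := Hbd (- t)).
    assert (Hln : (2 * INR m + 1) * PI <= (2 * INR m + 1) * PI * ln t).
    { rewrite <- (Rmult_1_r ((2 * INR m + 1) * PI)) at 1. apply Rmult_le_compat_l; [nra|auto]. }
    unfold main_term, main_slope.
    apply Rabs_le_between in A1. apply Rabs_le_between in A2. apply Rabs_le_between in Hb1. apply Rabs_le_between in Hb2.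
    unfold A. set (S1 := Rsum_lt r lam * (t * ln t)) in *.
    split; apply Rabs_le; lra.
Qed.

(** * Counting zeros *)

(** For [x <> 0] the limit of [atan (x / b)] as [b] decreases to 0; the value at 0 is chosen so that
    differences count the half-open interval [(T1, T2]]. *)
Definition step (x : R) : R := if Rle_dec 0 x then PI / 2 else - (PI / 2).

Definition indic (T1 T2 g : R) : R := if Rlt_dec T1 g then if Rle_dec g T2 then 1 else 0 else 0.

Lemma step_indic (T1 T2 g : R) : T1 <= T2 -> step (T2 - g) - step (T1 - g) = PI * indic T1 T2 g.
Proof.
  intros H. unfold step, indic.
  destruct (Rle_dec 0 (T2 - g)), (Rle_dec 0 (T1 - g)), (Rlt_dec T1 g), (Rle_dec g T2); lra.
Qed.

Lemma atan_inv_sum (x : R) : 0 < x -> atan x + atan (/ x) = PI / 2.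
Proof.
  intros H. rewrite (atan_inv x) by auto. ring.
Qed.

(** The mass that one zero puts on a window of length 2, bounded below; it has to dominate the tail
    of the smoothed count. *)
Lemma atan_diff_lower (b x : R) : 0 < b -> 2 * (b / (b * b + 2 * (x * x) + 2)) <= atan ((x + 1) / b) - atan ((x - 1) / b).
Proof.
  intros Hb.
  destruct (MVT_gen (fun u => atan (u / b)) (x - 1) (x + 1) (fun u => b / (b * b + u * u))) as (c & Hc & E).
  - intros u _. auto_derive; auto. assert (Hbu : 0 < b * b + u * u) by (assert (B0 := Rmult_lt_0_compat b b Hb Hb); assert (U0 := Rle_0_sqr u); unfold Rsqr in U0; lra). field. repeat split; lra.
  - intros u _. apply continuity_pt_filterlim.
    apply (ex_derive_continuous (V := R_NormedModule) (fun u => atan (u / b))). auto_derive; auto.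
  - rewrite Rmin_left, Rmax_right in Hc by lra. rewrite E.
    replace (x + 1 - (x - 1)) with 2 by ring. rewrite (Rmult_comm _ 2). apply Rmult_le_compat_l; [lra|].
    apply Rmult_le_compat_l; [lra|]. apply Rinv_le_contravar; [nra|].
    assert (c * c <= 2 * (x * x) + 2); [|lra].
    assert (0 <= (c - (x - 1)) * (x + 1 - c)) by (apply Rmult_le_pos; lra).
    assert (0 <= (2 * x - c) * (2 * x - c)) by apply Rle_0_sqr. lra.
Qed.

(* The combination [2 atan (x/b) - atan (x/2b)] cancels the [1/x] tail of the arctangent. *)
Lemma atan_comb_tail (b x : R) : 0 < b -> 0 <= x ->
  0 <= PI / 2 - (2 * atan (x / b) - atan (x / (2 * b))) <= 4 * PI * (b * b / (b * b + x * x)).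
Proof.
  intros Hb Hx. assert (HP := PI_RGT_0).
  (* Inversion of both arctangents turns the tail at infinity into [phi] at [y = b / x], and [phi']
     vanishes to second order at 0. For [y > 1] the trivial bound [phi <= PI] is used. *)
  set (phi := fun y => 2 * atan y - atan (2 * y)).
  assert (Dphi : forall y, is_derive phi y (6 * (y * y) * / ((1 + y * y) * (1 + 4 * (y * y))))).
  { intros y. unfold phi. auto_derive; auto. assert (Y0 := Rle_0_sqr y). unfold Rsqr in Y0. field. repeat split; nra. }
  assert (Cphi : forall y, continuity_pt phi y).
  { intros y. apply continuity_pt_filterlim. apply (ex_derive_continuous (V := R_NormedModule) phi). eexists; apply Dphi. }
  assert (P0 : phi 0 = 0) by (unfold phi; rewrite Rmult_0_r, atan_0; ring).
  destruct (Req_dec x 0) as [->|Hx0].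
  { replace (0 / b) with 0 by (field; lra). replace (0 / (2 * b)) with 0 by (field; lra). rewrite atan_0.
    replace (b * b / (b * b + 0 * 0)) with 1 by (field; lra). lra. }
  assert (Hxp : 0 < x) by lra. set (y := b / x). assert (Hy : 0 < y) by (apply Rdiv_lt_0_compat; auto).
  assert (E : PI / 2 - (2 * atan (x / b) - atan (x / (2 * b))) = phi y).
  { assert (A1 := atan_inv_sum (x / b) ltac:(apply Rdiv_lt_0_compat; auto)).
    assert (A2 := atan_inv_sum (x / (2 * b)) ltac:(apply Rdiv_lt_0_compat; lra)).
    replace (/ (x / b)) with y in A1 by (unfold y; field; lra).
    replace (/ (x / (2 * b))) with (2 * y) in A2 by (unfold y; field; lra). unfold phi. lra. }
  rewrite E.
  destruct (MVT_gen phi 0 y (fun y => 6 * (y * y) * / ((1 + y * y) * (1 + 4 * (y * y))))) as (c & Hc & Ec).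
  { intros; apply Dphi. } { intros; apply Cphi. }
  rewrite Rmin_left, Rmax_right in Hc by lra. rewrite P0, !Rminus_0_r in Ec.
  assert (Hden : 1 <= (1 + c * c) * (1 + 4 * (c * c))) by nra.
  assert (Hinv : 0 < / ((1 + c * c) * (1 + 4 * (c * c)))) by (apply Rinv_0_lt_compat; lra).
  assert (Hinv1 : / ((1 + c * c) * (1 + 4 * (c * c))) <= 1) by (rewrite <- Rinv_1; apply Rinv_le_contravar; lra).
  assert (Hpos : 0 <= phi y).
  { rewrite Ec. apply Rmult_le_pos; [|lra]. apply Rmult_le_pos; [|lra]. assert (0 <= c * c) by apply Rle_0_sqr. lra. }
  split; auto.
  replace (b * b / (b * b + x * x)) with (y * y / (1 + y * y)).
  2:{ unfold y. assert (X0 := Rmult_lt_0_compat x x Hxp Hxp). assert (B0 := Rmult_lt_0_compat b b Hb Hb). field. repeat split; lra. }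
  assert (Hy2 : 0 < 1 + y * y) by nra.
  apply Rmult_le_reg_r with (1 + y * y); auto.
  replace (4 * PI * (y * y / (1 + y * y)) * (1 + y * y)) with (4 * PI * (y * y)) by (field; lra).
  destruct (Rle_dec y 1) as [L|L].
  - assert (B : phi y <= 6 * (y * y)).
    { rewrite Ec. apply Rle_trans with (6 * (c * c) * 1 * y).
      - apply Rmult_le_compat_r; [lra|]. apply Rmult_le_compat_l; [nra|auto].
      - assert (Q1 : c * c <= y * y) by (apply Rmult_le_compat; lra). assert (Q0 : 0 <= c * c) by apply Rle_0_sqr.
        assert (Q2 : c * c * y <= y * y * 1) by (apply Rmult_le_compat; lra). lra. }
    assert (3 < PI) by (generalize PI2_3_2; unfold PI2; lra).
    assert (Q0 : 0 <= y * y) by apply Rle_0_sqr. assert (3 * (y * y) <= PI * (y * y)) by (apply Rmult_le_compat_r; lra).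
    assert (Q1 : y * y <= 1 * 1) by (apply Rmult_le_compat; lra).
    assert (phi y * (1 + y * y) <= 6 * (y * y) * 2) by (apply Rmult_le_compat; lra). lra.
  - assert (B : phi y <= PI).
    { unfold phi. assert (B1 := atan_bound y). assert (B2 := atan_nonneg (2 * y) ltac:(lra)). lra. }
    assert (Q1 : 1 * 1 <= y * y) by (apply Rmult_le_compat; lra).
    assert (phi y * (1 + y * y) <= PI * (1 + y * y)) by (apply Rmult_le_compat_r; lra).
    assert (PI * 1 <= PI * (y * y)) by (apply Rmult_le_compat_l; lra). lra.
Qed.

(** Both sides decay like [1 / x^2]. Summed over the zeros, the right side is an increment of the
    arctangent sum, which the argument of [X] bounds by [O(ln T)]; the sharp count thus follows from
    the smooth one. *)
Lemma step_atan (b x : R) : 1 <= b ->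
  Rabs (step x - (2 * atan (x / b) - atan (x / (2 * b)))) <= 8 * PI * b * (atan ((x + 1) / b) - atan ((x - 1) / b)).
Proof.
  intros Hb. assert (HP := PI_RGT_0).
  assert (L := atan_diff_lower b x ltac:(lra)).
  set (p := atan ((x + 1) / b) - atan ((x - 1) / b)) in *.
  assert (K : 4 * PI * (b * b / (b * b + x * x)) <= 8 * PI * b * p).
  { apply Rle_trans with (8 * PI * b * (2 * (b / (b * b + 2 * (x * x) + 2)))).
    - replace (8 * PI * b * (2 * (b / (b * b + 2 * (x * x) + 2)))) with (4 * PI * (b * b * (4 / (b * b + 2 * (x * x) + 2)))) by (field; nra).
      apply Rmult_le_compat_l; [lra|]. apply Rmult_le_compat_l; [nra|].
      apply Rmult_le_reg_r with ((b * b + x * x) * (b * b + 2 * (x * x) + 2)); [apply Rmult_lt_0_compat; nra|].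
      replace (/ (b * b + x * x) * ((b * b + x * x) * (b * b + 2 * (x * x) + 2))) with (b * b + 2 * (x * x) + 2) by (field; nra).
      replace (4 / (b * b + 2 * (x * x) + 2) * ((b * b + x * x) * (b * b + 2 * (x * x) + 2))) with (4 * (b * b + x * x)) by (field; nra).
      nra.
    - apply Rmult_le_compat_l; [nra|auto]. }
  unfold step. destruct (Rle_dec 0 x) as [H|H].
  - destruct (atan_comb_tail b x ltac:(lra) H) as [A B]. rewrite Rabs_right; lra.
  - destruct (atan_comb_tail b (- x) ltac:(lra) ltac:(lra)) as [A B].
    replace (- x / b) with (- (x / b)) in A, B by (field; lra). replace (- x / (2 * b)) with (- (x / (2 * b))) in A, B by (field; lra).
    rewrite !atan_opp in A, B. replace (- x * - x) with (x * x) in B by ring.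
    rewrite Rabs_left1; lra.
Qed.

Lemma Rlsum_ext (f g : C -> R) (l : list C) : (forall z, In z l -> f z = g z) -> Rlsum f l = Rlsum g l.
Proof.
  induction l as [|z l IH]; intros H; simpl; auto. rewrite H, IH; auto; [intros; apply H; right; auto|left; auto].
Qed.

Lemma Rlsum_plus (f g : C -> R) (l : list C) : Rlsum (fun z => f z + g z) l = Rlsum f l + Rlsum g l.
Proof. induction l as [|z l IH]; simpl; [ring|rewrite IH; ring]. Qed.

Lemma Rlsum_scal (c : R) (f : C -> R) (l : list C) : Rlsum (fun z => c * f z) l = c * Rlsum f l.
Proof. induction l as [|z l IH]; simpl; [ring|rewrite IH; ring]. Qed.

Lemma Rlsum_minus (f g : C -> R) (l : list C) : Rlsum (fun z => f z - g z) l = Rlsum f l - Rlsum g l.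
Proof. induction l as [|z l IH]; simpl; [ring|rewrite IH; ring]. Qed.

Lemma Rlsum_le (f g : C -> R) (l : list C) : (forall z, In z l -> f z <= g z) -> Rlsum f l <= Rlsum g l.
Proof.
  induction l as [|z l IH]; intros H; simpl; [lra|].
  assert (f z <= g z) by (apply H; left; auto). assert (Rlsum f l <= Rlsum g l) by (apply IH; intros; apply H; right; auto). lra.
Qed.

Lemma Rlsum_abs (f : C -> R) (l : list C) : Rabs (Rlsum f l) <= Rlsum (fun z => Rabs (f z)) l.
Proof.
  induction l as [|z l IH]; simpl; [rewrite Rabs_R0; lra|].
  eapply Rle_trans; [apply Rabs_triang|]. lra.
Qed.

Lemma Rlsum_filter (f : C -> R) (p : C -> bool) (l : list C) :
  (forall z, In z l -> p z = false -> f z = 0) -> Rlsum f (filter p l) = Rlsum f l.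
Proof.
  induction l as [|z l IH]; intros H; simpl; auto.
  assert (IH' : Rlsum f (filter p l) = Rlsum f l) by (apply IH; intros; apply H; auto; right; auto).
  destruct (p z) eqn:E; simpl; rewrite IH'; auto. rewrite (H z); auto; [ring|left; auto].
Qed.

Lemma Rlsum_zeros_stable (X : C -> C) (f : C -> R) (W W' : R) (l l' : list C) : W <= W' ->
  zeros_upto X W l -> zeros_upto X W' l' -> (forall z, W < Rabs (Im z) -> f z = 0) -> Rlsum f l = Rlsum f l'.
Proof.
  intros HW Hl Hl' Hf. rewrite <- (Rlsum_filter f (im_le W) l').
  - apply Rlsum_perm. eapply zeros_upto_perm; eauto. eapply zeros_upto_filter; eauto.
  - intros z _ Hz. apply Hf. unfold im_le in Hz. destruct (Rle_dec (Rabs (Im z)) W); [discriminate|lra].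
Qed.

(** [ord] stands for [Im] or its negative, so that zeros above and below the real axis are treated
    by one argument. *)
Definition arg_limit (X : C -> C) (ord : C -> R) (b t1 : R) (A : R -> R) : Prop :=
  forall T1 T2, t1 <= T1 -> T1 <= T2 -> forall eps, 0 < eps -> exists W0, 0 <= W0 /\ forall W l, W0 <= W -> zeros_upto X W l ->
    Rabs (Rlsum (fun z => atan ((T2 - ord z) / b)) l - Rlsum (fun z => atan ((T1 - ord z) / b)) l - (A T2 - A T1)) <= eps.

Lemma ln_ge1 (t : R) : 3 <= t -> 1 <= ln t.
Proof.
  intros H. rewrite <- (ln_exp 1). apply ln_mono; [apply exp_pos|]. generalize exp_le_3. lra.
Qed.

Lemma ln_succ_le (T : R) : 3 <= T -> ln (T + 1) <= 2 * ln T.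
Proof.
  intros H. replace (2 * ln T) with (ln (T * T)) by (rewrite ln_mult; lra). apply ln_mono; nra.
Qed.

Lemma main_increment (D k T : R) : 0 <= D -> 4 <= T ->
  (D * ((T + 1) * ln (T + 1)) + k * (T + 1)) - (D * ((T - 1) * ln (T - 1)) + k * (T - 1)) <= (6 * D + 2 * Rabs k) * ln T.
Proof.
  intros HD HT. assert (L1 := ln_ge1 T ltac:(lra)). assert (L2 := ln_succ_le T ltac:(lra)).
  assert (L3 : ln (T + 1) - ln (T - 1) <= 2 / (T - 1)).
  { assert (E : ln (T + 1) - ln (T - 1) = ln ((T + 1) / (T - 1))).
    { unfold Rdiv. rewrite ln_mult, ln_Rinv; try lra. apply Rinv_0_lt_compat; lra. }
    rewrite E. eapply Rle_trans; [apply ln_le_sub1; apply Rdiv_lt_0_compat; lra|]. right. field. lra. }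
  assert (L4 : (T - 1) * (ln (T + 1) - ln (T - 1)) <= 2).
  { apply Rle_trans with ((T - 1) * (2 / (T - 1))); [apply Rmult_le_compat_l; lra|right; field; lra]. }
  replace ((D * ((T + 1) * ln (T + 1)) + k * (T + 1)) - (D * ((T - 1) * ln (T - 1)) + k * (T - 1)))
    with (D * ((T - 1) * (ln (T + 1) - ln (T - 1)) + 2 * ln (T + 1)) + 2 * k) by ring.
  assert (D * ((T - 1) * (ln (T + 1) - ln (T - 1)) + 2 * ln (T + 1)) <= D * (6 * ln T)) by (apply Rmult_le_compat_l; lra).
  assert (Hk := Rle_abs k). assert (Hk2 := Rabs_pos k). nra.
Qed.

Lemma counting (X : C -> C) (ord : C -> R) (b t1 K D k : R) (A1 A2 : R -> R) : 1 <= b -> 3 <= t1 -> 0 <= K -> 0 <= D ->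
  (forall z, Rabs (ord z) = Rabs (Im z)) -> (forall W, 0 <= W -> exists l, zeros_upto X W l) ->
  arg_limit X ord b t1 A1 -> arg_limit X ord (2 * b) t1 A2 ->
  (forall t, t1 <= t -> Rabs (A1 t - (D * (t * ln t) + k * t)) <= K * ln t) ->
  (forall t, t1 <= t -> Rabs (A2 t - (D * (t * ln t) + k * t)) <= K * ln t) ->
  exists K', 0 <= K' /\ forall T1 T2 W l, t1 + 1 <= T1 -> T1 <= T2 -> T2 <= W -> zeros_upto X W l ->
    Rabs (PI * Rlsum (fun z => indic T1 T2 (ord z)) l - ((D * (T2 * ln T2) + k * T2) - (D * (T1 * ln T1) + k * T1))) <= K' * ln T2.
Proof.
  intros Hb Ht1 HK HD Hord Hex H1 H2 HA1 HA2. assert (HP := PI_RGT_0).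
  set (c := 8 * PI * b). assert (Hc : 0 <= c) by (unfold c; nra).
  set (P := 6 * D + 2 * Rabs k + 4 * K + 1).
  assert (HPp : 0 <= P) by (unfold P; generalize (Rabs_pos k); lra).
  exists (2 * c * P + 6 * K + 3). split; [nra|].
  intros T1 T2 W l HT1 HT12 HTW Hl.
  destruct (H1 T1 T2 ltac:(lra) HT12 1 Rlt_0_1) as (W1 & _ & B1).
  destruct (H2 T1 T2 ltac:(lra) HT12 1 Rlt_0_1) as (W2 & _ & B2).
  destruct (H1 (T1 - 1) (T1 + 1) ltac:(lra) ltac:(lra) 1 Rlt_0_1) as (W3 & _ & B3).
  destruct (H1 (T2 - 1) (T2 + 1) ltac:(lra) ltac:(lra) 1 Rlt_0_1) as (W4 & _ & B4).
  (* The count in [(T1, T2]] does not change when the list is enlarged to a height where all four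
     arctangent limits are within 1. *)
  set (W' := Rmax W (Rmax (Rmax W1 W2) (Rmax W3 W4))).
  assert (HW' : W <= W' /\ W1 <= W' /\ W2 <= W' /\ W3 <= W' /\ W4 <= W').
  { unfold W'. assert (Q1 := Rmax_l W (Rmax (Rmax W1 W2) (Rmax W3 W4))). assert (Q2 := Rmax_r W (Rmax (Rmax W1 W2) (Rmax W3 W4))).
    assert (Q3 := Rmax_l (Rmax W1 W2) (Rmax W3 W4)). assert (Q4 := Rmax_r (Rmax W1 W2) (Rmax W3 W4)).
    assert (Q5 := Rmax_l W1 W2). assert (Q6 := Rmax_r W1 W2). assert (Q7 := Rmax_l W3 W4). assert (Q8 := Rmax_r W3 W4).
    repeat split; lra. }
  destruct HW' as (V0 & V1 & V2 & V3 & V4). clearbody W'.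
  destruct (Hex W' ltac:(lra)) as [l' Hl'].
  specialize (B1 W' l' V1 Hl'). specialize (B2 W' l' V2 Hl'). specialize (B3 W' l' V3 Hl'). specialize (B4 W' l' V4 Hl').
  rewrite (Rlsum_zeros_stable X (fun z => indic T1 T2 (ord z)) W W' l l'); auto.
  2:{ intros z Hz. rewrite <- Hord in Hz. unfold indic. destruct (Rlt_dec T1 (ord z)); auto. destruct (Rle_dec (ord z) T2); auto.
      rewrite Rabs_right in Hz by lra. lra. }
  set (S := fun b T => Rlsum (fun z => atan ((T - ord z) / b)) l').
  fold (S b T1) (S b T2) in B1. fold (S (2 * b) T1) (S (2 * b) T2) in B2.
  fold (S b (T1 + 1)) (S b (T1 - 1)) in B3. fold (S b (T2 + 1)) (S b (T2 - 1)) in B4.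
  assert (HN : PI * Rlsum (fun z => indic T1 T2 (ord z)) l' = Rlsum (fun z => step (T2 - ord z)) l' - Rlsum (fun z => step (T1 - ord z)) l').
  { rewrite <- Rlsum_scal, <- Rlsum_minus. apply Rlsum_ext. intros z _. symmetry. apply step_indic; auto. }
  assert (HS : forall T, Rabs (Rlsum (fun z => step (T - ord z)) l' - (2 * S b T - S (2 * b) T)) <= c * (S b (T + 1) - S b (T - 1))).
  { intros T. unfold S. rewrite <- Rlsum_scal, <- !Rlsum_minus, <- Rlsum_scal.
    eapply Rle_trans; [apply Rlsum_abs|]. apply Rlsum_le. intros z _.
    replace (T + 1 - ord z) with (T - ord z + 1) by ring. replace (T - 1 - ord z) with (T - ord z - 1) by ring.
    apply step_atan; auto. }
  assert (HInc : forall T, t1 + 1 <= T -> Rabs (S b (T + 1) - S b (T - 1) - (A1 (T + 1) - A1 (T - 1))) <= 1 ->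
     S b (T + 1) - S b (T - 1) <= P * ln T).
  { intros T HT HB. assert (G1 := HA1 (T + 1) ltac:(lra)). assert (G2 := HA1 (T - 1) ltac:(lra)).
    assert (M := main_increment D k T HD ltac:(lra)). assert (L1 := ln_ge1 T ltac:(lra)). assert (L2 := ln_succ_le T ltac:(lra)).
    assert (L3 : ln (T - 1) <= ln T) by (apply ln_mono; lra).
    assert (K * ln (T + 1) <= K * (2 * ln T)) by (apply Rmult_le_compat_l; auto).
    assert (K * ln (T - 1) <= K * ln T) by (apply Rmult_le_compat_l; auto).
    assert (0 <= K * ln T) by (apply Rmult_le_pos; lra).
    apply Rabs_le_between in G1. apply Rabs_le_between in G2. apply Rabs_le_between in HB. unfold P. lra. }
  assert (I1 := HInc T1 HT1 B3). assert (I2 := HInc T2 ltac:(lra) B4).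
  assert (J1 := HS T1). assert (J2 := HS T2).
  assert (c * (S b (T1 + 1) - S b (T1 - 1)) <= c * (P * ln T1)) by (apply Rmult_le_compat_l; auto).
  assert (c * (S b (T2 + 1) - S b (T2 - 1)) <= c * (P * ln T2)) by (apply Rmult_le_compat_l; auto).
  assert (L1 := ln_ge1 T1 ltac:(lra)). assert (L12 : ln T1 <= ln T2) by (apply ln_mono; lra).
  assert (c * (P * ln T1) <= c * (P * ln T2)) by (apply Rmult_le_compat_l; auto; apply Rmult_le_compat_l; auto).
  assert (G1 := HA1 T1 ltac:(lra)). assert (G2 := HA1 T2 ltac:(lra)). assert (G3 := HA2 T1 ltac:(lra)). assert (G4 := HA2 T2 ltac:(lra)).
  assert (K * ln T1 <= K * ln T2) by (apply Rmult_le_compat_l; auto).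
  set (m1 := D * (T1 * ln T1) + k * T1) in *. set (m2 := D * (T2 * ln T2) + k * T2) in *.
  apply Rabs_le_between in G1. apply Rabs_le_between in G2. apply Rabs_le_between in G3. apply Rabs_le_between in G4.
  apply Rabs_le_between in J1. apply Rabs_le_between in J2. apply Rabs_le_between in B1. apply Rabs_le_between in B2.
  rewrite HN. apply Rabs_le. lra.
Qed.

(** * Abel summation against the counting function *)

Lemma is_RInt_zero (a b : R) : is_RInt (fun _ : R => 0) a b 0.
Proof.
  assert (E := is_RInt_const (V := R_NormedModule) a b 0).
  assert (E0 : scal (b - a) (0 : R_NormedModule) = 0) by (unfold scal; simpl; unfold mult; simpl; ring).
  rewrite E0 in E. exact E.
Qed.

Lemma is_RInt_step (f f' : R -> R) (V U g : R) : V <= U ->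
  (forall t, V <= t <= U -> is_derive f t (f' t)) -> (forall t, V <= t <= U -> continuous f' t) ->
  is_RInt (fun t => indic V t g * f' t) V U (indic V U g * (f U - f g)).
Proof.
  intros HVU Hd Hc.
  assert (Z := is_RInt_zero).
  unfold indic at 2. destruct (Rlt_dec V g) as [H1|H1].
  2:{ rewrite Rmult_0_l. apply (is_RInt_ext (fun _ => 0)); auto. intros t _. unfold indic.
      destruct (Rlt_dec V g); [lra|]. symmetry; apply Rmult_0_l. }
  destruct (Rle_dec g U) as [H2|H2].
  - rewrite Rmult_1_l. replace (f U - f g) with (plus 0 (f U - f g)) by (unfold plus; simpl; ring).
    apply (is_RInt_Chasles (V := R_NormedModule) _ V g U).
    + apply (is_RInt_ext (fun _ => 0)); auto. rewrite Rmin_left, Rmax_right by lra. intros t Ht. unfold indic.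
      destruct (Rlt_dec V g), (Rle_dec g t); try lra; symmetry; apply Rmult_0_l.
    + apply (is_RInt_ext f').
      * rewrite Rmin_left, Rmax_right by lra. intros t Ht. unfold indic.
        destruct (Rlt_dec V g), (Rle_dec g t); try lra; symmetry; apply Rmult_1_l.
      * apply (is_RInt_derive (V := R_CompleteNormedModule) f f'); rewrite Rmin_left, Rmax_right by lra; intros; [apply Hd|apply Hc]; lra.
  - rewrite Rmult_0_l. apply (is_RInt_ext (fun _ => 0)); auto. rewrite Rmin_left, Rmax_right by lra. intros t Ht. unfold indic.
    destruct (Rlt_dec V g), (Rle_dec g t); try lra; symmetry; apply Rmult_0_l.
Qed.

Lemma is_RInt_count (f f' : R -> R) (V U : R) (ord : C -> R) (l : list C) : V <= U ->
  (forall t, V <= t <= U -> is_derive f t (f' t)) -> (forall t, V <= t <= U -> continuous f' t) ->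
  is_RInt (fun t => Rlsum (fun z => indic V t (ord z)) l * f' t) V U (Rlsum (fun z => indic V U (ord z) * (f U - f (ord z))) l).
Proof.
  intros HVU Hd Hc. induction l as [|z l IH]; simpl.
  - apply (is_RInt_ext (fun _ => 0)); [intros; symmetry; apply Rmult_0_l|].
    apply is_RInt_zero.
  - apply (is_RInt_ext (fun t => indic V t (ord z) * f' t + Rlsum (fun z => indic V t (ord z)) l * f' t)); [intros; symmetry; apply Rmult_plus_distr_r|].
    apply (is_RInt_plus (V := R_NormedModule)); auto. apply is_RInt_step; auto.
Qed.

(** The sum over zeros is moved onto [f'], the counting function is replaced by the increment of
    [M / PI] up to [O(ln t)], and the main part is moved back by parts. The integrated error
    [K n ln t / t^2] and the boundary term at [U] together telescope to the value of
    [(ln t + 1) / t] at [V], so the bound is free of [U]. *)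
Lemma abel_sum (f f' M m : R -> R) (V U K n : R) (ord : C -> R) (l : list C) : 3 <= V -> V <= U -> 0 <= K -> 0 <= n ->
  (forall t, V <= t <= U -> is_derive f t (f' t)) -> (forall t, V <= t <= U -> continuous f' t) ->
  (forall t, V <= t <= U -> is_derive M t (m t)) -> (forall t, V <= t <= U -> continuous m t) ->
  (forall t, V <= t <= U -> Rabs (f t) <= n / t) -> (forall t, V <= t <= U -> Rabs (f' t) <= n / (t * t)) ->
  (forall t, V <= t <= U -> Rabs (PI * Rlsum (fun z => indic V t (ord z)) l - (M t - M V)) <= K * ln t) ->
  Rabs (PI * Rlsum (fun z => indic V U (ord z) * f (ord z)) l - RInt (fun t => m t * f t) V U) <= K * n * ((ln V + 1) / V).
Proof.
  intros HV HVU HK Hn Hf Hf' HM Hm Bf Bf' BN.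
  assert (I1 := is_RInt_count f f' V U ord l HVU Hf Hf').
  set (N := fun t => Rlsum (fun z => indic V t (ord z)) l) in *.
  assert (Cf : forall t, V <= t <= U -> continuous f t).
  { intros t Ht. apply (ex_derive_continuous (V := R_NormedModule) f). eexists; apply Hf; auto. }
  assert (CM : forall t, V <= t <= U -> continuous M t).
  { intros t Ht. apply (ex_derive_continuous (V := R_NormedModule) M). eexists; apply HM; auto. }
  assert (Emf : ex_RInt (fun t => m t * f t) V U).
  { apply (ex_RInt_continuous (V := R_CompleteNormedModule)). rewrite Rmin_left, Rmax_right by auto. intros t Ht.
    apply (continuous_mult (K := R_AbsRing) m f); auto. }
  set (I := RInt (fun t => m t * f t) V U).
  assert (I2 : is_RInt (fun t => m t * f t) V U I) by (apply (RInt_correct (V := R_CompleteNormedModule)); auto).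
  assert (I3 : is_RInt (fun t => m t * f t + (M t - M V) * f' t) V U ((M U - M V) * f U - (M V - M V) * f V)).
  { apply (is_RInt_derive (V := R_CompleteNormedModule) (fun t => (M t - M V) * f t)); rewrite Rmin_left, Rmax_right by auto; intros t Ht.
    - assert (D := is_derive_mult (fun t => M t - M V) f t (m t) (f' t)).
      apply D.
      + replace (m t) with (minus (m t) 0) by (unfold minus, plus, opp; simpl; ring).
        apply (is_derive_minus (V := R_NormedModule) M (fun _ => M V)); auto. apply (is_derive_const (V := R_NormedModule)).
      + apply Hf; auto.
      + intros; apply Rmult_comm.
    - apply (continuous_plus (V := R_NormedModule) (fun t => m t * f t)).
      + apply (continuous_mult (K := R_AbsRing) m f); auto.
      + apply (continuous_mult (K := R_AbsRing) (fun t => M t - M V) f'); auto.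
        apply (continuous_minus (V := R_NormedModule) M (fun _ => M V)); auto. apply continuous_const. }
  set (E := fun t => PI * N t - (M t - M V)).
  assert (I4 : is_RInt (fun t => E t * f' t) V U
    (PI * Rlsum (fun z => indic V U (ord z) * (f U - f (ord z))) l - (((M U - M V) * f U - (M V - M V) * f V) - I))).
  { apply (is_RInt_ext (fun t => PI * (N t * f' t) - ((m t * f t + (M t - M V) * f' t) - m t * f t))).
    - intros t _. unfold E. match goal with |- @eq _ ?a ?b => change (@eq R a b) end. ring.
    - apply (is_RInt_minus (V := R_NormedModule)).
      + apply (is_RInt_scal (V := R_NormedModule)); exact I1.
      + apply (is_RInt_minus (V := R_NormedModule)); auto. }
  set (IE := PI * Rlsum (fun z => indic V U (ord z) * (f U - f (ord z))) l - (((M U - M V) * f U - (M V - M V) * f V) - I)) in *.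
  assert (EN : Rlsum (fun z => indic V U (ord z) * (f U - f (ord z))) l = N U * f U - Rlsum (fun z => indic V U (ord z) * f (ord z)) l).
  { unfold N. rewrite Rmult_comm, <- Rlsum_scal, <- Rlsum_minus. apply Rlsum_ext. intros; ring. }
  assert (Key : PI * Rlsum (fun z => indic V U (ord z) * f (ord z)) l - I = E U * f U - IE).
  { unfold IE, E. rewrite EN. ring. }
  fold I. rewrite Key.
  set (G := fun t => (ln t + 1) / t).
  assert (I5 : is_RInt (fun t => K * n * (ln t / (t * t))) V U (K * n * (G V - G U))).
  { apply (is_RInt_scal (V := R_NormedModule)).
    replace (G V - G U) with (- G U - - G V) by ring.
    apply (is_RInt_derive (V := R_CompleteNormedModule) (fun t => - G t)); rewrite Rmin_left, Rmax_right by auto; intros t Ht.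
    - unfold G. auto_derive; [split; lra|]. field. lra.
    - apply (ex_derive_continuous (V := R_NormedModule) (fun t => ln t / (t * t))). auto_derive. split; nra. }
  assert (HE : forall t, V <= t <= U -> Rabs (E t * f' t) <= K * n * (ln t / (t * t))).
  { intros t Ht. rewrite Rabs_mult. replace (K * n * (ln t / (t * t))) with (K * ln t * (n / (t * t))) by (field; lra).
    apply Rmult_le_compat; try apply Rabs_pos; [apply BN|apply Bf']; auto. }
  assert (BI : Rabs IE <= K * n * (G V - G U)).
  { apply Rabs_le. split.
    - apply Ropp_le_cancel. rewrite Ropp_involutive.
      apply (is_RInt_le (fun t => - (E t * f' t)) (fun t => K * n * (ln t / (t * t))) V U); auto.
      + apply (is_RInt_opp (V := R_NormedModule)); exact I4.
      + intros t Ht. specialize (HE t ltac:(lra)). apply Rabs_le_between in HE. lra.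
    - apply (is_RInt_le (fun t => E t * f' t) (fun t => K * n * (ln t / (t * t))) V U); auto.
      intros t Ht. specialize (HE t ltac:(lra)). apply Rabs_le_between in HE. lra. }
  assert (BU : Rabs (E U * f U) <= K * n * G U).
  { rewrite Rabs_mult. assert (L := ln_ge1 U ltac:(lra)).
    apply Rle_trans with (K * ln U * (n / U)).
    - apply Rmult_le_compat; try apply Rabs_pos; [apply BN|apply Bf]; lra.
    - unfold G. replace (K * n * ((ln U + 1) / U)) with (K * (ln U + 1) * (n / U)) by (field; lra).
      apply Rmult_le_compat_r; [apply Rmult_le_pos; [lra|left; apply Rinv_0_lt_compat; lra]|].
      apply Rmult_le_compat_l; lra. }
  fold (G V). unfold Rminus at 1. eapply Rle_trans; [apply Rabs_triang|]. rewrite Rabs_Ropp. lra.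
Qed.

(** * The integrals of the main term *)

(* [1 - 1/(1/2 + i t)] equals [exp (i (ang t))]. *)
Definition ang (t : R) : R := PI - 2 * atan (2 * t).

Lemma atan_double_cos (x : R) : cos (2 * atan x) = (1 - x * x) / (1 + x * x).
Proof.
  assert (P : 0 < 1 + x * x) by nra. rewrite cos_2a_cos, cos_atan. unfold Rsqr.
  replace (2 * (1 / sqrt (1 + x * x)) * (1 / sqrt (1 + x * x))) with (2 / (sqrt (1 + x * x) * sqrt (1 + x * x))).
  - rewrite sqrt_sqrt by lra. field. lra.
  - field. apply Rgt_not_eq, sqrt_lt_R0; auto.
Qed.

Lemma atan_double_sin (x : R) : sin (2 * atan x) = 2 * x / (1 + x * x).
Proof.
  assert (P : 0 < 1 + x * x) by nra. rewrite sin_2a, cos_atan, sin_atan. unfold Rsqr.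
  replace (2 * (x / sqrt (1 + x * x)) * (1 / sqrt (1 + x * x))) with (2 * x / (sqrt (1 + x * x) * sqrt (1 + x * x))).
  - rewrite sqrt_sqrt by lra. field. lra.
  - field. apply Rgt_not_eq, sqrt_lt_R0; auto.
Qed.

Lemma cos_ang (t : R) : cos (ang t) = 1 - 2 / (1 + 4 * (t * t)).
Proof.
  unfold ang. rewrite cos_minus, cos_PI, sin_PI, atan_double_cos. field. nra.
Qed.

Lemma sin_ang (t : R) : sin (ang t) = 4 * t / (1 + 4 * (t * t)).
Proof.
  unfold ang. rewrite sin_minus, cos_PI, sin_PI, atan_double_sin. field. nra.
Qed.

Lemma ang_0 : ang 0 = PI.
Proof. unfold ang. rewrite Rmult_0_r, atan_0. ring. Qed.

Lemma ang_opp (t : R) : ang (- t) = 2 * PI - ang t.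
Proof. unfold ang. replace (2 * - t) with (- (2 * t)) by ring. rewrite atan_opp. ring. Qed.

Lemma ang_pos (t : R) : 0 < ang t.
Proof. unfold ang. generalize (atan_bound (2 * t)). lra. Qed.

Lemma ang_le_inv (t : R) : 0 < t -> ang t <= / t.
Proof.
  intros H. assert (A := atan_inv_sum (2 * t) ltac:(lra)).
  assert (B : atan (/ (2 * t)) <= / (2 * t)).
  { apply atan_approx. left. apply Rinv_0_lt_compat. lra. }
  replace (/ t) with (2 * / (2 * t)) by (field; lra). unfold ang. lra.
Qed.

Lemma is_derive_ang (t : R) : is_derive ang t (- 4 / (1 + 4 * (t * t))).
Proof. unfold ang. auto_derive; auto. field. nra. Qed.

Lemma abs_sin_le (x : R) : Rabs (sin x) <= Rabs x.
Proof.
  assert (Pos : forall y, 0 <= y -> Rabs (sin y) <= y).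
  { intros y Hy. destruct (Rle_dec y 1) as [H|H].
    - assert (3 < PI) by (generalize PI2_3_2; unfold PI2; lra).
      destruct Hy as [Hy|<-]; [|rewrite sin_0, Rabs_R0; lra].
      rewrite Rabs_right; [left; apply sin_lt_x; auto|apply Rle_ge, sin_ge_0; lra].
    - assert (B := SIN_bound y). apply Rabs_le. lra. }
  destruct (Rle_dec 0 x) as [H|H].
  - rewrite (Rabs_right x) by lra. auto.
  - rewrite (Rabs_left x) by lra. rewrite <- (Rabs_Ropp (sin x)), <- sin_neg. apply Pos. lra.
Qed.

(** Linear rather than quadratic in [x]: this gives [cosn n t <= n / t], the form shared with [sinn]
    in the Abel summation. *)
Lemma one_minus_cos (x : R) : 0 <= 1 - cos x <= Rabs x.
Proof.
  split; [generalize (COS_bound x); lra|].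
  replace x with (2 * (x / 2)) at 1 by field. rewrite cos_2a_sin.
  assert (A := abs_sin_le (x / 2)). assert (B := SIN_bound (x / 2)).
  assert (Rabs (sin (x / 2)) <= 1) by (apply Rabs_le; lra).
  replace (1 - (1 - 2 * sin (x / 2) * sin (x / 2))) with (2 * (Rabs (sin (x / 2)) * Rabs (sin (x / 2)))).
  - replace (Rabs x) with (2 * (Rabs (x / 2) * 1)).
    + apply Rmult_le_compat_l; [lra|]. apply Rmult_le_compat; auto; apply Rabs_pos.
    + unfold Rdiv. rewrite Rabs_mult, (Rabs_right (/ 2)) by lra. field.
  - rewrite <- Rabs_mult. rewrite Rabs_right by (apply Rle_ge, Rle_0_sqr). ring.
Qed.

Definition cosn (n : nat) (t : R) : R := 1 - cos (INR n * ang t).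
Definition sinn (n : nat) (t : R) : R := sin (INR n * ang t).

(** This is [ln |1/2 + i t|], used in place of [ln t]: it is smooth at 0, its derivative is
    [sin (ang t)], and it equals [- ln (2 sin (ang t / 2))]. *)
Definition lnw (t : R) : R := / 2 * ln (t * t + / 4).

Lemma is_derive_cosn (n : nat) (t : R) : is_derive (cosn n) t (- 4 / (1 + 4 * (t * t)) * (INR n * sinn n t)).
Proof.
  unfold cosn, sinn. generalize (INR n); intros N.
  evar_last. { apply (is_derive_minus (V := R_NormedModule) (fun _ => 1) (fun t => cos (N * ang t))).
    - apply (is_derive_const (V := R_NormedModule)).
    - apply (is_derive_comp (V := R_NormedModule) cos (fun t => N * ang t)); [apply is_derive_cos|].
      apply (is_derive_scal ang). apply is_derive_ang. }
  unfold minus, plus, opp, scal, zero; simpl; unfold mult; simpl. match goal with |- @eq _ ?a ?b => change (@eq R a b) end. field. nra.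
Qed.

Lemma is_derive_sinn (n : nat) (t : R) : is_derive (sinn n) t (- 4 / (1 + 4 * (t * t)) * (INR n * cos (INR n * ang t))).
Proof.
  unfold sinn. generalize (INR n); intros N.
  evar_last. { apply (is_derive_comp (V := R_NormedModule) sin (fun t => N * ang t)); [apply is_derive_sin|].
      apply (is_derive_scal ang). apply is_derive_ang. }
  unfold scal; simpl; unfold mult; simpl. match goal with |- @eq _ ?a ?b => change (@eq R a b) end. field. nra.
Qed.

Lemma continuous_cosn (n : nat) (t : R) : continuous (cosn n) t.
Proof. apply (ex_derive_continuous (V := R_NormedModule) (cosn n)). eexists; apply is_derive_cosn. Qed.

Lemma continuous_sinn (n : nat) (t : R) : continuous (sinn n) t.
Proof. apply (ex_derive_continuous (V := R_NormedModule) (sinn n)). eexists; apply is_derive_sinn. Qed.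

Lemma is_derive_lnw (t : R) : is_derive lnw t (4 * t / (1 + 4 * (t * t))).
Proof. unfold lnw. auto_derive; [nra|]. field. nra. Qed.

Lemma continuous_lnw (t : R) : continuous lnw t.
Proof. apply (ex_derive_continuous (V := R_NormedModule) lnw). eexists; apply is_derive_lnw. Qed.

Lemma ex_RInt_cts (f : R -> R) (a b : R) : (forall t, continuous f t) -> ex_RInt f a b.
Proof. intros H. apply (ex_RInt_continuous (V := R_CompleteNormedModule)). auto. Qed.

Lemma is_RInt_cts (f : R -> R) (a b : R) : (forall t, continuous f t) -> is_RInt f a b (RInt f a b).
Proof. intros H. apply (RInt_correct (V := R_CompleteNormedModule)). apply ex_RInt_cts; auto. Qed.

Definition J0 (n : nat) (U : R) : R := RInt (cosn n) 0 U.
Definition J1 (n : nat) (U : R) : R := RInt (fun t => lnw t * cosn n t) 0 U.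

Lemma continuous_lnw_cosn (n : nat) (t : R) : continuous (fun t => lnw t * cosn n t) t.
Proof. apply (continuous_mult (K := R_AbsRing) lnw (cosn n)); [apply continuous_lnw|apply continuous_cosn]. Qed.

Lemma is_RInt_J0 (n : nat) (U : R) : is_RInt (cosn n) 0 U (J0 n U).
Proof. apply is_RInt_cts, continuous_cosn. Qed.

Lemma is_RInt_J1 (n : nat) (U : R) : is_RInt (fun t => lnw t * cosn n t) 0 U (J1 n U).
Proof. apply (is_RInt_cts (fun t => lnw t * cosn n t)). apply continuous_lnw_cosn. Qed.

Lemma is_RInt_eq (f g : R -> R) (a b u v : R) : (forall t, f t = g t) -> is_RInt f a b u -> is_RInt g a b v -> u = v.
Proof.
  intros H Hf Hg. apply (is_RInt_ext f g) in Hf; [|intros; apply H].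
  rewrite <- (is_RInt_unique (V := R_CompleteNormedModule) _ _ _ _ Hf). apply (is_RInt_unique (V := R_CompleteNormedModule) _ _ _ _ Hg).
Qed.

Lemma is_RInt_second_diff (f g h : R -> R) (a b u v w : R) : is_RInt f a b u -> is_RInt g a b v -> is_RInt h a b w ->
  is_RInt (fun t => f t + g t - 2 * h t) a b (u + v - 2 * w).
Proof.
  intros Hf Hg Hh. apply (is_RInt_minus (V := R_NormedModule) (fun t => f t + g t) (fun t => 2 * h t)).
  - apply (is_RInt_plus (V := R_NormedModule) f g); auto.
  - apply (is_RInt_scal (V := R_NormedModule) h); auto.
Qed.

(** The factor [2 (1 - cos (ang t))] equals minus the derivative of [ang], so the second difference
    is the exact derivative of a multiple of [sinn (S n)]. *)
Lemma cosn_second_diff (n : nat) (t : R) :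
  cosn (S (S n)) t + cosn n t - 2 * cosn (S n) t = 4 / (1 + 4 * (t * t)) * cos (INR (S n) * ang t).
Proof.
  unfold cosn. rewrite (S_INR (S n)). set (N := INR (S n)).
  replace (INR n) with (N - 1) by (unfold N; rewrite S_INR; ring).
  replace ((N + 1) * ang t) with (N * ang t + ang t) by ring. replace ((N - 1) * ang t) with (N * ang t - ang t) by ring.
  rewrite cos_plus, cos_minus, cos_ang. field. nra.
Qed.

Lemma sinn_0 (n : nat) : sinn n 0 = 0.
Proof.
  unfold sinn. rewrite ang_0. induction n as [|n IH]; [rewrite Rmult_0_l; apply sin_0|].
  rewrite S_INR, Rmult_plus_distr_r, Rmult_1_l, neg_sin, IH. ring.
Qed.

Lemma J0_second_diff (n : nat) (U : R) :
  J0 (S (S n)) U + J0 n U - 2 * J0 (S n) U = - (/ INR (S n) * sinn (S n) U).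
Proof.
  assert (HN : INR (S n) <> 0) by (apply not_0_INR; lia).
  apply (is_RInt_eq (fun t => cosn (S (S n)) t + cosn n t - 2 * cosn (S n) t)
     (fun t => - (/ INR (S n)) * (- 4 / (1 + 4 * (t * t)) * (INR (S n) * cos (INR (S n) * ang t)))) 0 U).
  - intros t. rewrite cosn_second_diff. field. split; [nra|auto].
  - apply is_RInt_second_diff; apply is_RInt_J0.
  - replace (- (/ INR (S n) * sinn (S n) U)) with (- / INR (S n) * (sinn (S n) U - sinn (S n) 0)) by (rewrite sinn_0; ring).
    apply (is_RInt_scal (V := R_NormedModule)). apply (is_RInt_derive (V := R_CompleteNormedModule) (sinn (S n))).
    + intros; apply is_derive_sinn.
    + intros t _. apply (continuous_mult (K := R_AbsRing) (fun t => - 4 / (1 + 4 * (t * t)))).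
      * apply (ex_derive_continuous (V := R_NormedModule) (fun t => - 4 / (1 + 4 * (t * t)))). auto_derive. nra.
      * apply (continuous_mult (K := R_AbsRing) (fun t => INR (S n)) (fun t => cos (INR (S n) * ang t))); [apply continuous_const|].
        apply (ex_derive_continuous (V := R_NormedModule) (fun t => cos (INR (S n) * ang t))). unfold ang. generalize (INR (S n)). intros. auto_derive; auto.
Qed.

Lemma J0_0 (U : R) : J0 0 U = 0.
Proof.
  unfold J0. apply (is_RInt_unique (V := R_CompleteNormedModule)). apply (is_RInt_ext (fun _ => 0)).
  - intros. unfold cosn. simpl. rewrite Rmult_0_l, cos_0. match goal with |- @eq _ ?a ?b => change (@eq R a b) end. ring.
  - apply is_RInt_zero.
Qed.

Lemma J0_1 (U : R) : J0 1 U = atan (2 * U).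
Proof.
  unfold J0. apply (is_RInt_unique (V := R_CompleteNormedModule)). apply (is_RInt_ext (fun t => 2 / (1 + 4 * (t * t)))).
  - intros. unfold cosn. simpl. rewrite Rmult_1_l, cos_ang. match goal with |- @eq _ ?a ?b => change (@eq R a b) end. ring.
  - replace (atan (2 * U)) with (atan (2 * U) - atan (2 * 0)) by (rewrite Rmult_0_r, atan_0; ring).
    apply (is_RInt_derive (V := R_CompleteNormedModule) (fun t => atan (2 * t))).
    + intros t _. auto_derive; auto. field. nra.
    + intros t _. apply (ex_derive_continuous (V := R_NormedModule) (fun t => 2 / (1 + 4 * (t * t)))). auto_derive. nra.
Qed.

(* Integration by parts and [lnw' = sin ang] reduce the logarithmic integrals to the [J0]. *)
Lemma J1_second_diff (n : nat) (U : R) :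
  J1 (S (S n)) U + J1 n U - 2 * J1 (S n) U =
  / INR (S n) * (/ 2 * (J0 (S (S n)) U - J0 n U) - lnw U * sinn (S n) U).
Proof.
  assert (HN : INR (S n) <> 0) by (apply not_0_INR; lia).
  apply (is_RInt_eq (fun t => lnw t * cosn (S (S n)) t + lnw t * cosn n t - 2 * (lnw t * cosn (S n) t))
     (fun t => / INR (S n) * (/ 2 * (cosn (S (S n)) t - cosn n t) -
       (4 * t / (1 + 4 * (t * t)) * sinn (S n) t + lnw t * (- 4 / (1 + 4 * (t * t)) * (INR (S n) * cos (INR (S n) * ang t)))))) 0 U).
  - intros t. replace (lnw t * cosn (S (S n)) t + lnw t * cosn n t - 2 * (lnw t * cosn (S n) t))
      with (lnw t * (cosn (S (S n)) t + cosn n t - 2 * cosn (S n) t)) by ring. rewrite cosn_second_diff.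
    assert (E : / 2 * (cosn (S (S n)) t - cosn n t) = 4 * t / (1 + 4 * (t * t)) * sinn (S n) t).
    { unfold cosn, sinn. rewrite <- sin_ang, (S_INR (S n)). set (N := INR (S n)).
      replace (INR n) with (N - 1) by (unfold N; rewrite S_INR; ring).
      replace ((N + 1) * ang t) with (N * ang t + ang t) by ring. replace ((N - 1) * ang t) with (N * ang t - ang t) by ring.
      rewrite cos_plus, cos_minus. field. }
    rewrite E. field. split; [nra|auto].
  - apply (is_RInt_second_diff (fun t => lnw t * cosn (S (S n)) t) (fun t => lnw t * cosn n t) (fun t => lnw t * cosn (S n) t)); apply is_RInt_J1.
  - apply (is_RInt_scal (V := R_NormedModule)).
    apply (is_RInt_minus (V := R_NormedModule) (fun t => / 2 * (cosn (S (S n)) t - cosn n t))).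
    + apply (is_RInt_scal (V := R_NormedModule) (fun t => cosn (S (S n)) t - cosn n t)).
      apply (is_RInt_minus (V := R_NormedModule) (cosn (S (S n))) (cosn n)); apply is_RInt_J0.
    + replace (lnw U * sinn (S n) U) with (lnw U * sinn (S n) U - lnw 0 * sinn (S n) 0) by (rewrite sinn_0; ring).
      apply (is_RInt_derive (V := R_CompleteNormedModule) (fun t => lnw t * sinn (S n) t)).
      * intros t _. apply (is_derive_mult lnw (sinn (S n))); [apply is_derive_lnw|apply is_derive_sinn|intros; apply Rmult_comm].
      * intros t _. apply (continuous_plus (V := R_NormedModule) (fun t => 4 * t / (1 + 4 * (t * t)) * sinn (S n) t)).
        { apply (continuous_mult (K := R_AbsRing) (fun t => 4 * t / (1 + 4 * (t * t))) (sinn (S n))); [|apply continuous_sinn].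
          apply (ex_derive_continuous (V := R_NormedModule) (fun t => 4 * t / (1 + 4 * (t * t)))). auto_derive. nra. }
        apply (continuous_mult (K := R_AbsRing) lnw); [apply continuous_lnw|].
        apply (continuous_mult (K := R_AbsRing) (fun t => - 4 / (1 + 4 * (t * t)))).
        { apply (ex_derive_continuous (V := R_NormedModule) (fun t => - 4 / (1 + 4 * (t * t)))). auto_derive. nra. }
        apply (continuous_mult (K := R_AbsRing) (fun t => INR (S n)) (fun t => cos (INR (S n) * ang t))); [apply continuous_const|].
        apply (ex_derive_continuous (V := R_NormedModule) (fun t => cos (INR (S n) * ang t))). unfold ang. generalize (INR (S n)). intros. auto_derive; auto.
Qed.

(** * The integral of [ln (2 sin y)] up to its singular endpoint *)

Definition G (x : R) : R := RInt (fun y => ln (2 * sin y)) x (PI / 2).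

Lemma continuous_ln_sin (y : R) : 0 < y < PI -> continuous (fun y => ln (2 * sin y)) y.
Proof.
  intros H. apply (ex_derive_continuous (V := R_NormedModule) (fun y => ln (2 * sin y))). auto_derive.
  assert (S := sin_gt_0 y ltac:(lra) ltac:(lra)). lra.
Qed.

Lemma ex_RInt_ln_sin (x y : R) : 0 < x < PI -> 0 < y < PI -> ex_RInt (fun y => ln (2 * sin y)) x y.
Proof.
  intros Hx Hy. apply (ex_RInt_continuous (V := R_CompleteNormedModule)). intros t Ht. apply continuous_ln_sin.
  assert (0 < Rmin x y) by (apply Rmin_glb_lt; lra). assert (Rmax x y < PI) by (apply Rmax_lub_lt; lra). lra.
Qed.

Lemma is_derive_G (x : R) : 0 < x < PI -> is_derive G x (- ln (2 * sin x)).
Proof.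
  intros Hx. assert (HP := PI_RGT_0).
  apply (is_derive_RInt' (V := R_NormedModule) (fun y => ln (2 * sin y)) G x (PI / 2)); [|apply continuous_ln_sin; auto].
  assert (Hd : 0 < Rmin x (PI - x)) by (apply Rmin_glb_lt; lra).
  exists (mkposreal _ Hd). intros y Hy. unfold ball in Hy; simpl in Hy. unfold AbsRing_ball, abs, minus, plus, opp in Hy; simpl in Hy.
  apply Rabs_def2 in Hy. assert (A := Rmin_l x (PI - x)). assert (B := Rmin_r x (PI - x)).
  apply (RInt_correct (V := R_CompleteNormedModule)). apply ex_RInt_ln_sin; lra.
Qed.

Lemma G_half_pi : G (PI / 2) = 0.
Proof. apply (RInt_point (V := R_CompleteNormedModule)). Qed.

(** [G x] is half the Clausen function at [2 x], and this is its duplication formula. By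
    [sin (2 y) = 2 sin y cos y] the two sides have equal derivatives, and they agree at [PI / 4]. *)
Lemma G_double (x : R) : 0 < x <= PI / 4 -> G (2 * x) = 2 * G x - 2 * G (PI / 2 - x).
Proof.
  intros Hx. assert (HP := PI_RGT_0).
  set (D := fun x => G (2 * x) - (2 * G x - 2 * G (PI / 2 - x))).
  assert (DD : forall y, x <= y <= PI / 4 -> is_derive D y 0).
  { intros y Hy. unfold D.
    assert (S1 := sin_gt_0 y ltac:(lra) ltac:(lra)). assert (S2 := cos_gt_0 y ltac:(lra) ltac:(lra)).
    evar_last.
    - apply (is_derive_minus (V := R_NormedModule) (fun x => G (2 * x)) (fun x => 2 * G x - 2 * G (PI / 2 - x))).
      + apply (is_derive_comp (V := R_NormedModule) G (fun x => 2 * x)); [apply is_derive_G; lra|].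
        apply (is_derive_scal (fun x => x) y 2). apply (is_derive_id (K := R_AbsRing)).
      + apply (is_derive_minus (V := R_NormedModule) (fun x => 2 * G x) (fun x => 2 * G (PI / 2 - x))).
        * apply (is_derive_scal G). apply is_derive_G; lra.
        * apply (is_derive_scal (fun x => G (PI / 2 - x))).
          apply (is_derive_comp (V := R_NormedModule) G (fun x => PI / 2 - x)); [apply is_derive_G; lra|].
          apply (is_derive_minus (V := R_NormedModule) (fun _ => PI / 2) (fun x => x)); [apply (is_derive_const (V := R_NormedModule))|apply (is_derive_id (K := R_AbsRing))].
    - unfold minus, plus, opp, scal, one, zero; simpl; unfold mult; simpl. rewrite sin_shift.
      replace (2 * sin (2 * y)) with ((2 * sin y) * (2 * cos y)) by (rewrite sin_2a; ring).
      rewrite ln_mult by lra. match goal with |- @eq _ ?a ?b => change (@eq R a b) end. ring. }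
  assert (D0 : D (PI / 4) = 0).
  { unfold D. replace (2 * (PI / 4)) with (PI / 2) by field. replace (PI / 2 - PI / 4) with (PI / 4) by field. rewrite G_half_pi. ring. }
  destruct (MVT_gen D x (PI / 4) (fun _ => 0)) as (c & _ & E).
  - rewrite Rmin_left, Rmax_right by lra. intros y Hy. apply DD. lra.
  - rewrite Rmin_left, Rmax_right by lra. intros y Hy. apply continuity_pt_filterlim.
    apply (ex_derive_continuous (V := R_NormedModule) D). eexists; apply DD. lra.
  - unfold D in E, D0 |- *. lra.
Qed.

Lemma G_near_half_pi (x : R) : PI / 4 <= x <= PI / 2 -> Rabs (G x) <= PI / 2 - x.
Proof.
  intros Hx. assert (HP := PI_RGT_0). replace (PI / 2 - x) with ((PI / 2 - x) * 1) by ring.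
  apply abs_RInt_le_const; [lra|apply ex_RInt_ln_sin; lra|].
  intros t Ht. assert (B := SIN_bound t).
  assert (L : / 2 <= sin t).
  { replace (/ 2) with (sin (PI / 6)) by (rewrite sin_PI6; field). apply sin_incr_1; lra. }
  assert (0 <= ln (2 * sin t)) by (rewrite <- ln_1; apply ln_mono; lra).
  assert (ln (2 * sin t) <= 1).
  { assert (A := ln_le_sub1 (2 * sin t) ltac:(lra)). lra. }
  rewrite Rabs_right; lra.
Qed.

(** Induction on dyadic scales by [G x = G (2 x) / 2 + G (PI / 2 - x)], whose last term is at most
    [x] in absolute value. The square root leaves room: with [sqrt 2 <= 3/2] the constant reproduces
    itself, [4 * (3/2) / 2 + 1 = 4]. That [G] tends to 0 at 0 is the vanishing of the classical
    integral. *)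
Lemma G_small (k : nat) : forall x, PI / 4 / 2 ^ k <= x <= PI / 2 -> Rabs (G x) <= 4 * sqrt x.
Proof.
  assert (HP := PI_RGT_0). assert (HP4 := PI_4).
  assert (Base : forall x, PI / 4 <= x <= PI / 2 -> Rabs (G x) <= 4 * sqrt x).
  { intros x Hx. assert (A := G_near_half_pi x Hx). assert (/ 2 <= sqrt x); [|lra].
    replace (/ 2) with (sqrt (/ 2 * / 2)) by (apply sqrt_square; lra). apply sqrt_le_1_alt. generalize PI2_3_2. unfold PI2. lra. }
  induction k as [|k IH]; intros x Hx; [apply Base; simpl in Hx; lra|].
  destruct (Rle_dec (PI / 4) x) as [H|H]; [apply Base; lra|].
  assert (Pk : 0 < 2 ^ k) by (apply pow_lt; lra).
  assert (E : PI / 4 / 2 ^ S k = PI / 4 / 2 ^ k / 2) by (simpl; field; lra).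
  assert (Q : 0 < PI / 4 / 2 ^ k) by (apply Rdiv_lt_0_compat; lra).
  assert (Hx0 : 0 < x) by lra.
  assert (D := G_double x ltac:(lra)). assert (B1 := IH (2 * x) ltac:(lra)). assert (B2 := G_near_half_pi (PI / 2 - x) ltac:(lra)).
  assert (R1 : sqrt (2 * x) = sqrt 2 * sqrt x) by (apply sqrt_mult; lra). rewrite R1 in B1.
  set (r := sqrt x) in *. assert (Hr : 0 < r) by (apply sqrt_lt_R0; auto).
  assert (Er : x = r * r) by (symmetry; apply sqrt_sqrt; lra).
  assert (R2 : sqrt 2 <= 3 / 2).
  { replace (3 / 2) with (sqrt (3 / 2 * (3 / 2))) by (apply sqrt_square; lra). apply sqrt_le_1_alt. lra. }
  assert (Hr1 : r <= 1).
  { rewrite <- sqrt_1. apply sqrt_le_1_alt. lra. }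
  assert (sqrt 2 * r <= 3 / 2 * r) by (apply Rmult_le_compat_r; lra).
  assert (r * r <= r * 1) by (apply Rmult_le_compat_l; lra).
  apply Rabs_le_between in B1. apply Rabs_le_between in B2. apply Rabs_le. lra.
Qed.

Lemma G_bound (x : R) : 0 < x <= PI / 2 -> Rabs (G x) <= 4 * sqrt x.
Proof.
  intros Hx. assert (HP := PI_RGT_0).
  destruct (Pow_x_infinity 2 ltac:(rewrite Rabs_right; lra) (PI / 4 / x)) as [k Hk].
  specialize (Hk k (Nat.le_refl k)). assert (Pk : 0 < 2 ^ k) by (apply pow_lt; lra). rewrite Rabs_right in Hk by lra.
  apply (G_small k). split; [|lra]. apply Rmult_le_reg_r with (2 ^ k / x).
  - apply Rdiv_lt_0_compat; lra.
  - replace (PI / 4 / 2 ^ k * (2 ^ k / x)) with (PI / 4 / x) by (field; lra). replace (x * (2 ^ k / x)) with (2 ^ k) by (field; lra). lra.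
Qed.

Lemma lnw_sin (t : R) : ln (2 * sin (ang t / 2)) = - lnw t.
Proof.
  assert (H : 0 < sin (ang t / 2)).
  { assert (A := ang_pos t). assert (B := ang_pos (- t)). rewrite ang_opp in B. apply sin_gt_0; lra. }
  assert (E : ln (2 * sin (ang t / 2)) + ln (2 * sin (ang t / 2)) = - ln (t * t + / 4)).
  { rewrite <- ln_mult, <- ln_Rinv by nra. f_equal.
    replace (2 * sin (ang t / 2) * (2 * sin (ang t / 2))) with (2 * (1 - (1 - 2 * sin (ang t / 2) * sin (ang t / 2)))) by ring.
    rewrite <- cos_2a_sin. replace (2 * (ang t / 2)) with (ang t) by field. rewrite cos_ang. field. nra. }
  unfold lnw. lra.
Qed.

(** The substitution [y = ang t / 2] turns [lnw] into [- ln (2 sin y)] and [cosn 1 t dt] into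
    [- dy]. *)
Lemma J1_1 (U : R) : 0 <= U -> J1 1 U = - G (ang U / 2).
Proof.
  intros HU. assert (HP := PI_RGT_0).
  assert (Rg : forall t, 0 < ang t / 2 < PI) by (intros t; assert (A := ang_pos t); assert (B := ang_pos (- t)); rewrite ang_opp in B; lra).
  assert (I := is_RInt_comp (V := R_CompleteNormedModule) (fun y => ln (2 * sin y)) (fun t => ang t / 2) (fun t => - (2 / (1 + 4 * (t * t)))) 0 U).
  cbv beta in I. rewrite ang_0 in I.
  assert (I' : is_RInt (fun t => lnw t * cosn 1 t) 0 U (RInt (fun y => ln (2 * sin y)) (PI / 2) (ang U / 2))).
  { apply (is_RInt_ext (V := R_NormedModule) (fun t => scal (- (2 / (1 + 4 * (t * t)))) (ln (2 * sin (ang t / 2))))).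
    - intros t _. rewrite lnw_sin. unfold cosn. simpl. rewrite Rmult_1_l, cos_ang. unfold scal; simpl; unfold mult; simpl.
      match goal with |- @eq _ ?a ?b => change (@eq R a b) end. ring.
    - apply I.
      + intros t _. apply continuous_ln_sin, Rg.
      + intros t _. split.
        * unfold ang. auto_derive; auto. field. nra.
        * apply (ex_derive_continuous (V := R_NormedModule) (fun t => - (2 / (1 + 4 * (t * t))))). auto_derive. nra. }
  unfold J1. rewrite (is_RInt_unique (V := R_CompleteNormedModule) _ _ _ _ I'). unfold G.
  rewrite <- (opp_RInt_swap (V := R_CompleteNormedModule)); [reflexivity|].
  apply ex_RInt_ln_sin; [apply Rg|lra].
Qed.

(* An explicit rate makes sums of limits and the Cauchy criterion free of epsilons. *)
Definition sqrt_lim (f : R -> R) (l : R) : Prop := exists C, forall U, 3 <= U -> Rabs (f U - l) <= C / sqrt U.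

Lemma sqrt_lim_plus (f g : R -> R) (l k : R) : sqrt_lim f l -> sqrt_lim g k -> sqrt_lim (fun U => f U + g U) (l + k).
Proof.
  intros [C HC] [D HD]. exists (C + D). intros U HU. specialize (HC U HU). specialize (HD U HU).
  replace (f U + g U - (l + k)) with ((f U - l) + (g U - k)) by ring. eapply Rle_trans; [apply Rabs_triang|].
  unfold Rdiv in *. lra.
Qed.

Lemma sqrt_lim_scal (c : R) (f : R -> R) (l : R) : sqrt_lim f l -> sqrt_lim (fun U => c * f U) (c * l).
Proof.
  intros [C HC]. exists (Rabs c * C). intros U HU. specialize (HC U HU).
  replace (c * f U - c * l) with (c * (f U - l)) by ring. rewrite Rabs_mult.
  unfold Rdiv in *. rewrite Rmult_assoc. apply Rmult_le_compat_l; [apply Rabs_pos|auto].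
Qed.

Lemma sqrt_lim_ext (f g : R -> R) (l k : R) : (forall U, 3 <= U -> f U = g U) -> l = k -> sqrt_lim f l -> sqrt_lim g k.
Proof. intros H <- [C HC]. exists C. intros U HU. rewrite <- H; auto. Qed.

Lemma sqrt_ge1 (U : R) : 1 <= U -> 1 <= sqrt U.
Proof. intros H. rewrite <- sqrt_1. apply sqrt_le_1_alt. auto. Qed.

Lemma inv_le_inv_sqrt (U : R) : 1 <= U -> / U <= / sqrt U.
Proof.
  intros H. assert (S := sqrt_ge1 U H). apply Rinv_le_contravar; [lra|].
  rewrite <- (sqrt_sqrt U) at 2 by lra. rewrite <- (Rmult_1_r (sqrt U)) at 1. apply Rmult_le_compat_l; lra.
Qed.

Lemma abs_n_ang (n : nat) (t : R) : 0 < t -> Rabs (INR n * ang t) <= INR n / t.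
Proof.
  intros H. assert (A := ang_pos t). rewrite Rabs_right.
  - apply Rmult_le_compat_l; [apply pos_INR|apply ang_le_inv; auto].
  - apply Rle_ge, Rmult_le_pos; [apply pos_INR|lra].
Qed.

Lemma sinn_le (n : nat) (t : R) : 0 < t -> Rabs (sinn n t) <= INR n / t.
Proof. intros H. eapply Rle_trans; [apply abs_sin_le|apply abs_n_ang; auto]. Qed.

Lemma cosn_le (n : nat) (t : R) : 0 < t -> Rabs (cosn n t) <= INR n / t.
Proof.
  intros H. destruct (one_minus_cos (INR n * ang t)) as [A B]. unfold cosn. rewrite Rabs_right by lra.
  eapply Rle_trans; [apply B|apply abs_n_ang; auto].
Qed.

Lemma lnw_ln (t : R) : 1 <= t -> 0 <= lnw t - ln t <= / (t * t).
Proof.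
  intros H. assert (T : 0 < t * t) by nra.
  assert (E : lnw t - ln t = / 2 * (ln (t * t + / 4) - ln (t * t))) by (unfold lnw; rewrite (ln_mult t t) by lra; field).
  rewrite E. assert (A := ln_mono (t * t) (t * t + / 4) T ltac:(lra)). split; [lra|].
  assert (E2 : ln (t * t + / 4) - ln (t * t) = ln ((t * t + / 4) / (t * t))).
  { unfold Rdiv. rewrite (ln_mult (t * t + / 4)), (ln_Rinv (t * t)); try lra. apply Rinv_0_lt_compat; lra. }
  assert (B : ln ((t * t + / 4) / (t * t)) <= / 4 * / (t * t)).
  { eapply Rle_trans; [apply ln_le_sub1; apply Rdiv_lt_0_compat; lra|]. right. field. lra. }
  assert (0 < / (t * t)) by (apply Rinv_0_lt_compat; auto). lra.
Qed.

Lemma sqrt_lim_sinn (n : nat) : sqrt_lim (sinn n) 0.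
Proof.
  exists (INR n). intros U HU. rewrite Rminus_0_r. eapply Rle_trans; [apply sinn_le; lra|].
  apply Rmult_le_compat_l; [apply pos_INR|apply inv_le_inv_sqrt; lra].
Qed.

Lemma sqrt_lim_lnw_sinn (n : nat) : sqrt_lim (fun U => lnw U * sinn n U) 0.
Proof.
  exists (3 * INR n). intros U HU. rewrite Rminus_0_r, Rabs_mult.
  assert (S := sqrt_ge1 U ltac:(lra)). assert (A := lnw_ln U ltac:(lra)). assert (B := ln_le_sqrt U ltac:(lra)).
  assert (C := ln_ge1 U HU). assert (I : / (U * U) <= 1) by (rewrite <- Rinv_1; apply Rinv_le_contravar; nra).
  rewrite (Rabs_right (lnw U)) by lra.
  replace (3 * INR n / sqrt U) with (3 * sqrt U * (INR n / U)).
  - apply Rmult_le_compat; [lra|apply Rabs_pos|lra|apply sinn_le; lra].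
  - rewrite <- (sqrt_sqrt U) at 2 by lra. field. lra.
Qed.

(** The second differences in [n] tend to 0, so the limit is linear in [n] and fixed by its values
    at 0 and 1. *)
Lemma J0_lim (n : nat) : sqrt_lim (J0 n) (INR n * (PI / 2)).
Proof.
  assert (HP := PI_RGT_0).
  enough (H : sqrt_lim (J0 n) (INR n * (PI / 2)) /\ sqrt_lim (J0 (S n)) (INR (S n) * (PI / 2))) by apply H.
  induction n as [|n [IH1 IH2]].
  - split.
    + exists 0. intros U HU. rewrite J0_0. replace (0 - INR 0 * (PI / 2)) with 0 by (simpl; ring). rewrite Rabs_R0. unfold Rdiv. rewrite Rmult_0_l. apply Rle_refl.
    + exists 1. intros U HU. rewrite J0_1. simpl. rewrite Rmult_1_l, Rabs_left1 by (generalize (atan_bound (2 * U)); lra).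
      assert (A := ang_le_inv U ltac:(lra)). assert (B := inv_le_inv_sqrt U ltac:(lra)). assert (C := ang_pos U).
      unfold ang in A, C. unfold Rdiv at 2. rewrite Rmult_1_l. lra.
  - split; auto.
    apply (sqrt_lim_ext (fun U => (2 * J0 (S n) U + (-1) * J0 n U) + (- / INR (S n)) * sinn (S n) U) _
       ((2 * (INR (S n) * (PI / 2)) + (-1) * (INR n * (PI / 2))) + (- / INR (S n)) * 0)).
    + intros U _. assert (E := J0_second_diff n U). rewrite Rmult_comm with (r1 := / INR (S n)) in E.
      rewrite Ropp_mult_distr_l_reverse, Rmult_comm with (r1 := / INR (S n)). lra.
    + rewrite (S_INR (S n)), S_INR. ring.
    + apply sqrt_lim_plus; [apply sqrt_lim_plus|]; apply sqrt_lim_scal; auto. apply sqrt_lim_sinn.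
Qed.

Definition harm (n : nat) : R := Rsum_lt n (fun k => / INR (S k)).

Lemma J1_0 (U : R) : J1 0 U = 0.
Proof.
  unfold J1. apply (is_RInt_unique (V := R_CompleteNormedModule)). apply (is_RInt_ext (fun _ => 0)); [|apply is_RInt_zero].
  intros. unfold cosn. simpl. rewrite Rmult_0_l, cos_0. match goal with |- @eq _ ?a ?b => change (@eq R a b) end. ring.
Qed.

Lemma J1_1_lim : sqrt_lim (J1 1) 0.
Proof.
  exists 4. intros U HU. rewrite J1_1, Rminus_0_r, Rabs_Ropp by lra.
  assert (A := ang_pos U). assert (B := ang_le_inv U ltac:(lra)).
  assert (A2 : ang U <= PI) by (unfold ang; assert (C := atan_nonneg (2 * U) ltac:(lra)); lra).
  eapply Rle_trans; [apply G_bound; lra|]. apply Rmult_le_compat_l; [lra|].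
  rewrite <- sqrt_inv by lra. apply sqrt_le_1_alt. lra.
Qed.

(** The limiting second difference at [n + 1] is [PI / (2 (n + 1))], which is that of [PI / 2] times
    [n H_n] for the harmonic numbers [H_n]; the linear part is fixed by the value 0 at both [n = 0]
    and [n = 1]. *)
Lemma J1_lim (n : nat) : sqrt_lim (J1 n) (PI / 2 * (INR n * harm n - INR n)).
Proof.
  assert (HP := PI_RGT_0).
  set (b := fun n => PI / 2 * (INR n * harm n - INR n)).
  enough (H : sqrt_lim (J1 n) (b n) /\ sqrt_lim (J1 (S n)) (b (S n))) by apply H.
  induction n as [|n [IH1 IH2]].
  - split.
    + exists 0. intros U HU. rewrite J1_0. replace (0 - b 0%nat) with 0 by (unfold b; simpl; ring). rewrite Rabs_R0. unfold Rdiv. rewrite Rmult_0_l. apply Rle_refl.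
    + replace (b 1%nat) with 0; [apply J1_1_lim|]. unfold b, harm. simpl. field.
  - split; auto.
    apply (sqrt_lim_ext (fun U => (2 * J1 (S n) U + (-1) * J1 n U) + / INR (S n) * ((/ 2 * J0 (S (S n)) U + (- / 2) * J0 n U) + (-1) * (lnw U * sinn (S n) U))) _
       ((2 * b (S n) + (-1) * b n) + / INR (S n) * ((/ 2 * (INR (S (S n)) * (PI / 2)) + (- / 2) * (INR n * (PI / 2))) + (-1) * 0))).
    + intros U _. assert (E := J1_second_diff n U).
      replace ((/ 2 * J0 (S (S n)) U + (- / 2) * J0 n U) + (-1) * (lnw U * sinn (S n) U)) with (/ 2 * (J0 (S (S n)) U - J0 n U) - lnw U * sinn (S n) U) by ring.
      lra.
    + unfold b, harm. cbn [Rsum_lt]. assert (P := pos_INR n). rewrite !S_INR. field. lra.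
    + apply sqrt_lim_plus; [apply sqrt_lim_plus; apply sqrt_lim_scal; auto|].
      apply sqrt_lim_scal. apply sqrt_lim_plus; [apply sqrt_lim_plus; apply sqrt_lim_scal; apply J0_lim|].
      apply (sqrt_lim_scal (-1) (fun U => lnw U * sinn (S n) U)). apply sqrt_lim_lnw_sinn.
Qed.

Lemma harm_sum (k : nat) : sum_f_R0 (fun k => / INR (S k)) k = harm (S k).
Proof. induction k as [|k IH]; [unfold harm; simpl; ring|]. cbn [sum_f_R0]. rewrite IH. reflexivity. Qed.

(** [u] decreases and [u k - 1 / (k + 1)] increases, both to the Euler constant, which is therefore
    enclosed between them at every stage. *)
Lemma harm_gamma (n : nat) : (1 <= n)%nat -> Rabs (harm n - ln (INR n) - euler_gamma) <= / INR n.
Proof.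
  intros Hn. set (u := fun k => sum_f_R0 (fun k => / INR (S k)) k - ln (INR (S k))). set (v := fun k => u k - / INR (S k)).
  assert (St : forall k, u (S k) <= u k /\ v k <= v (S k)).
  { intros k. unfold v, u. rewrite !harm_sum. unfold harm. cbn [Rsum_lt].
    assert (P := lt_0_INR (S k) ltac:(lia)). rewrite (S_INR (S k)).
    assert (A := ln_step (INR (S k)) P). lra. }
  assert (Vm : forall k, v 0%nat <= v k).
  { induction k as [|k IH]; [lra|]. destruct (St k). lra. }
  assert (UV : forall k, v k <= u k).
  { intros k. unfold v. assert (0 < / INR (S k)) by (apply Rinv_0_lt_compat, lt_0_INR; lia). lra. }
  destruct (ex_finite_lim_seq_decr u (v 0%nat)) as [l Hl].
  { intros; apply St. } { intros k. specialize (Vm k). specialize (UV k). lra. }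
  assert (E : euler_gamma = l) by (unfold euler_gamma; fold u; rewrite (is_lim_seq_unique _ _ Hl); reflexivity).
  assert (Hv : is_lim_seq v l).
  { replace l with (l - 0) by ring. apply is_lim_seq_minus'; auto.
    apply (is_lim_seq_inv (fun k => INR (S k)) p_infty); [|discriminate].
    apply (is_lim_seq_incr_1 INR). apply is_lim_seq_INR. }
  destruct n as [|k]; [lia|].
  assert (B1 := is_lim_seq_decr_compare u l Hl (fun k => proj1 (St k)) k).
  assert (B2 := is_lim_seq_incr_compare v l Hv (fun k => proj2 (St k)) k).
  unfold v, u in B1, B2. rewrite !harm_sum in *. rewrite E. apply Rabs_le. lra.
Qed.

(** * The density of zeros integrated against [cosn] *)

Definition dens (D k t : R) : R := D * (ln t + 1) + k.

Lemma is_derive_main (D k t : R) : 0 < t -> is_derive (fun t => D * (t * ln t) + k * t) t (dens D k t).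
Proof. intros H. unfold dens. auto_derive; auto. field. lra. Qed.

Lemma continuous_dens (D k t : R) : 0 < t -> continuous (dens D k) t.
Proof. intros H. apply (ex_derive_continuous (V := R_NormedModule) (dens D k)). unfold dens. auto_derive. auto. Qed.

Lemma cosn_le2 (n : nat) (t : R) : 0 <= cosn n t <= 2.
Proof. unfold cosn. generalize (COS_bound (INR n * ang t)). lra. Qed.

(** [lnw] exceeds [ln] by at most [1 / t^2], so exchanging them costs the integral of [2 D / t^2].
    Only [lnw] is integrable from 0 without care, which is what makes the exact integrals
    available. *)
Lemma RInt_dens_cosn (D k V U : R) (n : nat) : 0 <= D -> 3 <= V -> V <= U ->
  Rabs (RInt (fun t => dens D k t * cosn n t) V U - (D * (J1 n U - J1 n V) + (D + k) * (J0 n U - J0 n V))) <= 2 * D / V.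
Proof.
  intros HD HV HU.
  assert (I0 : is_RInt (fun t => dens D k t * cosn n t) V U (RInt (fun t => dens D k t * cosn n t) V U)).
  { apply (RInt_correct (V := R_CompleteNormedModule)). apply (ex_RInt_continuous (V := R_CompleteNormedModule)).
    rewrite Rmin_left, Rmax_right by lra. intros t Ht. apply (continuous_mult (K := R_AbsRing) (dens D k) (cosn n)); [apply continuous_dens; lra|apply continuous_cosn]. }
  assert (Sub : forall f : R -> R, (forall t, continuous f t) -> is_RInt f V U (RInt f 0 U - RInt f 0 V)).
  { intros f Hf. replace (RInt f 0 U - RInt f 0 V) with (RInt f V U); [apply is_RInt_cts; auto|].
    assert (C := RInt_Chasles (V := R_CompleteNormedModule) f 0 V U (ex_RInt_cts f 0 V Hf) (ex_RInt_cts f V U Hf)).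
    unfold plus in C; simpl in C. lra. }
  assert (I1 := Sub (cosn n) (continuous_cosn n)). fold (J0 n U) (J0 n V) in I1.
  assert (I2 := Sub (fun t => lnw t * cosn n t) (continuous_lnw_cosn n)). fold (J1 n U) (J1 n V) in I2.
  set (I := RInt (fun t => dens D k t * cosn n t) V U) in *.
  set (E := I - (D * (J1 n U - J1 n V) + (D + k) * (J0 n U - J0 n V))).
  assert (I3 : is_RInt (fun t => dens D k t * cosn n t - (D * (lnw t * cosn n t) + (D + k) * cosn n t)) V U E).
  { unfold E. apply (is_RInt_minus (V := R_NormedModule) (fun t => dens D k t * cosn n t)); auto.
    apply (is_RInt_plus (V := R_NormedModule) (fun t => D * (lnw t * cosn n t))).
    - apply (is_RInt_scal (V := R_NormedModule) (fun t => lnw t * cosn n t)); auto.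
    - apply (is_RInt_scal (V := R_NormedModule) (cosn n)); auto. }
  assert (I4 : is_RInt (fun t => 2 * D * / (t * t)) V U (2 * D * (/ V - / U))).
  { apply (is_RInt_scal (V := R_NormedModule) (fun t => / (t * t))). replace (/ V - / U) with (- / U - - / V) by ring.
    apply (is_RInt_derive (V := R_CompleteNormedModule) (fun t => - / t)); rewrite Rmin_left, Rmax_right by lra; intros t Ht.
    - auto_derive; [lra|]. field. lra.
    - apply (ex_derive_continuous (V := R_NormedModule) (fun t => / (t * t))). auto_derive. nra. }
  assert (HB : forall t, V <= t <= U ->
     - (2 * D * / (t * t)) <= dens D k t * cosn n t - (D * (lnw t * cosn n t) + (D + k) * cosn n t) <= 0).
  { intros t Ht. destruct (lnw_ln t ltac:(lra)) as [A B]. destruct (cosn_le2 n t) as [C1 C2].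
    replace (dens D k t * cosn n t - (D * (lnw t * cosn n t) + (D + k) * cosn n t)) with (- (D * ((lnw t - ln t) * cosn n t))) by (unfold dens; ring).
    assert (0 <= (lnw t - ln t) * cosn n t) by (apply Rmult_le_pos; lra).
    assert ((lnw t - ln t) * cosn n t <= / (t * t) * 2) by (apply Rmult_le_compat; lra).
    assert (0 <= D * ((lnw t - ln t) * cosn n t)) by (apply Rmult_le_pos; lra).
    assert (D * ((lnw t - ln t) * cosn n t) <= D * (/ (t * t) * 2)) by (apply Rmult_le_compat_l; lra). lra. }
  assert (L1 : - (2 * D * (/ V - / U)) <= E).
  { apply (is_RInt_le (fun t => - (2 * D * / (t * t))) (fun t => dens D k t * cosn n t - (D * (lnw t * cosn n t) + (D + k) * cosn n t)) V U); auto.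
    - apply (is_RInt_opp (V := R_NormedModule)). exact I4.
    - intros; apply HB; lra. }
  assert (L2 : E <= 0).
  { apply (is_RInt_le (fun t => dens D k t * cosn n t - (D * (lnw t * cosn n t) + (D + k) * cosn n t)) (fun _ => 0) V U); auto; [apply is_RInt_zero|].
    intros; apply HB; lra. }
  assert (0 < / U) by (apply Rinv_0_lt_compat; lra). assert (0 <= 2 * D * / U) by (apply Rmult_le_pos; lra).
  unfold Rdiv. apply Rabs_le. lra.
Qed.

Lemma J0_le (n : nat) (V : R) : 0 <= V -> Rabs (J0 n V) <= 2 * V.
Proof.
  intros H. replace (2 * V) with ((V - 0) * 2) by ring. apply abs_RInt_le_const; auto.
  - apply ex_RInt_cts, continuous_cosn.
  - intros t _. destruct (cosn_le2 n t). rewrite Rabs_right; lra.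
Qed.

Lemma J1_le (n : nat) (V : R) : 3 <= V -> Rabs (J1 n V) <= 6 * (V * ln V).
Proof.
  intros H. assert (L := ln_ge1 V H). apply Rle_trans with ((V - 0) * (2 * (3 * ln V))); [|right; ring].
  apply abs_RInt_le_const; [lra| |].
  - apply (ex_RInt_cts (fun t => lnw t * cosn n t)), continuous_lnw_cosn.
  - intros t Ht. destruct (cosn_le2 n t) as [C1 C2]. rewrite Rabs_mult, Rmult_comm. apply Rmult_le_compat; try apply Rabs_pos.
    + rewrite Rabs_right; lra.
    + destruct (lnw_ln V ltac:(lra)) as [A B].
      assert (I : / (V * V) <= 1) by (rewrite <- Rinv_1; apply Rinv_le_contravar; nra).
      assert (U1 : lnw t <= lnw V) by (unfold lnw; apply Rmult_le_compat_l; [lra|apply ln_mono; nra]).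
      (* The minimum of [lnw], at 0, is [- ln 4 / 2], and [ln 4 <= 3]. *)
      assert (U2 : - (3 / 2) <= lnw t).
      { assert (F := ln_mono (/ 4) (t * t + / 4) ltac:(lra) ltac:(nra)). rewrite ln_Rinv in F by lra.
        assert (F4 := ln_le_sub1 4 ltac:(lra)). unfold lnw. lra. }
      apply Rabs_le. lra.
Qed.

Lemma le_of_inv_sqrt (a b c V : R) : (forall U, V <= U -> a <= b + c / sqrt U) -> a <= b.
Proof.
  intros H. apply Rnot_lt_le. intros L. set (d := a - b). assert (Hd : 0 < d) by (unfold d; lra).
  set (r := Rabs c / d + 1). assert (Hr : 1 <= r).
  { unfold r. assert (0 <= Rabs c / d) by (apply Rmult_le_pos; [apply Rabs_pos|left; apply Rinv_0_lt_compat; auto]). lra. }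
  set (U := Rmax V (r * r)). assert (HU := H U (Rmax_l _ _)).
  assert (Hs : r <= sqrt U).
  { rewrite <- (sqrt_square r) by lra. apply sqrt_le_1_alt. apply Rmax_r. }
  assert (B : c / sqrt U <= Rabs c / r).
  { apply Rle_trans with (Rabs c / sqrt U).
    - apply Rmult_le_compat_r; [left; apply Rinv_0_lt_compat; lra|apply Rle_abs].
    - apply div_le_den; auto; [apply Rabs_pos|lra]. }
  assert (C : Rabs c / r < d).
  { apply Rmult_lt_reg_r with r; [lra|]. replace (Rabs c / r * r) with (Rabs c) by (field; lra).
    unfold r. replace (d * (Rabs c / d + 1)) with (Rabs c + d) by (field; lra). lra. }
  unfold d in C. lra.
Qed.

(** The limit is the supremum of the lower bounds [g V - C / sqrt V], each of which lies below every
    [g W + C / sqrt W]. *)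
Lemma cauchy_inv_sqrt (g : R -> R) (C t0 : R) : (forall V U, t0 <= V -> V <= U -> Rabs (g U - g V) <= C / sqrt V) ->
  exists l, forall V, t0 <= V -> Rabs (g V - l) <= C / sqrt V.
Proof.
  intros H.
  assert (Cmp : forall V W, t0 <= V -> t0 <= W -> g V - C / sqrt V <= g W + C / sqrt W).
  { intros V W HV HW. assert (N1 := Rle_trans _ _ _ (Rabs_pos _) (H V V HV (Rle_refl V))).
    assert (N2 := Rle_trans _ _ _ (Rabs_pos _) (H W W HW (Rle_refl W))).
    destruct (Rle_dec V W) as [L|L].
    - specialize (H V W HV L). apply Rabs_le_between in H. lra.
    - specialize (H W V HW ltac:(lra)). apply Rabs_le_between in H. lra. }
  destruct (completeness (fun x => exists V, t0 <= V /\ x = g V - C / sqrt V)) as [l [Ul Ll]].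
  - exists (g t0 + C / sqrt t0). intros x (V & HV & ->). apply Cmp; lra.
  - exists (g t0 - C / sqrt t0). exists t0. split; [lra|auto].
  - exists l. intros V HV. assert (A := Ul _ (ex_intro _ V (conj HV eq_refl))).
    assert (B : l <= g V + C / sqrt V) by (apply Ll; intros x (W & HW & ->); apply Cmp; auto).
    apply Rabs_le. lra.
Qed.

Lemma zero_sum_split (X : C -> C) (f : R -> R) (V U : R) (lV lU : list C) : 0 <= V -> V <= U ->
  zeros_upto X V lV -> zeros_upto X U lU ->
  Rlsum (fun z => f (Im z)) lU = Rlsum (fun z => f (Im z)) lV
    + (Rlsum (fun z => indic V U (Im z) * f (Im z)) lU + Rlsum (fun z => indic V U (- Im z) * f (Im z)) lU).
Proof.
  intros HV HU HlV HlU.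
  set (h := fun z : C => if Rle_dec (Rabs (Im z)) V then f (Im z) else 0).
  replace (Rlsum (fun z => f (Im z)) lV) with (Rlsum h lU).
  - rewrite <- !Rlsum_plus. apply Rlsum_ext. intros z Hz. apply (zeros_upto_In X U) in Hz; auto. destruct Hz as [_ Hz].
    unfold h, indic. apply Rabs_le_between in Hz. destruct (Rle_dec (Rabs (Im z)) V) as [H|H].
    + apply Rabs_le_between in H. destruct (Rlt_dec V (Im z)), (Rlt_dec V (- Im z)); try lra.
    + assert (V < Im z \/ Im z < - V).
      { destruct (Rle_dec (Im z) V), (Rle_dec (- V) (Im z)); try lra. exfalso; apply H. apply Rabs_le; lra. }
      destruct (Rlt_dec V (Im z)), (Rlt_dec V (- Im z)), (Rle_dec (Im z) U), (Rle_dec (- Im z) U); lra.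
  - rewrite <- (Rlsum_zeros_stable X h V U lV lU); auto.
    + apply Rlsum_ext. intros z Hz. apply (zeros_upto_In X V) in Hz; auto. unfold h. destruct (Rle_dec (Rabs (Im z)) V); tauto.
    + intros z Hz. unfold h. destruct (Rle_dec (Rabs (Im z)) V); [lra|auto].
Qed.

(** * From the zero count to the Li coefficients *)

(** [W] may exceed [T2], so that a single list serves all the heights at which the count is
    evaluated inside an Abel summation. *)
Definition zero_count (X : C -> C) (ord : C -> R) (D k K t0 : R) : Prop :=
  forall T1 T2 W l, t0 <= T1 -> T1 <= T2 -> T2 <= W -> zeros_upto X W l ->
    Rabs (PI * Rlsum (fun z => indic T1 T2 (ord z)) l - ((D * (T2 * ln T2) + k * T2) - (D * (T1 * ln T1) + k * T1))) <= K * ln T2.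

Lemma cosn_opp (n : nat) (t : R) : cosn n (- t) = cosn n t.
Proof.
  unfold cosn. rewrite ang_opp. replace (INR n * (2 * PI - ang t)) with (- (INR n * ang t) + 2 * INR n * PI) by ring.
  rewrite cos_period, cos_neg. reflexivity.
Qed.

Lemma sinn_opp (n : nat) (t : R) : sinn n (- t) = - sinn n t.
Proof.
  unfold sinn. rewrite ang_opp. replace (INR n * (2 * PI - ang t)) with (- (INR n * ang t) + 2 * INR n * PI) by ring.
  rewrite sin_period, sin_neg. reflexivity.
Qed.

Lemma ang_derive_le (n : nat) (t x : R) : 0 < t -> Rabs x <= 1 -> Rabs (- 4 / (1 + 4 * (t * t)) * (INR n * x)) <= INR n / (t * t).
Proof.
  intros Ht Hx. assert (P := pos_INR n). assert (T : 0 < t * t) by nra.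
  replace (- 4 / (1 + 4 * (t * t)) * (INR n * x)) with (- (4 / (1 + 4 * (t * t)) * INR n * x)) by (field; lra).
  assert (Q : 0 < 4 / (1 + 4 * (t * t))) by (apply Rdiv_lt_0_compat; lra).
  assert (R : 4 / (1 + 4 * (t * t)) <= / (t * t)).
  { replace (/ (t * t)) with (4 / (4 * (t * t))) by (field; lra). apply div_le_den; lra. }
  rewrite Rabs_Ropp, Rabs_mult, (Rabs_right (4 / (1 + 4 * (t * t)) * INR n)) by (apply Rle_ge, Rmult_le_pos; lra).
  apply Rle_trans with (4 / (1 + 4 * (t * t)) * INR n * 1).
  - apply Rmult_le_compat_l; auto. apply Rmult_le_pos; lra.
  - rewrite Rmult_1_r, Rmult_comm. apply Rmult_le_compat_l; auto.
Qed.

Lemma zero_count_sum (X : C -> C) (ord : C -> R) (D k K t0 N : R) (f f' : R -> R) (V U : R) (l : list C) :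
  3 <= t0 -> 0 <= K -> 0 <= N -> zero_count X ord D k K t0 ->
  (forall t, is_derive f t (f' t)) -> (forall t, continuous f' t) ->
  (forall t, 0 < t -> Rabs (f t) <= N / t) -> (forall t, 0 < t -> Rabs (f' t) <= N / (t * t)) ->
  t0 <= V -> V <= U -> zeros_upto X U l ->
  Rabs (PI * Rlsum (fun z => indic V U (ord z) * f (ord z)) l - RInt (fun t => dens D k t * f t) V U) <= K * N * ((ln V + 1) / V).
Proof.
  intros Ht0 HK HN HZ Hf Hf' B1 B2 HV HU Hl.
  apply (abel_sum f f' (fun t => D * (t * ln t) + k * t) (dens D k)); auto; try lra.
  - intros t Ht. apply is_derive_main; lra.
  - intros t Ht. apply continuous_dens; lra.
  - intros t Ht. apply B1; lra.
  - intros t Ht. apply B2; lra.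
  - intros t Ht. apply (HZ V t U l); auto; lra.
Qed.

Lemma continuous_cosn' (n : nat) (t : R) : continuous (fun t => - 4 / (1 + 4 * (t * t)) * (INR n * sinn n t)) t.
Proof.
  apply (continuous_mult (K := R_AbsRing) (fun t => - 4 / (1 + 4 * (t * t)))).
  - apply (ex_derive_continuous (V := R_NormedModule) (fun t => - 4 / (1 + 4 * (t * t)))). auto_derive. nra.
  - apply (continuous_mult (K := R_AbsRing) (fun t => INR n) (sinn n)); [apply continuous_const|apply continuous_sinn].
Qed.

Lemma continuous_sinn' (n : nat) (t : R) : continuous (fun t => - 4 / (1 + 4 * (t * t)) * (INR n * cos (INR n * ang t))) t.
Proof.
  apply (continuous_mult (K := R_AbsRing) (fun t => - 4 / (1 + 4 * (t * t)))).
  - apply (ex_derive_continuous (V := R_NormedModule) (fun t => - 4 / (1 + 4 * (t * t)))). auto_derive. nra.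
  - apply (continuous_mult (K := R_AbsRing) (fun t => INR n) (fun t => cos (INR n * ang t))); [apply continuous_const|].
    apply (ex_derive_continuous (V := R_NormedModule) (fun t => cos (INR n * ang t))). unfold ang. generalize (INR n). intros. auto_derive; auto.
Qed.

(** Evenness of [cosn] lets the zeros below the axis be summed through [- Im z]; both halves have
    the same integral, hence the factor 2. *)
Lemma cosn_increment (X : C -> C) (D k K t0 : R) (n : nat) (V U : R) (lV lU : list C) : 3 <= t0 -> 0 <= K -> 0 <= D ->
  zero_count X Im D k K t0 -> zero_count X (fun z => - Im z) D k K t0 -> t0 <= V -> V <= U ->
  zeros_upto X V lV -> zeros_upto X U lU ->
  Rabs (PI * (Rlsum (fun z => cosn n (Im z)) lU - Rlsum (fun z => cosn n (Im z)) lV)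
    - 2 * (D * (J1 n U - J1 n V) + (D + k) * (J0 n U - J0 n V))) <= 4 * D / V + 2 * (K * INR n * ((ln V + 1) / V)).
Proof.
  intros Ht0 HK HD Z1 Z2 HV HU HlV HlU.
  assert (Hsin : forall t, Rabs (sinn n t) <= 1) by (intros t; apply Rabs_le; generalize (SIN_bound (INR n * ang t)); unfold sinn; lra).
  assert (A : forall ord, zero_count X ord D k K t0 -> Rabs (PI * Rlsum (fun z => indic V U (ord z) * cosn n (ord z)) lU
     - RInt (fun t => dens D k t * cosn n t) V U) <= K * INR n * ((ln V + 1) / V)).
  { intros ord HZ. eapply (zero_count_sum X ord D k K t0 (INR n) (cosn n)); eauto.
    - apply pos_INR.
    - apply is_derive_cosn.
    - apply continuous_cosn'.
    - intros; apply cosn_le; auto.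
    - intros; apply ang_derive_le; auto. }
  assert (A1 := A Im Z1). assert (A2 := A (fun z => - Im z) Z2). cbv beta in A2.
  rewrite (Rlsum_ext (fun z => indic V U (- Im z) * cosn n (- Im z)) (fun z => indic V U (- Im z) * cosn n (Im z))) in A2
    by (intros; rewrite cosn_opp; reflexivity).
  assert (S := zero_sum_split X (cosn n) V U lV lU ltac:(lra) HU HlV HlU).
  assert (I := RInt_dens_cosn D k V U n HD ltac:(lra) HU).
  rewrite S. replace (4 * D / V) with (2 * (2 * D / V)) by (field; lra).
  apply Rabs_le_between in A1. apply Rabs_le_between in A2. apply Rabs_le_between in I. apply Rabs_le. lra.
Qed.

(** The two halves have the same density, and oddness of [sinn] makes their integrals cancel; only
    the errors remain. No symmetry of the zero set under conjugation is invoked. *)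
Lemma sinn_increment (X : C -> C) (D k K t0 : R) (n : nat) (V U : R) (lV lU : list C) : 3 <= t0 -> 0 <= K ->
  zero_count X Im D k K t0 -> zero_count X (fun z => - Im z) D k K t0 -> t0 <= V -> V <= U ->
  zeros_upto X V lV -> zeros_upto X U lU ->
  Rabs (PI * (Rlsum (fun z => sinn n (Im z)) lU - Rlsum (fun z => sinn n (Im z)) lV)) <= 2 * (K * INR n * ((ln V + 1) / V)).
Proof.
  intros Ht0 HK Z1 Z2 HV HU HlV HlU.
  assert (A : forall ord, zero_count X ord D k K t0 -> Rabs (PI * Rlsum (fun z => indic V U (ord z) * sinn n (ord z)) lU
     - RInt (fun t => dens D k t * sinn n t) V U) <= K * INR n * ((ln V + 1) / V)).
  { intros ord HZ. eapply (zero_count_sum X ord D k K t0 (INR n) (sinn n)); eauto.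
    - apply pos_INR.
    - apply is_derive_sinn.
    - apply continuous_sinn'.
    - intros; apply sinn_le; auto.
    - intros; apply ang_derive_le; auto. apply Rabs_le, COS_bound. }
  assert (A1 := A Im Z1). assert (A2 := A (fun z => - Im z) Z2). cbv beta in A2.
  rewrite (Rlsum_ext (fun z => indic V U (- Im z) * sinn n (- Im z)) (fun z => (-1) * (indic V U (- Im z) * sinn n (Im z)))), Rlsum_scal in A2
    by (intros; rewrite sinn_opp; ring).
  assert (S := zero_sum_split X (sinn n) V U lV lU ltac:(lra) HU HlV HlU). rewrite S.
  apply Rabs_le_between in A1. apply Rabs_le_between in A2. apply Rabs_le. lra.
Qed.

(** Bounds the part of the Li sum below the cut, where each term is only known to be at most 2 in
    each component. *)
Lemma zero_count_total (X : C -> C) (D k K t0 : R) : 3 <= t0 -> 0 <= K -> 0 <= D -> (exists l, zeros_upto X t0 l) ->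
  zero_count X Im D k K t0 -> zero_count X (fun z => - Im z) D k K t0 ->
  exists C, 0 <= C /\ forall V l, t0 <= V -> zeros_upto X V l -> Rlsum (fun _ => 1) l <= C * (V * ln V).
Proof.
  intros Ht0 HK HD [l0 Hl0] Z1 Z2. assert (HP := PI_RGT_0). assert (HP3 : 3 < PI) by (generalize PI2_3_2; unfold PI2; lra).
  set (m0 := D * (t0 * ln t0) + k * t0). set (s0 := Rlsum (fun _ => 1) l0).
  exists (Rabs s0 + 2 * (D + Rabs k + Rabs m0 + K)).
  assert (P1 := Rabs_pos s0). assert (P2 := Rabs_pos k). assert (P3 := Rabs_pos m0). split; [lra|].
  intros V l HV Hl.
  assert (S := zero_sum_split X (fun _ => 1) t0 V l0 l ltac:(lra) HV Hl0 Hl). cbv beta in S. fold s0 in S.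
  rewrite (Rlsum_ext (fun z => indic t0 V (Im z) * 1) (fun z => indic t0 V (Im z))) in S by (intros; apply Rmult_1_r).
  rewrite (Rlsum_ext (fun z => indic t0 V (- Im z) * 1) (fun z => indic t0 V (- Im z))) in S by (intros; apply Rmult_1_r).
  assert (A1 := Z1 t0 V V l (Rle_refl _) HV (Rle_refl _) Hl). assert (A2 := Z2 t0 V V l (Rle_refl _) HV (Rle_refl _) Hl).
  cbv beta in A1, A2. fold m0 in A1, A2.
  assert (L := ln_ge1 V ltac:(lra)).
  assert (W1 : ln V <= V * ln V) by (rewrite <- (Rmult_1_l (ln V)) at 1; apply Rmult_le_compat_r; lra).
  assert (W2 : V <= V * ln V) by (rewrite <- (Rmult_1_r V) at 1; apply Rmult_le_compat_l; lra).
  set (w := V * ln V) in *.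
  assert (B1 : Rabs s0 * 1 <= Rabs s0 * w) by (apply Rmult_le_compat_l; lra).
  assert (B2 : k * V <= Rabs k * w).
  { apply Rle_trans with (Rabs k * V); [apply Rmult_le_compat_r; [lra|apply Rle_abs]|apply Rmult_le_compat_l; lra]. }
  assert (B3 : Rabs m0 * 1 <= Rabs m0 * w) by (apply Rmult_le_compat_l; lra).
  assert (B4 : K * ln V <= K * w) by (apply Rmult_le_compat_l; lra).
  assert (B5 := Rle_abs (- m0)). rewrite Rabs_Ropp in B5. assert (B6 := Rle_abs s0).
  set (Q := D * w + Rabs k * w + Rabs m0 * w + K * w).
  assert (HD0 : 0 <= D * w) by (apply Rmult_le_pos; lra). assert (HK0 : 0 <= K * w) by (apply Rmult_le_pos; lra).
  assert (Hk0 : 0 <= Rabs k * w) by (apply Rmult_le_pos; lra). assert (Hm0 : 0 <= Rabs m0 * w) by (apply Rmult_le_pos; lra).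
  assert (Le : forall x, PI * x <= Q -> x <= Q).
  { intros x Hx. destruct (Rle_dec x 0); [unfold Q; lra|]. assert (1 * x <= PI * x) by (apply Rmult_le_compat_r; lra). lra. }
  apply Rabs_le_between in A1. apply Rabs_le_between in A2.
  assert (E1 := Le (Rlsum (fun z => indic t0 V (Im z)) l) ltac:(unfold Q; lra)).
  assert (E2 := Le (Rlsum (fun z => indic t0 V (- Im z)) l) ltac:(unfold Q; lra)).
  rewrite S. unfold Q in E1, E2. lra.
Qed.

Lemma li_term_half_line (n : nat) (z : C) : Re z = / 2 -> li_term n z = (cosn n (Im z), sinn n (Im z)).
Proof.
  intros Hz. destruct z as [x t]. simpl in Hz. subst x. simpl.
  assert (E : (RtoC 1 - / ((/ 2)%R, t))%C = Cexp (0, ang t)).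
  { unfold Cexp. simpl. rewrite exp_0, cos_ang, sin_ang. apply injective_projections; simpl; field; nra. }
  assert (E2 : forall m, Cinv (Cpown (RtoC 1 - / ((/ 2)%R, t))%C m) = (cos (INR m * ang t), (- sin (INR m * ang t))%R)).
  { intros m. assert (Em : Cpown (RtoC 1 - / ((/ 2)%R, t))%C m = (cos (INR m * ang t), sin (INR m * ang t))).
    { rewrite E. induction m as [|m IH].
      - simpl. rewrite Rmult_0_l, cos_0, sin_0. reflexivity.
      - cbn [Cpown]. rewrite IH, S_INR. replace ((INR m + 1) * ang t) with (ang t + INR m * ang t) by ring.
        rewrite cos_plus, sin_plus. unfold Cexp. simpl. rewrite exp_0. apply injective_projections; simpl; ring. }
    rewrite Em. assert (S := sin2_cos2 (INR m * ang t)). unfold Rsqr in S. unfold Cinv. simpl.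
    replace (cos (INR m * ang t) * (cos (INR m * ang t) * 1) + sin (INR m * ang t) * (sin (INR m * ang t) * 1)) with 1 by lra.
    apply injective_projections; simpl; field. }
  unfold li_term. rewrite E2. unfold cosn, sinn. apply injective_projections; simpl; ring.
Qed.

Lemma li_sum_half_line (X : C -> C) (n : nat) (T : R) (l : list C) : half_line X -> zeros_upto X T l ->
  Csum_list (li_term n) l = (Rlsum (fun z => cosn n (Im z)) l, Rlsum (fun z => sinn n (Im z)) l).
Proof.
  intros HX Hl. assert (H : forall z, In z l -> Re z = / 2).
  { intros z Hz. apply HX. eapply zeros_upto_In; eauto. }
  clear Hl. induction l as [|z l IH]; [reflexivity|]. cbn [Csum_list Rlsum].
  rewrite IH by (intros; apply H; right; auto). rewrite li_term_half_line by (apply H; left; auto). reflexivity.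
Qed.

Lemma li_asymptotic (X : C -> C) (D k K t0 : R) : 3 <= t0 -> 0 <= K -> 0 <= D -> half_line X ->
  (forall W, 0 <= W -> exists l, zeros_upto X W l) ->
  zero_count X Im D k K t0 -> zero_count X (fun z => - Im z) D k K t0 ->
  exists B N, forall n, (N <= n)%nat -> exists L, li_coeff X n L /\
    Cmod (L - RtoC (D * INR n * ln (INR n) + (D * euler_gamma + k) * INR n))%C <= B * sqrt (INR n) * ln (INR n).
Proof.
  intros Ht0 HK HD HX Hex Z1 Z2. assert (HP := PI_RGT_0). assert (HP3 : 3 < PI) by (generalize PI2_3_2; unfold PI2; lra).
  destruct (zero_count_total X D k K t0 Ht0 HK HD (Hex t0 ltac:(lra)) Z1 Z2) as (Cz & HCz & Htot).
  (* A fixed list for each height turns the truncated sums into functions of [T], to which Cauchy's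
     criterion applies; other lists agree with it up to permutation. *)
  assert (Hch : exists zl : R -> list C, forall W, 0 <= W -> zeros_upto X W (zl W)).
  { exists (fun W => epsilon (inhabits nil) (fun l => zeros_upto X W l)). intros W HW. apply epsilon_spec. auto. }
  destruct Hch as [zl Hzl].
  assert (PK := Rabs_pos (D + k)).
  exists ((16 * D + 4 * K + 2 * PI * Cz + 4 * Rabs (D + k)) + D + (2 * PI * Cz + 4 * K)).
  (* [n >= t0^2] puts the cut [sqrt n] in the range where the counting formula holds; as [t0 >= 3]
     it also gives [n >= 9]. *)
  exists (Z.to_nat (up (t0 * t0))). intros n Hn.
  assert (Hn0 : t0 * t0 <= INR n).
  { destruct (archimed (t0 * t0)) as [A _]. apply le_INR in Hn. apply Rle_trans with (2 := Hn).
    rewrite INR_IZR_INZ, Z2Nat.id; [lra|]. apply le_IZR. nra. }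
  assert (H9 : 9 <= INR n) by nra.
  set (V := sqrt (INR n)). assert (HV : t0 <= V).
  { rewrite <- (sqrt_square t0) by lra. apply sqrt_le_1_alt. auto. }
  assert (EV : V * V = INR n) by (apply sqrt_sqrt; lra).
  assert (LV : ln (INR n) = 2 * ln V) by (rewrite <- EV, ln_mult; lra).
  assert (L1 := ln_ge1 V ltac:(lra)).
  set (gc := fun T => Rlsum (fun z => cosn n (Im z)) (zl T)). set (gs := fun T => Rlsum (fun z => sinn n (Im z)) (zl T)).
  set (E := fun V => K * INR n * ((ln V + 1) / V)).
  assert (IC : forall V U, t0 <= V -> V <= U ->
    Rabs (PI * (gc U - gc V) - 2 * (D * (J1 n U - J1 n V) + (D + k) * (J0 n U - J0 n V))) <= 4 * D / V + 2 * E V).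
  { intros V' U HV' HU. apply (cosn_increment X D k K t0 n V' U); auto; apply Hzl; lra. }
  assert (IS : forall V U, t0 <= V -> V <= U -> Rabs (PI * (gs U - gs V)) <= 2 * E V).
  { intros V' U HV' HU. apply (sinn_increment X D k K t0 n V' U); auto; apply Hzl; lra. }
  destruct (J0_lim n) as [C0 HC0]. destruct (J1_lim n) as [C1 HC1].
  set (l0 := INR n * (PI / 2)) in *. set (l1 := PI / 2 * (INR n * harm n - INR n)) in *.
  assert (HE : forall V, t0 <= V -> 0 <= E V <= 3 * (K * INR n) / sqrt V).
  { intros W HW. assert (S := sqrt_ge1 W ltac:(lra)). assert (A := ln_le_sqrt W ltac:(lra)). assert (A1 := ln_ge1 W ltac:(lra)).
    assert (KN : 0 <= K * INR n) by (apply Rmult_le_pos; [auto|apply pos_INR]). unfold E. split.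
    - apply Rmult_le_pos; auto. apply Rmult_le_pos; [lra|left; apply Rinv_0_lt_compat; lra].
    - replace (3 * (K * INR n) / sqrt W) with (K * INR n * (3 * sqrt W / W)).
      + apply Rmult_le_compat_l; auto. apply Rmult_le_compat_r; [left; apply Rinv_0_lt_compat|]; lra.
      + rewrite <- (sqrt_sqrt W) at 2 by lra. field. lra. }
  assert (PosPI : forall x y, Rabs (PI * x) <= y -> Rabs x <= y).
  { intros x y H. rewrite Rabs_mult, (Rabs_right PI) in H by lra. assert (P := Rabs_pos x).
    assert (1 * Rabs x <= PI * Rabs x) by (apply Rmult_le_compat_r; lra). lra. }
  assert (Dab : forall u v w x y, Rabs (u - l0) <= x -> Rabs (v - l0) <= y -> Rabs (w * (u - v)) <= Rabs w * (x + y)).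
  { intros u v w x y Hu Hv. rewrite Rabs_mult. apply Rmult_le_compat_l; [apply Rabs_pos|].
    apply Rabs_le_between in Hu. apply Rabs_le_between in Hv. apply Rabs_le. lra. }
  assert (Isq : forall V U, t0 <= V -> V <= U -> forall c, 0 <= c -> c / sqrt U <= c / sqrt V).
  { intros V' U HV' HU c Hc. assert (S := sqrt_ge1 V' ltac:(lra)). apply div_le_den; auto; [lra|]. apply sqrt_le_1_alt; auto. }
  assert (C0p : 0 <= C0).
  { specialize (HC0 3 (Rle_refl _)). assert (S := sqrt_ge1 3 ltac:(lra)). assert (P := Rle_trans _ _ _ (Rabs_pos _) HC0).
    replace C0 with (C0 / sqrt 3 * sqrt 3) by (field; lra). apply Rmult_le_pos; lra. }
  assert (C1p : 0 <= C1).
  { specialize (HC1 3 (Rle_refl _)). assert (S := sqrt_ge1 3 ltac:(lra)). assert (P := Rle_trans _ _ _ (Rabs_pos _) HC1).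
    replace C1 with (C1 / sqrt 3 * sqrt 3) by (field; lra). apply Rmult_le_pos; lra. }
  (* For fixed [n] all errors are [O(1 / sqrt W)]. The constants depend on [n], which is harmless
     because they only serve convergence. *)
  destruct (cauchy_inv_sqrt gc (4 * (D * C1) + 4 * (Rabs (D + k) * C0) + 4 * D + 6 * (K * INR n)) t0) as [lc Hlc].
  { intros W U HW HU. apply PosPI. assert (I := IC W U HW HU).
    assert (Q1 := HC1 W ltac:(lra)). assert (Q2 := HC1 U ltac:(lra)). assert (Q3 := HC0 W ltac:(lra)). assert (Q4 := HC0 U ltac:(lra)).
    assert (T1 := Isq W U HW HU C0 C0p). assert (T2 := Isq W U HW HU C1 C1p).
    assert (Y0 := Dab (J0 n U) (J0 n W) (D + k) (C0 / sqrt W) (C0 / sqrt W) ltac:(lra) Q3).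
    assert (Y1 : Rabs (D * (J1 n U - J1 n W)) <= D * (2 * (C1 / sqrt W))).
    { rewrite Rabs_mult, (Rabs_right D) by lra. apply Rmult_le_compat_l; auto.
      apply Rabs_le_between in Q1. apply Rabs_le_between in Q2. apply Rabs_le. lra. }
    destruct (HE W HW) as [_ E2]. assert (V2 := inv_le_inv_sqrt W ltac:(lra)).
    assert (V3 : 4 * D / W <= 4 * D / sqrt W) by (apply Rmult_le_compat_l; lra).
    apply Rabs_le_between in I. apply Rabs_le_between in Y0. apply Rabs_le_between in Y1. unfold Rdiv in *. apply Rabs_le. lra. }
  destruct (cauchy_inv_sqrt gs (6 * (K * INR n)) t0) as [ls Hls].
  { intros W U HW HU. apply PosPI. assert (I := IS W U HW HU). destruct (HE W HW) as [_ E2]. unfold Rdiv in *. lra. }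
  exists (lc, ls). split.
  - set (M1 := 4 * (D * C1) + 4 * (Rabs (D + k) * C0) + 4 * D + 6 * (K * INR n)) in *. set (M2 := 6 * (K * INR n)) in *.
    intros eps Heps.
    set (T0 := Rmax t0 (((Rabs M1 + Rabs M2 + 1) / eps) * ((Rabs M1 + Rabs M2 + 1) / eps))).
    assert (P1 := Rabs_pos M1). assert (P2 := Rabs_pos M2). set (M := Rabs M1 + Rabs M2 + 1) in *. assert (HM : 0 < M) by (unfold M; lra).
    exists T0. intros T HT. assert (HT0 : t0 <= T) by (generalize (Rmax_l t0 ((M / eps) * (M / eps))); fold T0; lra).
    split; [apply Hex; lra|]. intros l Hl. rewrite (li_sum_half_line X n T l HX Hl).
    assert (Perm := zeros_upto_perm X T l (zl T) Hl (Hzl T ltac:(lra))).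
    rewrite (Rlsum_perm _ _ _ Perm), (Rlsum_perm (fun z => sinn n (Im z)) _ _ Perm). fold (gc T) (gs T).
    eapply Rle_lt_trans; [apply Cmod_le_abs|]. simpl.
    assert (A1 := Hlc T HT0). assert (A2 := Hls T HT0). unfold Rminus in A1, A2.
    assert (Sq : M / eps <= sqrt T).
    { rewrite <- (sqrt_square (M / eps)) by (left; apply Rdiv_lt_0_compat; lra). apply sqrt_le_1_alt.
      generalize (Rmax_r t0 ((M / eps) * (M / eps))). fold T0. lra. }
    assert (MS : M / sqrt T <= eps).
    { assert (0 < M / eps) by (apply Rdiv_lt_0_compat; lra). apply Rle_trans with (M / (M / eps)); [apply div_le_den; lra|right; field; lra]. }
    assert (S := sqrt_ge1 T ltac:(lra)). assert (IS0 : 0 < / sqrt T) by (apply Rinv_0_lt_compat; lra).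
    assert (B1 : M1 / sqrt T <= Rabs M1 / sqrt T) by (apply Rmult_le_compat_r; [lra|apply Rle_abs]).
    assert (B2 : M2 / sqrt T <= Rabs M2 / sqrt T) by (apply Rmult_le_compat_r; [lra|apply Rle_abs]).
    unfold M in MS. unfold Rdiv in *. lra.
  (* With [V = sqrt n] fixed, letting [U] tend to infinity removes the uncontrolled constants [C0]
     and [C1] and keeps only [4 D / V + 2 E V]. *)
  - assert (ReB : Rabs (PI * lc - PI * gc V - 2 * (D * (l1 - J1 n V) + (D + k) * (l0 - J0 n V))) <= 4 * D / V + 2 * E V).
    { set (cc := PI * (4 * (D * C1) + 4 * (Rabs (D + k) * C0) + 4 * D + 6 * (K * INR n)) + 2 * (D * C1 + Rabs (D + k) * C0)).
      assert (H : forall U, V <= U -> Rabs (PI * lc - PI * gc V - 2 * (D * (l1 - J1 n V) + (D + k) * (l0 - J0 n V))) <= 4 * D / V + 2 * E V + cc / sqrt U).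
      { intros U HU. assert (I := IC V U HV HU). assert (A1 := Hlc U ltac:(lra)). assert (Q1 := HC1 U ltac:(lra)). assert (Q0 := HC0 U ltac:(lra)).
        assert (Y1 : Rabs (PI * (gc U - lc)) <= PI * ((4 * (D * C1) + 4 * (Rabs (D + k) * C0) + 4 * D + 6 * (K * INR n)) / sqrt U)).
        { rewrite Rabs_mult, (Rabs_right PI) by lra. apply Rmult_le_compat_l; lra. }
        assert (Y2 : Rabs (D * (J1 n U - l1)) <= D * (C1 / sqrt U)).
        { rewrite Rabs_mult, (Rabs_right D) by lra. apply Rmult_le_compat_l; lra. }
        assert (Y3 : Rabs ((D + k) * (J0 n U - l0)) <= Rabs (D + k) * (C0 / sqrt U)).
        { rewrite Rabs_mult. apply Rmult_le_compat_l; lra. }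
        apply Rabs_le_between in I. apply Rabs_le_between in Y1. apply Rabs_le_between in Y2. apply Rabs_le_between in Y3.
        unfold cc, Rdiv in *. apply Rabs_le. lra. }
      apply (le_of_inv_sqrt _ _ cc V H). }
    assert (ImB : Rabs (PI * (ls - gs V)) <= 2 * E V).
    { apply (le_of_inv_sqrt _ _ (PI * (6 * (K * INR n))) V). intros U HU. assert (I := IS V U HV HU). assert (A1 := Hls U ltac:(lra)).
      assert (Y1 : Rabs (PI * (gs U - ls)) <= PI * (6 * (K * INR n) / sqrt U)).
      { rewrite Rabs_mult, (Rabs_right PI) by lra. apply Rmult_le_compat_l; lra. }
      apply Rabs_le_between in I. apply Rabs_le_between in Y1. unfold Rdiv in *. apply Rabs_le. lra. }
    assert (Wt := Htot V (zl V) HV (Hzl V ltac:(lra))).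
    set (w := V * ln V) in *. assert (Hw1 : V <= w) by (unfold w; rewrite <- (Rmult_1_r V) at 1; apply Rmult_le_compat_l; lra).
    assert (BS : forall f : R -> R, (forall t, Rabs (f t) <= 2) -> Rabs (Rlsum (fun z => f (Im z)) (zl V)) <= 2 * (Cz * w)).
    { intros f Hf. eapply Rle_trans; [apply Rlsum_abs|].
      apply Rle_trans with (Rlsum (fun _ => 2 * 1) (zl V)); [apply Rlsum_le; intros; rewrite Rmult_1_r; apply Hf|].
      rewrite (Rlsum_scal 2 (fun _ => 1)). lra. }
    assert (Bc : Rabs (gc V) <= 2 * (Cz * w)) by (apply (BS (cosn n)); intros t; destruct (cosn_le2 n t); rewrite Rabs_right; lra).
    assert (Bs : Rabs (gs V) <= 2 * (Cz * w)) by (apply (BS (sinn n)); intros t; apply Rabs_le; generalize (SIN_bound (INR n * ang t)); unfold sinn; lra).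
    (* Here the choice [V^2 = n] enters: [n (ln V + 1) / V = V ln V + V]. *)
    assert (EB : E V <= 2 * (K * w)).
    { unfold E. rewrite <- EV. replace (K * (V * V) * ((ln V + 1) / V)) with (K * (w + V)) by (unfold w; field; lra).
      replace (2 * (K * w)) with (K * (w + w)) by ring. apply Rmult_le_compat_l; lra. }
    assert (DB : 4 * D / V <= 4 * (D * w)).
    { assert (I1 : / V <= 1) by (rewrite <- Rinv_1; apply Rinv_le_contravar; lra).
      replace (4 * (D * w)) with (4 * D * w) by ring. apply Rmult_le_compat_l; lra. }
    assert (J1B : Rabs (D * J1 n V) <= D * (6 * w)).
    { rewrite Rabs_mult, (Rabs_right D) by lra. apply Rmult_le_compat_l; auto. apply J1_le; lra. }
    assert (J0B : Rabs ((D + k) * J0 n V) <= Rabs (D + k) * (2 * w)).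
    { rewrite Rabs_mult. apply Rmult_le_compat_l; auto. apply Rle_trans with (2 * V); [apply J0_le; lra|lra]. }
    assert (PGc : Rabs (PI * gc V) <= PI * (2 * (Cz * w))) by (rewrite Rabs_mult, (Rabs_right PI) by lra; apply Rmult_le_compat_l; lra).
    assert (PGs : Rabs (PI * gs V) <= PI * (2 * (Cz * w))) by (rewrite Rabs_mult, (Rabs_right PI) by lra; apply Rmult_le_compat_l; lra).
    (* The [- n] in the limit of [J1] cancels the extra [D] that comes from differentiating
       [D t ln t]. *)
    assert (Main : 2 * (D * l1 + (D + k) * l0) = PI * (D * (INR n * harm n) + k * INR n)) by (unfold l0, l1; field).
    assert (R1 : Rabs (lc - (D * (INR n * harm n) + k * INR n)) <= 16 * (D * w) + 4 * (K * w) + PI * (2 * (Cz * w)) + 4 * (Rabs (D + k) * w)).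
    { apply PosPI. apply Rabs_le_between in ReB. apply Rabs_le_between in J1B. apply Rabs_le_between in J0B. apply Rabs_le_between in PGc.
      apply Rabs_le. lra. }
    assert (R2 : Rabs (D * (INR n * harm n) + k * INR n - (D * INR n * ln (INR n) + (D * euler_gamma + k) * INR n)) <= D).
    { assert (Hn1 : (1 <= n)%nat) by (apply INR_le; simpl; lra). assert (HG := harm_gamma n Hn1).
      replace (D * (INR n * harm n) + k * INR n - (D * INR n * ln (INR n) + (D * euler_gamma + k) * INR n))
        with (D * INR n * (harm n - ln (INR n) - euler_gamma)) by ring.
      rewrite Rabs_mult, (Rabs_right (D * INR n)) by (apply Rle_ge, Rmult_le_pos; lra).
      apply Rle_trans with (D * INR n * / INR n); [apply Rmult_le_compat_l; [apply Rmult_le_pos; lra|auto]|right; field; lra]. }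
    assert (I1 : Rabs ls <= PI * (2 * (Cz * w)) + 4 * (K * w)).
    { apply PosPI. apply Rabs_le_between in ImB. apply Rabs_le_between in PGs. apply Rabs_le. lra. }
    eapply Rle_trans; [apply Cmod_le_abs|]. simpl.
    apply Rle_trans with ((16 * D + 4 * K + 2 * PI * Cz + 4 * Rabs (D + k) + D + (2 * PI * Cz + 4 * K)) * w).
    + assert (DW : D * 1 <= D * w) by (apply Rmult_le_compat_l; lra).
      replace (ls + - 0) with ls by ring. apply Rabs_le_between in R1. apply Rabs_le_between in R2.
      apply Rle_trans with ((16 * (D * w) + 4 * (K * w) + PI * (2 * (Cz * w)) + 4 * (Rabs (D + k) * w) + D) + (PI * (2 * (Cz * w)) + 4 * (K * w))).
      * apply Rplus_le_compat; auto. apply Rabs_le. lra.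
      * lra.
    + rewrite LV. fold V.
      set (KK := 16 * D + 4 * K + 2 * PI * Cz + 4 * Rabs (D + k) + D + (2 * PI * Cz + 4 * K)).
      assert (HKK : 0 <= KK) by (assert (0 <= PI * Cz) by (apply Rmult_le_pos; lra); unfold KK; lra).
      replace (KK * V * (2 * ln V)) with (KK * w + KK * w) by (unfold w; ring).
      assert (0 <= KK * w) by (apply Rmult_le_pos; lra). lra.
Qed.

(** * The two counting functions and the constant [c_F] *)

Lemma ln_lam_const (r : nat) (lam : nat -> R) : (forall j, (j < r)%nat -> lam j > 0) ->
  0 < lam_const r lam /\ ln (lam_const r lam) = 2 * Rsum_lt r (fun j => lam j * ln (lam j)).
Proof.
  unfold lam_const. induction r as [|r IH]; intros H; cbn [Rprod_lt Rsum_lt].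
  - rewrite ln_1. split; lra.
  - destruct IH as [P E]; [intros; apply H; lia|]. assert (Q : 0 < Rpower (lam r) (2 * lam r)) by apply exp_pos. split.
    + apply Rmult_lt_0_compat; auto.
    + rewrite ln_mult, E by auto. unfold Rpower. rewrite ln_exp. ring.
Qed.

Lemma zero_count_exists (X : C -> C) (D k C0 b K t1 : R) (A1 A2 : R -> R) : 0 <= C0 -> (forall z, Cdiff X z) -> growth X C0 ->
  half_line X -> reflect_sym X -> 1 <= b -> 3 <= t1 -> 0 <= K -> 0 <= D ->
  (forall t, continuous A1 t) -> (forall t, continuous A2 t) ->
  (forall t, t1 <= Rabs t -> has_arg (X (/ 2 + b, t)) (A1 t)) -> (forall t, t1 <= Rabs t -> has_arg (X (/ 2 + 2 * b, t)) (A2 t)) ->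
  (forall t, t1 <= t -> Rabs (A1 t - (D * (t * ln t) + k * t)) <= K * ln t /\ Rabs (A1 (- t) + (D * (t * ln t) + k * t)) <= K * ln t) ->
  (forall t, t1 <= t -> Rabs (A2 t - (D * (t * ln t) + k * t)) <= K * ln t /\ Rabs (A2 (- t) + (D * (t * ln t) + k * t)) <= K * ln t) ->
  exists K', 0 <= K' /\ zero_count X Im D k K' (t1 + 1) /\ zero_count X (fun z => - Im z) D k K' (t1 + 1).
Proof.
  intros HC0 HX HG Hh Hs Hb Ht1 HK HD CA1 CA2 P1 P2 B1 B2.
  assert (Hex : forall W, 0 <= W -> exists l, zeros_upto X W l) by (intros W HW; apply (zeros_upto_exists X C0 W); auto).
  assert (AL : forall c A, 0 < c -> (forall t, continuous A t) -> (forall t, t1 <= Rabs t -> has_arg (X (/ 2 + c, t)) (A t)) ->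
    arg_limit X Im c t1 A /\ arg_limit X (fun z => - Im z) c t1 (fun t => - A (- t))).
  { intros c A Hc CA PA. split; intros T1 T2 HT1 HT2 eps Heps.
    - apply (arg_sum X C0 HC0 HX HG Hh Hs c T1 T2 A); auto. intros t Ht. apply PA. rewrite Rabs_right; lra.
    (* Ordinates below the axis: the interval is [[- T2, - T1]], and oddness of the arctangent turns
       its increments into those for [- Im z] and [- A (- t)]. *)
    - destruct (arg_sum X C0 HC0 HX HG Hh Hs c (- T2) (- T1) A) with (eps := eps) as (W0 & HW0 & H); auto; [lra| |].
      + intros t Ht. apply PA. rewrite Rabs_left; lra.
      + exists W0. split; auto. intros W l HW Hl. specialize (H W l HW Hl).
        assert (Sg : forall T, Rlsum (fun z => atan ((T - - Im z) / c)) l = - Rlsum (fun z => atan ((- T - Im z) / c)) l).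
        { intros T. replace (- Rlsum (fun z => atan ((- T - Im z) / c)) l) with ((-1) * Rlsum (fun z => atan ((- T - Im z) / c)) l) by ring.
          rewrite <- Rlsum_scal. apply Rlsum_ext. intros z _. replace ((- T - Im z) / c) with (- ((T - - Im z) / c)) by (field; lra).
          rewrite atan_opp. ring. }
        rewrite !Sg. apply Rabs_le_between in H. apply Rabs_le. lra. }
  destruct (AL b A1) as [L1 L1']; auto; [lra|]. destruct (AL (2 * b) A2) as [L2 L2']; auto; [lra|].
  assert (Ro : forall x y, - x - y = - (x + y)) by (intros; ring).
  destruct (counting X Im b t1 K D k A1 A2) as (K1 & HK1 & Z1); auto; try (intros; apply B1; auto); try (intros; apply B2; auto).
  destruct (counting X (fun z => - Im z) b t1 K D k (fun t => - A1 (- t)) (fun t => - A2 (- t))) as (K2 & HK2 & Z2); auto.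
  { intros; apply Rabs_Ropp. }
  { intros t Ht. rewrite Ro, Rabs_Ropp. apply B1; auto. }
  { intros t Ht. rewrite Ro, Rabs_Ropp. apply B2; auto. }
  exists (Rmax K1 K2). split; [apply Rle_trans with K1; auto; apply Rmax_l|].
  split; intros T1 T2 W l HT1 HT2 HW Hl; (assert (L := ln_ge1 T2 ltac:(lra))).
  - eapply Rle_trans; [apply (Z1 T1 T2 W l); auto|]. apply Rmult_le_compat_r; [lra|apply Rmax_l].
  - eapply Rle_trans; [apply (Z2 T1 T2 W l); auto|]. apply Rmult_le_compat_r; [lra|apply Rmax_r].
Qed.

Theorem theorem4p1 (F : C -> C) (a : nat -> C) (m : nat) (Q : R) (r : nat)
  (lam : nat -> R) (mu : nat -> C) (omega : C) (X : C -> C) :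
  selberg F a m Q r lam mu omega ->
  is_xi X F m Q r lam mu ->
  (* GRH: all non-trivial zeros (the zeros of xi_F) lie on Re s = 1/2 *)
  (forall rho, X rho = RtoC 0 -> Re rho = / 2) ->
  exists (K : R) (N : nat), forall n : nat, (N <= n)%nat ->
    exists L : C, li_coeff X n L /\
      Cmod (Cminus L (RtoC (degree r lam / 2 * INR n * ln (INR n)
                            + c_const Q r lam * INR n)))
        <= K * sqrt (INR n) * ln (INR n).
Proof.
  intros (_ & Hp & _ & Hfe & _ & Heu) Hxi Hh.
  assert (HX : forall z, Cdiff X z) by (intros z; apply Cder_ex_derive; apply (proj1 Hxi)).
  assert (Hs := xi_reflect X F m Q r lam mu omega Hfe Hxi HX).
  destruct Hfe as (HQ & Hlam & _).
  destruct (euler_near_one F Heu) as (s0 & Hs0 & HF).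
  destruct (xi_growth X F m Q r lam mu s0 HQ Hlam Hxi HX Hs Hp Hs0 HF) as (C0 & HC0 & HG).
  (* The two lines are [Re s = 1/2 + s0] and [Re s = 1/2 + 2 s0]; both lie where [F] is within [1/2]
     of 1. *)
  destruct (xi_arg X F m Q r lam mu s0 s0 HQ Hlam Hxi Hp Hs0 HF (Rle_refl _)) as (A1 & K1 & t1 & Ht1 & HK1 & CA1 & P1 & B1).
  destruct (xi_arg X F m Q r lam mu s0 (2 * s0) HQ Hlam Hxi Hp Hs0 HF ltac:(lra)) as (A2 & K2 & t2 & Ht2 & HK2 & CA2 & P2 & B2).
  set (t := Rmax t1 t2). assert (T1 := Rmax_l t1 t2). assert (T2 := Rmax_r t1 t2). fold t in T1, T2.
  set (K := Rmax K1 K2). assert (K1' := Rmax_l K1 K2). assert (K2' := Rmax_r K1 K2). fold K in K1', K2'.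
  set (D := Rsum_lt r lam).
  assert (HD : 0 <= D).
  { unfold D. clear - Hlam. induction r as [|r IH]; cbn [Rsum_lt]; [lra|].
    assert (0 <= Rsum_lt r lam) by (apply IH; intros; apply Hlam; lia). assert (lam r > 0) by (apply Hlam; lia). lra. }
  assert (Le : forall K' u x, 3 <= u -> K' <= K -> x <= K' * ln u -> x <= K * ln u).
  { intros K' u x Hu HK' Hx. assert (L := ln_ge1 u Hu). assert (K' * ln u <= K * ln u) by (apply Rmult_le_compat_r; lra). lra. }
  destruct (zero_count_exists X D (main_slope Q r lam) C0 s0 K t A1 A2) as (K' & HK' & Z1 & Z2); auto; try lra.
  - intros u Hu. apply P1; lra.
  - intros u Hu. apply P2; lra.
  - intros u Hu. destruct (B1 u ltac:(lra)) as [U1 U2]. split; apply (Le K1); auto; lra.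
  - intros u Hu. destruct (B2 u ltac:(lra)) as [U1 U2]. split; apply (Le K2); auto; lra.
  - destruct (li_asymptotic X D (main_slope Q r lam) K' (t + 1)) as (B & N & H); auto; [lra| |].
    { intros W HW; apply (zeros_upto_exists X C0 W); auto. }
    exists B, N. intros n Hn. destruct (H n Hn) as (L & HL & HB). exists L. split; auto.
    destruct (ln_lam_const r lam (fun j Hj => proj1 (Hlam j Hj))) as [PL EL].
    replace (degree r lam / 2) with D by (unfold degree, D; field).
    (* With [gamma] the Euler constant, what remains is that [D gamma + ln Q] plus the sum of
       [lam j ln (lam j) - lam j] equals [D (gamma - 1) + ln (lam_const r lam * Q^2) / 2]. *)
    replace (c_const Q r lam) with (D * euler_gamma + main_slope Q r lam); auto.
    unfold c_const, main_slope. rewrite ln_mult, EL by (auto; apply pow_lt; lra).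
    rewrite ln_pow by lra. unfold degree. fold D.
    assert (EM : Rsum_lt r (fun j => lam j * ln (lam j) - lam j) = Rsum_lt r (fun j => lam j * ln (lam j)) - D).
    { unfold D. clear. induction r as [|r IH]; cbn [Rsum_lt]; [ring|rewrite IH; ring]. }
    rewrite EM. simpl. field.
Qed.
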